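(* Let $J\subset\mathbb{R}$ be an open interval containing $0$, let $f_0:J\to\mathbb{L}^3$ be a regular smooth timelike curve, and let $V:J\to\mathbb{L}^3$ be a regular smooth vector field along $f_0$ which is everywhere orthogonal to $\frac{df_0}{dt}$ and satisfies $\langle V,V\rangle=-\langle \frac{df_0}{dt},\frac{df_0}{dt}\rangle$ on $J$. Let $H\neq0$, $J^-=\{y\in\mathbb{R}: -y\in J\}$, and $\Delta=\{(x,-x): x\in J\}\subset J\times J^-$. Let $\hat F_0:J\to\mathcal{G}$ be the extended frame along $\Delta$ constructed from $(f_0,V)$ and $H$ as described in the context. Set $\hat F_+(x)=\hat F_0(x)$ for $x\in J$ and $\hat F_-(y)=\hat F_0(-y)$ for $y\in J^-$. Then: (1) $(\chi,\psi)=(\hat F_+^{-1}d\hat F_+,\ \hat F_-^{-1}d\hat F_-)$ is a potential pair on $J\times J^-$, and is regular on an open set containing $\Delta$. (2) Set $\hat\Phi=\hat F_+^{-1}\hat F_-:J\times J^-\to\mathcal{G}$, i.e. $\hat\Phi(x,y)=\hat F_+(x)^{-1}\hat F_-(y)$, and $M^\circ=\hat\Phi^{-1}(\mathcal{B}_L)$. Pointwise on $M^\circ$ let $\hat\Phi=\hat H_-\hat H_+$ with $\hat H_-\in\mathcal{G}^-_*$, $\hat H_+\in\mathcal{G}^+$ be the normalized Birkhoff decomposition, and let $\hat F=\hat F_-\hat H_+^{-1}:M^\circ\to\mathcal{G}$. Then the surface $f:M^\circ\to\mathbb{L}^3$ obtained from $\hat F$ by the Sym formula is a solution of the given geometric Cauchy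 problem, i.e. of the problem of finding a timelike CMC $H$ surface which contains the curve $f_0$ and is tangent along this curve to the plane spanned by $\frac{df_0}{dt}$ and $V$.
   Context: $\mathbb{L}^3$ is Lorentz–Minkowski 3-space (signature $(-,+,+)$), identified with $\mathfrak{sl}(2,\mathbb{R})$ with $\langle X,Y\rangle=\frac12\operatorname{trace}(XY)$ and orthonormal basis $$e_0=\begin{pmatrix}0&-1\\1&0\end{pmatrix},\quad e_1=\begin{pmatrix}0&1\\1&0\end{pmatrix},\quad e_2=\begin{pmatrix}-1&0\\0&1\end{pmatrix},\qquad \langle e_0,e_0\rangle=-1.$$ A timelike immersion is one whose induced metric has signature $(-,+)$. In null coordinates $(x,y)$ the metric is $\varepsilon e^\omega dx\,dy$, $\varepsilon=\pm1$; with unit normal $N$ the mean curvature is $H=2\varepsilon e^{-\omega}\langle f_{xy},N\rangle$. A timelike CMC $H$ surface is a timelike immersion with constant mean curvature $H$. Associated isothermal coordinates: $u=\frac12(x-y)$, $v=\frac12(x+y)$, so that $\Delta=\{v=0\}$. When $\varepsilon=1$, $N$ is chosen so that $(f_u,f_v,N)$ has the orientation of $(e_0,e_1,e_2)$. The curve $f_0$ is placed along $\Delta$ by $t=u$. Loop groups. $\Lambda SL(2,\mathbb{C})$ is the group of loops $\mathbb{S}^1\to SL(2,\mathbb{C})$ with the $H^s$ topology, $s>1/2$. Involutions: $(\rho\gamma)(\lambda)=\overline{\gamma(\bar\lambda)}$ and $(\sigma\gamma)(\lambda)=\operatorname{Ad}_{e_2}\gamma(-\lambda)$. $\mathcal{G}$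 is the subgroup of loops fixed by both $\sigma$ and $\rho$; $Lie(\mathcal{G})$ is its Lie algebra. $\mathcal{G}^{+}$ (resp. $\mathcal{G}^-$) is the subgroup of loops in $\mathcal{G}$ extending holomorphically to the unit disc $\mathbb{D}^+$ (resp. to the exterior disc $\mathbb{D}^-$ in the Riemann sphere); $\mathcal{G}^\pm_*=\{\gamma\in\mathcal{G}^\pm:\gamma(0^\pm)=I\}$ with $0^+=0$, $0^-=\infty$. $\mathcal{B}_L=\mathcal{G}^-\cdot\mathcal{G}^+$, which is open and dense in $\mathcal{G}$, and multiplication $\mathcal{G}^-_*\times\mathcal{G}^+\to\mathcal{B}_L$ is a real analytic diffeomorphism (Birkhoff decomposition). Potential pairs. A potential pair $(\chi,\psi)$ on $I_x\times I_y$ is a pair of smooth $Lie(\mathcal{G})$-valued 1-forms on the intervals $I_x$, $I_y$ of the form $\chi=\sum_{j=-\infty}^{1}\chi_j\lambda^j\,dx$, $\psi=\sum_{j=-1}^{\infty}\psi_j\lambda^j\,dy$. It is regular (at a point $(x,y)$) if $[\chi_1]_{21}(x)\neq0$ and $[\psi_{-1}]_{12}(y)\neq0$. Extended frame along $\Delta$. Fix $t_0\in J$; after applying an orientation-preserving isometry of $\mathbb{L}^3$ it is assumed that $\frac{df_0}{dt}(t_0)$ is a positive multiple of $e_0$ and $V(t_0)$ a positive multiple of $e_1$. Define $\omega_0:J\to\mathbb{R}$ by $e^{\omega_0}=\langle V,V\rangle$ and $F_0:J\to SL(2,\mathbb{R})$ by $$\frac{df_0}{dt}=e^{\omega_0/2}\operatorname{Ad}_{F_0}(e_0),\quad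 V=e^{\omega_0/2}\operatorname{Ad}_{F_0}(e_1),\quad F_0(t_0)=I.$$ Write $F_0^{-1}F_0'=\begin{pmatrix}a&b\\c&-a\end{pmatrix}$, $N=\operatorname{Ad}_{F_0}(e_2)$, and set $$Q=-\tfrac12e^{\omega_0/2}(b-c)+\tfrac12\langle f_0'',N\rangle+\tfrac12He^{\omega_0},\qquad R=\tfrac12e^{\omega_0/2}(b-c)+\tfrac12\langle f_0'',N\rangle+\tfrac12He^{\omega_0}.$$ Then $\hat F_0:J\to\mathcal{G}$ is the solution of $\hat F_0(t_0)=I$ and $$\hat F_0^{-1}\hat F_0'=\begin{pmatrix}a&-Qe^{-\omega_0/2}\lambda+\frac12He^{\omega_0/2}\lambda^{-1}\\ \frac12He^{\omega_0/2}\lambda-Re^{-\omega_0/2}\lambda^{-1}&-a\end{pmatrix},$$ which at $\lambda=1$ equals $F_0^{-1}F_0'$, so that $\hat F_0|_{\lambda=1}=F_0$. Sym formula. For a $\mathcal{G}$-valued map $\hat F$ put $\mathcal{S}(\hat F)=2\lambda(\partial_\lambda\hat F)\hat F^{-1}-\operatorname{Ad}_{\hat F}(e_2)$, and $\mathcal{S}_1(\hat F)=\mathcal{S}(\hat F)|_{\lambda=1}$. The surface obtained from $\hat F$ is $f=\frac{1}{2H}\mathcal{S}_1(\hat F)$ up to a translation of $\mathbb{L}^3$, the translation being fixed by $f(t_0,-t_0)=f_0(t_0)$. *)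

(* Defs.v *)
From Stdlib Require Import Reals ZArith.
From Coquelicot Require Import Coquelicot.

Open Scope R_scope.

Notation M2 K := (@matrix K 2 2).

(* Indices start at 0: the entry A_21 is [ent A 1 0]. *)
Definition ent {K : Ring} (A : M2 K) (i j : nat) : K := coeff_mat zero A i j.

Definition mx2 {K : Ring} (a b c d : K) : M2 K :=
  mk_matrix 2 2 (fun i j => match i, j with
    | O, O => a | O, _ => b | _, O => c | _, _ => d end).

(* Coquelicot's [scal] on matrices is the matrix product, hence this one. *)
Definition mscal {K : Ring} (k : K) (A : M2 K) : M2 K :=
  mk_matrix 2 2 (fun i j => mult k (ent A i j)).

Definition mtr {K : Ring} (A : M2 K) : K := plus (ent A 0 0) (ent A 1 1).

Definition mdet {K : Ring} (A : M2 K) : K :=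
  minus (mult (ent A 0 0) (ent A 1 1)) (mult (ent A 0 1) (ent A 1 0)).

(* The adjugate; it is only ever applied to matrices of determinant one, where
   it is the inverse. *)
Definition sl_inv {K : Ring} (A : M2 K) : M2 K :=
  mx2 (ent A 1 1) (opp (ent A 0 1)) (opp (ent A 1 0)) (ent A 0 0).

Definition Ad {K : Ring} (g X : M2 K) : M2 K := Mmult (Mmult g X) (sl_inv g).

Definition cplx (A : M2 R) : M2 C := mk_matrix 2 2 (fun i j => RtoC (ent A i j)).

Definition L3 (X : M2 R) : Prop := mtr X = 0.

Definition lor (X Y : M2 R) : R := / 2 * mtr (Mmult X Y).

Definition e0 : M2 R := mx2 0 (-1) 1 0.
Definition e1 : M2 R := mx2 0 1 1 0.
Definition e2 : M2 R := mx2 (-1) 0 0 1.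

(* On sl(2,R), X = co0 X e0 + co1 X e1 + co2 X e2. *)
Definition co0 (X : M2 R) : R := (ent X 1 0 - ent X 0 1) / 2.
Definition co1 (X : M2 R) : R := (ent X 1 0 + ent X 0 1) / 2.
Definition co2 (X : M2 R) : R := ent X 1 1.

Definition vol (X Y Z : M2 R) : R :=
    co0 X * (co1 Y * co2 Z - co2 Y * co1 Z)
  - co1 X * (co0 Y * co2 Z - co2 Y * co0 Z)
  + co2 X * (co0 Y * co1 Z - co1 Y * co0 Z).

Definition in_span (A B Z : M2 R) : Prop :=
  exists a b : R, Z = plus (mscal a A) (mscal b B).

Definition motion (L : M2 R -> M2 R) (c X : M2 R) : M2 R := plus (L X) c.

Record orientation_preserving_isometry (L : M2 R -> M2 R) (c : M2 R) : Prop := {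
  opi_translation : L3 c;
  opi_stable : forall X, L3 X -> L3 (L X);
  opi_linear : forall (k : R) X Y, L3 X -> L3 Y ->
    L (plus (mscal k X) Y) = plus (mscal k (L X)) (L Y);
  opi_isometry : forall X Y, L3 X -> L3 Y -> lor (L X) (L Y) = lor X Y;
  opi_orientation : vol (L e0) (L e1) (L e2) > 0 }.

Definition interval (lo hi : Rbar) (t : R) : Prop := Rbar_lt lo t /\ Rbar_lt t hi.

Definition smooth_curve (J : R -> Prop) (f : R -> M2 R) : Prop :=
  forall (n i j : nat) t, J t -> ex_derive_n (fun u => ent (f u) i j) n t.

Definition mderive (f : R -> M2 R) (t : R) : M2 R :=
  mk_matrix 2 2 (fun i j => Derive (fun u => ent (f u) i j) t).

Record geometric_cauchy_data (J : R -> Prop) (f0 V : R -> M2 R) : Prop := {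
  gcd_f0_L3 : forall t, J t -> L3 (f0 t);
  gcd_V_L3 : forall t, J t -> L3 (V t);
  gcd_f0_smooth : smooth_curve J f0;
  gcd_V_smooth : smooth_curve J V;
  gcd_f0_regular : forall t, J t -> mderive f0 t <> zero;
  gcd_f0_timelike : forall t, J t -> lor (mderive f0 t) (mderive f0 t) < 0;
  gcd_V_regular : forall t, J t -> V t <> zero;
  gcd_orthogonal : forall t, J t -> lor (V t) (mderive f0 t) = 0;
  gcd_norm : forall t, J t ->
    lor (V t) (V t) = - lor (mderive f0 t) (mderive f0 t) }.

(* Only the values on the unit circle are meaningful. *)
Definition loop := C -> M2 C.

Definition loop_eq (g h : loop) : Prop := forall l, Cmod l = 1 -> g l = h l.

Definition loop_mul (g h : loop) : loop := fun l => Mmult (g l) (h l).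
Definition loop_inv (g : loop) : loop := fun l => sl_inv (g l).

Definition Czpow (l : C) (n : Z) : C :=
  match n with
  | Z0 => RtoC 1
  | Zpos p => Cpow l (Pos.to_nat p)
  | Zneg p => Cinv (Cpow l (Pos.to_nat p))
  end.

Definition is_zseries {K : AbsRing} {V : NormedModule K} (a : Z -> V) (v : V)
  : Prop :=
  exists v1 v2 : V,
    is_series (fun n : nat => a (Z.of_nat n)) v1 /\
    is_series (fun n : nat => a (- Z.of_nat (S n))%Z) v2 /\
    v = plus v1 v2.

Definition is_fourier (a : Z -> M2 C) (g : loop) : Prop :=
  forall l, Cmod l = 1 -> forall i j : nat,
    is_zseries (V := C_NormedModule)
      (fun n => Cmult (ent (a n) i j) (Czpow l n)) (ent (g l) i j).

Definition frob2 (A : M2 C) : R :=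
  Cmod (ent A 0 0) ^ 2 + Cmod (ent A 0 1) ^ 2 +
  Cmod (ent A 1 0) ^ 2 + Cmod (ent A 1 1) ^ 2.

(* q is the squared H^s norm of the family of Fourier coefficients a. *)
Definition is_Hs_sqnorm (s : R) (a : Z -> M2 C) (q : R) : Prop :=
  is_zseries (V := R_NormedModule)
    (fun n => Rpower (1 + IZR n ^ 2) s * frob2 (a n)) q.

Definition Hs_coeffs (s : R) (a : Z -> M2 C) (g : loop) : Prop :=
  is_fourier a g /\ exists q, is_Hs_sqnorm s a q.

(* For s > 1/2 the Fourier series of an H^s function on the circle converges
   absolutely, to the continuous representative. *)
Definition in_Hs (s : R) (g : loop) : Prop := exists a, Hs_coeffs s a g.

Definition loop_diffq (G : R -> loop) (t h : R) : loop :=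
  fun l => mscal (RtoC (/ h)) (minus (G (t + h) l) (G t l)).

(* The derivative of G at t is D in the H^s norm: its square is q below. *)
Definition is_Hs_derive (s : R) (G : R -> loop) (t : R) (D : loop) : Prop :=
  forall eps : posreal, exists delta : posreal,
    forall h : R, h <> 0 -> Rabs h < delta ->
      exists a q,
        is_fourier a (fun l => minus (loop_diffq G t h l) (D l)) /\
        is_Hs_sqnorm s a q /\ q < eps ^ 2.

Definition rho (g : loop) : loop :=
  fun l => mk_matrix 2 2 (fun i j => Cconj (ent (g (Cconj l)) i j)).

(* e2 is its own inverse, and has determinant -1. *)
Definition sigma (g : loop) : loop :=
  fun l => Mmult (Mmult (cplx e2) (g (Copp l))) (cplx e2).

Record in_G (s : R) (g : loop) : Prop := {
  G_Hs : in_Hs s g;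
  G_det : forall l, Cmod l = 1 -> mdet (g l) = RtoC 1;
  G_rho : loop_eq (rho g) g;
  G_sigma : loop_eq (sigma g) g }.

Record in_LieG (s : R) (g : loop) : Prop := {
  LieG_Hs : in_Hs s g;
  LieG_tr : forall l, Cmod l = 1 -> mtr (g l) = RtoC 0;
  LieG_rho : loop_eq (rho g) g;
  LieG_sigma : loop_eq (sigma g) g }.

(* g extends h continuously to the closed unit disc and holomorphically to the
   open one. *)
Record extends_to_disc (h : loop) (g : C -> M2 C) : Prop := {
  ext_boundary : loop_eq g h;
  ext_continuous : forall z, Cmod z <= 1 -> forall i j : nat,
    filterlim (fun w => ent (g w) i j)
      (within (fun w => Cmod w <= 1) (locally z)) (locally (ent (g z) i j));
  ext_holomorphic : forall z, Cmod z < 1 -> forall i j : nat,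
    ex_derive (K := C_AbsRing) (V := C_NormedModule) (fun w => ent (g w) i j) z }.

(* The exterior disc in the Riemann sphere, in the coordinate 1/lambda: the
   value of the extension at infinity is then its value at 0. *)
Definition extends_to_exterior (h : loop) (g : C -> M2 C) : Prop :=
  extends_to_disc (fun l => h (Cinv l)) g.

Definition in_Gplus (s : R) (h : loop) : Prop :=
  in_G s h /\ exists g, extends_to_disc h g.

Definition in_Gminus (s : R) (h : loop) : Prop :=
  in_G s h /\ exists g, extends_to_exterior h g.

Definition in_Gminus_star (s : R) (h : loop) : Prop :=
  in_G s h /\ exists g, extends_to_exterior h g /\ g (RtoC 0) = Mone.

Definition in_BL (s : R) (g : loop) : Prop :=
  exists gm gp, in_Gminus s gm /\ in_Gplus s gp /\ loop_eq g (loop_mul gm gp).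

(* G^{-1} dG = A dt on I, with the H^s derivative of G. *)
Definition is_maurer_cartan (s : R) (I : R -> Prop) (G A : R -> loop) : Prop :=
  forall t, I t -> exists D, is_Hs_derive s G t D /\
    loop_eq (loop_mul (loop_inv (G t)) D) (A t).

Definition Hs_smooth (s : R) (I : R -> Prop) (A : R -> loop) : Prop :=
  exists B : nat -> R -> loop,
    (forall t, I t -> loop_eq (B O t) (A t)) /\
    (forall n t, I t -> in_Hs s (B n t) /\ is_Hs_derive s (B n) t (B (S n) t)).

(* The 1-forms chi dx and psi dy are given by their coefficients. *)
Record potential_pair (s : R) (Ix Iy : R -> Prop) (chi psi : R -> loop) : Prop := {
  pp_chi_Lie : forall x, Ix x -> in_LieG s (chi x);
  pp_psi_Lie : forall y, Iy y -> in_LieG s (psi y);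
  pp_chi_smooth : Hs_smooth s Ix chi;
  pp_psi_smooth : Hs_smooth s Iy psi;
  pp_chi_form : forall x, Ix x -> exists a, Hs_coeffs s a (chi x) /\
    forall n, (1 < n)%Z -> a n = zero;
  pp_psi_form : forall y, Iy y -> exists a, Hs_coeffs s a (psi y) /\
    forall n, (n < -1)%Z -> a n = zero }.

Definition regular_at (s : R) (chi psi : R -> loop) (x y : R) : Prop :=
  exists a b, Hs_coeffs s a (chi x) /\ Hs_coeffs s b (psi y) /\
    ent (a 1%Z) 1 0 <> RtoC 0 /\ ent (b (-1)%Z) 0 1 <> RtoC 0.

Definition open2 (W : R -> R -> Prop) : Prop :=
  forall x y, W x y -> locally_2d W x y.

Definition Dx (f : R -> R -> M2 R) (x y : R) : M2 R := mderive (fun u => f u y) x.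
Definition Dy (f : R -> R -> M2 R) (x y : R) : M2 R := mderive (fun v => f x v) y.

(* u = (x - y)/2 and v = (x + y)/2, i.e. x = u + v and y = v - u. *)
Definition Du (f : R -> R -> M2 R) (x y : R) : M2 R := minus (Dx f x y) (Dy f x y).
Definition Dv (f : R -> R -> M2 R) (x y : R) : M2 R := plus (Dx f x y) (Dy f x y).

Definition smooth2 (M : R -> R -> Prop) (f : R -> R -> M2 R) : Prop :=
  forall (n i j : nat) x y, M x y -> ex_diff_n (fun u v => ent (f u v) i j) n x y.

Record timelike_immersion (M : R -> R -> Prop) (f : R -> R -> M2 R) : Prop := {
  ti_open : open2 M;
  ti_L3 : forall x y, M x y -> L3 (f x y);
  ti_smooth : smooth2 M f;
  ti_immersion : forall x y, M x y -> forall a b : R,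
    plus (mscal a (Dx f x y)) (mscal b (Dy f x y)) = zero -> a = 0 /\ b = 0;
  ti_signature : forall x y, M x y -> exists X Y,
    in_span (Dx f x y) (Dy f x y) X /\ in_span (Dx f x y) (Dy f x y) Y /\
    lor X X = -1 /\ lor Y Y = 1 /\ lor X Y = 0 }.

(* eps e^om dx dy is the metric and N the unit normal. *)
Definition timelike_CMC (H : R) (M : R -> R -> Prop) (f : R -> R -> M2 R) : Prop :=
  timelike_immersion M f /\
  exists (eps : R) (om : R -> R -> R) (N : R -> R -> M2 R),
    (eps = 1 \/ eps = -1) /\ smooth2 M N /\
    forall x y, M x y ->
      lor (Dx f x y) (Dx f x y) = 0 /\
      lor (Dy f x y) (Dy f x y) = 0 /\
      2 * lor (Dx f x y) (Dy f x y) = eps * exp (om x y) /\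
      L3 (N x y) /\ lor (N x y) (N x y) = 1 /\
      lor (Dx f x y) (N x y) = 0 /\ lor (Dy f x y) (N x y) = 0 /\
      (eps = 1 -> vol (Du f x y) (Dv f x y) (N x y) > 0) /\
      H = 2 * eps * exp (- om x y) * lor (Dy (Dx f) x y) (N x y).

Record solves_geometric_cauchy (J : R -> Prop) (f0 V : R -> M2 R) (H : R)
    (M : R -> R -> Prop) (f : R -> R -> M2 R) : Prop := {
  sgc_CMC : timelike_CMC H M f;
  sgc_curve : forall t, J t -> M t (- t) /\ f t (- t) = f0 t;
  sgc_tangent : forall t, J t -> forall Z,
    in_span (Dx f t (- t)) (Dy f t (- t)) Z <-> in_span (mderive f0 t) (V t) Z }.

Record normalized_at (t0 : R) (f0 V : R -> M2 R) : Prop := {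
  nrm_f0 : exists k, k > 0 /\ mderive f0 t0 = mscal k e0;
  nrm_V : exists k, k > 0 /\ V t0 = mscal k e1 }.

Record is_frame (J : R -> Prop) (t0 : R) (f0 V : R -> M2 R)
    (om0 : R -> R) (F0 : R -> M2 R) : Prop := {
  fr_om : forall t, J t -> exp (om0 t) = lor (V t) (V t);
  fr_smooth : smooth_curve J F0;
  fr_det : forall t, J t -> mdet (F0 t) = 1;
  fr_f0 : forall t, J t -> mderive f0 t = mscal (exp (om0 t / 2)) (Ad (F0 t) e0);
  fr_V : forall t, J t -> V t = mscal (exp (om0 t / 2)) (Ad (F0 t) e1);
  fr_init : F0 t0 = Mone }.

Definition frame_mc (F0 : R -> M2 R) (t : R) : M2 R :=
  Mmult (sl_inv (F0 t)) (mderive F0 t).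

Definition half_normal_acc (f0 F0 : R -> M2 R) (t : R) : R :=
  / 2 * lor (mderive (mderive f0) t) (Ad (F0 t) e2).

Definition coefQ (H : R) (f0 : R -> M2 R) (om0 : R -> R) (F0 : R -> M2 R) (t : R) : R :=
  - (/ 2 * exp (om0 t / 2) * (ent (frame_mc F0 t) 0 1 - ent (frame_mc F0 t) 1 0))
  + half_normal_acc f0 F0 t + / 2 * H * exp (om0 t).

Definition coefR (H : R) (f0 : R -> M2 R) (om0 : R -> R) (F0 : R -> M2 R) (t : R) : R :=
  / 2 * exp (om0 t / 2) * (ent (frame_mc F0 t) 0 1 - ent (frame_mc F0 t) 1 0)
  + half_normal_acc f0 F0 t + / 2 * H * exp (om0 t).

Definition frame_potential (H : R) (f0 : R -> M2 R) (om0 : R -> R) (F0 : R -> M2 R)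
    (t : R) : loop := fun l =>
  let a := ent (frame_mc F0 t) 0 0 in
  let q := coefQ H f0 om0 F0 t * exp (- om0 t / 2) in
  let r := coefR H f0 om0 F0 t * exp (- om0 t / 2) in
  let h := / 2 * H * exp (om0 t / 2) in
  @mx2 C_Ring
    (RtoC a) (RtoC (- q) * l + RtoC h * / l)%C
    (RtoC h * l - RtoC r * / l)%C (RtoC (- a)).

Record is_extended_frame (s : R) (J : R -> Prop) (t0 H : R) (f0 V : R -> M2 R)
    (om0 : R -> R) (F0 : R -> M2 R) (Fh0 : R -> loop) : Prop := {
  ef_frame : is_frame J t0 f0 V om0 F0;
  ef_G : forall t, J t -> in_G s (Fh0 t);
  ef_init : loop_eq (Fh0 t0) (fun _ => Mone);
  ef_ode : is_maurer_cartan s J Fh0 (frame_potential H f0 om0 F0) }.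

(* The derivative in lambda along the unit circle. *)
Definition is_circle_derive (g : loop) (l : C) (D : M2 C) : Prop :=
  forall i j : nat,
    filterlim
      (fun m : C => Cdiv (Cminus (ent (g m) i j) (ent (g l) i j)) (Cminus m l))
      (within (fun m : C => Cmod m = 1 /\ m <> l) (locally l))
      (locally (ent D i j)).

Definition is_Sym (g : loop) (l : C) (S : M2 C) : Prop :=
  exists D, is_circle_derive g l D /\
    S = minus (mscal (RtoC 2 * l)%C (Mmult D (sl_inv (g l))))
              (Ad (g l) (cplx e2)).

(* On M, f is (2H)^{-1} S_1(Fh) up to a translation of L^3. *)
Definition is_Sym_surface (H : R) (M : R -> R -> Prop) (Fh : R -> R -> loop)
    (f : R -> R -> M2 R) : Prop :=
  exists c, L3 c /\ forall x y, M x y -> exists S,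
    is_Sym (Fh x y) (RtoC 1) S /\
    cplx (f x y) = plus (mscal (RtoC (/ (2 * H))) S) (cplx c).

(* Main.v *)
(* All loops involved lie in a Wiener algebra with weight 2^|n|: the coefficients
   of the extended frame solve a linear recursive system and are O(C^|n| / |n|!),
   so that the frame is differentiable with values in this algebra. There the
   Birkhoff factorization is an open condition (Neumann series), the factors
   depend differentiably on the point, and comparing supports gives
     F^{-1} F_x = alpha_0 + alpha_1 lambda,   F^{-1} F_y = beta / lambda
   for F = F_- H_+^{-1}, where alpha_0, alpha_1 and beta are polynomials in one
   coefficient of H_-, one of H_+ and the potentials. The Fourier coefficients
   of H_- and H_+, together with F and its lambda-derivative at 1, thus form a
   system of functions closed under differentiation, which is why the surface is
   smooth. The Sym formula turns the two equations into null coordinates with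
   f_x = e^{w(x)/2} Ad_F E21 and f_y = e^{w(-y)/2} d^2 Ad_F E12, d being the
   upper left entry of H_+(0), from which the metric and the mean curvature are
   read off; on the diagonal H_+ = I, so f_x - f_y and f_x + f_y are the given
   velocity and V. *)

Require Import Defs.
From Stdlib Require Import Reals ZArith Lra Lia Psatz List Permutation Classical ClassicalEpsilon FunctionalExtensionality.
From Coquelicot Require Import Coquelicot.

Import ListNotations.

Open Scope R_scope.

(** The theorem quantifies over arbitrary pointwise Birkhoff factors: they are merely loops of class
    $H^s$, with no regularity in $(x,y)$. They enter the weighted algebra because their supports are
    one-sided: in $\hat H_-=\Phi\hat H_+^{-1}$ the frequencies $n\le0$ come from frequencies of
    $\Phi$ at least as far from $0$. All further structure (determinant one, invariance under
    $\sigma$, the form of the connection, the identity on the diagonal) comes from one principle: a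
    loop whose Fourier support lies in two disjoint sets vanishes. Since $\mathcal{G}^\pm$ are
    defined by holomorphic extension, knowing these supports takes the mean value property for
    functions that are complex differentiable inside the disc and continuous up to its boundary,
    hence Goursat's theorem. The base $2$ of the weight is one choice among many: what counts is
    that $2^{|n|}$ is submultiplicative, is beaten by $|n|!$, and dominates $|n|$, $n^2$ and the
    Sobolev weights up to constants. Norms are not computed; every estimate is an upper bound [B]
    for all finite partial sums, and derivatives carry explicit remainder bounds. *)

Fixpoint lsum {T : Type} (f : T -> C) (l : list T) : C :=
  match l with nil => RtoC 0 | t :: l' => (f t + lsum f l')%C end.

Fixpoint rsum {T : Type} (f : T -> R) (l : list T) : R :=
  match l with nil => 0 | t :: l' => f t + rsum f l' end.

(** * Unordered sums over an arbitrary index type *)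

Section UnorderedSums.

Context {T : Type}.
Implicit Types (f g : T -> C) (u v : T -> R) (l : list T).

Lemma lsum_app f l1 l2 : lsum f (l1 ++ l2) = (lsum f l1 + lsum f l2)%C.
Proof. induction l1; simpl; [ring | rewrite IHl1; ring]. Qed.

Lemma rsum_app u l1 l2 : rsum u (l1 ++ l2) = rsum u l1 + rsum u l2.
Proof. induction l1; simpl; [ring | rewrite IHl1; ring]. Qed.

Lemma lsum_perm f l1 l2 : Permutation l1 l2 -> lsum f l1 = lsum f l2.
Proof. induction 1; simpl; try congruence; ring. Qed.

Lemma rsum_perm u l1 l2 : Permutation l1 l2 -> rsum u l1 = rsum u l2.
Proof. induction 1; simpl; try congruence; ring. Qed.

Lemma lsum_ext f g l : (forall t, In t l -> f t = g t) -> lsum f l = lsum g l.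
Proof.
  induction l; simpl; intros E; [reflexivity|].
  rewrite (E a) by auto. rewrite IHl; auto.
Qed.

Lemma rsum_ext' u v l : (forall t, u t = v t) -> rsum u l = rsum v l.
Proof. intros E; induction l; simpl; congruence. Qed.

Lemma lsum_plus f g l : lsum (fun t => f t + g t)%C l = (lsum f l + lsum g l)%C.
Proof. induction l; simpl; [ring | rewrite IHl; ring]. Qed.

Lemma lsum_scal (c : C) f l : lsum (fun t => c * f t)%C l = (c * lsum f l)%C.
Proof. induction l; simpl; [ring | rewrite IHl; ring]. Qed.

Lemma rsum_plus u v l : rsum (fun t => u t + v t) l = rsum u l + rsum v l.
Proof. induction l; simpl; [ring | rewrite IHl; ring]. Qed.

Lemma rsum_scal (c : R) u l : rsum (fun t => c * u t) l = c * rsum u l.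
Proof. induction l; simpl; [ring | rewrite IHl; ring]. Qed.

Lemma rsum_le u v l : (forall t, In t l -> u t <= v t) -> rsum u l <= rsum v l.
Proof.
  induction l; simpl; intros E; [lra|].
  generalize (E a (or_introl eq_refl)). generalize (IHl (fun t h => E t (or_intror h))). lra.
Qed.

Lemma rsum_ge0 u l : (forall t, 0 <= u t) -> 0 <= rsum u l.
Proof. intros E; induction l; simpl; [lra|]. generalize (E a); lra. Qed.

Lemma Cmod_lsum f l : Cmod (lsum f l) <= rsum (fun t => Cmod (f t)) l.
Proof.
  induction l; simpl; [rewrite Cmod_0; lra|].
  eapply Rle_trans; [apply Cmod_triangle|lra].
Qed.

Lemma rsum_incl u l1 l2 : (forall t, 0 <= u t) -> NoDup l1 -> incl l1 l2 ->
  rsum u l1 <= rsum u l2.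
Proof.
  intros H0 Hd; revert l2; induction Hd as [|x l Hx Hd IH]; intros l2 Hi; simpl.
  - apply rsum_ge0; auto.
  - destruct (in_split x l2) as (a & b & ->); [apply Hi; simpl; auto|].
    assert (P : Permutation (a ++ x :: b) (x :: a ++ b)) by (symmetry; apply Permutation_middle).
    rewrite (rsum_perm _ _ _ P); simpl.
    assert (rsum u l <= rsum u (a ++ b)); [|lra].
    apply IH; intros y Hy.
    assert (In y (a ++ x :: b)) by (apply Hi; simpl; auto).
    apply in_app_iff in H; apply in_app_iff; simpl in H.
    destruct H as [?|[?|?]]; auto. subst; contradiction.
Qed.

(** Equality on [T] is decided by excluded middle, which lets [nodup] form unions of finite index
    sets as duplicate-free lists. *)
Definition eqd (x y : T) : {x = y} + {x <> y} := excluded_middle_informative (x = y).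

Definition lunion l1 l2 := nodup eqd (l1 ++ l2).

Lemma lunion_nodup l1 l2 : NoDup (lunion l1 l2).
Proof. apply NoDup_nodup. Qed.

Lemma lunion_l l1 l2 : incl l1 (lunion l1 l2).
Proof. intros x Hx; apply nodup_In, in_app_iff; auto. Qed.

Lemma lunion_r l1 l2 : incl l2 (lunion l1 l2).
Proof. intros x Hx; apply nodup_In, in_app_iff; auto. Qed.

(** Convergence along the net of finite subsets. Unlike the ordered two-sided series of the
    statement, it survives reindexing and regrouping, which products of Fourier series need;
    [is_zseries_usum] and [usum_is_zseries] pass between the two. *)
Definition usum f (s : C) : Prop := forall eps, 0 < eps -> exists l0,
  forall l, NoDup l -> incl l0 l -> Cmod (lsum f l - s) <= eps.

(** The $\ell^1$ norm itself is never formed: a common bound of all finite partial sums takes its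
    place, so that estimates only produce upper bounds. *)
Definition bsum u (B : R) : Prop := forall l, NoDup l -> rsum u l <= B.

Lemma bsum_mono u B B' : bsum u B -> B <= B' -> bsum u B'.
Proof. intros h hB l Hl; specialize (h l Hl); lra. Qed.

Lemma bsum_le u v B : (forall t, u t <= v t) -> bsum v B -> bsum u B.
Proof.
  intros h hB l Hl. eapply Rle_trans; [|apply (hB l Hl)]. apply rsum_le; auto.
Qed.

Lemma bsum_ge0 u B : bsum u B -> 0 <= B.
Proof. intros h; apply (h nil); constructor. Qed.

Lemma bsum_term u B t : bsum u B -> u t <= B.
Proof.
  intros h. specialize (h (t :: nil)). simpl in h.
  assert (NoDup (t :: nil)) by (repeat constructor; simpl; auto).
  specialize (h H); lra.
Qed.

Lemma bsum_plus u v B B' : bsum u B -> bsum v B' -> bsum (fun t => u t + v t) (B + B').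
Proof. intros h h' l Hl. rewrite rsum_plus. specialize (h l Hl); specialize (h' l Hl); lra. Qed.

Lemma bsum_scal u B c : 0 <= c -> bsum u B -> bsum (fun t => c * u t) (c * B).
Proof. intros hc h l Hl. rewrite rsum_scal. apply Rmult_le_compat_l; auto. Qed.

Lemma bsum_limit u B : (forall eps, 0 < eps -> bsum u (B + eps)) -> bsum u B.
Proof. intros h l Hl. apply le_epsilon; intros e he. apply (h e he l Hl). Qed.

Lemma bsum_sup u B : (forall t, 0 <= u t) -> bsum u B ->
  exists s, bsum u s /\ forall eps, 0 < eps -> exists l0, NoDup l0 /\ s - eps < rsum u l0.
Proof.
  intros h0 h.
  destruct (completeness (fun x => exists l, NoDup l /\ x = rsum u l)) as [s [hs1 hs2]].
  - exists B. intros x (l & hl & ->); auto.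
  - exists 0, nil. split; [constructor|reflexivity].
  - exists s; split.
    + intros l hl. apply hs1; eauto.
    + intros eps heps. apply NNPP; intros hn.
      assert (s <= s - eps); [|lra].
      apply hs2. intros x (l & hl & ->).
      apply Rnot_lt_le; intros hh. apply hn; eauto.
Qed.

(** The sum over [l0] comes within [eps] of the supremum, so a list disjoint from [l0] can add at
    most [eps]. *)
Lemma bsum_tail u B : (forall t, 0 <= u t) -> bsum u B -> forall eps, 0 < eps ->
  exists l0, NoDup l0 /\ forall l, NoDup l -> (forall t, In t l -> ~ In t l0) -> rsum u l <= eps.
Proof.
  intros h0 h eps heps.
  destruct (bsum_sup u B h0 h) as (s & hs & hs').
  destruct (hs' eps heps) as (l0 & hl0 & hl0').
  exists l0; split; auto. intros l hl hd.
  assert (hN : NoDup (l ++ l0)) by (apply NoDup_app; auto).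
  specialize (hs _ hN). rewrite rsum_app in hs. lra.
Qed.

Lemma incl_split l0 l : NoDup l0 -> NoDup l -> incl l0 l ->
  exists l', Permutation l (l0 ++ l') /\ NoDup l' /\ forall t, In t l' -> ~ In t l0.
Proof.
  intros hd; revert l; induction hd as [|x l0 hx hd IH]; intros l hl hi.
  - exists l; simpl; repeat split; auto.
  - destruct (in_split x l) as (a & b & ->); [apply hi; simpl; auto|].
    assert (P : Permutation (a ++ x :: b) (x :: a ++ b)) by (symmetry; apply Permutation_middle).
    assert (hl' : NoDup (x :: a ++ b)) by (eapply Permutation_NoDup; eauto).
    inversion hl'; subst.
    destruct (IH (a ++ b)) as (l' & p1 & p2 & p3); auto.
    { intros y hy. assert (In y (a ++ x :: b)) by (apply hi; simpl; auto).
      apply in_app_iff in H; apply in_app_iff; simpl in H.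
      destruct H as [?|[?|?]]; auto. subst; contradiction. }
    exists l'; repeat split; auto.
    + rewrite P; simpl; auto.
    + intros t ht [->|h]; [|eapply p3; eauto].
      apply H1. eapply Permutation_in; [symmetry; apply p1|]. apply in_app_iff; auto.
Qed.

Lemma usum_unique f s s' : usum f s -> usum f s' -> s = s'.
Proof.
  intros h h'. apply NNPP; intros hn.
  assert (hp : 0 < Cmod (s - s')).
  { apply Cmod_gt_0. intros e; apply hn. replace s with (s - s' + s')%C by ring. rewrite e; ring. }
  destruct (h (Cmod (s - s') / 3)) as (l0 & h0); [lra|].
  destruct (h' (Cmod (s - s') / 3)) as (l1 & h1); [lra|].
  specialize (h0 _ (lunion_nodup l0 l1) (lunion_l l0 l1)).
  specialize (h1 _ (lunion_nodup l0 l1) (lunion_r l0 l1)).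
  set (z := lsum f (lunion l0 l1)) in *.
  assert (Cmod (s - s') <= Cmod (z - s') + Cmod (z - s)); [|lra].
  replace (s - s')%C with ((z - s') + - (z - s))%C by ring.
  rewrite <- (Cmod_opp (z - s)). apply Cmod_triangle.
Qed.

Lemma usum_ext f g s : (forall t, f t = g t) -> usum f s -> usum g s.
Proof. intros e h. replace g with f; auto. apply functional_extensionality; auto. Qed.

(** The finite sums are real and [Re s] is the real number nearest to [s]; a positive distance from
    [s] to the real axis would keep them away from [s]. *)
Lemma usum_real u s : usum (fun t => RtoC (u t)) s -> RtoC (Re s) = s.
Proof.
  intros h. apply NNPP; intros hn.
  assert (hp : 0 < Cmod (RtoC (Re s) - s)).
  { apply Cmod_gt_0. intros e; apply hn. replace (RtoC (Re s)) with (RtoC (Re s) - s + s)%C by ring.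
    rewrite e; ring. }
  destruct (h (Cmod (RtoC (Re s) - s) / 2)) as (l0 & h0); [lra|].
  specialize (h0 _ (lunion_nodup l0 nil) (lunion_l l0 nil)).
  assert (e : forall l, lsum (fun t => RtoC (u t)) l = RtoC (rsum u l)).
  { clear. induction l; simpl; auto. rewrite IHl, RtoC_plus; auto. }
  rewrite e in h0. set (x := rsum u (lunion l0 nil)) in *.
  assert (Cmod (RtoC (Re s) - s) <= Cmod (RtoC x - s)); [|lra].
  unfold Cmod. apply sqrt_le_1_alt. unfold Re. simpl.
  generalize (pow2_ge_0 (x - fst s)). lra.
Qed.

Lemma usum_plus f g s s' : usum f s -> usum g s' -> usum (fun t => f t + g t)%C (s + s')%C.
Proof.
  intros h h' eps heps.
  destruct (h (eps / 2)) as (l0 & h0); [lra|].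
  destruct (h' (eps / 2)) as (l1 & h1); [lra|].
  exists (l0 ++ l1). intros l hl hi. rewrite lsum_plus.
  specialize (h0 l hl (fun x hx => hi x (in_or_app _ _ _ (or_introl hx)))).
  specialize (h1 l hl (fun x hx => hi x (in_or_app _ _ _ (or_intror hx)))).
  replace (lsum f l + lsum g l - (s + s'))%C with ((lsum f l - s) + (lsum g l - s'))%C by ring.
  eapply Rle_trans; [apply Cmod_triangle|lra].
Qed.

Lemma usum_scal (c : C) f s : usum f s -> usum (fun t => c * f t)%C (c * s)%C.
Proof.
  intros h eps heps.
  assert (hc : 0 < Cmod c + 1) by (generalize (Cmod_ge_0 c); lra).
  destruct (h (eps / (Cmod c + 1))) as (l0 & h0); [apply Rdiv_lt_0_compat; auto|].
  exists l0. intros l hl hi. rewrite lsum_scal. specialize (h0 l hl hi).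
  replace (c * lsum f l - c * s)%C with (c * (lsum f l - s))%C by ring.
  rewrite Cmod_mult.
  apply Rle_trans with (Cmod c * (eps / (Cmod c + 1))).
  - apply Rmult_le_compat_l; auto. apply Cmod_ge_0.
  - apply Rle_trans with ((Cmod c + 1) * (eps / (Cmod c + 1))).
    + apply Rmult_le_compat_r; [|lra]. left; apply Rdiv_lt_0_compat; auto.
    + right; field; lra.
Qed.

Lemma usum_bound f s B : bsum (fun t => Cmod (f t)) B -> usum f s -> Cmod s <= B.
Proof.
  intros hb h. apply le_epsilon; intros eps heps.
  destruct (h eps heps) as (l0 & h0).
  set (l := lunion l0 nil).
  specialize (h0 l (lunion_nodup l0 nil) (lunion_l l0 nil)).
  specialize (hb l (lunion_nodup l0 nil)).
  generalize (Cmod_lsum f l); intros h1.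
  replace s with (- (lsum f l - s) + lsum f l)%C by ring.
  eapply Rle_trans; [apply Cmod_triangle|]. rewrite Cmod_opp. lra.
Qed.

Lemma usum_single f t0 : (forall t, t <> t0 -> f t = RtoC 0) -> usum f (f t0).
Proof.
  intros h eps heps. exists (t0 :: nil). intros l hl hi.
  destruct (incl_split (t0 :: nil) l) as (l' & p1 & p2 & p3); auto.
  { repeat constructor; simpl; auto. }
  rewrite (lsum_perm _ _ _ p1). simpl.
  (* The zero terms are written as products so that [lsum_scal] pulls out a factor $0$. *)
  rewrite (lsum_ext f (fun _ => RtoC 0 * RtoC 0)%C).
  - rewrite lsum_scal.
    replace (f t0 + RtoC 0 * lsum (fun _ : T => RtoC 0) l' - f t0)%C with (RtoC 0) by ring.
    rewrite Cmod_0; lra.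
  - intros t ht. rewrite h; [ring|]. intros ->; apply (p3 t0 ht); simpl; auto.
Qed.

Lemma usum_real_pos u B : (forall t, 0 <= u t) -> bsum u B ->
  exists s : R, usum (fun t => RtoC (u t)) (RtoC s).
Proof.
  intros h0 h. destruct (bsum_sup u B h0 h) as (s & hs & hs').
  exists s. intros eps heps. destruct (hs' eps heps) as (l0 & hl0 & hl0').
  exists l0. intros l hl hi.
  assert (e : lsum (fun t => RtoC (u t)) l = RtoC (rsum u l)).
  { clear. induction l; simpl; auto. rewrite IHl, RtoC_plus; auto. }
  rewrite e, <- RtoC_minus, Cmod_R.
  assert (rsum u l0 <= rsum u l) by (apply rsum_incl; auto).
  specialize (hs l hl). apply Rabs_le; lra.
Qed.

Lemma usum_complete f B : bsum (fun t => Cmod (f t)) B -> exists s, usum f s.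
Proof.
  intros hb.
  assert (pos : forall u, (forall t, 0 <= u t <= Cmod (f t)) ->
     exists s : R, usum (fun t => RtoC (u t)) (RtoC s)).
  { intros u hu. apply usum_real_pos with B.
    - intros t; apply hu.
    - eapply bsum_le; [|apply hb]. intros t; apply hu. }
  assert (im : forall c : C, Rabs (Im c) <= Cmod c).
  { intros c. generalize (Rmax_Cmod c); generalize (Rmax_r (Rabs (fst c)) (Rabs (snd c))).
    unfold Im; lra. }
  destruct (pos (fun t => Rmax (Re (f t)) 0)) as (s1 & h1).
  { intros t; split; [apply Rmax_r|]. apply Rmax_lub; [|apply Cmod_ge_0].
    eapply Rle_trans; [apply Rle_abs|apply re_le_Cmod]. }
  destruct (pos (fun t => Rmax (- Re (f t)) 0)) as (s2 & h2).
  { intros t; split; [apply Rmax_r|]. apply Rmax_lub; [|apply Cmod_ge_0].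
    eapply Rle_trans; [apply Rle_abs|]. rewrite Rabs_Ropp. apply re_le_Cmod. }
  destruct (pos (fun t => Rmax (Im (f t)) 0)) as (s3 & h3).
  { intros t; split; [apply Rmax_r|]. apply Rmax_lub; [|apply Cmod_ge_0].
    eapply Rle_trans; [apply Rle_abs|apply im]. }
  destruct (pos (fun t => Rmax (- Im (f t)) 0)) as (s4 & h4).
  { intros t; split; [apply Rmax_r|]. apply Rmax_lub; [|apply Cmod_ge_0].
    eapply Rle_trans; [apply Rle_abs|]. rewrite Rabs_Ropp. apply im. }
  (* The positive and negative parts of the real and imaginary parts are dominated by [Cmod]; they
     recombine with the factors $1,-1,i,-i$. *)
  exists ((s1 + (RtoC (-1)) * s2) + (Ci * s3 + (- Ci) * s4))%C.
  eapply usum_ext; [|apply usum_plus; apply usum_plus;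
    [apply h1|apply usum_scal, h2|apply usum_scal, h3|apply usum_scal, h4]].
  intros t; simpl.
  assert (e : forall x, Rmax x 0 - Rmax (- x) 0 = x).
  { intros x; unfold Rmax; destruct (Rle_dec x 0), (Rle_dec (-x) 0); lra. }
  apply injective_projections; simpl.
  - generalize (e (Re (f t))); unfold Re; lra.
  - generalize (e (Im (f t))); unfold Im; lra.
Qed.

(** Summation as a total function; the value off the summable families is arbitrary, and
    [usumv_spec] gives it a meaning. *)
Definition usumv f : C := epsilon (inhabits (RtoC 0)) (usum f).

Lemma usumv_spec f B : bsum (fun t => Cmod (f t)) B -> usum f (usumv f).
Proof.
  intros h. unfold usumv. apply epsilon_spec. apply usum_complete with B; auto.
Qed.

End UnorderedSums.

Lemma NoDup_map_inj {S T : Type} (phi : S -> T) l :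
  (forall x y, phi x = phi y -> x = y) -> NoDup l -> NoDup (map phi l).
Proof.
  intros hinj. induction 1; simpl; constructor; auto.
  intros h; apply in_map_iff in h; destruct h as (y & e & hy).
  apply hinj in e; subst; contradiction.
Qed.

Lemma lsum_map {S T : Type} (phi : S -> T) f l : lsum f (map phi l) = lsum (fun x => f (phi x)) l.
Proof. induction l; simpl; congruence. Qed.

Lemma rsum_map {S T : Type} (phi : S -> T) f l : rsum f (map phi l) = rsum (fun x => f (phi x)) l.
Proof. induction l; simpl; congruence. Qed.

Lemma usum_reindex {S T : Type} (phi : S -> T) (psi : T -> S) f s :
  (forall x, psi (phi x) = x) -> (forall y, phi (psi y) = y) ->
  usum f s -> usum (fun x => f (phi x)) s.
Proof.
  intros h1 h2 h eps heps. destruct (h eps heps) as (l0 & h0).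
  exists (map psi l0). intros l hl hi.
  rewrite <- lsum_map. apply h0.
  - apply NoDup_map_inj; auto. intros x y e; rewrite <- (h1 x), <- (h1 y), e; auto.
  - intros y hy. rewrite <- (h2 y). apply in_map, hi, in_map, hy.
Qed.

Lemma bsum_inj {S T : Type} (phi : S -> T) u B :
  (forall x y, phi x = phi y -> x = y) -> bsum u B -> bsum (fun x => u (phi x)) B.
Proof.
  intros h1 h l hl. rewrite <- rsum_map. apply h. apply NoDup_map_inj; auto.
Qed.

Lemma rsum_swap {S T : Type} (F : S -> T -> R) l1 l2 :
  rsum (fun x => rsum (F x) l2) l1 = rsum (fun y => rsum (fun x => F x y) l1) l2.
Proof.
  induction l1; simpl.
  - induction l2; simpl; auto. rewrite <- IHl2; ring.
  - rewrite IHl1, rsum_plus; reflexivity.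
Qed.

Lemma rsum_list_prod {S T : Type} (F : S -> T -> R) l1 l2 :
  rsum (fun p => F (fst p) (snd p)) (list_prod l1 l2) = rsum (fun x => rsum (F x) l2) l1.
Proof.
  induction l1; simpl; auto. rewrite rsum_app, rsum_map, IHl1. reflexivity.
Qed.

Lemma lsum_list_prod {S T : Type} (F : S -> T -> C) l1 l2 :
  lsum (fun p => F (fst p) (snd p)) (list_prod l1 l2) = lsum (fun x => lsum (F x) l2) l1.
Proof.
  induction l1; simpl; auto. rewrite lsum_app, lsum_map, IHl1. reflexivity.
Qed.

Lemma NoDup_list_prod {S T : Type} (l1 : list S) (l2 : list T) :
  NoDup l1 -> NoDup l2 -> NoDup (list_prod l1 l2).
Proof.
  intros h1 h2; induction h1; simpl; [constructor|].
  apply NoDup_app; auto.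
  - apply NoDup_map_inj; auto. congruence.
  - intros p hp hq. apply in_map_iff in hp; destruct hp as (y & <- & hy).
    apply in_prod_iff in hq. tauto.
Qed.

(** Absolute summability of a double family, tested on finite rectangles. [bsum2_prod] extends the
    bound to any finite set of pairs, since such a set sits in the rectangle of its two
    projections. *)
Definition bsum2 {S T : Type} (F : S -> T -> R) (B : R) : Prop :=
  forall l1 l2, NoDup l1 -> NoDup l2 -> rsum (fun x => rsum (F x) l2) l1 <= B.

Lemma bsum2_swap {S T : Type} (F : S -> T -> R) B :
  bsum2 F B -> bsum2 (fun y x => F x y) B.
Proof. intros h l1 l2 h1 h2. rewrite <- rsum_swap. apply h; auto. Qed.

Lemma bsum2_prod {S T : Type} (F : S -> T -> R) B : (forall x y, 0 <= F x y) ->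
  bsum2 F B -> bsum (fun p => F (fst p) (snd p)) B.
Proof.
  intros h0 h l hl.
  apply Rle_trans with (rsum (fun p => F (fst p) (snd p))
     (list_prod (lunion (map fst l) nil) (lunion (map snd l) nil))).
  - apply rsum_incl; auto. intros [x y] hp. apply in_prod_iff; split.
    + apply lunion_l. apply (in_map fst) in hp; auto.
    + apply lunion_l. apply (in_map snd) in hp; auto.
  - rewrite rsum_list_prod. apply h; apply lunion_nodup.
Qed.

Lemma bsum2_row {S T : Type} (F : S -> T -> R) B x :
  bsum2 F B -> bsum (F x) B.
Proof.
  intros h l hl. specialize (h (x :: nil) l). simpl in h.
  assert (NoDup (x :: nil)) by (repeat constructor; simpl; auto).
  specialize (h H hl). lra.
Qed.

Lemma usum_lsum {S T : Type} (F : S -> T -> C) (r : S -> C) l1 eps : 0 < eps ->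
  (forall x, usum (F x) (r x)) ->
  exists l0, forall l, NoDup l -> incl l0 l ->
    Cmod (lsum (fun x => lsum (F x) l) l1 - lsum r l1) <= eps.
Proof.
  intros he h; revert eps he; induction l1 as [|x l1 IH]; intros eps he; simpl.
  - exists nil; intros. replace (RtoC 0 - RtoC 0)%C with (RtoC 0) by ring. rewrite Cmod_0; lra.
  - destruct (IH (eps / 2)) as (l0 & h0); [lra|].
    destruct (h x (eps / 2)) as (l0' & h0'); [lra|].
    exists (l0 ++ l0'). intros l hl hi.
    specialize (h0 l hl (fun x hx => hi x (in_or_app _ _ _ (or_introl hx)))).
    specialize (h0' l hl (fun x hx => hi x (in_or_app _ _ _ (or_intror hx)))).
    set (A := lsum (fun x0 => lsum (F x0) l) l1) in *.
    replace (lsum (F x) l + A - (r x + lsum r l1))%C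
      with ((lsum (F x) l - r x) + (A - lsum r l1))%C by ring.
    eapply Rle_trans; [apply Cmod_triangle|lra].
Qed.

(** On a rectangle [list_prod l1 m] that contains [l0] the double sum is close to [s]; for [m] large
    it is also close to the sum of the finitely many row sums [r]. *)
Lemma usum_rows {S T : Type} (F : S -> T -> C) (r : S -> C) s :
  usum (fun p => F (fst p) (snd p)) s -> (forall x, usum (F x) (r x)) -> usum r s.
Proof.
  intros hs hr eps heps. destruct (hs (eps / 2)) as (l0 & h0); [lra|].
  exists (map fst l0). intros l1 hl1 hi1.
  destruct (usum_lsum F r l1 (eps / 2)) as (l2 & h2); auto; [lra|].
  set (m := lunion (map snd l0) l2).
  specialize (h2 m (lunion_nodup _ _) (lunion_r _ _)).
  specialize (h0 (list_prod l1 m)).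
  rewrite lsum_list_prod in h0.
  set (A := lsum (fun x => lsum (F x) m) l1) in *.
  assert (Cmod (A - s) <= eps / 2).
  { apply h0.
    - apply NoDup_list_prod; auto. apply lunion_nodup.
    - intros [x y] hp. apply in_prod_iff; split.
      + apply hi1. apply (in_map fst) in hp; auto.
      + apply lunion_l. apply (in_map snd) in hp; auto. }
  replace (lsum r l1 - s)%C with (- (A - lsum r l1) + (A - s))%C by ring.
  eapply Rle_trans; [apply Cmod_triangle|]. rewrite Cmod_opp. lra.
Qed.

(** Both iterated sums equal the sum over pairs, which exists by absolute summability; exchanging
    the coordinates is a reindexing. *)
Lemma usum_fubini {S T : Type} (F : S -> T -> C) (r : S -> C) (c : T -> C) s B :
  bsum2 (fun x y => Cmod (F x y)) B ->
  (forall x, usum (F x) (r x)) -> usum r s ->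
  (forall y, usum (fun x => F x y) (c y)) -> usum c s.
Proof.
  intros hB hr hs hc.
  assert (hp : bsum (fun p => Cmod (F (fst p) (snd p))) B).
  { apply (bsum2_prod (fun x y => Cmod (F x y))); auto. intros; apply Cmod_ge_0. }
  destruct (usum_complete (fun p => F (fst p) (snd p)) B hp) as (s' & hs').
  assert (s = s') by (eapply usum_unique; [apply hs|eapply usum_rows; eauto]); subst s'.
  apply (usum_rows (fun y x => F x y)); auto.
  apply (usum_reindex (fun p : T * S => (snd p, fst p)) (fun p => (snd p, fst p)) _ _
     (fun p => match p with (a, b) => eq_refl end) (fun p => match p with (a, b) => eq_refl end) hs').
Qed.

Lemma bsum_columns {S T : Type} (F : S -> T -> C) (c : T -> C) (w : T -> R) B :
  (forall y, 0 <= w y) ->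
  bsum2 (fun x y => w y * Cmod (F x y)) B ->
  (forall y, usum (fun x => F x y) (c y)) -> bsum (fun y => w y * Cmod (c y)) B.
Proof.
  intros hw hB hc l hl. apply le_epsilon; intros eps heps.
  (* The finitely many columns in [l] are approximated on one common list [l1] with error [eps / W]
     each, so the weighted error is at most [eps]; the added $1$ keeps [W] positive. *)
  set (W := rsum w l + 1).
  assert (hW : 0 < W) by (unfold W; generalize (rsum_ge0 w l hw); lra).
  assert (H : forall l W, 0 < W -> exists l1, NoDup l1 /\ forall y, In y l ->
     Cmod (c y) <= rsum (fun x => Cmod (F x y)) l1 + eps / W).
  { clear l hl W hW. intros l W hW. induction l as [|y l IH].
    - exists nil; split; [constructor|simpl; tauto].
    - assert (hw' : 0 < eps / W) by (apply Rdiv_lt_0_compat; auto).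
      destruct IH as (l1 & hl1 & h1).
      destruct (hc y (eps / W) hw') as (l2 & h2).
      exists (lunion l1 l2); split; [apply lunion_nodup|].
      intros z [<-|hz].
      + specialize (h2 _ (lunion_nodup l1 l2) (lunion_r l1 l2)).
        generalize (Cmod_lsum (fun x => F x y) (lunion l1 l2)); intros h3.
        set (A := lsum (fun x => F x y) (lunion l1 l2)) in *.
        replace (c y) with (A + - (A - c y))%C by ring.
        eapply Rle_trans; [apply Cmod_triangle|]. rewrite Cmod_opp. lra.
      + specialize (h1 z hz).
        assert (rsum (fun x => Cmod (F x z)) l1 <= rsum (fun x => Cmod (F x z)) (lunion l1 l2)); [|lra].
        apply rsum_incl; auto; [intros; apply Cmod_ge_0|apply lunion_l]. }
  destruct (H l W hW) as (l1 & hl1 & h1).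
  apply Rle_trans with (rsum (fun y => rsum (fun x => w y * Cmod (F x y)) l1 + eps / W * w y) l).
  - apply rsum_le. intros y hy. rewrite rsum_scal.
    specialize (h1 y hy). specialize (hw y). nra.
  - rewrite rsum_plus, rsum_scal, <- rsum_swap.
    specialize (hB l1 l hl1 hl).
    assert (eps / W * rsum w l <= eps); [|lra].
    apply Rle_trans with (eps / W * W); [|right; field; lra].
    apply Rmult_le_compat_l; [left; apply Rdiv_lt_0_compat; auto|unfold W; lra].
Qed.

(** * Loops with absolutely convergent Fourier series *)

Lemma RtoC_m1 : RtoC (-1) = (- RtoC 1)%C.
Proof. rewrite <- RtoC_opp. f_equal. Qed.

Lemma Rabs_m1 : Rabs (-1) = 1.
Proof. rewrite Rabs_left; lra. Qed.

Lemma unit_neq0 l : Cmod l = 1 -> l <> RtoC 0.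
Proof. intros h ->; rewrite Cmod_0 in h; lra. Qed.

Lemma Czpow_succ l n : l <> RtoC 0 -> Czpow l (n + 1) = (l * Czpow l n)%C.
Proof.
  intros hl. destruct n as [|p|p].
  - simpl. ring.
  - replace (Z.pos p + 1)%Z with (Z.pos (p + 1)) by lia. unfold Czpow.
    rewrite Pos2Nat.inj_add, Nat.add_comm. simpl. reflexivity.
  - destruct (Pos.eq_dec p 1) as [->|hp].
    + simpl. field; auto.
    + replace (Z.neg p + 1)%Z with (Z.neg (Pos.pred p)) by lia. unfold Czpow.
      replace (Pos.to_nat p) with (S (Pos.to_nat (Pos.pred p))) by lia.
      rewrite Cpow_S. field. split; auto. apply Cpow_nz; auto.
Qed.

Lemma Czpow_pred l n : l <> RtoC 0 -> Czpow l (n - 1) = (/ l * Czpow l n)%C.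
Proof.
  intros hl. replace n with (n - 1 + 1)%Z at 2 by lia. rewrite (Czpow_succ l (n - 1)) by auto.
  field; auto.
Qed.

Lemma Czpow_add l m n : l <> RtoC 0 -> Czpow l (m + n) = (Czpow l m * Czpow l n)%C.
Proof.
  intros hl. revert m. apply (Z.peano_ind (fun m => Czpow l (m + n) = (Czpow l m * Czpow l n)%C)).
  - simpl. ring.
  - intros m IH. replace (Z.succ m + n)%Z with (m + n + 1)%Z by lia.
    replace (Z.succ m) with (m + 1)%Z by lia.
    rewrite !Czpow_succ, IH; auto. ring.
  - intros m IH. replace (Z.pred m + n)%Z with (m + n - 1)%Z by lia.
    replace (Z.pred m) with (m - 1)%Z by lia.
    rewrite !Czpow_pred, IH; auto. ring.
Qed.

Lemma Czpow_nat l (n : nat) : Czpow l (Z.of_nat n) = (l ^ n)%C.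
Proof.
  destruct n; [reflexivity|]. unfold Z.of_nat, Czpow. rewrite SuccNat2Pos.id_succ. reflexivity.
Qed.

Lemma Czpow_neg_nat l (n : nat) : Czpow l (- Z.of_nat n) = (/ (l ^ n))%C.
Proof.
  destruct n; [|unfold Z.of_nat, Z.opp, Czpow; rewrite SuccNat2Pos.id_succ; reflexivity].
  simpl. field.
Qed.

Lemma Z_nat_cases n : exists k : nat, n = Z.of_nat k \/ n = (- Z.of_nat k)%Z.
Proof. exists (Z.abs_nat n). lia. Qed.

Lemma Cmod_Czpow l n : Cmod l = 1 -> Cmod (Czpow l n) = 1.
Proof.
  intros h. destruct (Z_nat_cases n) as (k & [->| ->]).
  - rewrite Czpow_nat, Cmod_pow, h. apply pow1.
  - rewrite Czpow_neg_nat, Cmod_inv, Cmod_pow, h, pow1; [lra|].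
    apply Cpow_nz, unit_neq0; auto.
Qed.

Definition cis (t : R) : C := (cos t, sin t).

Lemma Cmod_cis t : Cmod (cis t) = 1.
Proof.
  unfold Cmod, cis; simpl. generalize (sin2_cos2 t); unfold Rsqr; intros e.
  replace (cos t * (cos t * 1) + sin t * (sin t * 1)) with 1 by lra. apply sqrt_1.
Qed.

Lemma cis_plus s t : cis (s + t) = (cis s * cis t)%C.
Proof. unfold cis, Cmult; simpl. rewrite cos_plus, sin_plus. f_equal; ring. Qed.

Lemma Czpow_cis t n : Czpow (cis t) n = cis (IZR n * t).
Proof.
  assert (hz : cis t <> RtoC 0) by (apply unit_neq0, Cmod_cis).
  revert n. apply Z.peano_ind.
  - simpl. unfold cis. rewrite Rmult_0_l, cos_0, sin_0. reflexivity.
  - intros m IH. replace (Z.succ m) with (m + 1)%Z by lia.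
    rewrite Czpow_succ, IH, <- cis_plus, plus_IZR; auto. f_equal; ring.
  - intros m IH. replace (Z.pred m) with (m - 1)%Z by lia.
    rewrite Czpow_pred, IH, minus_IZR; auto.
    replace (IZR m * t) with (t + (IZR m - 1) * t) by ring.
    rewrite cis_plus. field; auto.
Qed.

Lemma Czpow_conj l n : l <> RtoC 0 -> Cconj (Czpow (Cconj l) n) = Czpow l n.
Proof.
  intros hl.
  assert (hc : Cconj l <> RtoC 0).
  { intros e. apply hl. apply (f_equal Cconj) in e. rewrite Cconj_conj in e. rewrite e.
    unfold Cconj; simpl. apply injective_projections; simpl; lra. }
  destruct (Z_nat_cases n) as (k & [->| ->]).
  - rewrite !Czpow_nat, Cpow_conj, Cconj_conj; auto.
  - rewrite !Czpow_neg_nat, Cinv_conj, Cpow_conj, Cconj_conj; auto. apply Cpow_nz; auto.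
Qed.

Definition sgnz (n : Z) : R := if Z.even n then 1 else -1.

Lemma Czpow_opp l n : l <> RtoC 0 -> Czpow (- l)%C n = (RtoC (sgnz n) * Czpow l n)%C.
Proof.
  intros hl.
  assert (hc : (- l)%C <> RtoC 0).
  { intros e. apply hl. replace l with (- - l)%C by ring. rewrite e. ring. }
  revert n. apply Z.peano_ind.
  - simpl. unfold sgnz; simpl. ring.
  - intros m IH. replace (Z.succ m) with (m + 1)%Z by lia.
    rewrite !Czpow_succ, IH; auto. unfold sgnz.
    replace (m + 1)%Z with (Z.succ m) by lia. rewrite Z.even_succ, <- Z.negb_even.
    destruct (Z.even m); simpl; apply injective_projections; simpl; ring.
  - intros m IH. replace (Z.pred m) with (m - 1)%Z by lia.
    rewrite !Czpow_pred, IH; auto. unfold sgnz.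
    replace (m - 1)%Z with (Z.pred m) by lia. rewrite Z.even_pred, <- Z.negb_even.
    destruct (Z.even m); simpl; [replace (RtoC (-1)) with (- (1))%C by (rewrite <- RtoC_opp; f_equal; lra)|
     replace (RtoC (-1)) with (- (1))%C by (rewrite <- RtoC_opp; f_equal; lra)]; field; auto.
Qed.

Definition four (a : Z -> R) (g : C -> C) : Prop := forall l, Cmod l = 1 ->
  usum (fun n => RtoC (a n) * Czpow l n)%C (g l).

Definition wb (w a : Z -> R) (B : R) : Prop := bsum (fun n => w n * Rabs (a n)) B.

(** The $n$-th Fourier coefficient as a total function of the loop, so that it can serve as a
    functional. Only the real part is integrated because the coefficients of interest are real;
    [four_cf] identifies the value. *)
Definition cf (g : C -> C) (n : Z) : R :=
  / (2 * PI) * RInt (fun t => Re (g (cis t) * Czpow (cis t) (- n))%C) 0 (2 * PI).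

(** The filter of unordered summation. With it [filterlim_RInt], the theorem on limits of integrals,
    applies to partial sums indexed by lists. *)
Definition uord {T : Type} (P : list T -> Prop) : Prop :=
  exists l0, forall l, NoDup l -> incl l0 l -> P l.

Global Instance uord_proper {T : Type} : ProperFilter (@uord T).
Proof.
  split.
  - intros P (l0 & h). exists (lunion l0 nil). apply h; [apply lunion_nodup|apply lunion_l].
  - split.
    + exists nil; auto.
    + intros P Q (l0 & h) (l1 & h'). exists (l0 ++ l1). intros l hl hi; split.
      * apply h; auto. intros x hx; apply hi, in_app_iff; auto.
      * apply h'; auto. intros x hx; apply hi, in_app_iff; auto.
    + intros P Q hPQ (l0 & h). exists l0. auto.
Qed.

Lemma is_RInt_cosn (k : Z) : is_RInt (fun t => cos (IZR k * t)) 0 (2 * PI)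
  (if Z.eq_dec k 0 then 2 * PI else 0).
Proof.
  destruct (Z.eq_dec k 0) as [->|hk].
  - apply (is_RInt_ext (fun _ => 1)).
    + intros x _. rewrite Rmult_0_l, cos_0; auto.
    + evar_last; [apply (@is_RInt_const R_NormedModule)|].
      unfold scal; simpl; unfold mult; simpl; ring.
  - assert (hk' : IZR k <> 0) by (apply not_0_IZR; auto).
    evar_last.
    + apply (@is_RInt_derive R_CompleteNormedModule (fun t => sin (IZR k * t) / IZR k)).
      * intros x _. auto_derive; auto. field; auto.
      * intros x _. apply (@ex_derive_continuous R_AbsRing R_NormedModule). auto_derive; auto.
    + assert (e : sin (IZR k * (2 * PI)) = 0).
      { destruct (Z_nat_cases k) as (n & [->| ->]).
        - rewrite <- INR_IZR_INZ.
          replace (INR n * (2 * PI)) with (0 + 2 * INR n * PI) by ring.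
          rewrite sin_period, sin_0; auto.
        - rewrite opp_IZR, <- INR_IZR_INZ.
          replace (- INR n * (2 * PI)) with (- (0 + 2 * INR n * PI)) by ring.
          rewrite sin_neg, sin_period, sin_0; ring. }
      rewrite e. unfold minus, plus, opp; simpl. rewrite Rmult_0_r, sin_0. field; auto.
Qed.

Lemma wb_1 w a B : (forall n, 1 <= w n) -> wb w a B -> bsum (fun n => Rabs (a n)) B.
Proof.
  intros hw. apply bsum_le. intros n. generalize (Rabs_pos (a n)) (hw n); intros; nra.
Qed.

Lemma Cmod_coef a l n : Cmod l = 1 -> Cmod (RtoC (a n) * Czpow l n)%C = Rabs (a n).
Proof. intros h. rewrite Cmod_mult, Cmod_R, Cmod_Czpow; auto. ring. Qed.

Lemma bsum_coef a l B : Cmod l = 1 -> bsum (fun n => Rabs (a n)) B ->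
  bsum (fun n => Cmod (RtoC (a n) * Czpow l n)) B.
Proof. intros hl. apply bsum_le. intros n. rewrite Cmod_coef; auto. lra. Qed.

Lemma Cmod_sum_tail {T : Type} (f : T -> C) s l0 eps : usum f s -> NoDup l0 ->
  (forall l, NoDup l -> (forall t, In t l -> ~ In t l0) -> rsum (fun t => Cmod (f t)) l <= eps) ->
  forall l, NoDup l -> incl l0 l -> Cmod (lsum f l - s) <= eps.
Proof.
  intros hs hd0 ht l hl hi. apply le_epsilon; intros e he.
  destruct (hs e he) as (l1 & h1).
  specialize (h1 (lunion l l1) (lunion_nodup _ _) (lunion_r _ _)).
  destruct (incl_split l (lunion l l1) hl (lunion_nodup _ _) (lunion_l _ _)) as (l' & p1 & p2 & p3).
  rewrite (lsum_perm _ _ _ p1), lsum_app in h1.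
  assert (h2 : rsum (fun t => Cmod (f t)) l' <= eps).
  { apply ht; auto. intros t h h'. apply (p3 t h), hi, h'. }
  generalize (Cmod_lsum f l'); intros h3.
  replace (lsum f l - s)%C with (- (lsum f l') + (lsum f l + lsum f l' - s))%C by ring.
  eapply Rle_trans; [apply Cmod_triangle|]. rewrite Cmod_opp. lra.
Qed.

Lemma rsum_single {T : Type} (u : T -> R) l t0 : NoDup l -> In t0 l ->
  (forall t, t <> t0 -> u t = 0) -> rsum u l = u t0.
Proof.
  intros hl hi hz.
  assert (z : forall l, ~ In t0 l -> rsum u l = 0).
  { clear l hl hi. induction l; simpl; intros h; auto.
    rewrite IHl, hz; [ring|..]; intuition. }
  induction hl as [|x l hx hl IH]; simpl in hi; [tauto|]. simpl.
  destruct hi as [->|hi].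
  - rewrite z; auto; ring.
  - rewrite IH, hz; auto; [ring|]. intros ->; contradiction.
Qed.

(** Absolute summability bounds the tails independently of the point of the circle, so the partial
    sums converge uniformly and may be integrated term by term; orthogonality of the characters
    leaves one term. *)
Lemma four_cf a g B : bsum (fun n => Rabs (a n)) B -> four a g -> forall n, cf g n = a n.
Proof.
  intros hb hf n.
  pose (f := fun (l : list Z) (t : R) => Re (lsum (fun m => RtoC (a m) * Czpow (cis t) m) l * Czpow (cis t) (- n))%C).
  pose (h := fun (l : list Z) => rsum (fun m => a m * (if Z.eq_dec (m - n) 0 then 2 * PI else 0)) l).
  destruct (@filterlim_RInt (list Z) R_CompleteNormedModule f 0 (2 * PI) uord uord_proper
    (fun t => Re (g (cis t) * Czpow (cis t) (- n))%C) h) as (I & h1 & h2).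
  - intros l. unfold f, h. clear h f.
    apply (is_RInt_ext (fun t => rsum (fun m => a m * cos (IZR (m - n) * t)) l)).
    + intros t _. induction l as [|m l IH]; [simpl; ring|].
      cbn [lsum rsum]. rewrite IH.
      rewrite Cmult_plus_distr_r.
      replace (RtoC (a m) * Czpow (cis t) m * Czpow (cis t) (- n))%C
        with (RtoC (a m) * cis (IZR (m - n) * t))%C.
      * unfold cis, Re; simpl. ring.
      * rewrite <- Czpow_cis. replace (m - n)%Z with (m + - n)%Z by lia.
        rewrite Czpow_add; [ring|]. apply unit_neq0, Cmod_cis.
    + induction l as [|m l IH]; simpl.
      * evar_last; [apply (@is_RInt_const R_NormedModule)|]. apply Rmult_0_r.
      * apply (@is_RInt_plus R_NormedModule); auto.
        apply (@is_RInt_scal R_NormedModule). apply is_RInt_cosn.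
  - intros P (eps & hP).
    destruct (bsum_tail _ _ (fun t => Rabs_pos (a t)) hb (eps / 2)) as (l0 & d0 & t0).
    { destruct eps; simpl; lra. }
    exists l0. intros l hl hi. apply hP. intros t. unfold f.
    change (Rabs (Re (lsum (fun m => RtoC (a m) * Czpow (cis t) m) l * Czpow (cis t) (- n))%C
      - Re (g (cis t) * Czpow (cis t) (- n))%C) < eps).
    replace (Re (lsum (fun m => RtoC (a m) * Czpow (cis t) m) l * Czpow (cis t) (- n))%C
      - Re (g (cis t) * Czpow (cis t) (- n))%C) with
      (Re ((lsum (fun m => RtoC (a m) * Czpow (cis t) m) l - g (cis t)) * Czpow (cis t) (- n))%C)
      by (unfold Re; simpl; ring).
    eapply Rle_lt_trans; [apply re_le_Cmod|]. rewrite Cmod_mult, Cmod_Czpow, Rmult_1_r by apply Cmod_cis.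
    apply Rle_lt_trans with (eps / 2); [|destruct eps; simpl; lra].
    apply (Cmod_sum_tail _ _ l0); auto.
    + apply hf, Cmod_cis.
    + intros l' hl' hd. eapply Rle_trans; [|apply (t0 l' hl' hd)].
      apply rsum_le. intros m _. rewrite Cmod_coef by apply Cmod_cis. lra.
  - assert (hI : I = 2 * PI * a n).
    { apply (filterlim_locally_unique (F := uord) h); auto.
      intros P (eps & hP). exists (n :: nil). intros l hl hi. apply hP.
      unfold h. rewrite (rsum_single _ _ n); auto.
      - destruct (Z.eq_dec (n - n) 0); [|lia].
        replace (a n * (2 * PI)) with (2 * PI * a n) by ring. apply ball_center.
      - apply hi; simpl; auto.
      - intros m hm. destruct (Z.eq_dec (m - n) 0); [lia|ring]. }
    unfold cf. rewrite hI in h2.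
    rewrite (@is_RInt_unique R_CompleteNormedModule _ _ _ _ h2). field. apply PI_neq0.
Qed.

(** Submultiplicativity makes the weighted $\ell^1$ norm an algebra norm, and $w\ge1$ makes it
    dominate the supremum norm on the circle. *)
Definition weight (w : Z -> R) : Prop :=
  (forall n, 1 <= w n) /\ (forall m n, w (m + n)%Z <= w m * w n).

Definition w1 (n : Z) : R := 1.
(** A finite [w2] norm means absolute convergence on the annulus $1/2\le|\lambda|\le2$. The weight
    absorbs a factor $|n|$, hence a derivative in $\lambda$. *)
Definition w2 (n : Z) : R := 2 ^ Z.abs_nat n.

Lemma weight_w1 : weight w1.
Proof. unfold w1; split; intros; lra. Qed.

Lemma weight_w2 : weight w2.
Proof.
  split; intros; unfold w2.
  - apply pow_R1_Rle; lra.
  - rewrite <- pow_add. apply Rle_pow; [lra|lia].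
Qed.

(** The coefficients of the product are the convolution. The three weights are independent of each
    other, and the inequality between them is asked only at frequencies where [a] is nonzero:
    [rep_regular] uses this for a factor with one-sided support. *)
Lemma conv a b g h A B :
  bsum (fun n => Rabs (a n)) A -> bsum (fun n => Rabs (b n)) B -> four a g -> four b h ->
  exists c, four c (fun l => g l * h l)%C /\
    (forall n, (forall k, a k * b (n - k)%Z = 0) -> c n = 0) /\
    (forall v1 v2 v3 B1 B2, (forall n, 0 <= v1 n) -> (forall n, 0 <= v2 n) -> (forall n, 0 <= v3 n) ->
      (forall k m, a k <> 0 -> v3 (k + m)%Z <= v1 k * v2 m) ->
      wb v1 a B1 -> wb v2 b B2 -> wb v3 c (B1 * B2)).
Proof.
  intros ha hb hg hh.
  assert (bnd : forall v1 v2 v3 B1 B2, (forall n, 0 <= v1 n) -> (forall n, 0 <= v2 n) ->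
    (forall n, 0 <= v3 n) ->
    (forall k m, a k <> 0 -> v3 (k + m)%Z <= v1 k * v2 m) -> wb v1 a B1 -> wb v2 b B2 ->
    bsum2 (fun k n => v3 n * Cmod (RtoC (a k * b (n - k)%Z))) (B1 * B2)).
  { intros v1 v2 v3 B1 B2 p1 p2 p3 hv h1 h2 l1 l2 hl1 hl2.
    apply Rle_trans with (rsum (fun k => B2 * (v1 k * Rabs (a k))) l1).
    - apply rsum_le. intros k _.
      apply Rle_trans with (rsum (fun n => (v1 k * Rabs (a k)) * (v2 (n - k)%Z * Rabs (b (n - k)%Z))) l2).
      + apply rsum_le. intros n _. rewrite Cmod_R, Rabs_mult.
        destruct (Req_dec (a k) 0) as [->|hk]; [rewrite Rabs_R0; lra|].
        specialize (hv k (n - k)%Z hk). replace (k + (n - k))%Z with n in hv by lia.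
        generalize (Rabs_pos (a k)) (Rabs_pos (b (n - k)%Z)) (p1 k) (p2 (n - k)%Z). intros.
        assert (0 <= Rabs (a k) * Rabs (b (n - k)%Z)) by (apply Rmult_le_pos; auto).
        nra.
      + rewrite rsum_scal. rewrite Rmult_comm. apply Rmult_le_compat_r.
        * apply Rmult_le_pos; [apply p1|apply Rabs_pos].
        * apply (bsum_inj (fun n => (n - k)%Z) _ B2) in h2; [apply (h2 l2 hl2)|].
          intros x y; lia.
    - rewrite rsum_scal. rewrite Rmult_comm. apply Rmult_le_compat_r; [|apply h1; auto].
      eapply bsum_ge0; eauto. }
  assert (b1 : bsum2 (fun k n => Cmod (RtoC (a k * b (n - k)%Z))) (A * B)).
  { intros l1 l2 hl1 hl2. eapply Rle_trans; [|refine (bnd w1 w1 w1 A B _ _ _ _ _ _ l1 l2 hl1 hl2)].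
    - right. apply rsum_ext'; intros k. apply rsum_ext'; intros n. unfold w1; ring.
    - intros; unfold w1; lra.
    - intros; unfold w1; lra.
    - intros; unfold w1; lra.
    - intros; unfold w1; lra.
    - intros l hl. rewrite (rsum_ext' _ (fun n => Rabs (a n))); [apply ha; auto|unfold w1; intros; ring].
    - intros l hl. rewrite (rsum_ext' _ (fun n => Rabs (b n))); [apply hb; auto|unfold w1; intros; ring]. }
  pose (c := fun n => Re (usumv (fun k => RtoC (a k * b (n - k)%Z)))).
  assert (hc : forall n, usum (fun k => RtoC (a k * b (n - k)%Z)) (RtoC (c n))).
  { intros n.
    assert (hs : usum (fun k => RtoC (a k * b (n - k)%Z)) (usumv (fun k => RtoC (a k * b (n - k)%Z)))).
    { apply usumv_spec with (A * B). apply (bsum2_row _ _ n (bsum2_swap _ _ b1)). }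
    unfold c. rewrite (usum_real _ _ hs). apply hs. }
  exists c. split; [|split].
  - intros l hl.
    apply (usum_fubini (fun k n => RtoC (a k * b (n - k)%Z) * Czpow l n)%C
      (fun k => RtoC (a k) * Czpow l k * h l)%C _ _ (A * B)).
    + intros l1 l2 h1 h2. eapply Rle_trans; [|apply (b1 l1 l2 h1 h2)].
      apply rsum_le; intros k _. apply rsum_le; intros n _.
      rewrite Cmod_mult, Cmod_Czpow; auto; lra.
    + intros k.
      apply (usum_ext (fun n => (RtoC (a k) * Czpow l k) * (RtoC (b (n - k)%Z) * Czpow l (n - k)%Z))%C).
      * intros n. assert (e : Czpow l n = (Czpow l k * Czpow l (n - k))%C).
        { rewrite <- Czpow_add by (apply unit_neq0; auto). f_equal; lia. }
        rewrite e, RtoC_mult. ring.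
      * apply usum_scal.
        apply (usum_reindex (fun n => (n - k)%Z) (fun n => (n + k)%Z)
          (fun n => RtoC (b n) * Czpow l n)%C); [lia|lia|auto].
    + apply (usum_ext (fun k => h l * (RtoC (a k) * Czpow l k))%C); [intros; ring|].
      rewrite Cmult_comm. apply usum_scal; auto.
    + intros n. apply (usum_ext (fun k => Czpow l n * RtoC (a k * b (n - k)%Z))%C); [intros; ring|].
      rewrite Cmult_comm. apply usum_scal; auto.
  - intros n hn. apply RtoC_inj. apply (usum_unique (fun k => RtoC (a k * b (n - k)%Z))); auto.
    replace (RtoC 0) with ((fun k => RtoC (a k * b (n - k)%Z)) 0%Z) by (cbv beta; rewrite hn; auto).
    apply (usum_single (fun k => RtoC (a k * b (n - k)%Z))). intros t _. rewrite hn; auto.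
  - intros v1 v2 v3 B1 B2 p1 p2 p3 hv h1 h2.
    eapply bsum_le; [|apply (bsum_columns (fun k n => RtoC (a k * b (n - k)%Z)) (fun n => RtoC (c n)) v3); eauto].
    intros n. simpl. rewrite Cmod_R. lra.
Qed.

Section Rep.

Context (w : Z -> R) (hw : weight w).
Implicit Types (g h : C -> C) (S : Z -> Prop).

(* Real Fourier coefficients encode the invariance under [rho]. *)
Definition rep S (B : R) g : Prop :=
  wb w (cf g) B /\ (forall n, ~ S n -> cf g n = 0) /\ four (cf g) g.

Lemma rep_intro S B g a :
  wb w a B -> (forall n, ~ S n -> a n = 0) -> four a g -> rep S B g.
Proof.
  intros h1 h2 h3. assert (e : cf g = a).
  { apply functional_extensionality. apply (four_cf a g B); auto.
    apply (wb_1 w); auto. apply hw. }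
  unfold rep; rewrite e; auto.
Qed.

Lemma w_ge0 n : 0 <= w n.
Proof. generalize (proj1 hw n); lra. Qed.

Lemma rep_ge0 S B g : rep S B g -> 0 <= B.
Proof. intros (h & _); eapply bsum_ge0; eauto. Qed.

Lemma rep_bsum S B g : rep S B g -> bsum (fun n => Rabs (cf g n)) B.
Proof. intros (h & _). apply (wb_1 w); auto. apply hw. Qed.

Lemma cf_ext g h : (forall l, Cmod l = 1 -> g l = h l) -> cf g = cf h.
Proof.
  intros e. apply functional_extensionality; intros n. unfold cf. f_equal.
  apply RInt_ext. intros t _. rewrite e; auto. apply Cmod_cis.
Qed.

Lemma rep_ext S B g h : (forall l, Cmod l = 1 -> g l = h l) -> rep S B g -> rep S B h.
Proof.
  intros e (h1 & h2 & h3). apply (rep_intro _ _ _ (cf g)); auto.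
  intros l hl. rewrite <- e; auto.
Qed.

Lemma rep_mono S S' B B' g : (forall n, S n -> S' n) -> B <= B' -> rep S B g -> rep S' B' g.
Proof.
  intros hS hB (h1 & h2 & h3). split; [|split]; auto. eapply bsum_mono; eauto.
Qed.

Lemma rep_limit S B g : (forall eps, 0 < eps -> rep S (B + eps) g) -> rep S B g.
Proof.
  intros h. destruct (h 1) as (_ & h2 & h3); [lra|]. split; [|split]; auto.
  apply bsum_limit. intros e he. apply (h e he).
Qed.

Lemma cf_plus S S' B B' g h n : rep S B g -> rep S' B' h ->
  cf (fun l => g l + h l)%C n = cf g n + cf h n.
Proof.
  intros hg hh. apply (four_cf (fun n => cf g n + cf h n) _ (B + B')).
  - eapply bsum_le; [|apply bsum_plus; [apply (rep_bsum _ _ _ hg)|apply (rep_bsum _ _ _ hh)]].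
    intros k; simpl. apply Rabs_triang.
  - intros l hl. apply (usum_ext (fun n => RtoC (cf g n) * Czpow l n + RtoC (cf h n) * Czpow l n)%C).
    + intros k. rewrite RtoC_plus. ring.
    + apply usum_plus; [apply hg|apply hh]; auto.
Qed.

Lemma cf_scal S B g c n : rep S B g -> cf (fun l => RtoC c * g l)%C n = c * cf g n.
Proof.
  intros hg. apply (four_cf (fun n => c * cf g n) _ (Rabs c * B)).
  - eapply bsum_le; [|apply bsum_scal; [apply Rabs_pos|apply (rep_bsum _ _ _ hg)]].
    intros k; simpl. rewrite Rabs_mult. lra.
  - intros l hl. apply (usum_ext (fun n => RtoC c * (RtoC (cf g n) * Czpow l n))%C).
    + intros k. rewrite RtoC_mult. ring.
    + apply usum_scal, hg; auto.
Qed.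

Lemma rep_plus S B B' g h : rep S B g -> rep S B' h -> rep S (B + B') (fun l => g l + h l)%C.
Proof.
  intros hg hh.
  assert (e := fun n => cf_plus _ _ _ _ _ _ n hg hh).
  destruct hg as (h1 & h2 & h3), hh as (h1' & h2' & h3').
  apply (rep_intro _ _ _ (fun n => cf g n + cf h n)).
  - eapply bsum_le; [|apply bsum_plus; [apply h1|apply h1']].
    intros k; simpl. rewrite <- Rmult_plus_distr_l. apply Rmult_le_compat_l; [apply w_ge0|apply Rabs_triang].
  - intros n hn. rewrite h2, h2'; auto; ring.
  - intros l hl. apply (usum_ext (fun n => RtoC (cf g n) * Czpow l n + RtoC (cf h n) * Czpow l n)%C).
    + intros k. rewrite RtoC_plus. ring.
    + apply usum_plus; auto.
Qed.

Lemma rep_scal S B g c : rep S B g -> rep S (Rabs c * B) (fun l => RtoC c * g l)%C.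
Proof.
  intros (h1 & h2 & h3). apply (rep_intro _ _ _ (fun n => c * cf g n)).
  - eapply bsum_le; [|apply bsum_scal; [apply Rabs_pos|apply h1]].
    intros k; simpl. rewrite Rabs_mult. generalize (w_ge0 k); intros; lra.
  - intros n hn; rewrite h2; auto; ring.
  - intros l hl. apply (usum_ext (fun n => RtoC c * (RtoC (cf g n) * Czpow l n))%C).
    + intros k. rewrite RtoC_mult. ring.
    + apply usum_scal, h3; auto.
Qed.

Lemma rep_opp S B g : rep S B g -> rep S B (fun l => - g l)%C.
Proof.
  intros h. apply (rep_ext _ _ (fun l => RtoC (-1) * g l)%C).
  - intros l _. rewrite RtoC_m1. ring.
  - replace B with (Rabs (-1) * B); [apply rep_scal; auto|].
    rewrite Rabs_m1; ring.
Qed.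

Lemma rep_minus S B B' g h : rep S B g -> rep S B' h -> rep S (B + B') (fun l => g l - h l)%C.
Proof. intros hg hh. apply rep_plus; auto. apply rep_opp; auto. Qed.

Lemma rep_zero S : rep S 0 (fun _ => RtoC 0).
Proof.
  apply (rep_intro _ _ _ (fun _ => 0)); auto.
  - intros l _. rewrite (rsum_ext' _ (fun n => 0 * 0)) by (intros; rewrite Rabs_R0; ring).
    rewrite rsum_scal; lra.
  - intros l hl.
    evar_last; [apply (usum_single (fun n => RtoC 0 * Czpow l n)%C 0%Z); intros; ring|].
    simpl; ring.
Qed.

Lemma rep_monomial S k : S k -> rep S (w k) (fun l => Czpow l k).
Proof.
  intros hk. apply (rep_intro _ _ _ (fun n => if Z.eq_dec n k then 1 else 0)).
  - intros l hl.
    destruct (in_dec Z.eq_dec k l) as [hi|hi].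
    + rewrite (rsum_single _ _ k); auto.
      * destruct (Z.eq_dec k k); [|lia]. rewrite Rabs_R1; lra.
      * intros n hn. destruct (Z.eq_dec n k); [lia|]. rewrite Rabs_R0; ring.
    + apply Rle_trans with 0; [|apply w_ge0]. right.
      clear hl. induction l; simpl in *; auto.
      destruct (Z.eq_dec a k); [subst; tauto|]. rewrite Rabs_R0, IHl; [ring|tauto].
  - intros n hn. destruct (Z.eq_dec n k); subst; [tauto|auto].
  - intros l hl.
    evar_last.
    + apply (usum_single (fun n => RtoC (if Z.eq_dec n k then 1 else 0) * Czpow l n)%C k).
      intros n hn. destruct (Z.eq_dec n k); [lia|]. ring.
    + simpl. destruct (Z.eq_dec k k); [|lia]. ring.
Qed.

Lemma rep_mult S S' S'' B B' g h : (forall m n, S m -> S' n -> S'' (m + n)%Z) ->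
  rep S B g -> rep S' B' h -> rep S'' (B * B') (fun l => g l * h l)%C.
Proof.
  intros hS hg hh.
  destruct (conv (cf g) (cf h) g h B B') as (c & c1 & c2 & c3).
  - apply (rep_bsum _ _ _ hg).
  - apply (rep_bsum _ _ _ hh).
  - apply hg.
  - apply hh.
  - apply (rep_intro _ _ _ c); auto.
    + apply (c3 w w w); try apply w_ge0; [|apply hg|apply hh].
      intros k m _; apply hw.
    + intros n hn. apply c2. intros k.
      destruct (classic (S k)) as [hk|hk]; [|rewrite (proj1 (proj2 hg) k hk); ring].
      destruct (classic (S' (n - k)%Z)) as [hk'|hk']; [|rewrite (proj1 (proj2 hh) _ hk'); ring].
      exfalso. apply hn. replace n with (k + (n - k))%Z by lia. auto.
Qed.

Lemma rep_Cmod S B g l : rep S B g -> Cmod l = 1 -> Cmod (g l) <= B.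
Proof.
  intros hg hl. eapply usum_bound; [|apply hg; auto]. apply bsum_coef; auto.
  apply (rep_bsum _ _ _ hg).
Qed.

Lemma rep_cf S B g n : rep S B g -> w n * Rabs (cf g n) <= B.
Proof. intros (h & _). apply (bsum_term _ _ n h). Qed.

Lemma rep_cf1 S B g n : rep S B g -> Rabs (cf g n) <= B.
Proof.
  intros h. apply rep_cf with (n := n) in h. generalize (proj1 hw n) (Rabs_pos (cf g n)); nra.
Qed.

Lemma rep_inter S S' B B' g : rep S B g -> rep S' B' g -> rep (fun n => S n /\ S' n) B g.
Proof.
  intros (h1 & h2 & h3) (_ & h2' & _). split; [|split]; auto.
  intros n hn. destruct (classic (S n)); [|auto]. apply h2'; tauto.
Qed.

Lemma rep_const S B g : rep S B g -> (forall n, S n -> n = 0%Z) ->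
  forall l, Cmod l = 1 -> g l = RtoC (cf g 0).
Proof.
  intros (h1 & h2 & h3) hS l hl.
  apply (usum_unique (fun n => RtoC (cf g n) * Czpow l n)%C); auto.
  evar_last; [apply (usum_single (fun n => RtoC (cf g n) * Czpow l n)%C 0%Z)|simpl; ring].
  intros n hn. rewrite h2; [ring|]. intros hn'. apply hn; auto.
Qed.

Lemma rep_empty S B g : rep S B g -> (forall n, ~ S n) -> forall l, Cmod l = 1 -> g l = RtoC 0.
Proof.
  intros h hS l hl. rewrite (rep_const S B g); auto.
  - destruct h as (_ & h & _). rewrite h; auto.
  - intros n hn. exfalso; eapply hS; eauto.
Qed.

Lemma four_part a g B (D : Z -> Prop) : bsum (fun n => Rabs (a n)) B ->
  exists u, four (fun n => if excluded_middle_informative (D n) then a n else 0) u.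
Proof.
  intros hb.
  exists (fun l => usumv (fun n => RtoC (if excluded_middle_informative (D n) then a n else 0) * Czpow l n)%C).
  intros l hl. apply usumv_spec with B. apply bsum_coef; auto.
  eapply bsum_le; [|apply hb]. intros n; simpl.
  destruct (excluded_middle_informative (D n)); [lra|]. rewrite Rabs_R0. apply Rabs_pos.
Qed.

(** The part [u] is chosen from [g] and [D] alone, before the support [S] and the bound [B]: one and
    the same projection then serves all estimates for a loop. *)
Lemma rep_split g (D : Z -> Prop) : exists u, forall S B, rep S B g ->
  rep (fun n => S n /\ D n) B u /\ rep (fun n => S n /\ ~ D n) B (fun l => g l - u l)%C.
Proof.
  destruct (classic (exists S B, rep S B g)) as [(S0 & B0 & h0)|hn].
  2: { exists g. intros S B h. exfalso; apply hn; eauto. }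
  destruct (four_part (cf g) g B0 D (rep_bsum _ _ _ h0)) as (u & hu).
  exists u. intros S B (h1 & h2 & h3). split.
  - apply (rep_intro _ _ _ (fun n => if excluded_middle_informative (D n) then cf g n else 0)); auto.
    + eapply bsum_le; [|apply h1]. intros n; simpl. apply Rmult_le_compat_l; [apply w_ge0|].
      destruct (excluded_middle_informative (D n)); [lra|]. rewrite Rabs_R0. apply Rabs_pos.
    + intros n hn. destruct (excluded_middle_informative (D n)); [apply h2; tauto|reflexivity].
  - apply (rep_intro _ _ _ (fun n => if excluded_middle_informative (D n) then 0 else cf g n)).
    + eapply bsum_le; [|apply h1]. intros n; simpl. apply Rmult_le_compat_l; [apply w_ge0|].
      destruct (excluded_middle_informative (D n)); [|lra]. rewrite Rabs_R0. apply Rabs_pos.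
    + intros n hn. destruct (excluded_middle_informative (D n)); [reflexivity|apply h2; tauto].
    + intros l hl.
      apply (usum_ext (fun n => RtoC (cf g n) * Czpow l n +
         RtoC (-1) * (RtoC (if excluded_middle_informative (D n) then cf g n else 0) * Czpow l n))%C).
      * intros n. rewrite RtoC_m1. destruct (excluded_middle_informative (D n)); ring.
      * replace (g l - u l)%C with (g l + RtoC (-1) * u l)%C by (rewrite RtoC_m1; ring).
        apply usum_plus; auto. apply usum_scal; auto.
Qed.

(* The norm of the projection to the frequencies in [S] is at most one. *)
Lemma rep_project S B0 B B1 u v : rep S B0 u -> rep (fun _ => True) B v ->
  rep (fun n => ~ S n) B1 (fun l => u l + v l)%C -> rep S B u.
Proof.
  intros hu hv huv. destruct hu as (h1 & h2 & h3). split; [|split]; auto.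
  eapply bsum_le; [|apply (proj1 hv)]. intros n; simpl.
  apply Rmult_le_compat_l; [apply w_ge0|].
  destruct (classic (S n)) as [hn|hn].
  - assert (e : cf u n + cf v n = 0).
    { rewrite <- (cf_plus S (fun _ => True) B0 B u v n); auto; [|split; auto].
      apply huv. tauto. }
    replace (cf u n) with (- cf v n) by lra. rewrite Rabs_Ropp; lra.
  - rewrite h2; auto. rewrite Rabs_R0; apply Rabs_pos.
Qed.

(** Completeness of the weighted algebra: the coefficients are summed one by one, and Fubini
    identifies the resulting Fourier series with the pointwise sum. *)
Lemma rep_sum {T : Type} S (b : T -> R) B (F : T -> C -> C) :
  (forall t, rep S (b t) (F t)) -> bsum b B ->
  exists g, rep S B g /\ forall l, Cmod l = 1 -> usum (fun t => F t l) (g l).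
Proof.
  intros hF hB.
  assert (hb2 : bsum2 (fun t n => w n * Cmod (RtoC (cf (F t) n))) B).
  { intros l1 l2 h1 h2. eapply Rle_trans; [|apply (hB l1 h1)].
    apply rsum_le. intros t _. eapply Rle_trans; [|apply (proj1 (hF t) l2 h2)].
    apply rsum_le. intros n _. rewrite Cmod_R; lra. }
  assert (hb1 : bsum2 (fun t n => Cmod (RtoC (cf (F t) n))) B).
  { intros l1 l2 h1 h2. eapply Rle_trans; [|apply (hb2 l1 l2 h1 h2)].
    apply rsum_le. intros t _. apply rsum_le. intros n _.
    generalize (proj1 hw n) (Cmod_ge_0 (RtoC (cf (F t) n))); nra. }
  pose (c := fun n => Re (usumv (fun t => RtoC (cf (F t) n)))).
  assert (hc : forall n, usum (fun t => RtoC (cf (F t) n)) (RtoC (c n))).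
  { intros n.
    assert (hs : usum (fun t => RtoC (cf (F t) n)) (usumv (fun t => RtoC (cf (F t) n)))).
    { apply usumv_spec with B. apply (bsum2_row _ _ n (bsum2_swap _ _ hb1)). }
    unfold c. rewrite (usum_real _ _ hs). apply hs. }
  exists (fun l => usumv (fun t => F t l)).
  assert (hg : forall l, Cmod l = 1 -> usum (fun t => F t l) (usumv (fun t => F t l))).
  { intros l hl. apply usumv_spec with B. eapply bsum_le; [|apply hB].
    intros t; simpl. eapply rep_Cmod; eauto. }
  split; auto.
  apply (rep_intro _ _ _ c).
  - eapply bsum_le; [|apply (bsum_columns (fun t n => RtoC (cf (F t) n)) (fun n => RtoC (c n)) w); eauto].
    + intros n. simpl. rewrite Cmod_R. lra.
    + apply w_ge0.
  - intros n hn. apply RtoC_inj. apply (usum_unique (fun t => RtoC (cf (F t) n))); auto.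
    assert (z : forall t, cf (F t) n = 0) by (intros t; apply (hF t); auto).
    intros eps he. exists nil. intros l _ _.
    replace (lsum (fun t => RtoC (cf (F t) n)) l) with (RtoC 0).
    + replace (RtoC 0 - RtoC 0)%C with (RtoC 0) by ring. rewrite Cmod_0; lra.
    + induction l; simpl; auto. rewrite <- IHl, z; ring.
  - intros l hl.
    apply (usum_fubini (fun t n => RtoC (cf (F t) n) * Czpow l n)%C (fun t => F t l) _ _ B).
    + intros l1 l2 h1 h2. eapply Rle_trans; [|apply (hb1 l1 l2 h1 h2)].
      apply rsum_le; intros k _. apply rsum_le; intros n _.
      rewrite Cmod_mult, Cmod_Czpow; auto; lra.
    + intros t. apply (hF t); auto.
    + apply hg; auto.
    + intros n. apply (usum_ext (fun t => Czpow l n * RtoC (cf (F t) n))%C); [intros; ring|].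
      rewrite Cmult_comm. apply usum_scal; auto.
Qed.

Lemma rep_conj S B g l : rep S B g -> Cmod l = 1 -> Cconj (g (Cconj l)) = g l.
Proof.
  intros (h1 & h2 & h3) hl. apply (usum_unique (fun n => RtoC (cf g n) * Czpow l n)%C); auto.
  assert (hl' : Cmod (Cconj l) = 1) by (rewrite Cmod_conj; auto).
  intros eps he. destruct (h3 _ hl' eps he) as (l0 & h0). exists l0. intros l' hl1 hi.
  specialize (h0 l' hl1 hi).
  rewrite <- Cmod_conj, Cminus_conj, Cconj_conj.
  rewrite <- Cmod_conj, Cminus_conj in h0.
  replace (Cconj (lsum (fun n => RtoC (cf g n) * Czpow l n)%C l')) with
    (lsum (fun n => RtoC (cf g n) * Czpow (Cconj l) n)%C l').
  - rewrite <- Cmod_conj, Cminus_conj, !Cconj_conj in h0. exact h0.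
  - clear h0 hi hl1. induction l'; simpl; [unfold Cconj; simpl; apply injective_projections; simpl; ring|].
    rewrite IHl', Cplus_conj, Cmult_conj. f_equal. f_equal.
    + unfold Cconj; simpl; apply injective_projections; simpl; ring.
    + rewrite <- (Czpow_conj (Cconj l)), Cconj_conj; auto. apply unit_neq0; auto.
Qed.

Lemma rep_neg S B g : rep S B g -> rep S B (fun l => g (- l)%C).
Proof.
  intros (h1 & h2 & h3). apply (rep_intro _ _ _ (fun n => sgnz n * cf g n)).
  - eapply bsum_le; [|apply h1]. intros n; simpl. apply Rmult_le_compat_l; [apply w_ge0|].
    rewrite Rabs_mult. unfold sgnz; destruct (Z.even n); [rewrite Rabs_R1; lra|].
    rewrite Rabs_m1; lra.
  - intros n hn. rewrite h2; auto; ring.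
  - intros l hl. assert (hl' : Cmod (- l)%C = 1) by (rewrite Cmod_opp; auto).
    generalize (h3 _ hl'). apply usum_ext. intros n. rewrite Czpow_opp, RtoC_mult; [ring|].
    apply unit_neq0; auto.
Qed.

End Rep.

(** * Goursat's theorem and the mean value property *)

(* Complex differentiability of [U + iV], with derivative [p + iq]. *)
Definition cdiff (U V : R -> R -> R) (x y : R) : Prop :=
  exists p q, forall eps, 0 < eps -> exists delta, 0 < delta /\
    forall x' y', Rabs (x' - x) < delta -> Rabs (y' - y) < delta ->
      Rabs (U x' y' - U x y - (p * (x' - x) - q * (y' - y))) <= eps * (Rabs (x' - x) + Rabs (y' - y)) /\
      Rabs (V x' y' - V x y - (q * (x' - x) + p * (y' - y))) <= eps * (Rabs (x' - x) + Rabs (y' - y)).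

Lemma small_affine_cont (f : R -> R) x k :
  (forall eps, 0 < eps -> exists delta, 0 < delta /\ forall x', Rabs (x' - x) < delta ->
     Rabs (f x' - f x - k * (x' - x)) <= eps * Rabs (x' - x)) -> continuous f x.
Proof.
  intros h. apply (@ex_derive_continuous R_AbsRing R_NormedModule). exists k.
  apply is_derive_Reals. intros eps he. destruct (h (eps / 2)) as (d & hd & h'); [lra|].
  exists (mkposreal d hd). intros t ht htd. simpl in htd.
  specialize (h' (x + t)). replace (x + t - x) with t in h' by ring. specialize (h' htd).
  replace ((f (x + t) - f x) / t - k) with ((f (x + t) - f x - k * t) / t) by (field; auto).
  unfold Rdiv. rewrite Rabs_mult, Rabs_inv.
  assert (0 < Rabs t) by (apply Rabs_pos_lt; auto).
  apply Rle_lt_trans with (eps / 2 * Rabs t * / Rabs t).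
  - apply Rmult_le_compat_r; [left; apply Rinv_0_lt_compat|]; auto.
  - field_simplify; lra.
Qed.

Lemma cdiff_cont_U_y U V x y : cdiff U V x y -> continuous (fun t => U x t) y.
Proof.
  intros (p & q & h). apply (small_affine_cont _ _ (- q)). intros eps he.
  destruct (h eps he) as (d & hd & h'). exists d; split; auto. intros y' hy.
  destruct (h' x y') as (h1 & _); auto; [rewrite Rminus_diag, Rabs_R0; auto|].
  rewrite Rminus_diag, Rabs_R0 in h1. replace (p * 0 - q * (y' - y)) with (- q * (y' - y)) in h1 by ring.
  lra.
Qed.

Lemma cdiff_cont_V_x U V x y : cdiff U V x y -> continuous (fun t => V t y) x.
Proof.
  intros (p & q & h). apply (small_affine_cont _ _ q). intros eps he.
  destruct (h eps he) as (d & hd & h'). exists d; split; auto. intros x' hx.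
  destruct (h' x' y) as (_ & h1); auto; [rewrite Rminus_diag, Rabs_R0; auto|].
  rewrite Rminus_diag, Rabs_R0 in h1. replace (q * (x' - x) + p * 0) with (q * (x' - x)) in h1 by ring.
  lra.
Qed.

(* The imaginary part of the contour integral of [U + iV] around the rectangle. *)
Definition bdry (U V : R -> R -> R) (a b c d : R) : R :=
  RInt (fun x => V x c) a b - RInt (fun x => V x d) a b
  + RInt (fun y => U b y) c d - RInt (fun y => U a y) c d.

Lemma RInt_minus_const (f g : R -> R) k a b : ex_RInt f a b -> ex_RInt g a b ->
  RInt (fun t => f t - g t - k) a b = RInt f a b - RInt g a b - k * (b - a).
Proof.
  intros hf hg. apply (@is_RInt_unique R_CompleteNormedModule).
  rewrite (Rmult_comm k).
  apply (@is_RInt_minus R_NormedModule (fun t => f t - g t) (fun _ => k) a b (RInt f a b - RInt g a b)).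
  - apply (@is_RInt_minus R_NormedModule f g); apply (@RInt_correct R_CompleteNormedModule); auto.
  - apply (@is_RInt_const R_NormedModule).
Qed.

Section Goursat.

Context (U V : R -> R -> R) (a0 b0 c0 d0 : R).
Hypothesis (hUV : forall x y, a0 <= x <= b0 -> c0 <= y <= d0 -> cdiff U V x y).

Let exV a b c : a0 <= a <= b -> b <= b0 -> c0 <= c <= d0 -> ex_RInt (fun x => V x c) a b.
Proof.
  intros h1 h2 h3. apply (@ex_RInt_continuous R_CompleteNormedModule).
  intros z hz. rewrite Rmin_left, Rmax_right in hz by lra.
  apply (cdiff_cont_V_x U). apply hUV; lra.
Qed.

Let exU c d a : c0 <= c <= d -> d <= d0 -> a0 <= a <= b0 -> ex_RInt (fun y => U a y) c d.
Proof.
  intros h1 h2 h3. apply (@ex_RInt_continuous R_CompleteNormedModule).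
  intros z hz. rewrite Rmin_left, Rmax_right in hz by lra.
  apply (cdiff_cont_U_y U V). apply hUV; lra.
Qed.

Let chV a m b c : a0 <= a <= m -> m <= b <= b0 -> c0 <= c <= d0 ->
  RInt (fun x => V x c) a b = RInt (fun x => V x c) a m + RInt (fun x => V x c) m b.
Proof.
  intros h1 h2 h3. symmetry. apply (@RInt_Chasles R_CompleteNormedModule); apply exV; lra.
Qed.

Let chU c m d a : c0 <= c <= m -> m <= d <= d0 -> a0 <= a <= b0 ->
  RInt (fun y => U a y) c d = RInt (fun y => U a y) c m + RInt (fun y => U a y) m d.
Proof.
  intros h1 h2 h3. symmetry. apply (@RInt_Chasles R_CompleteNormedModule); apply exU; lra.
Qed.

Let bdry_split a m b c n d : a0 <= a <= m -> m <= b <= b0 -> c0 <= c <= n -> n <= d <= d0 ->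
  bdry U V a b c d = bdry U V a m c n + bdry U V m b c n + bdry U V a m n d + bdry U V m b n d.
Proof.
  intros h1 h2 h3 h4. unfold bdry.
  rewrite (chV a m b c), (chV a m b d), (chU c n d b), (chU c n d a) by lra. ring.
Qed.

(** The affine approximation contributes $p(c-d)(b-a)$ from the horizontal sides and $p(b-a)(d-c)$
    from the vertical ones. These cancel, and only the remainder is left to integrate. *)
Let bdry_small a b c d x y eps p q :
  a0 <= a <= x -> x <= b <= b0 -> c0 <= c <= y -> y <= d <= d0 -> 0 <= eps ->
  (forall x' y', a <= x' <= b -> c <= y' <= d ->
      Rabs (U x' y' - U x y - (p * (x' - x) - q * (y' - y))) <= eps * (Rabs (x' - x) + Rabs (y' - y)) /\
      Rabs (V x' y' - V x y - (q * (x' - x) + p * (y' - y))) <= eps * (Rabs (x' - x) + Rabs (y' - y))) ->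
  Rabs (bdry U V a b c d) <= 2 * eps * (b - a + (d - c)) ^ 2.
Proof.
  intros h1 h2 h3 h4 he h.
  assert (hs : forall x' y', a <= x' <= b -> c <= y' <= d ->
     eps * (Rabs (x' - x) + Rabs (y' - y)) <= eps * (b - a + (d - c))).
  { intros x' y' hx hy. apply Rmult_le_compat_l; auto. apply Rplus_le_compat; apply Rabs_le; lra. }
  assert (b1 : Rabs (RInt (fun t => V t c - V t d - p * (c - d)) a b) <= (b - a) * (2 * eps * (b - a + (d - c)))).
  { apply (norm_RInt_le_const (V := R_NormedModule) (fun t => V t c - V t d - p * (c - d)) a b); [lra|..].
    - intros t ht. unfold norm; simpl; unfold abs; simpl.
      destruct (h t c) as (_ & e1); [lra|lra|]. destruct (h t d) as (_ & e2); [lra|lra|].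
      generalize (hs t c ht ltac:(lra)) (hs t d ht ltac:(lra)). intros s1 s2.
      replace (V t c - V t d - p * (c - d)) with
        ((V t c - V x y - (q * (t - x) + p * (c - y))) + - (V t d - V x y - (q * (t - x) + p * (d - y)))) by ring.
      eapply Rle_trans; [apply Rabs_triang|]. rewrite Rabs_Ropp. lra.
    - apply (@RInt_correct R_CompleteNormedModule).
      apply (@ex_RInt_minus R_NormedModule); [|apply ex_RInt_const].
      apply (@ex_RInt_minus R_NormedModule); apply exV; lra. }
  assert (b2 : Rabs (RInt (fun t => U b t - U a t - p * (b - a)) c d) <= (d - c) * (2 * eps * (b - a + (d - c)))).
  { apply (norm_RInt_le_const (V := R_NormedModule) (fun t => U b t - U a t - p * (b - a)) c d); [lra|..].
    - intros t ht. unfold norm; simpl; unfold abs; simpl.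
      destruct (h b t) as (e1 & _); [lra|lra|]. destruct (h a t) as (e2 & _); [lra|lra|].
      generalize (hs b t ltac:(lra) ht) (hs a t ltac:(lra) ht). intros s1 s2.
      replace (U b t - U a t - p * (b - a)) with
        ((U b t - U x y - (p * (b - x) - q * (t - y))) + - (U a t - U x y - (p * (a - x) - q * (t - y)))) by ring.
      eapply Rle_trans; [apply Rabs_triang|]. rewrite Rabs_Ropp. lra.
    - apply (@RInt_correct R_CompleteNormedModule).
      apply (@ex_RInt_minus R_NormedModule); [|apply ex_RInt_const].
      apply (@ex_RInt_minus R_NormedModule); apply exU; lra. }
  rewrite (RInt_minus_const (fun t => V t c)) in b1 by (apply exV; lra).
  rewrite (RInt_minus_const (fun t => U b t)) in b2 by (apply exU; lra).
  unfold bdry.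
  replace (RInt (fun x0 => V x0 c) a b - RInt (fun x0 => V x0 d) a b +
     RInt (fun y0 => U b y0) c d - RInt (fun y0 => U a y0) c d) with
   ((RInt (fun t => V t c) a b - RInt (fun t => V t d) a b - p * (c - d) * (b - a)) +
    (RInt (fun t => U b t) c d - RInt (fun t => U a t) c d - p * (b - a) * (d - c))) by ring.
  eapply Rle_trans; [apply Rabs_triang|]. eapply Rle_trans; [apply Rplus_le_compat; [apply b1|apply b2]|]. right; ring.
Qed.

Let rect : Type := ((R * R) * (R * R))%type.
Let B (r : rect) := bdry U V (fst (fst r)) (snd (fst r)) (fst (snd r)) (snd (snd r)).

(** Selects a quarter that keeps at least a quarter of the boundary integral. If the first three
    fail, the fourth qualifies by the triangle inequality, as [bdry_split] adds the four up. *)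
Let next (r : rect) : rect :=
  let '((a, b), (c, d)) := r in let m := (a + b) / 2 in let n := (c + d) / 2 in
  if Rle_dec (Rabs (B r) / 4) (Rabs (B ((a, m), (c, n)))) then ((a, m), (c, n)) else
  if Rle_dec (Rabs (B r) / 4) (Rabs (B ((m, b), (c, n)))) then ((m, b), (c, n)) else
  if Rle_dec (Rabs (B r) / 4) (Rabs (B ((a, m), (n, d)))) then ((a, m), (n, d)) else ((m, b), (n, d)).

Let good (r : rect) := a0 <= fst (fst r) /\ fst (fst r) <= snd (fst r) /\ snd (fst r) <= b0 /\
  c0 <= fst (snd r) /\ fst (snd r) <= snd (snd r) /\ snd (snd r) <= d0.

Let next_spec r : good r -> good (next r) /\ Rabs (B r) / 4 <= Rabs (B (next r)) /\
  fst (fst r) <= fst (fst (next r)) /\ snd (fst (next r)) <= snd (fst r) /\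
  fst (snd r) <= fst (snd (next r)) /\ snd (snd (next r)) <= snd (snd r) /\
  snd (fst (next r)) - fst (fst (next r)) = (snd (fst r) - fst (fst r)) / 2 /\
  snd (snd (next r)) - fst (snd (next r)) = (snd (snd r) - fst (snd r)) / 2.
Proof.
  destruct r as ((a, b), (c, d)). unfold good; simpl. intros hr.
  assert (e := bdry_split a ((a + b) / 2) b c ((c + d) / 2) d ltac:(lra) ltac:(lra) ltac:(lra) ltac:(lra)).
  unfold next, B. simpl.
  destruct Rle_dec as [h1|h1]; simpl; [repeat split; lra|].
  destruct Rle_dec as [h2|h2]; simpl; [repeat split; lra|].
  destruct Rle_dec as [h3|h3]; simpl; [repeat split; lra|].
  repeat split; try lra. rewrite e in *.
  match goal with |- Rabs (?A1 + ?A2 + ?A3 + ?A4) / 4 <= _ =>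
    generalize (Rabs_triang (A1 + A2 + A3) A4) (Rabs_triang (A1 + A2) A3) (Rabs_triang A1 A2) end.
  lra.
Qed.

Lemma nested_point (u v : nat -> R) : (forall n, u n <= u (S n)) -> (forall n, v (S n) <= v n) ->
  (forall n, u n <= v n) -> exists x, forall n, u n <= x <= v n.
Proof.
  intros hu hv huv.
  assert (mu : forall n k, u n <= u (n + k)%nat).
  { intros n k; induction k; [rewrite Nat.add_0_r; lra|].
    rewrite Nat.add_succ_r. generalize (hu (n + k)%nat); lra. }
  assert (mv : forall n k, v (n + k)%nat <= v n).
  { intros n k; induction k; [rewrite Nat.add_0_r; lra|].
    rewrite Nat.add_succ_r. generalize (hv (n + k)%nat); lra. }
  assert (c : forall m n, u m <= v n).
  { intros m n. generalize (mu m n) (mv n m) (huv (m + n)%nat). rewrite (Nat.add_comm n m). lra. }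
  destruct (completeness (fun x => exists n, x = u n)) as [x [h1 h2]].
  - exists (v O). intros x (n & ->); auto.
  - exists (u O), O; auto.
  - exists x. intros n; split; [apply h1; eauto|]. apply h2. intros y (m & ->); auto.
Qed.

(** If the integral were nonzero, the nested quarters would keep $4^{-n}$ of its absolute value,
    while differentiability at their common point bounds it by $2\varepsilon D^24^{-n}$, where [D]
    is the half perimeter. *)
Theorem goursat : a0 <= b0 -> c0 <= d0 -> bdry U V a0 b0 c0 d0 = 0.
Proof.
  intros hab hcd.
  pose (r0 := ((a0, b0), (c0, d0)) : rect).
  pose (r := fix r (n : nat) : rect := match n with O => r0 | S n => next (r n) end).
  assert (hg : forall n, good (r n)).
  { induction n; [unfold good, r, r0; simpl; lra|]. apply (next_spec (r n) IHn). }
  assert (hw : forall n, snd (fst (r n)) - fst (fst (r n)) = (b0 - a0) * (/ 2) ^ n /\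
     snd (snd (r n)) - fst (snd (r n)) = (d0 - c0) * (/ 2) ^ n).
  { induction n; [simpl; split; ring|].
    destruct (next_spec (r n) (hg n)) as (_ & _ & _ & _ & _ & _ & e1 & e2).
    change (r (S n)) with (next (r n)). rewrite e1, e2. destruct IHn as (-> & ->). simpl; split; field. }
  assert (hB : forall n, Rabs (B r0) * (/ 4) ^ n <= Rabs (B (r n))).
  { induction n; [simpl; lra|].
    destruct (next_spec (r n) (hg n)) as (_ & e & _). change (r (S n)) with (next (r n)). simpl. lra. }
  destruct (nested_point (fun n => fst (fst (r n))) (fun n => snd (fst (r n)))) as (x & hx).
  { intros n; apply (next_spec (r n) (hg n)). }
  { intros n; apply (next_spec (r n) (hg n)). }
  { intros n; apply (hg n). }
  destruct (nested_point (fun n => fst (snd (r n))) (fun n => snd (snd (r n)))) as (y & hy).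
  { intros n; apply (next_spec (r n) (hg n)). }
  { intros n; apply (next_spec (r n) (hg n)). }
  { intros n; apply (hg n). }
  change (B r0 = 0).
  apply NNPP; intros hn. assert (hp : 0 < Rabs (B r0)) by (apply Rabs_pos_lt; auto).
  destruct (hUV x y (hx O) (hy O)) as (p & q & h).
  pose (D := b0 - a0 + (d0 - c0)). assert (hD : 0 <= D) by (unfold D; lra).
  (* Chosen so that [2 * eps * D ^ 2] is at most half of [Rabs (B r0)]; the added $1$ covers a
     degenerate rectangle. *)
  pose (eps := Rabs (B r0) / (4 * (D ^ 2 + 1))).
  assert (hD2 : 0 < D ^ 2 + 1) by nra.
  assert (heps : 0 < eps) by (unfold eps; apply Rdiv_lt_0_compat; lra).
  destruct (h eps heps) as (del & hdel & h').
  assert (exists n, D * (/ 2) ^ n < del) as (n & hn').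
  { destruct (pow_lt_1_zero (/ 2)) with (y := del / (D + 1)) as (N & hN).
    - rewrite Rabs_right; lra.
    - apply Rdiv_lt_0_compat; lra.
    - exists N. specialize (hN N (le_n _)). rewrite Rabs_right in hN.
      + apply Rle_lt_trans with ((D + 1) * (/ 2) ^ N).
        * apply Rmult_le_compat_r; [apply pow_le; lra|lra].
        * apply Rmult_lt_reg_l with (/ (D + 1)); [apply Rinv_0_lt_compat; lra|].
          rewrite <- Rmult_assoc, Rinv_l, Rmult_1_l; [|lra]. unfold Rdiv in hN. lra.
      + apply Rle_ge, pow_le; lra. }
  destruct (hw n) as (e1 & e2). specialize (hx n); specialize (hy n); specialize (hB n).
  cbv beta in hx, hy.
  destruct (hg n) as (g1 & g2 & g3 & g4 & g5 & g6).
  assert (hpow : 0 < (/ 2) ^ n) by (apply pow_lt; lra).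
  assert (0 <= (b0 - a0) * (/ 2) ^ n) by (apply Rmult_le_pos; lra).
  assert (0 <= (d0 - c0) * (/ 2) ^ n) by (apply Rmult_le_pos; lra).
  assert (hs : Rabs (B (r n)) <= 2 * eps * (D * (/ 2) ^ n) ^ 2).
  { unfold B. replace (D * (/ 2) ^ n) with
      (snd (fst (r n)) - fst (fst (r n)) + (snd (snd (r n)) - fst (snd (r n)))) by (rewrite e1, e2; unfold D; ring).
    apply (bdry_small _ _ _ _ x y eps p q); try lra.
    intros x' y' hx' hy'. apply h'; apply Rabs_lt_between'; unfold D in *; lra. }
  rewrite Rpow_mult_distr, <- pow_mult, Nat.mul_comm, pow_mult in hs.
  replace ((/ 2) ^ 2) with (/ 4) in hs by field.
  assert (hq : 0 < (/ 4) ^ n) by (apply pow_lt; lra).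
  assert (Rabs (B r0) * (/ 4) ^ n <= (2 * eps * D ^ 2) * (/ 4) ^ n) by lra.
  apply Rmult_le_reg_r in H1; auto.
  assert (2 * eps * D ^ 2 <= Rabs (B r0) / 2); [|lra].
  unfold eps. apply Rmult_le_reg_r with (D ^ 2 + 1); auto. field_simplify; [|lra]. nra.
Qed.

End Goursat.

(** The map $e^{x+it}$: circles around $0$ become vertical segments and the punctured disc a half
    strip, so that a theorem on rectangles speaks about integrals over circles. *)
Definition polar (x t : R) : C := (exp x * cos t, exp x * sin t).

Lemma exp_le_compat x y : x <= y -> exp x <= exp y.
Proof. intros [h| ->]; [left; apply exp_increasing; auto|lra]. Qed.

Lemma polar_cis x t : polar x t = (RtoC (exp x) * cis t)%C.
Proof. unfold polar, cis, Cmult, RtoC; simpl. f_equal; ring. Qed.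

Lemma Cmod_polar x t : Cmod (polar x t) = exp x.
Proof.
  rewrite polar_cis, Cmod_mult, Cmod_R, Cmod_cis, Rabs_right; [ring|].
  left; apply exp_pos.
Qed.

Lemma polar_plus x t y s : polar (x + y) (t + s) = (polar x t * polar y s)%C.
Proof.
  rewrite !polar_cis, cis_plus, exp_plus, RtoC_mult. ring.
Qed.

Lemma derive0_bound (f : R -> R) l : is_derive f 0 l -> forall eps, 0 < eps ->
  exists d, 0 < d /\ forall t, Rabs t < d -> Rabs (f t - f 0 - l * t) <= eps * Rabs t.
Proof.
  intros h eps he. apply is_derive_Reals in h. destruct (h eps he) as (d & hd).
  exists d. split; [apply cond_pos|]. intros t ht.
  destruct (Req_dec t 0) as [->|hn]; [rewrite Rabs_R0; replace (f 0 - f 0 - l * 0) with 0 by ring; rewrite Rabs_R0; lra|].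
  specialize (hd t hn ht). rewrite Rplus_0_l in hd.
  replace (f t - f 0 - l * t) with (((f t - f 0) / t - l) * t) by (field; auto).
  rewrite Rabs_mult. apply Rmult_le_compat_r; [apply Rabs_pos|lra].
Qed.

Lemma Cmod_le_sum (z : C) : Cmod z <= Rabs (Re z) + Rabs (Im z).
Proof.
  replace z with (RtoC (Re z) + Ci * RtoC (Im z))%C at 1.
  - eapply Rle_trans; [apply Cmod_triangle|]. rewrite Cmod_mult, !Cmod_R, Cmod_Ci. lra.
  - destruct z; unfold Re, Im; simpl. apply injective_projections; simpl; ring.
Qed.

Lemma Im_le_Cmod (z : C) : Rabs (Im z) <= Cmod z.
Proof. generalize (Rmax_Cmod z) (Rmax_r (Rabs (fst z)) (Rabs (snd z))). unfold Im; lra. Qed.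

Lemma polar_diff eps : 0 < eps -> exists d, 0 < d /\ forall x t, Rabs x < d -> Rabs t < d ->
  Cmod (polar x t - 1 - (x, t))%C <= eps * (Rabs x + Rabs t).
Proof.
  intros he.
  assert (he' : 0 < eps / 6) by lra.
  destruct (derive0_bound exp 1) with (eps := eps / 6) as (d1 & p1 & h1); auto.
  { evar_last; [apply is_derive_exp|apply exp_0]. }
  destruct (derive0_bound cos 0) with (eps := eps / 6) as (d2 & p2 & h2); auto.
  { evar_last; [apply is_derive_cos|rewrite sin_0; ring]. }
  destruct (derive0_bound sin 1) with (eps := eps / 6) as (d3 & p3 & h3); auto.
  { evar_last; [apply is_derive_sin|apply cos_0]. }
  rewrite exp_0 in h1. rewrite cos_0 in h2. rewrite sin_0 in h3.
  destruct (derive0_bound exp 1) with (eps := 1) as (d4 & p4 & h4); [|lra|].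
  { evar_last; [apply is_derive_exp|apply exp_0]. }
  rewrite exp_0 in h4.
  pose (d := Rmin (Rmin d1 d2) (Rmin (Rmin d3 d4) (Rmin (1 / 2) (eps / 12)))).
  assert (hd : 0 < d /\ d <= d1 /\ d <= d2 /\ d <= d3 /\ d <= d4 /\ d <= 1/2 /\ d <= eps / 12).
  { unfold d. repeat split; [repeat apply Rmin_glb_lt; lra|..];
    unfold Rmin; repeat destruct Rle_dec; lra. }
  clearbody d. exists d; split; [lra|]. intros x t hx ht.
  specialize (h1 x ltac:(lra)). specialize (h2 t ltac:(lra)). specialize (h3 t ltac:(lra)).
  specialize (h4 x ltac:(lra)).
  eapply Rle_trans; [apply Cmod_le_sum|]. simpl.
  set (ax := Rabs x) in *. set (at_ := Rabs t) in *.
  assert (0 <= ax) by apply Rabs_pos. assert (0 <= at_) by apply Rabs_pos.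
  assert (e4 : Rabs (exp x - 1) <= 2 * ax).
  { replace (exp x - 1) with ((exp x - 1 - 1 * x) + x) by ring.
    eapply Rle_trans; [apply Rabs_triang|]. fold ax. lra. }
  assert (e5 : 0 < exp x <= 2).
  { split; [apply exp_pos|]. apply Rabs_le_between in e4. lra. }
  assert (q1 : Rabs (exp x * cos t - 1 - x) <= eps / 3 * at_ + eps / 6 * ax).
  { replace (exp x * cos t - 1 - x) with (exp x * (cos t - 1 - 0 * t) + (exp x - 1 - 1 * x)) by ring.
    eapply Rle_trans; [apply Rabs_triang|]. rewrite Rabs_mult, (Rabs_right (exp x)) by lra.
    generalize (Rabs_pos (cos t - 1 - 0 * t)). nra. }
  assert (q2 : Rabs (exp x * sin t - t) <= eps / 3 * at_ + eps / 6 * at_).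
  { replace (exp x * sin t - t) with (exp x * (sin t - 0 - 1 * t) + (exp x - 1) * t) by ring.
    eapply Rle_trans; [apply Rabs_triang|]. rewrite !Rabs_mult, (Rabs_right (exp x)) by lra.
    fold at_. generalize (Rabs_pos (sin t - 0 - 1 * t)).
    assert (Rabs (exp x - 1) * at_ <= eps / 6 * at_) by (apply Rmult_le_compat_r; lra). nra. }
  unfold Re, Im. simpl.
  replace (exp x * cos t + - (1) + - x) with (exp x * cos t - 1 - x) by ring.
  replace (exp x * sin t + - 0 + - t) with (exp x * sin t - t) by ring.
  nra.
Qed.

(** Since $e^w$ is its own derivative, the composite has the derivative [l * z0], with [l] the
    derivative of [f] at [z0]. *)
Lemma cdiff_polar (f : C -> C) x t :
  ex_derive (K := C_AbsRing) (V := C_NormedModule) f (polar x t) ->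
  cdiff (fun x t => Re (f (polar x t))) (fun x t => Im (f (polar x t))) x t.
Proof.
  intros (l & _ & hl). set (z0 := polar x t) in *.
  pose (m := (l * z0)%C). exists (Re m), (Im m). intros eps he.
  pose (K := Cmod z0 + Cmod m + 1).
  assert (hK : 0 < K) by (unfold K; generalize (Cmod_ge_0 z0) (Cmod_ge_0 m); lra).
  pose (e1 := eps / (4 * K)). assert (he1 : 0 < e1) by (unfold e1; apply Rdiv_lt_0_compat; lra).
  specialize (hl z0 (fun P h => h) (mkposreal e1 he1)).
  destruct hl as (del & hdel). simpl in hdel.
  destruct (polar_diff (Rmin 1 e1)) as (d & hd & hd'); [apply Rmin_glb_lt; lra|].
  pose (D := Rmin d (del / (4 * K))).
  assert (hdp : 0 < del) by apply cond_pos.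
  assert (hD : 0 < D) by (unfold D; apply Rmin_glb_lt; auto; apply Rdiv_lt_0_compat; lra).
  exists D; split; auto. intros x' t' hx ht.
  specialize (hd' (x' - x) (t' - t)).
  assert (Rabs (x' - x) < d) by (eapply Rlt_le_trans; [apply hx|apply Rmin_l]).
  assert (Rabs (t' - t) < d) by (eapply Rlt_le_trans; [apply ht|apply Rmin_l]).
  specialize (hd' H H0).
  assert (hx2 : Rabs (x' - x) < del / (4 * K)) by (eapply Rlt_le_trans; [apply hx|apply Rmin_r]).
  assert (ht2 : Rabs (t' - t) < del / (4 * K)) by (eapply Rlt_le_trans; [apply ht|apply Rmin_r]).
  set (s := Rabs (x' - x) + Rabs (t' - t)) in *.
  assert (hs : 0 <= s) by (unfold s; generalize (Rabs_pos (x' - x)) (Rabs_pos (t' - t)); lra).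
  set (z := polar x' t').
  set (dz := (x' - x, t' - t) : C) in *.
  assert (ez : z = (z0 * polar (x' - x) (t' - t))%C).
  { unfold z0. rewrite <- polar_plus. unfold z. f_equal; ring. }
  set (r := (polar (x' - x) (t' - t) - 1 - dz)%C) in *.
  assert (ez2 : (z - z0 = z0 * (dz + r))%C) by (rewrite ez; unfold r; ring).
  assert (hdz : Cmod dz <= s) by (apply Cmod_le_sum).
  assert (hr : Cmod r <= s).
  { eapply Rle_trans; [apply hd'|]. generalize (Rmin_l 1 e1). nra. }
  assert (hr2 : Cmod r <= e1 * s).
  { eapply Rle_trans; [apply hd'|]. generalize (Rmin_r 1 e1). nra. }
  assert (hz : Cmod (z - z0) <= K * (2 * s)).
  { rewrite ez2, Cmod_mult. apply Rmult_le_compat; try apply Cmod_ge_0.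
    - unfold K; generalize (Cmod_ge_0 m); lra.
    - eapply Rle_trans; [apply Cmod_triangle|lra]. }
  assert (hzd : Cmod (z - z0) < del).
  { eapply Rle_lt_trans; [apply hz|]. unfold s. apply Rlt_le_trans with (K * (2 * (del / (4 * K) + del / (4 * K)))).
    - apply Rmult_lt_compat_l; lra.
    - right; field; lra. }
  specialize (hdel z hzd).
  assert (hmain : Cmod (f z - f z0 - m * dz) <= eps * s).
  { replace (f z - f z0 - m * dz)%C with ((f z - f z0 - (z - z0) * l) + m * r)%C
      by (rewrite ez2; unfold m; ring).
    eapply Rle_trans; [apply Cmod_triangle|]. rewrite Cmod_mult.
    assert (q1 : Cmod (f z - f z0 - (z - z0) * l) <= e1 * (K * (2 * s))).
    { eapply Rle_trans; [apply hdel|]. apply Rmult_le_compat_l; [lra|]. apply hz. }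
    assert (q2 : Cmod m * Cmod r <= K * (e1 * s)).
    { apply Rmult_le_compat; auto; try apply Cmod_ge_0. unfold K; generalize (Cmod_ge_0 z0); lra. }
    eapply Rle_trans; [apply Rplus_le_compat; [apply q1|apply q2]|].
    replace (e1 * (K * (2 * s)) + K * (e1 * s)) with (3 * (e1 * K) * s) by ring.
    replace (e1 * K) with (eps / 4) by (unfold e1; field; lra). nra. }
  split.
  - replace (_ - _) with (Re (f z - f z0 - m * dz)%C).
    + eapply Rle_trans; [apply re_le_Cmod|apply hmain].
    + unfold dz, Re, Im; simpl. fold z z0. ring.
  - replace (_ - _) with (Im (f z - f z0 - m * dz)%C).
    + eapply Rle_trans; [apply Im_le_Cmod|apply hmain].
    + unfold dz, Re, Im; simpl. fold z z0. ring.
Qed.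

Lemma within_disc_eps (f : C -> C) z :
  filterlim f (within (fun w => Cmod w <= 1) (locally z)) (locally (f z)) ->
  forall eps, 0 < eps -> exists d, 0 < d /\ forall w, Cmod w <= 1 ->
    Rabs (fst w - fst z) < d -> Rabs (snd w - snd z) < d -> Rabs (Re (f w) - Re (f z)) < eps.
Proof.
  intros h eps he.
  destruct (h (fun w => ball (f z) eps w)) as (d & hd).
  { exists (mkposreal eps he). auto. }
  exists d; split; [apply cond_pos|]. intros w hw h1 h2.
  apply (hd w); auto. split; auto.
Qed.

Lemma continuity_2d_fst (f : R -> R) x y : continuous f x -> continuity_2d_pt (fun u _ => f u) x y.
Proof.
  intros h eps. destruct (h (fun v => Rabs (v - f x) < eps)) as (d & hd).
  { exists eps. auto. }
  exists d. intros u v hu _. apply hd. exact hu.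
Qed.

Lemma continuity_2d_snd (f : R -> R) x y : continuous f y -> continuity_2d_pt (fun _ v => f v) x y.
Proof.
  intros h eps. destruct (h (fun v => Rabs (v - f y) < eps)) as (d & hd).
  { exists eps. auto. }
  exists d. intros u v _ hv. apply hd. exact hv.
Qed.

Lemma continuous_Rmin0 x : continuous (fun x => Rmin x 0) x.
Proof.
  intros P (eps & hP). exists eps. intros y hy. apply hP.
  change (Rabs (Rmin y 0 - Rmin x 0) < eps). change (Rabs (y - x) < eps) in hy.
  revert hy. unfold Rabs, Rmin. repeat destruct Rle_dec; repeat destruct Rcase_abs; lra.
Qed.

(** The integral of the real part over the circle of radius $e^x$ is constant for $x<0$ by Goursat.
    It tends to the boundary integral as $x\to0$ by uniform continuity, and to $2\pi$ times the
    value at the center as $x\to-\infty$. *)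
Theorem mean_value (f : C -> C) :
  (forall z, Cmod z <= 1 ->
     filterlim f (within (fun w => Cmod w <= 1) (locally z)) (locally (f z))) ->
  (forall z, Cmod z < 1 -> ex_derive (K := C_AbsRing) (V := C_NormedModule) f z) ->
  RInt (fun t => Re (f (cis t))) 0 (2 * PI) = 2 * PI * Re (f (RtoC 0)).
Proof.
  intros hc hd.
  assert (hpi := PI_RGT_0).
  pose (U := fun x t => Re (f (polar x t))).
  (* Clamping the radius at $1$ continues the function past the boundary, since the continuity
     statements below ask for full neighbourhoods in the plane. *)
  pose (W := fun x t => Re (f (polar (Rmin x 0) t))).
  assert (cW : forall x t, continuity_2d_pt W x t).
  { intros x t eps.
    assert (hle : forall x t, Cmod (polar (Rmin x 0) t) <= 1).
    { intros. rewrite Cmod_polar. rewrite <- exp_0. apply exp_le_compat, Rmin_r. }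
    destruct (within_disc_eps f _ (hc _ (hle x t)) eps (cond_pos eps)) as (d & hd0 & hd1).
    assert (c1 : continuity_2d_pt (fun x t => exp (Rmin x 0) * cos t) x t).
    { apply continuity_2d_pt_mult; [apply continuity_2d_fst|apply continuity_2d_snd].
      - apply (continuous_comp (fun x => Rmin x 0) exp); [apply continuous_Rmin0|apply continuous_exp].
      - apply continuous_cos. }
    assert (c2 : continuity_2d_pt (fun x t => exp (Rmin x 0) * sin t) x t).
    { apply continuity_2d_pt_mult; [apply continuity_2d_fst|apply continuity_2d_snd].
      - apply (continuous_comp (fun x => Rmin x 0) exp); [apply continuous_Rmin0|apply continuous_exp].
      - apply continuous_sin. }
    generalize (locally_2d_and _ _ _ _ (c1 (mkposreal d hd0)) (c2 (mkposreal d hd0))).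
    apply locally_2d_impl, locally_2d_forall. intros x' t' (q1 & q2).
    apply hd1; auto. }
  assert (cWt : forall x t, continuous (W x) t).
  { intros x t P (eps & hP). destruct (cW x t eps) as (d & hd').
    exists d. intros y hy. apply hP. apply (hd' x y); auto.
    rewrite Rminus_diag, Rabs_R0; apply cond_pos. }
  assert (iW : forall x, ex_RInt (W x) 0 (2 * PI)).
  { intros x. apply (@ex_RInt_continuous R_CompleteNormedModule). intros z _. apply cWt. }
  pose (J := fun x : R => RInt (W x) 0 (2 * PI) : R).
  assert (hdiff : forall x (L : R -> R) e, (forall t, 0 <= t <= 2 * PI -> Rabs (W x t - L t) <= e) ->
     ex_RInt L 0 (2 * PI) -> Rabs (J x - RInt L 0 (2 * PI)) <= 2 * PI * e).
  { intros x L e h hL.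
    assert (e1 : is_RInt (fun t => W x t - L t) 0 (2 * PI) (J x - RInt L 0 (2 * PI))).
    { apply (@is_RInt_minus R_NormedModule); apply (@RInt_correct R_CompleteNormedModule); auto. }
    replace (2 * PI * e) with ((2 * PI - 0) * e) by ring.
    apply (norm_RInt_le_const (V := R_NormedModule) (fun t => W x t - L t) 0 (2 * PI)); auto; lra. }
  assert (hconst : forall x1 x2, x1 <= x2 < 0 -> J x1 = J x2).
  { intros x1 x2 hx.
    assert (g := goursat U (fun x t => Im (f (polar x t))) x1 x2 0 (2 * PI)).
    unfold bdry in g.
    assert (e : forall x, x < 0 -> RInt (fun y => U x y) 0 (2 * PI) = J x).
    { intros x hx0. apply RInt_ext. intros t _. unfold U, W. rewrite Rmin_left; auto; lra. }
    rewrite !e in g by lra.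
    (* By periodicity the two horizontal sides carry the same integral and cancel. *)
    assert (ep : forall x, polar x (2 * PI) = polar x 0).
    { intros x. unfold polar. rewrite cos_2PI, sin_2PI, cos_0, sin_0; auto. }
    replace (RInt (fun x => Im (f (polar x (2 * PI)))) x1 x2) with
      (RInt (fun x => Im (f (polar x 0))) x1 x2) in g.
    - symmetry. apply Rminus_diag_uniq. transitivity (RInt (fun x => Im (f (polar x 0))) x1 x2
       - RInt (fun x => Im (f (polar x 0))) x1 x2 + J x2 - J x1); [ring|]. apply g; try lra.
      intros x y h1 _. apply cdiff_polar, hd. rewrite Cmod_polar, <- exp_0. apply exp_increasing; lra.
    - apply RInt_ext. intros x _. rewrite ep; auto. }
  assert (h0 : forall e, 0 < e -> exists x, x < 0 /\ Rabs (J x - J 0) <= 2 * PI * e).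
  { intros e he.
    destruct (uniform_continuity_2d W (-1) 0 0 (2 * PI)) with (eps := mkposreal e he) as (d & hd').
    { intros; apply cW. }
    assert (hdp := cond_pos d).
    exists (Rmax (-1) (- d / 2)). split; [unfold Rmax; destruct Rle_dec; lra|].
    apply hdiff; auto. intros t ht. left. apply hd'; try lra.
    - unfold Rmax; destruct Rle_dec; lra.
    - unfold Rmax; destruct Rle_dec; apply Rabs_lt_between; lra.
    - rewrite Rminus_diag, Rabs_R0; auto. }
  assert (hinf : forall e, 0 < e -> exists x0, x0 < 0 /\ forall x, x <= x0 ->
     Rabs (J x - 2 * PI * Re (f (RtoC 0))) <= 2 * PI * e).
  { intros e he.
    destruct (within_disc_eps f (RtoC 0)) with (eps := e) as (d & hdp & hd'); auto.
    { apply hc. rewrite Cmod_0; lra. }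
    pose (d' := Rmin d (1 / 2)). assert (hd0 : 0 < d') by (unfold d'; apply Rmin_glb_lt; lra).
    assert (hl : ln d' < 0).
    { rewrite <- ln_1. apply ln_increasing; auto. unfold d'. generalize (Rmin_r d (1/2)); lra. }
    exists (ln d' - 1); split; [lra|]. intros x hx.
    replace (2 * PI * Re (f (RtoC 0))) with (RInt (fun _ => Re (f (RtoC 0))) 0 (2 * PI)).
    2: { rewrite RInt_const. unfold scal; simpl; unfold mult; simpl. ring. }
    apply hdiff; auto; [|apply ex_RInt_const]. intros t _. left. unfold W.
    rewrite Rmin_left by lra.
    assert (hm : Cmod (polar x t) < d').
    { rewrite Cmod_polar. apply Rle_lt_trans with (exp (ln d' - 1)).
      - apply exp_le_compat; auto.
      - rewrite <- (exp_ln d') at 2 by auto. apply exp_increasing; lra. }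
    assert (d' <= 1 / 2) by apply Rmin_r. assert (d' <= d) by apply Rmin_l.
    apply hd'; [lra|..]; simpl fst; simpl snd; rewrite Rminus_0_r.
    - generalize (re_le_Cmod (polar x t)); unfold Re; simpl; lra.
    - generalize (Im_le_Cmod (polar x t)); unfold Im; simpl; lra. }
  assert (hfin : Rabs (J 0 - 2 * PI * Re (f (RtoC 0))) <= 0).
  { apply le_epsilon. intros e he. rewrite Rplus_0_l.
    assert (he' : 0 < e / (4 * PI)) by (apply Rdiv_lt_0_compat; lra).
    destruct (h0 _ he') as (x & hx & k1). destruct (hinf _ he') as (x0 & hx0 & k2).
    specialize (k2 (Rmin x x0) (Rmin_r _ _)).
    rewrite (hconst (Rmin x x0) x) in k2 by (split; [apply Rmin_l|auto]).
    replace (J 0 - 2 * PI * Re (f (RtoC 0))) with (- (J x - J 0) + (J x - 2 * PI * Re (f (RtoC 0)))) by ring.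
    eapply Rle_trans; [apply Rabs_triang|]. rewrite Rabs_Ropp.
    replace e with (2 * PI * (e / (4 * PI)) + 2 * PI * (e / (4 * PI))) by (field; lra). lra. }
  assert (hJ : J 0 = 2 * PI * Re (f (RtoC 0))).
  { apply Rminus_diag_uniq. generalize (Rabs_pos (J 0 - 2 * PI * Re (f (RtoC 0)))).
    intros hp. apply Rabs_eq_0. lra. }
  rewrite <- hJ. unfold J. apply RInt_ext. intros t _. unfold W.
  rewrite Rmin_left by lra. rewrite polar_cis, exp_0. do 2 f_equal. ring.
Qed.

(** * Two by two matrices *)

Section Entries.

Context {K : Ring}.
Implicit Types (A B : M2 K).

(** Out-of-range entries read the default [zero]. Thanks to this the entry formulas hold for all
    [i j], which is how the definitions of the statement quantify over entries. *)
Lemma ent_out A i j : (2 <= i \/ 2 <= j)%nat -> ent A i j = zero.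
Proof.
  destruct A as ((a, (b, t)), ((c, (d, t')), t'')), t, t', t''.
  intros h. destruct i as [|[|i]], j as [|[|j]]; try reflexivity; lia.
Qed.

Lemma ent_mk (u : nat -> nat -> K) i j : (i < 2)%nat -> (j < 2)%nat -> ent (mk_matrix 2 2 u) i j = u i j.
Proof. intros; apply coeff_mat_bij; auto. Qed.

Lemma mx_ext A B : ent A 0 0 = ent B 0 0 -> ent A 0 1 = ent B 0 1 ->
  ent A 1 0 = ent B 1 0 -> ent A 1 1 = ent B 1 1 -> A = B.
Proof.
  intros h1 h2 h3 h4. apply (coeff_mat_ext_aux zero zero). intros i j hi hj.
  destruct i as [|[|i]], j as [|[|j]]; auto; lia.
Qed.

Lemma two_cases i : (i = 0 \/ i = 1 \/ 2 <= i)%nat.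
Proof. lia. Qed.

Lemma ent_mult A B i j : ent (Mmult A B) i j =
  plus (mult (ent A i 0) (ent B 0 j)) (mult (ent A i 1) (ent B 1 j)).
Proof.
  destruct (le_lt_dec 2 i) as [hi|hi].
  { rewrite (ent_out _ i j), (ent_out A i 0), (ent_out A i 1) by auto.
    rewrite !mult_zero_l, plus_zero_l; auto. }
  destruct (le_lt_dec 2 j) as [hj|hj].
  { rewrite (ent_out _ i j), (ent_out B 0 j), (ent_out B 1 j) by auto.
    rewrite !mult_zero_r, plus_zero_l; auto. }
  unfold Mmult. rewrite ent_mk by auto. simpl. rewrite sum_Sn, sum_O. reflexivity.
Qed.

Lemma ent_plus A B i j : ent (plus A B) i j = plus (ent A i j) (ent B i j).
Proof.
  destruct (le_lt_dec 2 i) as [hi|hi]; [repeat rewrite (ent_out _ i j) by auto; rewrite plus_zero_l; auto|].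
  destruct (le_lt_dec 2 j) as [hj|hj]; [repeat rewrite (ent_out _ i j) by auto; rewrite plus_zero_l; auto|].
  apply (ent_mk (fun i j => plus (ent A i j) (ent B i j))); auto.
Qed.

Lemma ent_opp A i j : ent (opp A) i j = opp (ent A i j).
Proof.
  destruct (le_lt_dec 2 i) as [hi|hi]; [repeat rewrite (ent_out _ i j) by auto; symmetry; apply (@opp_zero K)|].
  destruct (le_lt_dec 2 j) as [hj|hj]; [repeat rewrite (ent_out _ i j) by auto; symmetry; apply (@opp_zero K)|].
  apply (ent_mk (fun i j => opp (ent A i j))); auto.
Qed.

Lemma ent_minus A B i j : ent (minus A B) i j = minus (ent A i j) (ent B i j).
Proof. unfold minus. rewrite ent_plus, ent_opp. reflexivity. Qed.

Lemma ent_zero i j : ent (zero : M2 K) i j = zero.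
Proof.
  destruct (le_lt_dec 2 i) as [hi|hi]; [repeat rewrite (ent_out _ i j) by auto; auto|].
  destruct (le_lt_dec 2 j) as [hj|hj]; [repeat rewrite (ent_out _ i j) by auto; auto|].
  apply (ent_mk (fun i j => zero)); auto.
Qed.

Lemma ent_mscal k A i j : ent (mscal k A) i j = mult k (ent A i j).
Proof.
  destruct (le_lt_dec 2 i) as [hi|hi]; [repeat rewrite (ent_out _ i j) by auto; rewrite mult_zero_r; auto|].
  destruct (le_lt_dec 2 j) as [hj|hj]; [repeat rewrite (ent_out _ i j) by auto; rewrite mult_zero_r; auto|].
  unfold mscal. rewrite ent_mk; auto.
Qed.

End Entries.

Lemma ent_mderive f t i j : ent (mderive f t) i j = Derive (fun u => ent (f u) i j) t.
Proof.
  destruct (le_lt_dec 2 i) as [hi|hi].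
  { rewrite ent_out by lia. symmetry. rewrite (Derive_ext _ (fun _ => 0)); [apply Derive_const|].
    intros u. apply (ent_out (K := R_Ring)); lia. }
  destruct (le_lt_dec 2 j) as [hj|hj].
  { rewrite ent_out by lia. symmetry. rewrite (Derive_ext _ (fun _ => 0)); [apply Derive_const|].
    intros u. apply (ent_out (K := R_Ring)); lia. }
  unfold mderive. rewrite ent_mk; auto.
Qed.

Lemma ent_cplx A i j : ent (cplx A) i j = RtoC (ent A i j).
Proof.
  destruct (le_lt_dec 2 i) as [hi|hi]; [repeat rewrite (ent_out _ i j) by auto; auto|].
  destruct (le_lt_dec 2 j) as [hj|hj]; [repeat rewrite (ent_out _ i j) by auto; auto|].
  unfold cplx. rewrite ent_mk; auto.
Qed.

Lemma entC_mult (A B : M2 C) i j : ent (Mmult A B) i j =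
  (ent A i 0 * ent B 0 j + ent A i 1 * ent B 1 j)%C.
Proof. apply (ent_mult (K := C_Ring)). Qed.

Lemma entC_plus (A B : M2 C) i j : ent (plus A B) i j = (ent A i j + ent B i j)%C.
Proof. apply (ent_plus (K := C_Ring)). Qed.

Lemma entC_minus (A B : M2 C) i j : ent (minus A B) i j = (ent A i j - ent B i j)%C.
Proof. apply (ent_minus (K := C_Ring)). Qed.

(* Fixed instances of the matrix sum: Coquelicot's [plus] elaborates to
   different structures depending on the shape of its arguments. *)
Definition cadd (A B : M2 C) : M2 C := plus A B.
Definition csub (A B : M2 C) : M2 C := minus A B.

Lemma entC_cadd (A B : M2 C) i j : ent (cadd A B) i j = (ent A i j + ent B i j)%C.
Proof. apply (ent_plus (K := C_Ring)). Qed.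

Lemma entC_csub (A B : M2 C) i j : ent (csub A B) i j = (ent A i j - ent B i j)%C.
Proof. apply (ent_minus (K := C_Ring)). Qed.

Lemma entC_mscal k (A : M2 C) i j : ent (mscal k A) i j = (k * ent A i j)%C.
Proof. apply (ent_mscal (K := C_Ring)). Qed.

Lemma entC_zero i j : ent (zero : M2 C) i j = RtoC 0.
Proof. apply (ent_zero (K := C_Ring)). Qed.

Lemma entR_mult (A B : M2 R) i j : ent (Mmult A B) i j = ent A i 0 * ent B 0 j + ent A i 1 * ent B 1 j.
Proof. apply (ent_mult (K := R_Ring)). Qed.

Lemma entR_plus (A B : M2 R) i j : ent (plus A B) i j = ent A i j + ent B i j.
Proof. apply (ent_plus (K := R_Ring)). Qed.

Lemma entR_minus (A B : M2 R) i j : ent (minus A B) i j = ent A i j - ent B i j.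
Proof. apply (ent_minus (K := R_Ring)). Qed.

Lemma entR_mscal k (A : M2 R) i j : ent (mscal k A) i j = k * ent A i j.
Proof. apply (ent_mscal (K := R_Ring)). Qed.

Lemma entR_zero i j : ent (zero : M2 R) i j = 0.
Proof. apply (ent_zero (K := R_Ring)). Qed.

Lemma mx2_entC (a b c d : C) : ent (mx2 (K := C_Ring) a b c d) 0 0 = a /\ ent (mx2 (K := C_Ring) a b c d) 0 1 = b /\
  ent (mx2 (K := C_Ring) a b c d) 1 0 = c /\ ent (mx2 (K := C_Ring) a b c d) 1 1 = d.
Proof. repeat split. Qed.

Lemma mx2_entR (a b c d : R) : ent (mx2 (K := R_Ring) a b c d) 0 0 = a /\ ent (mx2 (K := R_Ring) a b c d) 0 1 = b /\
  ent (mx2 (K := R_Ring) a b c d) 1 0 = c /\ ent (mx2 (K := R_Ring) a b c d) 1 1 = d.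
Proof. repeat split. Qed.

Lemma sl_invC (A : M2 C) : ent (sl_inv A) 0 0 = ent A 1 1 /\ ent (sl_inv A) 0 1 = (- ent A 0 1)%C /\
  ent (sl_inv A) 1 0 = (- ent A 1 0)%C /\ ent (sl_inv A) 1 1 = ent A 0 0.
Proof. repeat split. Qed.

Lemma sl_invR (A : M2 R) : ent (sl_inv A) 0 0 = ent A 1 1 /\ ent (sl_inv A) 0 1 = - ent A 0 1 /\
  ent (sl_inv A) 1 0 = - ent A 1 0 /\ ent (sl_inv A) 1 1 = ent A 0 0.
Proof. repeat split. Qed.

Lemma MoneC : ent (Mone : M2 C) 0 0 = RtoC 1 /\ ent (Mone : M2 C) 0 1 = RtoC 0 /\
  ent (Mone : M2 C) 1 0 = RtoC 0 /\ ent (Mone : M2 C) 1 1 = RtoC 1.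
Proof. repeat split. Qed.

Lemma MoneR : ent (Mone : M2 R) 0 0 = 1 /\ ent (Mone : M2 R) 0 1 = 0 /\
  ent (Mone : M2 R) 1 0 = 0 /\ ent (Mone : M2 R) 1 1 = 1.
Proof. repeat split. Qed.

Lemma mdetC (A : M2 C) : mdet A = (ent A 0 0 * ent A 1 1 - ent A 0 1 * ent A 1 0)%C.
Proof. reflexivity. Qed.

Lemma mdetR (A : M2 R) : mdet A = ent A 0 0 * ent A 1 1 - ent A 0 1 * ent A 1 0.
Proof. reflexivity. Qed.

Lemma mtrC (A : M2 C) : mtr A = (ent A 0 0 + ent A 1 1)%C.
Proof. reflexivity. Qed.

Lemma mtrR (A : M2 R) : mtr A = ent A 0 0 + ent A 1 1.
Proof. reflexivity. Qed.

Ltac entC := repeat (rewrite ?entC_mult, ?entC_plus, ?entC_minus, ?entC_cadd, ?entC_csub, ?entC_mscal, ?entC_zero, ?ent_cplx,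
  ?(proj1 (sl_invC _)), ?(proj1 (proj2 (sl_invC _))),
  ?(proj1 (proj2 (proj2 (sl_invC _)))), ?(proj2 (proj2 (proj2 (sl_invC _)))),
  ?(proj1 MoneC), ?(proj1 (proj2 MoneC)), ?(proj1 (proj2 (proj2 MoneC))), ?(proj2 (proj2 (proj2 MoneC))),
  ?(proj1 (mx2_entC _ _ _ _)), ?(proj1 (proj2 (mx2_entC _ _ _ _))),
  ?(proj1 (proj2 (proj2 (mx2_entC _ _ _ _)))), ?(proj2 (proj2 (proj2 (mx2_entC _ _ _ _)))),
  ?mdetC, ?mtrC).

Ltac entR := repeat (rewrite ?entR_mult, ?entR_plus, ?entR_minus, ?entR_mscal, ?entR_zero,
  ?(proj1 (sl_invR _)), ?(proj1 (proj2 (sl_invR _))),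
  ?(proj1 (proj2 (proj2 (sl_invR _)))), ?(proj2 (proj2 (proj2 (sl_invR _)))),
  ?(proj1 MoneR), ?(proj1 (proj2 MoneR)), ?(proj1 (proj2 (proj2 MoneR))), ?(proj2 (proj2 (proj2 MoneR))),
  ?(proj1 (mx2_entR _ _ _ _)), ?(proj1 (proj2 (mx2_entR _ _ _ _))),
  ?(proj1 (proj2 (proj2 (mx2_entR _ _ _ _)))), ?(proj2 (proj2 (proj2 (mx2_entR _ _ _ _)))),
  ?mdetR, ?mtrR).

Lemma mx_extC (A B : M2 C) : ent A 0 0 = ent B 0 0 :> C -> ent A 0 1 = ent B 0 1 :> C ->
  ent A 1 0 = ent B 1 0 :> C -> ent A 1 1 = ent B 1 1 :> C -> A = B.
Proof. apply mx_ext. Qed.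

Lemma mx_extR (A B : M2 R) : ent A 0 0 = ent B 0 0 :> R -> ent A 0 1 = ent B 0 1 :> R ->
  ent A 1 0 = ent B 1 0 :> R -> ent A 1 1 = ent B 1 1 :> R -> A = B.
Proof. apply mx_ext. Qed.

Lemma Ceq_minus (a b : C) : (a - b)%C = RtoC 0 -> a = b.
Proof. intros h. replace a with (a - b + b)%C by ring. rewrite h. ring. Qed.

Lemma Req_minus (a b : R) : a - b = 0 -> a = b.
Proof. lra. Qed.

Ltac Cring := apply Ceq_minus; ring.
Ltac Rring := apply Req_minus; ring.
Ltac mxC := apply mx_extC; entC; try Cring.

(** * Sobolev loops and Wiener loops *)

(** A subfamily that carries all nonzero terms has the same sum; this reduces a sum over [Z] to one
    of its halves, indexed by [nat]. *)
Lemma usum_inj {S T : Type} (phi : S -> T) (f : T -> C) s :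
  (forall x y, phi x = phi y -> x = y) -> (forall t, (forall x, phi x <> t) -> f t = RtoC 0) ->
  usum f s -> usum (fun x => f (phi x)) s.
Proof.
  intros hinj hz hs eps he. destruct (hs eps he) as (l0 & h0).
  assert (exists l1, forall t, In t l0 -> (exists x, phi x = t) -> exists x, In x l1 /\ phi x = t) as (l1 & h1).
  { clear h0. induction l0 as [|t l0 (l1 & h1)]; [exists nil; simpl; tauto|].
    destruct (classic (exists x, phi x = t)) as [(x & hx)|hn].
    - exists (x :: l1). intros t' [<-|ht] hx'; [exists x; simpl; auto|].
      destruct (h1 t' ht hx') as (y & hy1 & hy2). exists y; simpl; auto.
    - exists l1. intros t' [<-|ht] hx'; [tauto|auto]. }
  exists l1. intros l hl hi. rewrite <- lsum_map.
  assert (hm : NoDup (map phi l)) by (apply NoDup_map_inj; auto).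
  destruct (incl_split (map phi l) (lunion (map phi l) l0) hm (lunion_nodup _ _) (lunion_l _ _))
    as (l' & p1 & p2 & p3).
  specialize (h0 _ (lunion_nodup (map phi l) l0) (lunion_r _ _)).
  rewrite (lsum_perm _ _ _ p1), lsum_app in h0.
  rewrite (lsum_ext f (fun _ => RtoC 0 * RtoC 0)%C l') in h0.
  - rewrite lsum_scal in h0. replace (lsum f (map phi l)) with
      (lsum f (map phi l) + 0 * lsum (fun _ : T => RtoC 0) l')%C by ring. exact h0.
  - intros t ht. rewrite hz; [ring|]. intros x hx.
    assert (hin : In t l0).
    { assert (hi' : In t (lunion (map phi l) l0)).
      { eapply Permutation_in; [symmetry; apply p1|]. apply in_app_iff; auto. }
      apply nodup_In, in_app_iff in hi'. destruct hi'; auto. exfalso; eapply p3; eauto. }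
    destruct (h1 t hin (ex_intro _ x hx)) as (y & hy & <-).
    apply (p3 _ ht). apply in_map, hi, hy.
Qed.

Lemma sum_n_lsum (f : nat -> C) N : @sum_n C_AbelianGroup f N = lsum f (seq 0 (S N)).
Proof.
  induction N.
  - rewrite sum_O. simpl. ring.
  - rewrite sum_Sn, IHN, (seq_S (S N)), lsum_app. simpl lsum at 3.
    change (lsum f (seq 0 (S N)) + f (S N) = lsum f (seq 0 (S N)) + (f (S N) + 0))%C. ring.
Qed.

Lemma sum_n_rsum (f : nat -> R) N : sum_n f N = rsum f (seq 0 (S N)).
Proof.
  induction N.
  - rewrite sum_O. simpl. ring.
  - rewrite sum_Sn, IHN, (seq_S (S N)), rsum_app. unfold plus; simpl. ring.
Qed.

Lemma usum_is_series (f : nat -> C) s : usum f s -> is_series (V := C_NormedModule) f s.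
Proof.
  intros h P (eps & hP).
  destruct (h (eps / 2)) as (l0 & h0); [destruct eps; simpl; lra|].
  assert (exists N, forall n, In n l0 -> (n <= N)%nat) as (N & hN).
  { clear h0. induction l0 as [|x l0 (N & hN)]; [exists O; simpl; tauto|].
    exists (Nat.max x N). intros n [<-|hn]; [lia|]. specialize (hN n hn); lia. }
  exists N. intros n hn. apply hP. apply C_NormedModule_mixin_compat1.
  change (Cmod (@sum_n C_AbelianGroup f n - s) < eps). rewrite sum_n_lsum.
  apply Rle_lt_trans with (eps / 2); [|destruct eps; simpl; lra].
  apply h0; [apply seq_NoDup|]. intros x hx. apply in_seq. specialize (hN x hx); lia.
Qed.

(** The family is split by sign: the nonnegative half starts at $0$ and the negative one at $-1$,
    whence the index [- Z.of_nat (S n)]. *)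
Lemma is_zseries_usum (f : Z -> C) B s : bsum (fun n => Cmod (f n)) B -> usum f s ->
  is_zseries (V := C_NormedModule) f s.
Proof.
  intros hB hs.
  pose (f1 := fun n => if (0 <=? n)%Z then f n else RtoC 0).
  pose (f2 := fun n => if (0 <=? n)%Z then RtoC 0 else f n).
  assert (b1 : bsum (fun n => Cmod (f1 n)) B).
  { eapply bsum_le; [|apply hB]. intros n; unfold f1. destruct (0 <=? n)%Z; simpl; [lra|].
    rewrite Cmod_0; apply Cmod_ge_0. }
  assert (b2 : bsum (fun n => Cmod (f2 n)) B).
  { eapply bsum_le; [|apply hB]. intros n; unfold f2. destruct (0 <=? n)%Z; simpl; [|lra].
    rewrite Cmod_0; apply Cmod_ge_0. }
  destruct (usum_complete _ _ b1) as (v1 & h1). destruct (usum_complete _ _ b2) as (v2 & h2).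
  exists v1, v2. repeat split.
  - apply usum_is_series.
    apply (usum_inj Z.of_nat) in h1; [|lia|].
    + revert h1. apply usum_ext. intros n. unfold f1. destruct (Z.leb_spec 0 (Z.of_nat n)); auto; lia.
    + intros t ht. unfold f1. destruct (Z.leb_spec 0 t); auto.
      exfalso. apply (ht (Z.to_nat t)). lia.
  - apply usum_is_series.
    apply (usum_inj (fun n => (- Z.of_nat (S n))%Z)) in h2; [|lia|].
    + revert h2. apply usum_ext. intros n. unfold f2. destruct (Z.leb_spec 0 (- Z.of_nat (S n))); auto; lia.
    + intros t ht. unfold f2. destruct (Z.leb_spec 0 t); auto.
      exfalso. apply (ht (Z.to_nat (- t - 1))). lia.
  - apply (usum_unique f); auto.
    change (usum f (v1 + v2)%C). generalize (usum_plus _ _ _ _ h1 h2). apply usum_ext.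
    intros n; unfold f1, f2. destruct (0 <=? n)%Z; ring.
Qed.

Lemma is_zseries_unique (f : Z -> C) s s' : is_zseries (V := C_NormedModule) f s ->
  is_zseries (V := C_NormedModule) f s' -> s = s'.
Proof.
  intros (v1 & v2 & h1 & h2 & ->) (v1' & v2' & h1' & h2' & ->).
  rewrite (filterlim_locally_unique (K := C_AbsRing) (V := C_NormedModule) (F := eventually) _ v1 v1' h1 h1').
  rewrite (filterlim_locally_unique (K := C_AbsRing) (V := C_NormedModule) (F := eventually) _ v2 v2' h2 h2').
  reflexivity.
Qed.

Lemma usum_is_zseries (f : Z -> C) B s : bsum (fun n => Cmod (f n)) B ->
  is_zseries (V := C_NormedModule) f s -> usum f s.
Proof.
  intros hB hs. destruct (usum_complete _ _ hB) as (s' & hs').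
  rewrite (is_zseries_unique f s s'); auto. eapply is_zseries_usum; eauto.
Qed.

Lemma bsum_ex_series (u : nat -> R) B : (forall n, 0 <= u n) -> bsum u B -> ex_series u.
Proof.
  intros h0 hB. apply ex_finite_lim_seq_correct.
  apply ex_finite_lim_seq_correct.
  apply (ex_finite_lim_seq_incr _ B).
  - intros n. rewrite sum_Sn. unfold plus; simpl. generalize (h0 (S n)); lra.
  - intros n. rewrite sum_n_rsum. apply hB, seq_NoDup.
Qed.

Lemma bsum_zseries (u : Z -> R) B : (forall n, 0 <= u n) -> bsum u B ->
  exists q, is_zseries (V := R_NormedModule) u q.
Proof.
  intros h0 hB.
  destruct (bsum_ex_series (fun n => u (Z.of_nat n)) B) as (v1 & h1); auto.
  { apply (bsum_inj Z.of_nat); auto. lia. }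
  destruct (bsum_ex_series (fun n => u (- Z.of_nat (S n))%Z) B) as (v2 & h2); auto.
  { apply (bsum_inj (fun n => (- Z.of_nat (S n))%Z)); auto. lia. }
  exists (plus v1 v2), v1, v2; auto.
Qed.

Lemma is_series_partial (u : nat -> R) v N : (forall n, 0 <= u n) -> is_series u v -> sum_n u N <= v.
Proof.
  intros h0 h. apply (is_lim_seq_incr_compare (sum_n u)); [apply h|].
  intros n. rewrite sum_Sn. unfold plus; simpl. generalize (h0 (S n)); lra.
Qed.

Lemma zseries_bsum (u : Z -> R) q : (forall n, 0 <= u n) ->
  is_zseries (V := R_NormedModule) u q -> bsum u q.
Proof.
  intros h0 (v1 & v2 & h1 & h2 & ->) l hl.
  assert (exists N, forall n, In n l -> (Z.abs n <= Z.of_nat N)%Z) as (N & hN).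
  { clear hl. induction l as [|x l (N & hN)]; [exists O; simpl; tauto|].
    exists (Nat.max (Z.abs_nat x) N). intros n [<-|hn]; [lia|]. specialize (hN n hn); lia. }
  apply Rle_trans with (rsum u (map Z.of_nat (seq 0 (S N)) ++ map (fun n => (- Z.of_nat (S n))%Z) (seq 0 (S N)))).
  - apply rsum_incl; auto. intros n hn. specialize (hN n hn). apply in_app_iff.
    destruct (Z_le_gt_dec 0 n).
    + left. apply in_map_iff. exists (Z.to_nat n). rewrite in_seq. lia.
    + right. apply in_map_iff. exists (Z.to_nat (- n - 1)). rewrite in_seq. lia.
  - rewrite rsum_app, !rsum_map, <- !sum_n_rsum.
    apply Rplus_le_compat; apply is_series_partial; auto.
Qed.

Lemma hs_weight_ge1 s n : 0 <= s -> 1 <= Rpower (1 + IZR n ^ 2) s.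
Proof.
  intros hs. assert (h : 1 <= 1 + IZR n ^ 2) by nra.
  apply Rle_trans with (Rpower (1 + IZR n ^ 2) 0); [rewrite Rpower_O; lra|].
  apply Rle_Rpower; lra.
Qed.

Lemma telescope_bsum (u phi : nat -> R) C : (forall n, 0 <= phi n) -> (forall n, 0 <= u n) ->
  (forall n, u n <= C * (phi n - phi (S n))) -> 0 <= C -> bsum u (C * phi O).
Proof.
  intros hp h0 h hC l hl.
  assert (exists N, forall n, In n l -> (n <= N)%nat) as (N & hN).
  { clear hl. induction l as [|x l (N & hN)]; [exists O; simpl; tauto|].
    exists (Nat.max x N). intros n [<-|hn]; [lia|]. specialize (hN n hn); lia. }
  apply Rle_trans with (rsum u (seq 0 (S N))).
  { apply rsum_incl; auto. intros x hx. apply in_seq. specialize (hN x hx); lia. }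
  rewrite <- sum_n_rsum. apply Rle_trans with (C * (phi O - phi (S N))).
  - induction N; [rewrite sum_O; apply h|]. rewrite sum_Sn. unfold plus; simpl.
    assert (hN' : sum_n u N <= C * (phi O - phi (S N))).
    { clear - h. induction N; [rewrite sum_O; apply h|]. rewrite sum_Sn. unfold plus; simpl.
      specialize (h (S N)). nra. }
    specialize (h (S N)). nra.
  - specialize (hp (S N)). nra.
Qed.

(** Comparison of $(1+n^2)^{-s}$ with the differences of $(n+1)^{-d}$, $d=2s-1>0$: by the mean value
    theorem such a difference is $d\,x^{-2s}$ for some $x\le n+2$. *)
Lemma hs_weight_summable s : s > 1 / 2 -> exists B, bsum (fun n : Z => / Rpower (1 + IZR n ^ 2) s) B.
Proof.
  intros hs. pose (d := 2 * s - 1). assert (hd : 0 < d) by (unfold d; lra).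
  pose (phi := fun n : nat => Rpower (INR n + 1) (- d)).
  (* The $5$ comes from $(n+2)^2\le5(1+n^2)$, where the difference of the two sides is
     $(2n-1)^2$. *)
  pose (C := Rpower 5 s / d).
  assert (hC : 0 < C) by (unfold C; apply Rdiv_lt_0_compat; auto; apply exp_pos).
  assert (key : forall n : nat, / Rpower (1 + INR n ^ 2) s <= C * (phi n - phi (S n))).
  { intros n. assert (hn := pos_INR n).
    destruct (MVT_gen (fun x => Rpower x (- d)) (INR n + 1) (INR n + 2) (fun x => - d * Rpower x (- d - 1))) as (x & hx & e).
    - intros x hx. rewrite Rmin_left in hx by lra. apply is_derive_Reals, derivable_pt_lim_power. lra.
    - intros x hx. rewrite Rmin_left in hx by lra. apply derivable_continuous_pt.
      eexists. apply derivable_pt_lim_power; lra.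
    - rewrite Rmin_left, Rmax_right in hx by lra. cbv beta in e.
      replace (INR n + 2 - (INR n + 1)) with 1 in e by ring.
      replace (phi n - phi (S n)) with (d * Rpower x (- d - 1)).
      2: { unfold phi. rewrite S_INR. replace (INR n + 1 + 1) with (INR n + 2) by ring. lra. }
      replace (C * (d * Rpower x (- d - 1))) with (Rpower 5 s * Rpower x (- (2 * s))).
      2: { unfold C. replace (- d - 1) with (- (2 * s)) by (unfold d; ring). field; lra. }
      rewrite Rpower_Ropp, <- Rpower_mult.
      replace (Rpower x 2) with (x ^ 2) by (rewrite <- (Rpower_pow 2) by lra; f_equal; simpl; ring).
      rewrite <- (Rinv_inv (Rpower 5 s)), <- Rinv_mult.
      apply Rinv_le_contravar.
      + apply Rmult_lt_0_compat; [apply Rinv_0_lt_compat|]; apply exp_pos.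
      + apply Rmult_le_reg_l with (Rpower 5 s); [apply exp_pos|].
        rewrite <- Rmult_assoc, Rinv_r, Rmult_1_l by (apply Rgt_not_eq, exp_pos).
        rewrite Rpower_mult_distr by nra. apply Rle_Rpower_l; [lra|]. split; [nra|].
        apply Rle_trans with ((INR n + 2) ^ 2); [apply pow_incr; lra|].
        generalize (pow2_ge_0 (2 * INR n - 1)). nra. }
  assert (hb : bsum (fun n : nat => / Rpower (1 + INR n ^ 2) s) (C * phi O)).
  { apply telescope_bsum; auto; try lra.
    - intros n; left; apply exp_pos.
    - intros n; left; apply Rinv_0_lt_compat, exp_pos. }
  destruct (bsum_ex_series _ _ (fun n => Rlt_le _ _ (Rinv_0_lt_compat _ (exp_pos _))) hb) as (v1 & h1).
  assert (hb2 : bsum (fun n : nat => / Rpower (1 + INR (S n) ^ 2) s) (C * phi O)).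
  { apply (bsum_inj S (fun n : nat => / Rpower (1 + INR n ^ 2) s)); auto. }
  destruct (bsum_ex_series _ _ (fun n => Rlt_le _ _ (Rinv_0_lt_compat _ (exp_pos _))) hb2) as (v2 & h2).
  exists (plus v1 v2). apply zseries_bsum.
  - intros n; left; apply Rinv_0_lt_compat, exp_pos.
  - exists v1, v2. repeat split.
    + revert h1. apply is_series_ext. intros n. rewrite <- INR_IZR_INZ. auto.
    + revert h2. apply is_series_ext. intros n. rewrite opp_IZR, <- INR_IZR_INZ.
      replace ((- INR (S n)) ^ 2) with (INR (S n) ^ 2) by ring. auto.
Qed.

Lemma frob2_ge A i j : Cmod (ent A i j) ^ 2 <= frob2 A.
Proof.
  unfold frob2.
  generalize (pow2_ge_0 (Cmod (ent A 0 0))) (pow2_ge_0 (Cmod (ent A 0 1)))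
    (pow2_ge_0 (Cmod (ent A 1 0))) (pow2_ge_0 (Cmod (ent A 1 1))). intros.
  destruct (le_lt_dec 2 i) as [hi|hi].
  { rewrite (ent_out (K := C_Ring) A i j) by auto. change (@zero C_Ring) with (RtoC 0).
    rewrite Cmod_0, pow_i by lia. lra. }
  destruct (le_lt_dec 2 j) as [hj|hj].
  { rewrite (ent_out (K := C_Ring) A i j) by auto. change (@zero C_Ring) with (RtoC 0).
    rewrite Cmod_0, pow_i by lia. lra. }
  destruct i as [|[|i]], j as [|[|j]]; try lia; lra.
Qed.

Lemma frob2_ge0 A : 0 <= frob2 A.
Proof. eapply Rle_trans; [|apply (frob2_ge A 0 0)]. apply pow2_ge_0. Qed.

Lemma Hs_sqnorm_coef s a q n i j : 0 <= s -> is_Hs_sqnorm s a q -> Cmod (ent (a n) i j) ^ 2 <= q.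
Proof.
  intros hs h. apply zseries_bsum in h.
  - eapply Rle_trans; [|apply (bsum_term _ _ n h)]. generalize (hs_weight_ge1 s n hs) (frob2_ge (a n) i j) (frob2_ge0 (a n)). nra.
  - intros m. apply Rmult_le_pos; [left; apply exp_pos|apply frob2_ge0].
Qed.

(* AM-GM: 2 |a_n| <= eps (1 + n^2)^(-s) + (1 + n^2)^s |a_n|^2 / eps. *)
Lemma Hs_bsum s a q B eps i j : 0 < eps -> bsum (fun n : Z => / Rpower (1 + IZR n ^ 2) s) B ->
  is_Hs_sqnorm s a q -> bsum (fun n => Cmod (ent (a n) i j)) (eps * B + / eps * q).
Proof.
  intros he hB h. apply zseries_bsum in h.
  - eapply bsum_le; [|apply bsum_plus; [apply bsum_scal; [|apply hB]|apply bsum_scal; [|apply h]]].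
    + intros n; simpl. set (W := Rpower (1 + IZR n ^ 2) s).
      assert (hW : 0 < W) by apply exp_pos.
      set (z := Cmod (ent (a n) i j)). assert (hz : 0 <= z) by apply Cmod_ge_0.
      apply Rle_trans with (eps * / W + / eps * (W * z ^ 2)).
      * apply Rmult_le_reg_r with (eps * W); [nra|].
        replace ((eps * / W + / eps * (W * z ^ 2)) * (eps * W)) with (eps ^ 2 + (W * z) ^ 2) by (field; lra).
        generalize (pow2_ge_0 (eps - W * z)). nra.
      * apply Rplus_le_compat_l, Rmult_le_compat_l; [left; apply Rinv_0_lt_compat; auto|].
        apply Rmult_le_compat_l; [left; apply exp_pos|]. apply frob2_ge.
    + lra.
    + left; apply Rinv_0_lt_compat; auto.
  - intros m. apply Rmult_le_pos; [left; apply exp_pos|apply frob2_ge0].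
Qed.

Lemma usum_conj {T : Type} (f : T -> C) s : usum f s -> usum (fun t => Cconj (f t)) (Cconj s).
Proof.
  intros h eps he. destruct (h eps he) as (l0 & h0). exists l0. intros l hl hi.
  specialize (h0 l hl hi). rewrite <- Cmod_conj, Cminus_conj in h0.
  replace (lsum (fun t => Cconj (f t)) l) with (Cconj (lsum f l)); auto.
  clear. induction l; simpl; [unfold Cconj; simpl; apply injective_projections; simpl; ring|].
  rewrite Cplus_conj, IHl; auto.
Qed.

(** Averaging the series of $g(\lambda)$ with the conjugate of the series of $g(\bar\lambda)$
    replaces each coefficient by its real part and leaves the sum unchanged. *)
Lemma four_of_fourier (a : Z -> C) (g : C -> C) B : bsum (fun n => Cmod (a n)) B ->
  (forall l, Cmod l = 1 -> is_zseries (V := C_NormedModule) (fun n => a n * Czpow l n)%C (g l)) ->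
  (forall l, Cmod l = 1 -> Cconj (g (Cconj l)) = g l) ->
  four (fun n => Re (a n)) g.
Proof.
  intros hB hz hc l hl.
  assert (hu : forall l, Cmod l = 1 -> usum (fun n => a n * Czpow l n)%C (g l)).
  { intros l' hl'. apply usum_is_zseries with B; auto. eapply bsum_le; [|apply hB].
    intros n. simpl. rewrite Cmod_mult, Cmod_Czpow; auto. lra. }
  assert (hl' : Cmod (Cconj l) = 1) by (rewrite Cmod_conj; auto).
  generalize (usum_scal (RtoC (/ 2)) _ _ (usum_plus _ _ _ _ (hu l hl) (usum_conj _ _ (hu _ hl')))).
  rewrite hc by auto.
  replace (RtoC (/ 2) * (g l + g l))%C with (g l).
  2: { apply injective_projections; simpl; field. }
  apply usum_ext. intros n. rewrite Cmult_conj, Czpow_conj by (apply unit_neq0; auto).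
  destruct (a n) as (x, y). unfold Re. apply injective_projections; simpl; field.
Qed.

Lemma rho_ent g l i j : loop_eq (rho g) g -> Cmod l = 1 ->
  Cconj (ent (g (Cconj l)) i j) = ent (g l) i j.
Proof.
  intros h hl. destruct (classic (i < 2 /\ j < 2)%nat) as [[hi hj]|hn].
  - rewrite <- (h l hl). unfold rho. rewrite (ent_mk (K := C_Ring)); auto.
  - rewrite !(ent_out (K := C_Ring)) by lia. unfold Cconj; simpl. apply injective_projections; simpl; ring.
Qed.

Definition mrep (w : Z -> R) (S : Z -> Prop) (B : R) (g : loop) : Prop :=
  forall i j, rep w S B (fun l => ent (g l) i j).

Definition allz (n : Z) : Prop := True.

Lemma is_fourier_four a g B : is_fourier a g -> loop_eq (rho g) g ->
  (forall i j, bsum (fun n => Cmod (ent (a n) i j)) B) ->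
  forall i j, four (fun n => Re (ent (a n) i j)) (fun l => ent (g l) i j).
Proof.
  intros hf hr hb i j. apply (four_of_fourier (fun n => ent (a n) i j) _ B); [apply hb|..].
  - intros l hl. apply (hf l hl i j).
  - intros l hl. apply rho_ent; auto.
Qed.

(** The Sobolev embedding into the Wiener algebra; [Hs_bsum], with its free parameter set to $1$,
    bounds the absolute sums. *)
Lemma Hs_fourier_rep s a q g : s > 1 / 2 -> is_fourier a g -> is_Hs_sqnorm s a q -> loop_eq (rho g) g ->
  exists B, mrep w1 allz B g /\ forall n i j, cf (fun l => ent (g l) i j) n = Re (ent (a n) i j).
Proof.
  intros hs hf hq hr. destruct (hs_weight_summable s hs) as (B & hB).
  exists (1 * B + / 1 * q).
  assert (hb := fun i j => Hs_bsum s a q B 1 i j Rlt_0_1 hB hq).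
  assert (h4 := is_fourier_four a g _ hf hr hb).
  assert (hre : forall i j, bsum (fun n => Rabs (Re (ent (a n) i j))) (1 * B + / 1 * q)).
  { intros i j. eapply bsum_le; [|apply (hb i j)]. intros n; apply re_le_Cmod. }
  split.
  - intros i j. apply (rep_intro w1 weight_w1 _ _ _ (fun n => Re (ent (a n) i j))); auto.
    + eapply bsum_le; [|apply (hre i j)]. intros n; unfold w1; lra.
    + intros n hn; exfalso; apply hn; exact I.
  - intros n i j. apply (four_cf (fun n => Re (ent (a n) i j)) _ _ (hre i j)). auto.
Qed.

Lemma in_G_rep s g : s > 1 / 2 -> in_G s g -> exists B, mrep w1 allz B g.
Proof.
  intros hs [(a & hf & q & hq) _ hr _].
  destruct (Hs_fourier_rep s a q g hs hf hq hr) as (B & h & _). eauto.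
Qed.

(** * Holomorphic extension and supports of Fourier series *)

Lemma filterlim_within_C (f : C -> C) (D : C -> Prop) (z L : C) :
  filterlim f (within D (locally z)) (locally L) <->
  (forall eps, 0 < eps -> exists d, 0 < d /\ forall w, D w -> Cmod (w - z) < d -> Cmod (f w - L) < eps).
Proof.
  split.
  - intros h eps he. assert (hl : locally L (fun v => Cmod (v - L) < eps)).
    { apply locally_C. exists (mkposreal eps he). intros v hv. exact hv. }
    destruct (proj1 (locally_C z _) (h _ hl)) as (d & hd).
    exists d. split; [apply cond_pos|]. intros w hw hwd. exact (hd w hwd hw).
  - intros h P hP. apply locally_C in hP. destruct hP as (eps & hP).
    destruct (h eps (cond_pos eps)) as (d & hd & hd').
    apply locally_C. exists (mkposreal d hd). intros w hw hDw. apply hP. exact (hd' w hDw hw).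
Qed.

Definition in_disc (w : C) : Prop := Cmod w <= 1.

Definition disc_cont (f : C -> C) (z : C) : Prop := filterlim f (within in_disc (locally z)) (locally (f z)).

Lemma disc_cont_mult f g z : disc_cont f z -> disc_cont g z -> disc_cont (fun w => f w * g w)%C z.
Proof.
  unfold disc_cont. rewrite !filterlim_within_C. intros hf hg eps he.
  pose (K := Cmod (f z) + Cmod (g z) + 1).
  assert (hK : 1 <= K) by (unfold K; generalize (Cmod_ge_0 (f z)) (Cmod_ge_0 (g z)); lra).
  pose (e := Rmin 1 (eps / (2 * K))).
  assert (he0 : 0 < e) by (unfold e; apply Rmin_glb_lt; [lra|apply Rdiv_lt_0_compat; lra]).
  destruct (hf e he0) as (d1 & p1 & q1). destruct (hg e he0) as (d2 & p2 & q2).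
  exists (Rmin d1 d2); split; [apply Rmin_glb_lt; auto|]. intros w hw hwd.
  specialize (q1 w hw (Rlt_le_trans _ _ _ hwd (Rmin_l _ _))).
  specialize (q2 w hw (Rlt_le_trans _ _ _ hwd (Rmin_r _ _))).
  replace (f w * g w - f z * g z)%C with ((f w - f z) * (g w - g z) + ((f w - f z) * g z + f z * (g w - g z)))%C by ring.
  eapply Rle_lt_trans; [apply Cmod_triangle|].
  eapply Rle_lt_trans; [apply Rplus_le_compat_l, Cmod_triangle|]. rewrite !Cmod_mult.
  assert (e <= 1) by apply Rmin_l. assert (e <= eps / (2 * K)) by apply Rmin_r.
  assert (e * K <= eps / 2).
  { apply Rle_trans with (eps / (2 * K) * K); [apply Rmult_le_compat_r; lra|right; field; lra]. }
  generalize (Cmod_ge_0 (f w - f z)) (Cmod_ge_0 (g w - g z)) (Cmod_ge_0 (f z)) (Cmod_ge_0 (g z)). intros.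
  unfold K in *.
  assert (Cmod (f w - f z) * Cmod (g w - g z) <= e * 1) by (apply Rmult_le_compat; lra).
  assert (Cmod (f w - f z) * Cmod (g z) <= e * Cmod (g z)) by (apply Rmult_le_compat_r; lra).
  assert (Cmod (f z) * Cmod (g w - g z) <= Cmod (f z) * e) by (apply Rmult_le_compat_l; lra).
  lra.
Qed.

Lemma disc_cont_pow (f : C -> C) k z : disc_cont f z -> disc_cont (fun w => w ^ k * f w)%C z.
Proof.
  intros hf. induction k as [|k IH].
  - unfold disc_cont in *. rewrite filterlim_within_C in *. intros eps he.
    destruct (hf eps he) as (d & hd & h). exists d; split; auto. intros w hw hwd. simpl.
    replace (1 * f w - 1 * f z)%C with (f w - f z)%C by ring. auto.
  - assert (hid : disc_cont (fun w => w) z).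
    { unfold disc_cont. rewrite filterlim_within_C. intros eps he. exists eps; auto. }
    generalize (disc_cont_mult _ _ _ hid IH). unfold disc_cont. rewrite !filterlim_within_C.
    intros h eps he. destruct (h eps he) as (d & hd & h'). exists d; split; auto.
    intros w hw hwd. simpl.
    replace (w * w ^ k * f w - z * z ^ k * f z)%C with (w * (w ^ k * f w) - z * (z ^ k * f z))%C by ring.
    auto.
Qed.

(** The two sides differ in the normed-module structure on [C]; the product rule is available for
    the one coming from the absolute ring. *)
Lemma is_derive_C_AbsRing (f : C -> C) z l :
  is_derive (K := C_AbsRing) (V := C_NormedModule) f z l <->
  is_derive (K := C_AbsRing) (V := AbsRing_NormedModule C_AbsRing) f z l.
Proof.
  split; intros (_ & h); (split; [apply is_linear_scal_l|exact h]).
Qed.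

Lemma ex_derive_pow (f : C -> C) k z : ex_derive (K := C_AbsRing) (V := C_NormedModule) f z ->
  ex_derive (K := C_AbsRing) (V := C_NormedModule) (fun w => w ^ k * f w)%C z.
Proof.
  intros hf. induction k as [|k (l & IH)].
  - destruct hf as (l & hf). exists l. revert hf. apply is_derive_ext. intros t; simpl.
    change (f t = (1 * f t)%C). ring.
  - exists (l * z + z ^ k * f z)%C.
    apply (is_derive_ext (K := C_AbsRing) (V := C_NormedModule) (fun w => (w ^ k * f w) * w)%C).
    { intros t; simpl. change ((t ^ k * f t * t)%C = (t * t ^ k * f t)%C). ring. }
    apply is_derive_C_AbsRing. apply is_derive_C_AbsRing in IH.
    evar_last.
    + apply (is_derive_mult (K := C_AbsRing) (fun w => (w ^ k * f w)%C) (fun w => w) z l (RtoC 1) IH).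
      * apply (is_derive_id (K := C_AbsRing)).
      * intros a b; apply Cmult_comm.
    + unfold plus, mult; simpl. change ((l * z + (z ^ k * f z) * 1)%C = (l * z + z ^ k * f z)%C). ring.
Qed.

(** The coefficient of index $-k$ is the mean of $z^kg(z)$ over the circle, hence the value of this
    holomorphic function at $0$, which vanishes for $k>0$. *)
Lemma extends_coef h g i j (k : nat) : extends_to_disc h g ->
  cf (fun l => ent (h l) i j) (- Z.of_nat k) = if Nat.eq_dec k 0 then Re (ent (g (RtoC 0)) i j) else 0.
Proof.
  intros [hb hc hd].
  assert (m := mean_value (fun z => z ^ k * ent (g z) i j)%C).
  unfold cf. rewrite Z.opp_involutive.
  assert (hpi := PI_RGT_0).
  transitivity (/ (2 * PI) * (2 * PI * Re ((RtoC 0) ^ k * ent (g (RtoC 0)) i j)%C)).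
  - rewrite <- m.
    + f_equal. apply RInt_ext. intros t _. rewrite Czpow_nat, <- hb by apply Cmod_cis.
      rewrite Cmult_comm. reflexivity.
    + intros z hz. exact (disc_cont_pow (fun w => ent (g w) i j) k z (hc z hz i j)).
    + intros z hz. exact (ex_derive_pow (fun w => ent (g w) i j) k z (hd z hz i j)).
  - rewrite <- Rmult_assoc, Rinv_l, Rmult_1_l by lra.
    destruct (Nat.eq_dec k 0) as [->|hk].
    + f_equal. simpl. apply Cmult_1_l.
    + destruct k; [lia|]. rewrite Cpow_S. replace (_ * _)%C with (RtoC 0) by ring. reflexivity.
Qed.

Lemma pow2_ge_id n : INR n <= 2 ^ n.
Proof.
  induction n; [simpl; lra|]. rewrite S_INR. simpl.
  assert (1 <= 2 ^ n) by (apply pow_R1_Rle; lra). lra.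
Qed.

Lemma pow2_ge_sq n : INR n ^ 2 <= 2 * 2 ^ n.
Proof.
  destruct n as [|[|[|n]]]; [simpl; lra..|].
  induction n; [simpl; lra|].
  rewrite S_INR. change (2 ^ S (S (S (S n)))) with (2 * 2 ^ S (S (S n))).
  assert (3 <= INR (S (S (S n)))) by (rewrite !S_INR; generalize (pos_INR n); lra). nra.
Qed.

Lemma Cpow_diff1 (w z : C) n : Cmod w <= 1 -> Cmod z <= 1 ->
  Cmod (w ^ n - z ^ n) <= INR n * Cmod (w - z).
Proof.
  intros hw hz. induction n.
  - simpl. replace (1 - 1)%C with (RtoC 0) by ring. rewrite Cmod_0; lra.
  - rewrite S_INR. replace (w ^ S n - z ^ S n)%C with (w * (w ^ n - z ^ n) + (w - z) * z ^ n)%C by (simpl; ring).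
    eapply Rle_trans; [apply Cmod_triangle|]. rewrite !Cmod_mult, Cmod_pow.
    assert (Cmod z ^ n <= 1) by (rewrite <- (pow1 n); apply pow_incr; split; [apply Cmod_ge_0|auto]).
    generalize (Cmod_ge_0 w) (Cmod_ge_0 (w - z)) (Cmod_ge_0 (w ^ n - z ^ n)). nra.
Qed.

Lemma Cpow_diff2 (w z : C) n : Cmod w <= 1 -> Cmod z <= 1 ->
  Cmod (w ^ n - z ^ n - RtoC (INR n) * z ^ (pred n) * (w - z)) <= INR n ^ 2 * Cmod (w - z) ^ 2.
Proof.
  intros hw hz. induction n.
  - simpl. replace (1 - 1 - 0 * 1 * (w - z))%C with (RtoC 0) by ring. rewrite Cmod_0.
    generalize (Cmod_ge_0 (w - z)); nra.
  - assert (e : (w ^ S n - z ^ S n - RtoC (INR (S n)) * z ^ (pred (S n)) * (w - z) =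
      z * (w ^ n - z ^ n - RtoC (INR n) * z ^ (pred n) * (w - z)) + (w - z) * (w ^ n - z ^ n))%C).
    { rewrite S_INR, RtoC_plus. destruct n; simpl; [ring|ring]. }
    rewrite e. eapply Rle_trans; [apply Cmod_triangle|]. rewrite !Cmod_mult, S_INR.
    generalize (Cpow_diff1 w z n hw hz) (Cmod_ge_0 z) (Cmod_ge_0 (w - z)) (Cmod_ge_0 (w ^ n - z ^ n))
      (Cmod_ge_0 (w ^ n - z ^ n - RtoC (INR n) * z ^ (pred n) * (w - z))) (pos_INR n). nra.
Qed.

Section PowerSeries.

Context (a : nat -> R) (B : R).
Hypothesis (hB : bsum (fun n => 2 ^ n * Rabs (a n)) B).

Definition pser (z : C) : C := usumv (fun n => RtoC (a n) * z ^ n)%C.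

Lemma pser_spec z : Cmod z <= 1 -> usum (fun n => RtoC (a n) * z ^ n)%C (pser z).
Proof.
  intros hz. apply usumv_spec with B. eapply bsum_le; [|apply hB]. intros n; simpl.
  rewrite Cmod_mult, Cmod_R, Cmod_pow.
  assert (Cmod z ^ n <= 1) by (rewrite <- (pow1 n); apply pow_incr; split; [apply Cmod_ge_0|auto]).
  assert (1 <= 2 ^ n) by (apply pow_R1_Rle; lra).
  generalize (Rabs_pos (a n)). nra.
Qed.

Lemma pser_0 : pser (RtoC 0) = RtoC (a O).
Proof.
  apply (usum_unique (fun n => RtoC (a n) * (RtoC 0) ^ n)%C).
  - apply pser_spec. rewrite Cmod_0; lra.
  - evar_last; [apply (usum_single (fun n => RtoC (a n) * (RtoC 0) ^ n)%C O)|simpl; ring].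
    intros [|n] h; [lia|]. simpl; ring.
Qed.

Lemma pser_lip w z : Cmod w <= 1 -> Cmod z <= 1 -> Cmod (pser w - pser z) <= B * Cmod (w - z).
Proof.
  intros hw hz.
  apply (usum_bound (fun n => RtoC (a n) * w ^ n + RtoC (-1) * (RtoC (a n) * z ^ n))%C).
  - rewrite Rmult_comm. eapply bsum_le; [|apply bsum_scal; [apply Cmod_ge_0|apply hB]]. intros n; simpl.
    replace (RtoC (a n) * w ^ n + RtoC (-1) * (RtoC (a n) * z ^ n))%C with (RtoC (a n) * (w ^ n - z ^ n))%C
      by (rewrite RtoC_m1; ring).
    rewrite Cmod_mult, Cmod_R.
    generalize (Cpow_diff1 w z n hw hz) (pow2_ge_id n) (Rabs_pos (a n)) (Cmod_ge_0 (w - z)). intros.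
    apply Rle_trans with (Rabs (a n) * (2 ^ n * Cmod (w - z))); [|right; ring].
    apply Rmult_le_compat_l; auto. eapply Rle_trans; [apply H|]. apply Rmult_le_compat_r; auto.
  - replace (pser w - pser z)%C with (pser w + RtoC (-1) * pser z)%C by (rewrite RtoC_m1; ring).
    apply usum_plus; [|apply usum_scal]; apply pser_spec; auto.
Qed.

(** A remainder quadratic in $|w-z|$, uniform on the closed disc, follows term by term from
    [Cpow_diff2], because $n^2\le2\cdot2^n$ is absorbed by the weight. *)
Lemma pser_derive z : Cmod z <= 1 -> exists D, forall w, Cmod w <= 1 ->
  Cmod (pser w - pser z - D * (w - z)) <= 2 * B * Cmod (w - z) ^ 2.
Proof.
  intros hz. pose (d := fun n => (RtoC (a n) * (RtoC (INR n) * z ^ (pred n)))%C).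
  assert (hd : usum d (usumv d)).
  { apply usumv_spec with B. eapply bsum_le; [|apply hB]. intros n; unfold d.
    rewrite !Cmod_mult, !Cmod_R, Cmod_pow.
    assert (Cmod z ^ (pred n) <= 1) by (rewrite <- (pow1 (pred n)); apply pow_incr; split; [apply Cmod_ge_0|auto]).
    assert (0 <= Cmod z ^ (pred n)) by (apply pow_le, Cmod_ge_0).
    rewrite (Rabs_right (INR n)) by (apply Rle_ge, pos_INR).
    generalize (pow2_ge_id n) (pos_INR n) (Rabs_pos (a n)). intros.
    rewrite (Rmult_comm (2 ^ n)). apply Rmult_le_compat_l; auto. nra. }
  exists (usumv d). intros w hw.
  apply (usum_bound (fun n => RtoC (a n) * w ^ n + RtoC (-1) * (RtoC (a n) * z ^ n) + (- (w - z)) * d n)%C).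
  - replace (2 * B * Cmod (w - z) ^ 2) with ((2 * Cmod (w - z) ^ 2) * B) by ring.
    eapply bsum_le; [|apply bsum_scal; [|apply hB]].
    + intros n; simpl.
      replace (RtoC (a n) * w ^ n + RtoC (-1) * (RtoC (a n) * z ^ n) + (- (w - z)) * d n)%C
        with (RtoC (a n) * (w ^ n - z ^ n - RtoC (INR n) * z ^ (pred n) * (w - z)))%C
        by (unfold d; rewrite RtoC_m1; ring).
      rewrite Cmod_mult, Cmod_R.
      generalize (Cpow_diff2 w z n hw hz) (pow2_ge_sq n) (Rabs_pos (a n)) (pow2_ge_0 (Cmod (w - z))). intros.
      apply Rle_trans with (Rabs (a n) * ((2 * 2 ^ n) * Cmod (w - z) ^ 2)).
      * apply Rmult_le_compat_l; auto. eapply Rle_trans; [apply H|]. apply Rmult_le_compat_r; auto.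
      * right; simpl; ring.
    + generalize (pow2_ge_0 (Cmod (w - z))); lra.
  - replace (pser w - pser z - usumv d * (w - z))%C with (pser w + RtoC (-1) * pser z + (- (w - z)) * usumv d)%C
      by (rewrite RtoC_m1; ring).
    apply usum_plus; [apply usum_plus|apply usum_scal; auto]; [|apply usum_scal]; apply pser_spec; auto.
Qed.

Lemma pser_disc_cont z : Cmod z <= 1 -> disc_cont pser z.
Proof.
  intros hz. unfold disc_cont. rewrite filterlim_within_C. intros eps he.
  assert (hB0 : 0 <= B) by (eapply bsum_ge0; eauto).
  exists (eps / (B + 1)). split; [apply Rdiv_lt_0_compat; lra|]. intros w hw hwd.
  eapply Rle_lt_trans; [apply pser_lip; auto|].
  apply Rle_lt_trans with ((B + 1) * Cmod (w - z)); [apply Rmult_le_compat_r; [apply Cmod_ge_0|lra]|].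
  apply Rlt_le_trans with ((B + 1) * (eps / (B + 1))); [apply Rmult_lt_compat_l; lra|right; field; lra].
Qed.

Lemma pser_ex_derive z : Cmod z < 1 -> ex_derive (K := C_AbsRing) (V := C_NormedModule) pser z.
Proof.
  intros hz. destruct (pser_derive z) as (D & hD); [lra|].
  assert (hB0 : 0 <= B) by (eapply bsum_ge0; eauto).
  exists D. split; [apply (is_linear_scal_l (K := C_AbsRing) (V := C_NormedModule))|].
  intros x hx. assert (z = x) by (apply (is_filter_lim_locally_unique (K := C_AbsRing) (V := AbsRing_NormedModule C_AbsRing)); auto).
  subst x. intros eps.
  assert (hd : 0 < Rmin (1 - Cmod z) (eps / (2 * B + 1))).
  { apply Rmin_glb_lt; [lra|]. apply Rdiv_lt_0_compat; [apply cond_pos|lra]. }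
  exists (mkposreal _ hd). intros w hw. change (Cmod (w - z) < Rmin (1 - Cmod z) (eps / (2 * B + 1))) in hw.
  assert (hw1 := Rlt_le_trans _ _ _ hw (Rmin_l _ _)). assert (hw2 := Rlt_le_trans _ _ _ hw (Rmin_r _ _)).
  assert (hw3 : Cmod w <= 1).
  { replace w with (z + (w - z))%C by ring. eapply Rle_trans; [apply Cmod_triangle|]. lra. }
  change (Cmod (pser w - pser z - (w - z) * D) <= eps * Cmod (w - z)).
  rewrite (Cmult_comm (w - z)). eapply Rle_trans; [apply hD; auto|].
  replace (2 * B * Cmod (w - z) ^ 2) with ((2 * B * Cmod (w - z)) * Cmod (w - z)) by ring.
  apply Rmult_le_compat_r; [apply Cmod_ge_0|].
  apply Rle_trans with ((2 * B + 1) * (eps / (2 * B + 1))); [|right; field; lra].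
  apply Rmult_le_compat; try lra. apply Cmod_ge_0.
Qed.

End PowerSeries.

Lemma four_nonneg a B g l : bsum (fun n => w2 n * Rabs (a n)) B -> (forall n, (n < 0)%Z -> a n = 0) ->
  four a g -> Cmod l = 1 -> pser (fun n => a (Z.of_nat n)) l = g l.
Proof.
  intros hB h0 hf hl.
  apply (usum_unique (fun n : nat => RtoC (a (Z.of_nat n)) * l ^ n)%C).
  - apply (pser_spec _ B); [|lra].
    apply (bsum_inj Z.of_nat) in hB; [|lia]. revert hB. apply bsum_le.
    intros n. unfold w2. rewrite Zabs2Nat.id. lra.
  - generalize (hf l hl). intros h. apply (usum_inj Z.of_nat) in h; [|lia|].
    + revert h. apply usum_ext. intros n. rewrite Czpow_nat. auto.
    + intros t ht. rewrite h0; [ring|]. destruct (Z_lt_ge_dec t 0); auto.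
      exfalso. apply (ht (Z.to_nat t)). lia.
Qed.

Definition pos0 (n : Z) : Prop := (0 <= n)%Z.
Definition neg0 (n : Z) : Prop := (n <= 0)%Z.
Definition neg1 (n : Z) : Prop := (n <= -1)%Z.

Lemma rep_extends (B : R) (g : loop) : mrep w2 pos0 B g ->
  exists G, extends_to_disc g G /\ forall i j, ent (G (RtoC 0)) i j = RtoC (cf (fun l => ent (g l) i j) 0).
Proof.
  intros hg.
  pose (u := fun (i j : nat) (z : C) => pser (fun n => cf (fun l => ent (g l) i j) (Z.of_nat n)) z).
  assert (hb : forall i j, bsum (fun n : nat => 2 ^ n * Rabs (cf (fun l => ent (g l) i j) (Z.of_nat n))) B).
  { intros i j. destruct (hg i j) as (h & _ & _). unfold wb in h. apply (bsum_inj Z.of_nat) in h; [|lia].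
    revert h. apply bsum_le. intros n. unfold w2. rewrite Zabs2Nat.id. lra. }
  assert (hbd : forall l i j, Cmod l = 1 -> u i j l = ent (g l) i j).
  { intros l i j hl. destruct (hg i j) as (h1 & h2 & h3).
    apply (four_nonneg _ B (fun l => ent (g l) i j)); auto. intros n hn; apply h2. unfold pos0; lia. }
  pose (G := fun z => mk_matrix 2 2 (fun i j => u i j z) : M2 C).
  assert (hG : forall z i j, (i < 2)%nat -> (j < 2)%nat -> ent (G z) i j = u i j z).
  { intros z i j hi hj. apply (ent_mk (K := C_Ring) (fun i j => u i j z)); auto. }
  exists G. split; [split|].
  - intros l hl. apply mx_extC; (etransitivity; [apply hG; lia|apply hbd; auto]).
  - intros z hz i j. change (disc_cont (fun w => ent (G w) i j) z).
    destruct (classic (i < 2 /\ j < 2)%nat) as [[hi hj]|hn].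
    + assert (e : (fun w => ent (G w) i j) = u i j)
        by (apply functional_extensionality; intros w; exact (hG w i j hi hj)).
      rewrite e. exact (pser_disc_cont _ B (hb i j) z hz).
    + assert (e : (fun w => ent (G w) i j) = (fun _ : C => RtoC 0))
        by (apply functional_extensionality; intros w; apply (ent_out (K := C_Ring)); lia).
      rewrite e. apply filterlim_const.
  - intros z hz i j. destruct (classic (i < 2 /\ j < 2)%nat) as [[hi hj]|hn].
    + assert (e : (fun w => ent (G w) i j) = u i j)
        by (apply functional_extensionality; intros w; exact (hG w i j hi hj)).
      exact (eq_ind_r (fun F : C -> C => ex_derive (K := C_AbsRing) (V := C_NormedModule) F z)
        (pser_ex_derive _ B (hb i j) z hz) e).
    + assert (e : (fun w => ent (G w) i j) = (fun _ : C => RtoC 0))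
        by (apply functional_extensionality; intros w; apply (ent_out (K := C_Ring)); lia).
      exact (eq_ind_r (fun F : C -> C => ex_derive (K := C_AbsRing) (V := C_NormedModule) F z)
        (ex_derive_const (K := C_AbsRing) (V := C_NormedModule) (RtoC 0) z) e).
  - intros i j. destruct (classic (i < 2 /\ j < 2)%nat) as [[hi hj]|hn].
    + rewrite (hG (RtoC 0) i j hi hj). exact (pser_0 _ B (hb i j)).
    + rewrite (ent_out (K := C_Ring)) by lia. symmetry.
      replace (cf (fun l => ent (g l) i j) 0) with 0; auto. symmetry.
      apply (four_cf (fun _ => 0) _ 0).
      * intros l _. rewrite (rsum_ext' _ (fun n => 0 * 0)) by (intros; rewrite Rabs_R0; ring).
        rewrite rsum_scal; lra.
      * intros l hl. rewrite (ent_out (K := C_Ring)) by lia.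
        evar_last; [apply (usum_single (fun n => RtoC 0 * Czpow l n)%C 0%Z); intros; ring|].
        simpl. change (0 * 1 = RtoC 0)%C. ring.
Qed.

(* The derivative of [g] along the unit circle at [1]. *)
Definition df (g : C -> C) : R := Re (usumv (fun n => RtoC (IZR n * cf g n))).

Lemma w2_ge_abs n : Rabs (IZR n) <= w2 n.
Proof.
  unfold w2. rewrite <- abs_IZR, <- Zabs2Nat.id_abs, <- INR_IZR_INZ. apply pow2_ge_id.
Qed.

Lemma df_spec S B g : rep w2 S B g -> usum (fun n => RtoC (IZR n * cf g n)) (RtoC (df g)).
Proof.
  intros (h & _ & _). assert (hs : usum (fun n => RtoC (IZR n * cf g n)) (usumv (fun n => RtoC (IZR n * cf g n)))).
  { apply usumv_spec with B. eapply bsum_le; [|apply h]. intros n; simpl. rewrite Cmod_R, Rabs_mult.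
    apply Rmult_le_compat_r; [apply Rabs_pos|]. apply w2_ge_abs. }
  unfold df. rewrite (usum_real _ _ hs); auto.
Qed.

Lemma df_bound S B g : rep w2 S B g -> Rabs (df g) <= B.
Proof.
  intros hg. rewrite <- Cmod_R. eapply usum_bound; [|eapply df_spec; eauto].
  eapply bsum_le; [|apply hg]. intros n; simpl. rewrite Cmod_R, Rabs_mult.
  apply Rmult_le_compat_r; [apply Rabs_pos|]. apply w2_ge_abs.
Qed.

(** For $n=-k$ the power is the conjugate of $m^k$ on the circle, and $(\bar m-1)+(m-1)=-|m-1|^2$
    turns the conjugate of the linear term into the required one up to a quadratic error. *)
Lemma Czpow_diff2 m n : Cmod m = 1 ->
  Cmod (Czpow m n - 1 - RtoC (IZR n) * (m - 1)) <= 4 * w2 n * Cmod (m - 1) ^ 2.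
Proof.
  intros hm.
  assert (key : forall k : nat, Cmod (m ^ k - 1 - RtoC (INR k) * (m - 1)) <= INR k ^ 2 * Cmod (m - 1) ^ 2).
  { intros k. generalize (Cpow_diff2 m 1 k ltac:(lra) ltac:(rewrite Cmod_1; lra)).
    rewrite !Cpow_1_l. intros h. eapply Rle_trans; [|apply h]. right. f_equal. ring. }
  destruct (Z_nat_cases n) as (k & [->| ->]).
  - rewrite Czpow_nat, <- INR_IZR_INZ. unfold w2. rewrite Zabs2Nat.id.
    eapply Rle_trans; [apply key|]. apply Rmult_le_compat_r; [apply pow2_ge_0|].
    generalize (pow2_ge_sq k). assert (0 < 2 ^ k) by (apply pow_lt; lra). lra.
  - rewrite Czpow_neg_nat, opp_IZR, <- INR_IZR_INZ. unfold w2.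
    replace (Z.abs_nat (- Z.of_nat k)) with k by lia.
    assert (hinv : forall z : C, Cmod z = 1 -> (/ z = Cconj z)%C).
    { intros z hz. assert (hz0 := unit_neq0 z hz).
      replace (Cconj z) with (z * Cconj z * / z)%C by (field; auto).
      rewrite <- Cmod2_conj, hz. simpl. replace (1 * (1 * 1)) with 1 by ring. field; auto. }
    rewrite hinv by (rewrite Cmod_pow, hm; apply pow1).
    replace (Cconj (m ^ k) - 1 - RtoC (- INR k) * (m - 1))%C with
      (Cconj (m ^ k - 1 - RtoC (INR k) * (m - 1)) + RtoC (INR k) * ((Cconj m - 1) + (m - 1)))%C.
    2: { rewrite !Cminus_conj, Cmult_conj, Cminus_conj.
         replace (Cconj (RtoC 1)) with (RtoC 1) by (apply injective_projections; simpl; ring).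
         replace (Cconj (RtoC (INR k))) with (RtoC (INR k)) by (apply injective_projections; simpl; ring).
         rewrite RtoC_opp. ring. }
    assert (e : (Cconj m - 1 + (m - 1) = - (m - 1) * Cconj (m - 1))%C).
    { rewrite Cminus_conj. replace (Cconj (RtoC 1)) with (RtoC 1) by (apply injective_projections; simpl; ring).
      rewrite <- (hinv m hm). field. apply unit_neq0; auto. }
    rewrite e. eapply Rle_trans; [apply Cmod_triangle|].
    rewrite Cmod_conj, !Cmod_mult, Cmod_opp, Cmod_conj, Cmod_R, Rabs_right by (apply Rle_ge, pos_INR).
    generalize (key k) (pow2_ge_sq k) (pow2_ge_id k) (pos_INR k) (pow2_ge_0 (Cmod (m - 1))). intros.
    set (d := Cmod (m - 1)) in *.
    replace (INR k * (d * d)) with (INR k * d ^ 2) by ring.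
    apply Rle_trans with ((INR k ^ 2 + INR k) * d ^ 2); [lra|].
    apply Rmult_le_compat_r; auto. lra.
Qed.

Lemma circle_derive_bound S B g m : rep w2 S B g -> Cmod m = 1 ->
  Cmod (g m - g 1 - RtoC (df g) * (m - 1)) <= 4 * B * Cmod (m - 1) ^ 2.
Proof.
  intros hg hm.
  assert (h1 : Cmod (RtoC 1) = 1) by apply Cmod_1.
  assert (z1 : forall n, Czpow 1 n = RtoC 1).
  { intros n. destruct (Z_nat_cases n) as (k & [->| ->]); [rewrite Czpow_nat|rewrite Czpow_neg_nat]; rewrite Cpow_1_l; auto.
    field. }
  apply (usum_bound (fun n => RtoC (cf g n) * Czpow m n + RtoC (-1) * (RtoC (cf g n) * Czpow 1 n)
     + (- (m - 1)) * RtoC (IZR n * cf g n))%C).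
  - replace (4 * B * Cmod (m - 1) ^ 2) with ((4 * Cmod (m - 1) ^ 2) * B) by ring.
    eapply bsum_le; [|apply bsum_scal; [|apply hg]].
    + intros n; simpl. rewrite z1.
      replace (RtoC (cf g n) * Czpow m n + RtoC (-1) * (RtoC (cf g n) * 1) + (- (m - 1)) * RtoC (IZR n * cf g n))%C
        with (RtoC (cf g n) * (Czpow m n - 1 - RtoC (IZR n) * (m - 1)))%C
        by (rewrite RtoC_m1, RtoC_mult; ring).
      rewrite Cmod_mult, Cmod_R. generalize (Czpow_diff2 m n hm) (Rabs_pos (cf g n)). intros.
      apply Rle_trans with (Rabs (cf g n) * (4 * w2 n * Cmod (m - 1) ^ 2)); [apply Rmult_le_compat_l; auto|].
      right; simpl; ring.
    + generalize (pow2_ge_0 (Cmod (m - 1))); lra.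
  - replace (g m - g 1 - RtoC (df g) * (m - 1))%C with (g m + RtoC (-1) * g 1 + (- (m - 1)) * RtoC (df g))%C
      by (rewrite RtoC_m1; ring).
    apply usum_plus; [apply usum_plus|apply usum_scal; eapply df_spec; eauto]; [apply hg; auto|].
    apply usum_scal. apply hg; auto.
Qed.

Lemma rep_circle_derive S B g : mrep w2 S B g ->
  is_circle_derive g 1 (mk_matrix 2 2 (fun i j => RtoC (df (fun l => ent (g l) i j)))).
Proof.
  intros hg i j. destruct (classic (i < 2 /\ j < 2)%nat) as [[hi hj]|hn].
  - rewrite (ent_mk (K := C_Ring) (fun i j => RtoC (df (fun l => ent (g l) i j)))) by auto.
    apply filterlim_within_C. intros eps he.
    assert (hB0 := rep_ge0 _ _ _ _ (hg i j)).
    exists (eps / (4 * B + 1)). split; [apply Rdiv_lt_0_compat; lra|]. intros m (hm & hm1) hmd.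
    assert (hz : (m - 1)%C <> RtoC 0).
    { intros e; apply hm1. replace m with (m - 1 + 1)%C by ring. rewrite e; ring. }
    assert (hp : 0 < Cmod (m - 1)) by (apply Cmod_gt_0; auto).
    assert (hbd := circle_derive_bound _ _ _ m (hg i j) hm). cbv beta in hbd.
    replace ((ent (g m) i j - ent (g 1) i j) / (m - 1) - RtoC (df (fun l => ent (g l) i j)))%C with
      ((ent (g m) i j - ent (g 1) i j - RtoC (df (fun l => ent (g l) i j)) * (m - 1)) / (m - 1))%C
      by (field; auto).
    rewrite Cmod_div by auto.
    apply Rle_lt_trans with (4 * B * Cmod (m - 1)).
    + apply Rmult_le_reg_r with (Cmod (m - 1)); auto. field_simplify; lra.
    + apply Rle_lt_trans with ((4 * B + 1) * Cmod (m - 1)); [apply Rmult_le_compat_r; lra|].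
      apply Rlt_le_trans with ((4 * B + 1) * (eps / (4 * B + 1))); [apply Rmult_lt_compat_l; lra|right; field; lra].
  - rewrite (ent_out (K := C_Ring)) by lia. apply filterlim_within_C. intros eps he.
    exists 1; split; [lra|]. intros m (hm & hm1) _. rewrite !(ent_out (K := C_Ring)) by lia.
    change (Cmod ((0 - 0) / (m - 1) - 0) < eps). unfold Cdiv.
    replace ((0 - 0) * / (m - 1) - 0)%C with (RtoC 0) by ring. rewrite Cmod_0; auto.
Qed.

(** * Birkhoff factorization in the Wiener algebra *)

Lemma rep_weaken S B g : rep w2 S B g -> rep w1 S B g.
Proof.
  intros (h1 & h2 & h3). split; [|split]; auto. eapply bsum_le; [|apply h1].
  intros n; simpl. apply Rmult_le_compat_r; [apply Rabs_pos|]. apply weight_w2.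
Qed.

(** The uniqueness principle behind what is said about Birkhoff factors. The coefficients are
    determined by the loop, whatever weights the two estimates carry. *)
Lemma rep_disjoint w w' S S' B B' g : weight w -> rep w S B g -> rep w' S' B' g ->
  (forall n, S n -> S' n -> False) -> forall l, Cmod l = 1 -> g l = RtoC 0.
Proof.
  intros hw (h1 & h2 & h3) (_ & h2' & _) hd.
  apply (rep_empty w (fun _ => False) B g); [|tauto].
  split; [|split]; auto. intros n _. destruct (classic (S n)); [|auto].
  apply h2'. intros h; eapply hd; eauto.
Qed.

Section MatrixLoops.

Context (w : Z -> R) (hw : weight w).
Implicit Types (g h : loop) (S : Z -> Prop).

Lemma mrep_ge0 S B g : mrep w S B g -> 0 <= B.
Proof. intros h; apply (rep_ge0 w _ _ _ (h O O)). Qed.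

Lemma mrep_ext S B g h : (forall l, Cmod l = 1 -> g l = h l) -> mrep w S B g -> mrep w S B h.
Proof.
  intros e hg i j. apply (rep_ext w hw _ _ (fun l => ent (g l) i j)); auto.
  intros l hl; rewrite e; auto.
Qed.

Lemma mrep_mono S S' B B' g : (forall n, S n -> S' n) -> B <= B' -> mrep w S B g -> mrep w S' B' g.
Proof. intros hS hB h i j. apply (rep_mono w S S' B B'); auto. Qed.

Lemma rep_zero' S B : 0 <= B -> rep w S B (fun _ => RtoC 0).
Proof. intros h. apply (rep_mono w S S 0 B); auto. apply rep_zero; auto. Qed.

Lemma mrep_intro S B g : 0 <= B ->
  (forall i j, (i < 2)%nat -> (j < 2)%nat -> rep w S B (fun l => ent (g l) i j)) -> mrep w S B g.
Proof.
  intros hB h i j. destruct (classic (i < 2 /\ j < 2)%nat) as [[hi hj]|hn]; [auto|].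
  apply (rep_ext w hw _ _ (fun _ => RtoC 0)); [|apply rep_zero'; auto].
  intros l _. rewrite (ent_out (K := C_Ring)) by lia. reflexivity.
Qed.

Lemma mrep_zero S : mrep w S 0 (fun _ => zero).
Proof.
  intros i j. apply (rep_ext w hw _ _ (fun _ => RtoC 0)); [|apply rep_zero; auto].
  intros l _. rewrite entC_zero; auto.
Qed.

Lemma mrep_plus S B B' g h : mrep w S B g -> mrep w S B' h ->
  mrep w S (B + B') (fun l => cadd (g l) (h l)).
Proof.
  intros hg hh i j.
  apply (rep_ext w hw _ _ (fun l => ent (g l) i j + ent (h l) i j)%C).
  - intros l _. rewrite entC_cadd; auto.
  - apply (rep_plus w hw _ _ _ (fun l => ent (g l) i j) (fun l => ent (h l) i j)); auto.
Qed.

Lemma mrep_minus S B B' g h : mrep w S B g -> mrep w S B' h ->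
  mrep w S (B + B') (fun l => csub (g l) (h l)).
Proof.
  intros hg hh i j.
  apply (rep_ext w hw _ _ (fun l => ent (g l) i j - ent (h l) i j)%C).
  - intros l _. rewrite entC_csub; auto.
  - apply (rep_minus w hw _ _ _ (fun l => ent (g l) i j) (fun l => ent (h l) i j)); auto.
Qed.

Lemma mrep_scal S B c g : mrep w S B g -> mrep w S (Rabs c * B) (fun l => mscal (RtoC c) (g l)).
Proof.
  intros hg i j.
  apply (rep_ext w hw _ _ (fun l => RtoC c * ent (g l) i j)%C).
  - intros l _. rewrite entC_mscal; auto.
  - apply (rep_scal w hw _ _ (fun l => ent (g l) i j)); auto.
Qed.

Lemma mrep_mult S S' S'' B B' g h : (forall m n, S m -> S' n -> S'' (m + n)%Z) ->
  mrep w S B g -> mrep w S' B' h -> mrep w S'' (2 * B * B') (fun l => Mmult (g l) (h l)).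
Proof.
  intros hS hg hh i j.
  apply (rep_ext w hw _ _ (fun l => ent (g l) i 0 * ent (h l) 0 j + ent (g l) i 1 * ent (h l) 1 j)%C).
  - intros l _. rewrite entC_mult; auto.
  - replace (2 * B * B') with (B * B' + B * B') by ring.
    apply (rep_plus w hw _ _ _ (fun l => ent (g l) i 0 * ent (h l) 0 j)%C (fun l => ent (g l) i 1 * ent (h l) 1 j)%C).
    + apply (rep_mult w hw S S' S'' B B' (fun l => ent (g l) i 0%nat) (fun l => ent (h l) 0%nat j)); auto.
    + apply (rep_mult w hw S S' S'' B B' (fun l => ent (g l) i 1%nat) (fun l => ent (h l) 1%nat j)); auto.
Qed.

Lemma mrep_inv S B g : mrep w S B g -> mrep w S B (fun l => sl_inv (g l)).
Proof.
  intros hg. apply mrep_intro; [eapply mrep_ge0; eauto|].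
  intros i j hi hj. destruct i as [|[|i]], j as [|[|j]]; try lia.
  - apply (rep_ext w hw _ _ (fun l => ent (g l) 1 1)); auto.
  - apply (rep_ext w hw _ _ (fun l => - ent (g l) 0 1)%C); [auto|]. apply (rep_opp w hw _ _ (fun l => ent (g l) 0 1)); auto.
  - apply (rep_ext w hw _ _ (fun l => - ent (g l) 1 0)%C); [auto|]. apply (rep_opp w hw _ _ (fun l => ent (g l) 1 0)); auto.
  - apply (rep_ext w hw _ _ (fun l => ent (g l) 0 0)); auto.
Qed.

Lemma mrep_sigma S B g : mrep w S B g -> mrep w S B (Defs.sigma g).
Proof.
  intros hg. apply mrep_intro; [eapply mrep_ge0; eauto|].
  assert (hn : forall i j, rep w S B (fun l => ent (g (- l)%C) i j)).
  { intros i j. apply (rep_neg w hw S B (fun l => ent (g l) i j)); auto. }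
  assert (hn' : forall i j, rep w S B (fun l => - ent (g (- l)%C) i j)%C).
  { intros i j. apply (rep_opp w hw S B (fun l => ent (g (- l)%C) i j)); auto. }
  intros i j hi hj. destruct i as [|[|i]], j as [|[|j]]; try lia.
  - apply (rep_ext w hw _ _ (fun l => ent (g (- l)%C) 0 0)); auto. intros l _. unfold Defs.sigma, e2. entC.
    entR. rewrite ?RtoC_m1. Cring.
  - apply (rep_ext w hw _ _ (fun l => - ent (g (- l)%C) 0 1)%C); auto. intros l _. unfold Defs.sigma, e2. entC.
    entR. rewrite ?RtoC_m1. Cring.
  - apply (rep_ext w hw _ _ (fun l => - ent (g (- l)%C) 1 0)%C); auto. intros l _. unfold Defs.sigma, e2. entC.
    entR. rewrite ?RtoC_m1. Cring.
  - apply (rep_ext w hw _ _ (fun l => ent (g (- l)%C) 1 1)); auto. intros l _. unfold Defs.sigma, e2. entC.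
    entR. rewrite ?RtoC_m1. Cring.
Qed.

Lemma rep_real S B c : S 0%Z -> Rabs c * w 0%Z <= B -> rep w S B (fun _ => RtoC c).
Proof.
  intros h0 hB. apply (rep_mono w S S (Rabs c * w 0%Z)); auto.
  apply (rep_ext w hw _ _ (fun l => RtoC c * Czpow l 0)%C); [intros l _; simpl; ring|].
  apply (rep_scal w hw). apply rep_monomial; auto.
Qed.

Lemma mrep_real S (A : M2 R) : S 0%Z -> exists B, mrep w S B (fun _ => cplx A).
Proof.
  intros h0.
  pose (B := (Rabs (ent A 0 0) + Rabs (ent A 0 1) + Rabs (ent A 1 0) + Rabs (ent A 1 1)) * w 0%Z).
  assert (hp := w_ge0 w hw 0).
  generalize (Rabs_pos (ent A 0 0)) (Rabs_pos (ent A 0 1)) (Rabs_pos (ent A 1 0)) (Rabs_pos (ent A 1 1)). intros.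
  exists B. apply mrep_intro.
  - unfold B. apply Rmult_le_pos; lra.
  - intros i j hi hj. apply (rep_ext w hw _ _ (fun _ => RtoC (ent A i j))).
    + intros l _. rewrite ent_cplx; auto.
    + apply rep_real; auto. unfold B. apply Rmult_le_compat_r; auto.
      destruct i as [|[|i]], j as [|[|j]]; try lia; lra.
Qed.

Lemma mrep_conj S B g l : mrep w S B g -> Cmod l = 1 -> rho g l = g l.
Proof.
  intros hg hl. apply mx_extC; unfold rho; (etransitivity; [apply (ent_mk (K := C_Ring)); lia|]);
  apply (rep_conj w S B (fun l => ent (g l) _ _) l (hg _ _) hl).
Qed.

Lemma mrep_sum {T : Type} S (b : T -> R) B (F : T -> loop) :
  (forall t, mrep w S (b t) (F t)) -> bsum b B ->
  exists g, mrep w S B g /\ forall l i j, Cmod l = 1 -> usum (fun t => ent (F t l) i j) (ent (g l) i j).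
Proof.
  intros hF hB.
  assert (h : forall i j, exists g : C -> C, rep w S B g /\ forall l, Cmod l = 1 -> usum (fun t => ent (F t l) i j) (g l)).
  { intros i j. apply (rep_sum w hw S b B (fun t l => ent (F t l) i j)); auto. intros t; apply hF. }
  destruct (h 0%nat 0%nat) as (g00 & r00 & u00). destruct (h 0%nat 1%nat) as (g01 & r01 & u01).
  destruct (h 1%nat 0%nat) as (g10 & r10 & u10). destruct (h 1%nat 1%nat) as (g11 & r11 & u11).
  exists (fun l => mx2 (K := C_Ring) (g00 l) (g01 l) (g10 l) (g11 l)). split.
  - apply mrep_intro; [eapply rep_ge0; eauto|].
    intros i j hi hj. destruct i as [|[|i]], j as [|[|j]]; try lia; [apply r00|apply r01|apply r10|apply r11].
  - intros l i j hl. destruct (classic (i < 2 /\ j < 2)%nat) as [[hi hj]|hn].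
    + destruct i as [|[|i]], j as [|[|j]]; try lia; [apply u00|apply u01|apply u10|apply u11]; auto.
    + rewrite (ent_out (K := C_Ring)) by lia. intros eps he. exists nil. intros l' _ _.
      replace (lsum (fun t => ent (F t l) i j) l') with (RtoC 0).
      * change (Cmod (0 - 0) <= eps). replace (0 - 0)%C with (RtoC 0) by ring. rewrite Cmod_0; lra.
      * induction l'; simpl; auto. rewrite <- IHl', (ent_out (K := C_Ring)) by lia.
        change (RtoC 0 = 0 + 0)%C. ring.
Qed.

End MatrixLoops.

(** The negative-frequency part, obtained by choice from [rep_split]; [mproj_spec] collects its
    properties. *)
Definition proj (g : C -> C) : C -> C :=
  proj1_sig (constructive_indefinite_description _ (rep_split w2 weight_w2 g neg1)).

Definition mproj (g : loop) : loop := fun l =>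
  mx2 (K := C_Ring) (proj (fun l => ent (g l) 0 0) l) (proj (fun l => ent (g l) 0 1) l)
    (proj (fun l => ent (g l) 1 0) l) (proj (fun l => ent (g l) 1 1) l).

Lemma mproj_spec B g : mrep w2 allz B g ->
  mrep w2 neg1 B (mproj g) /\ mrep w2 pos0 B (fun l => csub (g l) (mproj g l)).
Proof.
  intros hg. assert (hB := mrep_ge0 _ _ _ _ hg).
  assert (h : forall i j, rep w2 neg1 B (proj (fun l => ent (g l) i j)) /\
     rep w2 pos0 B (fun l => ent (g l) i j - proj (fun l => ent (g l) i j) l)%C).
  { intros i j. unfold proj. destruct constructive_indefinite_description as (u & hu); simpl.
    destruct (hu _ _ (hg i j)) as (h1 & h2). split.
    - revert h1; apply rep_mono; [tauto|lra].
    - revert h2; apply rep_mono; [|lra]. unfold pos0, neg1; intros; lia. }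
  assert (e : forall i j l, (i < 2)%nat -> (j < 2)%nat -> ent (mproj g l) i j = proj (fun l => ent (g l) i j) l).
  { intros i j l hi hj. unfold mproj. destruct i as [|[|i]], j as [|[|j]]; try lia; entC; reflexivity. }
  split; (apply mrep_intro; [apply weight_w2|auto|]); intros i j hi hj.
  - apply (rep_ext w2 weight_w2 _ _ (proj (fun l => ent (g l) i j))); [|apply (proj1 (h i j))].
    intros l _. rewrite e; auto.
  - apply (rep_ext w2 weight_w2 _ _ (fun l => ent (g l) i j - proj (fun l => ent (g l) i j) l)%C); [|apply (proj2 (h i j))].
    intros l _. rewrite entC_csub, e; auto.
Qed.

Lemma usum_shift (f : nat -> C) s : usum f s -> usum (fun n => f (S n)) (s - f O)%C.
Proof.
  intros h.
  assert (h1 : usum (fun n => if Nat.eq_dec n 0 then f O else RtoC 0) (f O)).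
  { evar_last; [apply (usum_single (fun n => if Nat.eq_dec n 0 then f O else RtoC 0) O)|reflexivity].
    intros [|n] hn; [lia|reflexivity]. }
  assert (h2 := usum_plus _ _ _ _ h (usum_scal (RtoC (-1)) _ _ h1)).
  apply (usum_inj S) in h2; [|lia|].
  - replace (s - f O)%C with (s + RtoC (-1) * f O)%C by (rewrite RtoC_m1; ring).
    revert h2. apply usum_ext. intros n. simpl. ring.
  - intros [|n] hn; [simpl; rewrite RtoC_m1; ring|]. exfalso; apply (hn n); auto.
Qed.

(* The Neumann series of [p + P(p W) = - P(W)], [P] the projection to the
   negative frequencies. *)
Lemma birkhoff_near_id W om : om <= 1 / 8 -> mrep w2 allz om W ->
  exists p B, mrep w2 neg1 (2 * om) p /\
    mrep w2 pos0 B (fun l => cadd (p l) (cadd (Mmult (p l) (W l)) (W l))).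
Proof.
  intros hom hW. assert (h0 := mrep_ge0 _ _ _ _ hW).
  pose (neg := fun g : loop => (fun l => mscal (RtoC (-1)) (g l)) : loop).
  pose (p := fix p (m : nat) : loop := match m with O => neg (mproj W)
     | S m => neg (mproj (fun l => Mmult (p m l) (W l))) end).
  assert (hneg : forall S B g, mrep w2 S B g -> mrep w2 S B (neg g)).
  { intros S B g hg. replace B with (Rabs (-1) * B) by (rewrite Rabs_m1; ring).
    apply mrep_scal; auto. apply weight_w2. }
  (* One step multiplies the bound by at most [2 * om], the $2$ being that of the matrix product;
     this is at most $1/4$ for [om] up to $1/8$. *)
  pose (b := fun m : nat => om * (/ 4) ^ m).
  assert (hb0 : forall m, 0 <= b m).
  { intros m; apply Rmult_le_pos; auto. apply pow_le; lra. }
  assert (hp : forall m, mrep w2 neg1 (b m) (p m)).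
  { assert (hall : forall B g, mrep w2 neg1 B g -> mrep w2 allz B g).
    { intros B g. apply mrep_mono; [unfold allz; auto|lra]. }
    induction m.
    - unfold b; simpl. rewrite Rmult_1_r.
      exact (hneg _ _ _ (proj1 (mproj_spec _ _ hW))).
    - change (p (S m)) with (neg (mproj (fun l => Mmult (p m l) (W l)))).
      refine (hneg _ _ _ (proj1 (mproj_spec _ _ _))).
      apply (mrep_mono w2 allz allz (2 * b m * om)); auto.
      + unfold b. simpl. assert (0 < (/ 4) ^ m) by (apply pow_lt; lra).
        assert (0 <= om * (/ 4) ^ m) by (apply Rmult_le_pos; lra).
        apply Rle_trans with (2 * (om * (/ 4) ^ m) * (1 / 8)); [apply Rmult_le_compat_l; lra|lra].
      + apply (mrep_mult w2 weight_w2 allz allz); unfold allz; auto. }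
  assert (hpW : forall m, mrep w2 allz (b m) (fun l => Mmult (p m l) (W l))).
  { intros m. apply (mrep_mono w2 allz allz (2 * b m * om)); auto; [specialize (hb0 m); nra|].
    apply (mrep_mult w2 weight_w2 neg1 allz); unfold allz; auto. }
  assert (hsum : bsum b (4 / 3 * om)).
  { evar_last; [apply (telescope_bsum b (fun n => (/ 4) ^ n) (4 / 3 * om))|simpl; ring]; auto; try lra.
    - intros n; apply pow_le; lra.
    - intros n; unfold b; simpl. right; field. }
  destruct (mrep_sum w2 weight_w2 neg1 b (4 / 3 * om) p hp hsum) as (q & hq & uq).
  (* [V m] is the nonnegative part of $p_mW$, that is $p_mW+p_{m+1}$. Summing over $m$ gives
     $r=qW+q+P(W)$, which is [key]. *)
  pose (V := fun m => (fun l => csub (Mmult (p m l) (W l)) (mproj (fun l => Mmult (p m l) (W l)) l)) : loop).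
  destruct (mrep_sum w2 weight_w2 pos0 b (4 / 3 * om) V) as (r & hr & ur); auto.
  { intros m. exact (proj2 (mproj_spec _ _ (hpW m))). }
  exists q, (om + 4 / 3 * om). split.
  - revert hq. apply mrep_mono; [auto|lra].
  - apply (mrep_ext w2 weight_w2 _ _ (fun l => cadd (csub (W l) (mproj W l)) (r l))).
    + intros l hl.
      assert (key : forall i j, ent (r l) i j = (ent (q l) i j + ent (mproj W l) i j + ent (Mmult (q l) (W l)) i j)%C).
      { intros i j. apply (usum_unique _ _ _ (ur l i j hl)).
        assert (k1 := usum_shift _ _ (uq l i j hl)).
        assert (k2 := usum_plus _ _ _ _
           (usum_scal (ent (W l) 0 j) _ _ (uq l i 0%nat hl)) (usum_scal (ent (W l) 1 j) _ _ (uq l i 1%nat hl))).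
        assert (k3 := usum_plus _ _ _ _ k1 k2).
        replace (ent (q l) i j + ent (mproj W l) i j + ent (Mmult (q l) (W l)) i j)%C with
          (ent (q l) i j - ent (p O l) i j + (ent (W l) 0 j * ent (q l) i 0 + ent (W l) 1 j * ent (q l) i 1))%C.
        - revert k3. apply usum_ext. intros m. unfold V.
          change (p (S m) l) with (mscal (RtoC (-1)) (mproj (fun l => Mmult (p m l) (W l)) l)).
          entC. rewrite RtoC_m1. Cring.
        - change (p O l) with (mscal (RtoC (-1)) (mproj W l)). entC. rewrite RtoC_m1. Cring. }
      apply mx_extC; entC; rewrite key; entC; Cring.
    + apply (mrep_plus w2 weight_w2); auto. exact (proj2 (mproj_spec _ _ hW)).
Qed.

(** From $\ln x\le x-1$ at $x=e(1+|n|)$, with [e] so small that $2se\le\ln2$. *)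
Lemma Rpower_le_w2 s : 0 <= s -> exists K, 0 < K /\ forall n, Rpower (1 + IZR n ^ 2) s <= K * w2 n.
Proof.
  intros hs. pose (e := ln 2 / (2 * s + 1)).
  assert (hl2 : 0 < ln 2) by (rewrite <- ln_1; apply ln_increasing; lra).
  assert (he : 0 < e) by (unfold e; apply Rdiv_lt_0_compat; lra).
  assert (hes : 2 * s * e <= ln 2).
  { unfold e. apply Rmult_le_reg_r with (2 * s + 1); [lra|]. field_simplify; [|lra]. nra. }
  exists (exp (2 * s * (e - 1 - ln e))). split; [apply exp_pos|]. intros n.
  set (N := Z.abs_nat n). assert (hN : IZR n ^ 2 = INR N ^ 2).
  { unfold N. rewrite INR_IZR_INZ, Zabs2Nat.id_abs, abs_IZR. rewrite <- !Rsqr_pow2, <- Rsqr_abs. auto. }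
  assert (hN0 := pos_INR N).
  rewrite hN. unfold w2. fold N.
  apply Rle_trans with (Rpower ((1 + INR N) ^ 2) s).
  { apply Rle_Rpower_l; auto. nra. }
  replace ((1 + INR N) ^ 2) with (Rpower (1 + INR N) 2).
  2: { replace 2 with (INR 2) by (simpl; ring). rewrite Rpower_pow by lra. simpl; ring. }
  rewrite Rpower_mult. unfold Rpower.
  assert (hln : ln (1 + INR N) <= e * (1 + INR N) - 1 - ln e).
  { assert (hx : 0 < e * (1 + INR N)) by (apply Rmult_lt_0_compat; lra).
    generalize (exp_ineq1_le (ln (e * (1 + INR N)))). rewrite exp_ln, ln_mult by lra. lra. }
  apply Rle_trans with (exp (2 * s * (e - 1 - ln e) + INR N * ln 2)).
  - apply exp_le_compat. apply Rle_trans with (2 * s * (e * (1 + INR N) - 1 - ln e)).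
    + apply Rmult_le_compat_l; lra.
    + nra.
  - rewrite exp_plus. apply Rmult_le_compat_l; [left; apply exp_pos|].
    change (exp (INR N * ln 2)) with (Rpower 2 (INR N)). rewrite Rpower_pow by lra. lra.
Qed.

(** Each coefficient is at most [B] in absolute value, so its square is at most [B] times that
    value, and the squared Sobolev sum is dominated by the [w2] sum. *)
Lemma mrep_in_Hs s S B g : 0 <= s -> mrep w2 S B g -> in_Hs s g.
Proof.
  intros hs hg.
  pose (a := fun n => cplx (mk_matrix 2 2 (fun i j => cf (fun l => ent (g l) i j) n))).
  assert (ha : forall n i j, (i < 2)%nat -> (j < 2)%nat -> ent (a n) i j = RtoC (cf (fun l => ent (g l) i j) n)).
  { intros n i j hi hj. unfold a. rewrite ent_cplx. f_equal.
    apply (ent_mk (K := R_Ring) (fun i j => cf (fun l => ent (g l) i j) n)); auto. }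
  exists a. split.
  - intros l hl i j. destruct (classic (i < 2 /\ j < 2)%nat) as [[hi hj]|hn].
    + apply is_zseries_usum with B.
      * rewrite (functional_extensionality _ (fun n => Cmod (RtoC (cf (fun l => ent (g l) i j) n) * Czpow l n)%C)).
        -- apply bsum_coef; auto. apply (rep_bsum w2 weight_w2 _ _ _ (hg i j)).
        -- intros n. rewrite ha; auto.
      * generalize (proj2 (proj2 (hg i j)) l hl). apply usum_ext. intros n. rewrite ha; auto.
    + rewrite (ent_out (K := C_Ring)) by lia.
      apply is_zseries_usum with 0.
      * intros l' _. rewrite (rsum_ext' _ (fun n => 0 * 0)); [rewrite rsum_scal; lra|].
        intros n. rewrite (ent_out (K := C_Ring)) by lia. change (Cmod (0 * Czpow l n) = 0 * 0).
        rewrite Cmod_mult, Cmod_0. ring.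
      * intros eps he. exists nil. intros l' _ _.
        rewrite (lsum_ext _ (fun _ => RtoC 0 * RtoC 0)%C); [rewrite lsum_scal|].
        -- change (Cmod (0 * lsum (fun _ : Z => RtoC 0) l' - 0) <= eps).
           replace (0 * lsum (fun _ : Z => RtoC 0) l' - 0)%C with (RtoC 0) by ring. rewrite Cmod_0; lra.
        -- intros n _. rewrite (ent_out (K := C_Ring)) by lia. change ((0 * Czpow l n)%C = (0 * 0)%C). ring.
  - destruct (Rpower_le_w2 s hs) as (K & hK & hKw).
    assert (hB := mrep_ge0 _ _ _ _ hg).
    assert (hone : forall i j, bsum (fun n => Rpower (1 + IZR n ^ 2) s * Rabs (cf (fun l => ent (g l) i j) n) ^ 2) (K * B * B)).
    { intros i j. eapply bsum_le; [|apply (bsum_scal (fun n => w2 n * Rabs (cf (fun l => ent (g l) i j) n)) B (K * B))].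
      - intros n; simpl. assert (h1 := rep_cf1 w2 weight_w2 _ _ _ n (hg i j)). cbv beta in h1.
        set (c := Rabs (cf (fun l => ent (g l) i j) n)) in *. assert (hc : 0 <= c) by apply Rabs_pos.
        assert (hw : 0 <= w2 n) by (apply w_ge0, weight_w2).
        apply Rle_trans with (K * w2 n * (c * (c * 1))); [apply Rmult_le_compat_r; [nra|apply hKw]|].
        apply Rle_trans with (K * w2 n * (B * c)); [|right; ring].
        apply Rmult_le_compat_l; [apply Rmult_le_pos; lra|nra].
      - apply Rmult_le_pos; lra.
      - apply hg. }
    assert (hq := bsum_plus _ _ _ _ (bsum_plus _ _ _ _ (hone 0%nat 0%nat) (hone 0%nat 1%nat))
       (bsum_plus _ _ _ _ (hone 1%nat 0%nat) (hone 1%nat 1%nat))).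
    destruct (bsum_zseries (fun n => Rpower (1 + IZR n ^ 2) s * frob2 (a n)) (K * B * B + K * B * B + (K * B * B + K * B * B)))
      as (q & hq').
    + intros n. apply Rmult_le_pos; [left; apply exp_pos|apply frob2_ge0].
    + eapply bsum_le; [|apply hq]. intros n; cbv beta. unfold frob2. rewrite !ha by lia.
      rewrite !Cmod_R. right; ring.
    + exists q. exact hq'.
Qed.

Lemma mrep_in_G s S B g : 0 <= s -> mrep w2 S B g -> (forall l, Cmod l = 1 -> mdet (g l) = RtoC 1) ->
  (forall l, Cmod l = 1 -> Defs.sigma g l = g l) -> in_G s g.
Proof.
  intros hs hg hd hsig. split; auto.
  - eapply mrep_in_Hs; eauto.
  - intros l hl. eapply mrep_conj; eauto.
Qed.

(** The substitution $\lambda\mapsto1/\lambda$ reverses the coefficients; it brings the exterior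
    disc within reach of [extends_coef] and [rep_extends]. *)
Lemma rep_inv_var w S B g : weight w -> (forall n, w (- n)%Z = w n) -> rep w S B g ->
  rep w (fun n => S (- n)%Z) B (fun l => g (/ l)%C) /\ forall n, cf (fun l => g (/ l)%C) n = cf g (- n)%Z.
Proof.
  intros hw hsym (h1 & h2 & h3).
  assert (hf : four (fun n => cf g (- n)%Z) (fun l => g (/ l)%C)).
  { intros l hl. assert (hl0 := unit_neq0 l hl).
    assert (hl' : Cmod (/ l)%C = 1) by (rewrite Cmod_inv, hl; auto; field).
    assert (hz : (/ l)%C <> RtoC 0) by (apply unit_neq0; auto).
    generalize (usum_reindex Z.opp Z.opp _ _ Z.opp_involutive Z.opp_involutive (h3 _ hl')).
    apply usum_ext. intros n. f_equal.
    destruct (Z_nat_cases n) as (k & [->| ->]); rewrite ?Z.opp_involutive, ?Czpow_nat, ?Czpow_neg_nat.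
    - rewrite Cpow_inv by auto. field. apply Cpow_nz; auto.
    - apply Cpow_inv; auto. }
  assert (hb : wb w (fun n => cf g (- n)%Z) B).
  { unfold wb. generalize (bsum_inj Z.opp _ _ ltac:(lia) h1). apply bsum_le. intros n. rewrite hsym. lra. }
  split.
  - apply (rep_intro w hw _ _ _ (fun n => cf g (- n)%Z)); auto.
  - apply (four_cf (fun n => cf g (- n)%Z) _ B); auto. apply (wb_1 w); auto. apply hw.
Qed.

Lemma w2_opp n : w2 (- n) = w2 n.
Proof. unfold w2. f_equal. lia. Qed.

Lemma in_Gplus_rep s g : s > 1 / 2 -> in_Gplus s g -> exists B, mrep w1 pos0 B g.
Proof.
  intros hs (hG & g' & hext). destruct (in_G_rep s g hs hG) as (B & hB). exists B.
  intros i j. destruct (hB i j) as (h1 & h2 & h3). split; [|split]; auto.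
  intros n hn. unfold pos0 in hn.
  assert (e := extends_coef g g' i j (Z.to_nat (- n)) hext).
  replace (- Z.of_nat (Z.to_nat (- n)))%Z with n in e by lia. rewrite e.
  destruct Nat.eq_dec; [lia|auto].
Qed.

Lemma cf_const c n : cf (fun _ => RtoC c) n = if Z.eq_dec n 0 then c else 0.
Proof.
  assert (h : rep w1 (fun n => n = 0%Z) (Rabs c) (fun _ => RtoC c)).
  { apply rep_real; [apply weight_w1|auto|unfold w1; lra]. }
  destruct Z.eq_dec as [->|hn]; [|apply h; auto].
  symmetry. apply RtoC_inj. apply (rep_const w1 (fun n => n = 0%Z) (Rabs c) (fun _ => RtoC c) h (fun _ h => h) 1).
  apply Cmod_1.
Qed.

(** The extension is taken in the coordinate $1/\lambda$, so its value at $0$, the identity, is the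
    coefficient of index $0$; subtracting it makes the support strictly negative. *)
Lemma in_Gminus_star_rep s g : s > 1 / 2 -> in_Gminus_star s g ->
  exists B, mrep w1 neg0 B g /\ mrep w1 neg1 B (fun l => csub (g l) Mone).
Proof.
  intros hs (hG & g' & hext & h0). destruct (in_G_rep s g hs hG) as (B & hB).
  assert (hneg : mrep w1 neg0 B g).
  { intros i j. destruct (hB i j) as (h1 & h2 & h3). split; [|split]; auto.
    intros n hn. unfold neg0 in hn.
    destruct (rep_inv_var w1 _ _ _ weight_w1 (fun _ => eq_refl) (hB i j)) as (_ & e0).
    assert (e := extends_coef _ g' i j (Z.to_nat n) hext).
    rewrite e0 in e.
    replace (- - Z.of_nat (Z.to_nat n))%Z with n in e by lia. rewrite e.
    destruct Nat.eq_dec; [lia|auto]. }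
  assert (hc : forall i j, cf (fun l => ent (g l) i j) 0 = Re (ent (Mone : M2 C) i j)).
  { intros i j.
    destruct (rep_inv_var w1 _ _ _ weight_w1 (fun _ => eq_refl) (hB i j)) as (_ & e0).
    assert (e := extends_coef _ g' i j 0 hext). rewrite e0 in e. simpl in e. rewrite e, h0; auto. }
  destruct (mrep_real w1 weight_w1 neg0 Mone) as (B1 & hB1); [unfold neg0; lia|].
  assert (hone : cplx Mone = Mone) by (apply mx_extC; entC; entR; auto).
  assert (hd : mrep w1 neg0 (B + B1) (fun l => csub (g l) Mone)).
  { rewrite <- hone. apply mrep_minus; auto. apply weight_w1. }
  exists (B + B1). split; [revert hneg; apply mrep_mono; auto; generalize (mrep_ge0 _ _ _ _ hB1); lra|].
  intros i j. destruct (hd i j) as (h1 & h2 & h3). split; [|split]; auto.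
  intros n hn. destruct (Z.eq_dec n 0) as [->|hn0]; [|apply h2; unfold neg0, neg1 in *; lia].
  set (c := Re (ent (Mone : M2 C) i j)) in *.
  assert (e : cf (fun l => ent (csub (g l) Mone) i j) = cf (fun l => ent (g l) i j + RtoC (- c))%C).
  { apply cf_ext. intros l _. rewrite entC_csub. unfold c.
    rewrite RtoC_opp.
    assert (hM : ent (Mone : M2 C) i j = RtoC (Re (ent (Mone : M2 C) i j))).
    { destruct (classic (i < 2 /\ j < 2)%nat) as [[hi hj]|hno].
      - destruct i as [|[|i]], j as [|[|j]]; try lia; reflexivity.
      - rewrite !(ent_out (K := C_Ring)) by lia. reflexivity. }
    rewrite hM at 1. reflexivity. }
  rewrite e.
  rewrite (cf_plus w1 weight_w1 neg0 neg0 B (Rabs (- c) * 1) (fun l => ent (g l) i j) (fun l => RtoC (- c))).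
  - rewrite hc, cf_const. destruct Z.eq_dec; [unfold c; ring|lia].
  - apply hneg.
  - apply rep_real; [apply weight_w1|unfold neg0; lia|unfold w1; lra].
Qed.

(** The factor [u] carries no decay, yet the part of the product with frequencies in [D] keeps the
    weight of [phi]: a frequency in [D] that is reached by adding an element of [S] weighs no more
    than the frequency it came from. *)
Lemma rep_regular u phi S D B B' : rep w1 S B u -> rep w2 allz B' phi ->
  (forall k m, S k -> D (k + m)%Z -> w2 (k + m) <= w2 m) ->
  exists v, rep w2 D (B * B') v /\ rep w1 (fun n => ~ D n) (B * B') (fun l => u l * phi l - v l)%C.
Proof.
  intros hu hphi hD.
  assert (hphi1 := rep_weaken _ _ _ hphi).
  assert (hprod : rep w1 allz (B * B') (fun l => u l * phi l)%C).
  { apply (rep_mult w1 weight_w1 S allz); unfold allz; auto. }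
  destruct (rep_split w1 weight_w1 (fun l => u l * phi l)%C D) as (v & hv).
  destruct (hv _ _ hprod) as (v1 & v2). exists v. split.
  - destruct (conv (cf u) (cf phi) u phi B B') as (c & c1 & _ & c3).
    + apply (rep_bsum w1 weight_w1 _ _ _ hu).
    + apply (rep_bsum w1 weight_w1 _ _ _ hphi1).
    + apply hu.
    + apply hphi.
    + assert (p1 : forall n, 0 <= w1 n) by (intros; apply w_ge0, weight_w1).
      assert (p2 : forall n, 0 <= w2 n) by (intros; apply w_ge0, weight_w2).
      (* The output weight is cut off to zero outside [D], so that [conv] estimates the projected
         part only. *)
      assert (hc := c3 w1 w2 (fun n => if excluded_middle_informative (D n) then w2 n else 0) B B' p1 p2).
      assert (ec : forall n, cf (fun l => u l * phi l)%C n = c n).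
      { apply (four_cf c _ (B * B')); auto.
        assert (h := c3 w1 w1 w1 B B' p1 p1 p1).
        apply (wb_1 w1); [unfold w1; intros; lra|]. apply h; [|apply hu|apply hphi1].
        intros k m _. unfold w1; lra. }
      destruct v1 as (q1 & q2 & q3).
      split; [|split].
      * eapply bsum_le; [|apply hc].
        -- intros n. cbv beta. destruct excluded_middle_informative as [hn|hn].
           ++ rewrite <- ec. replace (cf (fun l => u l * phi l)%C n) with (cf v n); [lra|].
              assert (e : cf (fun l => u l * phi l)%C = cf (fun l => v l + (u l * phi l - v l))%C).
              { apply cf_ext. intros l _. ring. }
              rewrite e, (cf_plus w1 weight_w1 _ _ _ _ _ _ n (conj q1 (conj q2 q3)) v2).
              rewrite (proj1 (proj2 v2) n) by tauto. ring.
           ++ rewrite q2 by tauto. rewrite Rabs_R0; lra.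
        -- intros n. destruct excluded_middle_informative; auto; lra.
        -- intros k m hk. destruct excluded_middle_informative as [hn|hn].
           ++ unfold w1. rewrite Rmult_1_l. apply hD; auto.
              apply NNPP; intros hk'. apply hk. apply hu; auto.
           ++ unfold w1. rewrite Rmult_1_l. auto.
        -- apply hu.
        -- apply hphi.
      * intros n hn. apply q2. tauto.
      * auto.
  - revert v2. apply rep_mono; [tauto|lra].
Qed.

(** The sum is supported in [D], so the parts of the two products outside [D] must cancel; the rest
    is controlled by [rep_regular]. An entry of a matrix product is a sum of two such products. *)
Lemma rep_regular_sum u phi u' phi' S D B B' B'' : rep w1 S B u -> rep w2 allz B' phi ->
  rep w1 S B u' -> rep w2 allz B' phi' ->
  (forall k m, S k -> D (k + m)%Z -> w2 (k + m) <= w2 m) ->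
  rep w1 D B'' (fun l => u l * phi l + u' l * phi' l)%C ->
  rep w2 D (2 * B * B') (fun l => u l * phi l + u' l * phi' l)%C.
Proof.
  intros h1 h2 h1' h2' hD hs.
  destruct (rep_regular u phi S D B B' h1 h2 hD) as (v & v1 & v2).
  destruct (rep_regular u' phi' S D B B' h1' h2' hD) as (v' & v1' & v2').
  assert (hv := rep_plus w2 weight_w2 _ _ _ _ _ v1 v1').
  apply (rep_ext w2 weight_w2 _ _ (fun l => v l + v' l)%C).
  - intros l hl.
    assert (e : ((u l * phi l + u' l * phi' l) - (v l + v' l))%C = RtoC 0).
    { apply (rep_disjoint w1 w1 D (fun n => ~ D n) (B'' + (B * B' + B * B')) (B * B' + B * B')
       (fun l => (u l * phi l + u' l * phi' l) - (v l + v' l))%C weight_w1); auto.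
      - apply (rep_minus w1 weight_w1 _ _ _ (fun l => u l * phi l + u' l * phi' l)%C (fun l => v l + v' l)%C); auto.
        apply rep_weaken. auto.
      - apply (rep_ext w1 weight_w1 _ _ (fun l => (u l * phi l - v l) + (u' l * phi' l - v' l))%C); [intros; ring|].
        apply (rep_plus w1 weight_w1 _ _ _ _ _ v2 v2'). }
    replace (u l * phi l + u' l * phi' l)%C with ((u l * phi l + u' l * phi' l) - (v l + v' l) + (v l + v' l))%C by ring.
    rewrite e. ring.
  - replace (2 * B * B') with (B * B' + B * B') by ring. auto.
Qed.

(** The factorization in $\mathcal{G}^-_*\cdot\mathcal{G}^+$ translated into Fourier supports, with
    both factors raised to the weight [w2]; [bk_1] is the normalization at infinity. *)
Record birk (Phi gm gp : loop) : Prop := {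
  bk_eq : forall l, Cmod l = 1 -> Phi l = Mmult (gm l) (gp l);
  bk_m : exists B, mrep w2 neg0 B gm;
  bk_1 : exists B, mrep w2 neg1 B (fun l => csub (gm l) Mone);
  bk_p : exists B, mrep w2 pos0 B gp;
  bk_detm : forall l, Cmod l = 1 -> mdet (gm l) = RtoC 1;
  bk_detp : forall l, Cmod l = 1 -> mdet (gp l) = RtoC 1 }.

Lemma sl_inv_l (A : M2 C) : mdet A = RtoC 1 -> Mmult (sl_inv A) A = Mone.
Proof.
  intros h. rewrite mdetC in h. apply mx_extC; entC; rewrite <- ?h; Cring.
Qed.

Lemma sl_inv_r (A : M2 C) : mdet A = RtoC 1 -> Mmult A (sl_inv A) = Mone.
Proof.
  intros h. rewrite mdetC in h. apply mx_extC; entC; rewrite <- ?h; Cring.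
Qed.

Lemma Mmult_assocC (A B D : M2 C) : Mmult (Mmult A B) D = Mmult A (Mmult B D).
Proof. mxC. Qed.

Lemma Mmult_1l (A : M2 C) : Mmult Mone A = A.
Proof. mxC. Qed.

Lemma Mmult_1r (A : M2 C) : Mmult A Mone = A.
Proof. mxC. Qed.

Lemma mdet_mult (A B : M2 C) : mdet (Mmult A B) = (mdet A * mdet B)%C.
Proof. rewrite !mdetC. entC. Cring. Qed.

Lemma mdet_inv (A : M2 C) : mdet (sl_inv A) = mdet A.
Proof. rewrite !mdetC. entC. Cring. Qed.

Lemma sl_inv_mult (A B : M2 C) : sl_inv (Mmult A B) = Mmult (sl_inv B) (sl_inv A).
Proof. mxC. Qed.

Lemma sl_inv_invol (A : M2 C) : sl_inv (sl_inv A) = A.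
Proof. mxC. Qed.

(** In $g_-=\Phi g_+^{-1}$ a frequency $n\le0$ arises from $k\ge0$ in $g_+^{-1}$ and $m=n-k$ in
    $\Phi$, with $|n|\le|m|$, so [rep_regular_sum] hands the weight of $\Phi$ on to $g_-$. For
    $g_+=g_-^{-1}\Phi$ the argument is symmetric. *)
Lemma birk_of_G s Phi gm gp B : s > 1 / 2 -> in_Gminus_star s gm -> in_Gplus s gp ->
  loop_eq Phi (loop_mul gm gp) -> mrep w2 allz B Phi -> birk Phi gm gp.
Proof.
  intros hs hm hp he hPhi.
  destruct (in_Gminus_star_rep s gm hs hm) as (Bm & m0 & m1).
  destruct (in_Gplus_rep s gp hs hp) as (Bp & p0).
  assert (dm : forall l, Cmod l = 1 -> mdet (gm l) = RtoC 1) by apply hm.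
  assert (dp : forall l, Cmod l = 1 -> mdet (gp l) = RtoC 1) by apply hp.
  assert (q : exists B, mrep w2 neg0 B gm).
  { exists (2 * Bp * B). apply (mrep_ext w2 weight_w2 _ _ (fun l => Mmult (Phi l) (sl_inv (gp l)))).
    { intros l hl. rewrite (he l hl). unfold loop_mul. rewrite Mmult_assocC, sl_inv_r, Mmult_1r; auto. }
    assert (hi := mrep_inv w1 weight_w1 _ _ _ p0).
    intros i j.
    apply (rep_ext w2 weight_w2 _ _ (fun l => ent (sl_inv (gp l)) 0 j * ent (Phi l) i 0 + ent (sl_inv (gp l)) 1 j * ent (Phi l) i 1)%C).
    { intros l _. rewrite entC_mult. ring. }
    apply (rep_regular_sum (fun l => ent (sl_inv (gp l)) 0%nat j) (fun l => ent (Phi l) i 0%nat)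
        (fun l => ent (sl_inv (gp l)) 1%nat j) (fun l => ent (Phi l) i 1%nat) pos0 neg0 Bp B Bm); auto.
    - unfold pos0, neg0. intros k m hk hkm. unfold w2. apply Rle_pow; [lra|lia].
    - apply (rep_ext w1 weight_w1 _ _ (fun l => ent (gm l) i j)); auto. intros l hl.
      transitivity (ent (Mmult (Phi l) (sl_inv (gp l))) i j).
      + rewrite (he l hl). unfold loop_mul. rewrite Mmult_assocC, sl_inv_r, Mmult_1r; auto.
      + rewrite entC_mult. ring. }
  assert (q' : exists B, mrep w2 pos0 B gp).
  { exists (2 * Bm * B). apply (mrep_ext w2 weight_w2 _ _ (fun l => Mmult (sl_inv (gm l)) (Phi l))).
    { intros l hl. rewrite (he l hl). unfold loop_mul. rewrite <- Mmult_assocC, sl_inv_l, Mmult_1l; auto. }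
    assert (hi := mrep_inv w1 weight_w1 _ _ _ m0).
    intros i j.
    apply (rep_ext w2 weight_w2 _ _ (fun l => ent (sl_inv (gm l)) i 0 * ent (Phi l) 0 j + ent (sl_inv (gm l)) i 1 * ent (Phi l) 1 j)%C).
    { intros l _. rewrite entC_mult. ring. }
    apply (rep_regular_sum (fun l => ent (sl_inv (gm l)) i 0%nat) (fun l => ent (Phi l) 0%nat j)
        (fun l => ent (sl_inv (gm l)) i 1%nat) (fun l => ent (Phi l) 1%nat j) neg0 pos0 Bm B Bp); auto.
    - unfold pos0, neg0. intros k m hk hkm. unfold w2. apply Rle_pow; [lra|lia].
    - apply (rep_ext w1 weight_w1 _ _ (fun l => ent (gp l) i j)); auto. intros l hl.
      transitivity (ent (Mmult (sl_inv (gm l)) (Phi l)) i j).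
      + rewrite (he l hl). unfold loop_mul. rewrite <- Mmult_assocC, sl_inv_l, Mmult_1l; auto.
      + rewrite entC_mult. ring. }
  split; auto.
  destruct q as (Bq & q).
  destruct (mrep_real w2 weight_w2 neg0 Mone) as (B1 & hB1); [unfold neg0; lia|].
  assert (hone : cplx Mone = Mone) by (apply mx_extC; entC; entR; auto).
  rewrite hone in hB1.
  exists (Bq + B1). intros i j. destruct (mrep_minus w2 weight_w2 _ _ _ _ _ q hB1 i j) as (r1 & r2 & r3).
  split; [|split]; auto. apply (m1 i j).
Qed.

Ltac supp := unfold allz, neg0, neg1, pos0; intros; auto; lia.

Lemma mrep_disjoint S S' B B' g : mrep w2 S B g -> mrep w2 S' B' g ->
  (forall n, S n -> S' n -> False) -> forall l, Cmod l = 1 -> g l = zero.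
Proof.
  intros h h' hd l hl.
  assert (e : forall i j, ent (g l) i j = RtoC 0).
  { intros i j. apply (rep_disjoint w2 w2 S S' B B' (fun l => ent (g l) i j) weight_w2); auto. }
  apply mx_extC; rewrite e, entC_zero; auto.
Qed.

Lemma mrep_one S : S 0%Z -> exists B, mrep w2 S B (fun _ => Mone).
Proof.
  intros h. destruct (mrep_real w2 weight_w2 S Mone h) as (B & hB). exists B.
  assert (hone : cplx Mone = Mone) by (apply mx_extC; entC; entR; auto).
  rewrite hone in hB; auto.
Qed.

Lemma mrep_all S B g : mrep w2 S B g -> mrep w2 allz B g.
Proof. apply mrep_mono; [supp|lra]. Qed.

Lemma sigma_mult g h l : Defs.sigma (fun l => Mmult (g l) (h l)) l = Mmult (Defs.sigma g l) (Defs.sigma h l).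
Proof.
  unfold Defs.sigma.
  assert (e : Mmult (cplx e2) (cplx e2) = Mone).
  { unfold e2. apply mx_extC; entC; entR; rewrite ?RtoC_m1; Cring. }
  rewrite !Mmult_assocC. f_equal. f_equal.
  rewrite <- (Mmult_assocC (cplx e2) (cplx e2)), e, Mmult_1l. reflexivity.
Qed.

Lemma sigma_inv g l : Defs.sigma (fun l => sl_inv (g l)) l = sl_inv (Defs.sigma g l).
Proof.
  unfold Defs.sigma, e2. apply mx_extC; entC; entR; rewrite ?RtoC_m1; Cring.
Qed.

Lemma sigma_plus g h l : Defs.sigma (fun l => cadd (g l) (h l)) l = cadd (Defs.sigma g l) (Defs.sigma h l).
Proof. unfold Defs.sigma. mxC. Qed.

Lemma sigma_one l : Defs.sigma (fun _ => Mone) l = Mone.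
Proof. unfold Defs.sigma, e2. apply mx_extC; entC; entR; rewrite ?RtoC_m1; Cring. Qed.

Lemma sigma_plus_one g l : Defs.sigma (fun l => cadd Mone (g l)) l = cadd Mone (Defs.sigma g l).
Proof. rewrite (sigma_plus (fun _ => Mone)), sigma_one. reflexivity. Qed.

Lemma sigma_ext g h l : (forall l, Cmod l = 1 -> g l = h l) -> Cmod l = 1 -> Defs.sigma g l = Defs.sigma h l.
Proof. intros e hl. unfold Defs.sigma. rewrite e; auto. rewrite Cmod_opp; auto. Qed.

Definition sigma_fixed (g : loop) : Prop := forall l, Cmod l = 1 -> Defs.sigma g l = g l.

Lemma sigma_fixed_mult g h : sigma_fixed g -> sigma_fixed h -> sigma_fixed (fun l => Mmult (g l) (h l)).
Proof. intros hg hh l hl. rewrite sigma_mult, hg, hh; auto. Qed.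

Lemma sigma_fixed_inv g : sigma_fixed g -> sigma_fixed (fun l => sl_inv (g l)).
Proof. intros hg l hl. rewrite sigma_inv, hg; auto. Qed.

Lemma sigma_fixed_ext g h : (forall l, Cmod l = 1 -> g l = h l) -> sigma_fixed g -> sigma_fixed h.
Proof. intros e hg l hl. rewrite <- (sigma_ext g h l e hl), hg, e; auto. Qed.

Lemma plus_one_det (p : M2 C) : mdet (cadd Mone p) = (1 + (ent p 0 0 + ent p 1 1 + mdet p))%C.
Proof. rewrite !mdetC. entC. Cring. Qed.

Lemma rep_det S B g : (forall m n, S m -> S n -> S (m + n)%Z) -> mrep w2 S B g ->
  rep w2 S (2 * B * B) (fun l => mdet (g l)).
Proof.
  intros hS hg.
  apply (rep_ext w2 weight_w2 _ _ (fun l => ent (g l) 0 0 * ent (g l) 1 1 - ent (g l) 0 1 * ent (g l) 1 0)%C); [auto|].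
  replace (2 * B * B) with (B * B + B * B) by ring.
  apply (rep_minus w2 weight_w2 _ _ _ (fun l => ent (g l) 0 0 * ent (g l) 1 1)%C (fun l => ent (g l) 0 1 * ent (g l) 1 0)%C).
  - apply (rep_mult w2 weight_w2 S S S B B (fun l => ent (g l) 0%nat 0%nat) (fun l => ent (g l) 1%nat 1%nat)); auto.
  - apply (rep_mult w2 weight_w2 S S S B B (fun l => ent (g l) 0%nat 1%nat) (fun l => ent (g l) 1%nat 0%nat)); auto.
Qed.

(** $\det(1+p)-1$ has strictly negative support and $\det q-1$ nonnegative support; being equal,
    both vanish. *)
Lemma det_one_of_support p q B B' : mrep w2 neg1 B p -> mrep w2 pos0 B' q ->
  (forall l, Cmod l = 1 -> mdet (cadd Mone (p l)) = mdet (q l)) ->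
  forall l, Cmod l = 1 -> mdet (cadd Mone (p l)) = RtoC 1.
Proof.
  intros hp hq he l hl.
  assert (h1 : rep w2 neg1 (B + B + 2 * B * B) (fun l => ent (p l) 0 0 + ent (p l) 1 1 + mdet (p l))%C).
  { apply (rep_plus w2 weight_w2 _ _ _ (fun l => ent (p l) 0 0 + ent (p l) 1 1)%C (fun l => mdet (p l))).
    - apply (rep_plus w2 weight_w2 _ _ _ (fun l => ent (p l) 0 0) (fun l => ent (p l) 1 1)); auto.
    - apply rep_det; auto. supp. }
  assert (h2 : rep w2 pos0 (2 * B' * B' + Rabs (-1) * 1) (fun l => ent (p l) 0 0 + ent (p l) 1 1 + mdet (p l))%C).
  { apply (rep_ext w2 weight_w2 _ _ (fun l => mdet (q l) + RtoC (-1))%C).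
    - intros l' hl'. rewrite <- he, plus_one_det, RtoC_m1 by auto. ring.
    - apply (rep_plus w2 weight_w2 _ _ _ (fun l => mdet (q l)) (fun l => RtoC (-1))).
      + apply rep_det; auto. supp.
      + apply rep_real; [apply weight_w2|supp|unfold w2; simpl; lra]. }
  rewrite plus_one_det.
  rewrite (rep_disjoint w2 w2 neg1 pos0 _ _ _ weight_w2 h1 h2 ltac:(supp) l hl). Cring.
Qed.

Lemma adj_plus_one (p : M2 C) : sl_inv (cadd Mone p) = cadd Mone (sl_inv p).
Proof. mxC. Qed.

Lemma one_mult_one (p q : M2 C) : Mmult (cadd Mone p) (cadd Mone q) = cadd Mone (cadd p (cadd q (Mmult p q))).
Proof. mxC. Qed.

Lemma mrep_one_mult S p q B B' : (forall m n, S m -> S n -> S (m + n)%Z) -> mrep w2 S B p -> mrep w2 S B' q ->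
  mrep w2 S (B + (B' + 2 * B * B')) (fun l => cadd (p l) (cadd (q l) (Mmult (p l) (q l)))).
Proof.
  intros hS hp hq. apply (mrep_plus w2 weight_w2); auto. apply (mrep_plus w2 weight_w2); auto.
  apply (mrep_mult w2 weight_w2 S S); auto.
Qed.

Lemma plus_zero_rC (p : M2 C) : cadd p zero = p.
Proof. mxC. Qed.

Lemma plus_one_cancel (p q : M2 C) : cadd Mone p = cadd Mone q -> p = q.
Proof.
  intros h. replace p with (csub (cadd Mone p) Mone) by mxC. rewrite h. mxC.
Qed.

(** With $1+W=g_-^{-1}\Phi g_+^{-1}$ near the identity, the Neumann series gives $(1+p)(1+W)=1+v$
    with $p$ strictly negative and $v$ nonnegative, hence the factors $g_-(1+p)^{-1}$ and $(1+v)g_+$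
    of $\Phi$. *)
Lemma birk_near Phi0 gm gp : birk Phi0 gm gp -> exists d, 0 < d /\ forall Phi,
  mrep w2 allz d (fun l => csub (Phi l) (Phi0 l)) -> (forall l, Cmod l = 1 -> mdet (Phi l) = RtoC 1) ->
  sigma_fixed gm -> sigma_fixed gp -> sigma_fixed Phi ->
  exists hm hp B, mrep w2 neg0 B hm /\ mrep w2 pos0 B hp /\
    (forall l, Cmod l = 1 -> Phi l = Mmult (hm l) (hp l)) /\
    (forall l, Cmod l = 1 -> mdet (hm l) = RtoC 1) /\ (forall l, Cmod l = 1 -> mdet (hp l) = RtoC 1) /\
    sigma_fixed hm /\ sigma_fixed hp.
Proof.
  intros [he (Bm & hm0) _ (Bp & hp0) dm dp].
  assert (pBm := mrep_ge0 _ _ _ _ hm0). assert (pBp := mrep_ge0 _ _ _ _ hp0).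
  (* With this [d] the bound $2B_m\cdot2dB_p$ of [W] is at most $1/8$; the added $1$ keeps the
     denominator positive. *)
  exists (/ (32 * (Bm * Bp + 1))).
  assert (hpos : 0 < 32 * (Bm * Bp + 1)) by nra.
  split; [apply Rinv_0_lt_compat; auto|]. intros Phi hd hdet sm sp sPhi.
  pose (W := fun l => csub (Mmult (sl_inv (gm l)) (Mmult (Phi l) (sl_inv (gp l)))) Mone).
  assert (hW : mrep w2 allz (1 / 8) W).
  { apply (mrep_mono w2 allz allz (2 * Bm * (2 * (/ (32 * (Bm * Bp + 1))) * Bp))); auto.
    - apply Rmult_le_reg_r with (32 * (Bm * Bp + 1)); auto. field_simplify; nra.
    - apply (mrep_ext w2 weight_w2 _ _ (fun l => Mmult (sl_inv (gm l)) (Mmult (csub (Phi l) (Phi0 l)) (sl_inv (gp l))))).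
      + intros l hl. unfold W.
        replace Mone with (Mmult (sl_inv (gm l)) (Mmult (Phi0 l) (sl_inv (gp l)))).
        * mxC.
        * rewrite he, Mmult_assocC, sl_inv_r, Mmult_1r, sl_inv_l; auto.
      + apply (mrep_mult w2 weight_w2 allz allz); [supp|eapply mrep_all, mrep_inv; eauto; apply weight_w2|].
        apply (mrep_mult w2 weight_w2 allz allz); [supp|auto|eapply mrep_all, mrep_inv; eauto; apply weight_w2]. }
  destruct (birkhoff_near_id W (1 / 8)) as (p & Bv & hp & hv); [lra|auto|].
  set (v := fun l => cadd (p l) (cadd (Mmult (p l) (W l)) (W l))) in *.
  assert (hh : forall l, cadd Mone (v l) = Mmult (cadd Mone (p l)) (cadd Mone (W l))) by (intros l; unfold v; mxC).
  assert (hIW : forall l, cadd Mone (W l) = Mmult (sl_inv (gm l)) (Mmult (Phi l) (sl_inv (gp l)))) by (intros l; unfold W; mxC).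
  assert (dIW : forall l, Cmod l = 1 -> mdet (cadd Mone (W l)) = RtoC 1).
  { intros l hl. rewrite hIW, !mdet_mult, !mdet_inv, dm, dp, hdet; auto. Cring. }
  destruct (mrep_one pos0) as (B1 & hone); [supp|].
  destruct (mrep_one neg0) as (B1' & hone'); [supp|].
  assert (hvp : mrep w2 pos0 (B1 + Bv) (fun l => cadd Mone (v l))) by (apply (mrep_plus w2 weight_w2); auto).
  assert (dq : forall l, Cmod l = 1 -> mdet (cadd Mone (p l)) = RtoC 1).
  { apply (det_one_of_support p (fun l => cadd Mone (v l)) _ _ hp hvp).
    intros l hl. rewrite hh, mdet_mult, dIW; auto. Cring. }
  assert (dh : forall l, Cmod l = 1 -> mdet (cadd Mone (v l)) = RtoC 1).
  { intros l hl. rewrite hh, mdet_mult, dq, dIW; auto. Cring. }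
  assert (sW : forall l, Cmod l = 1 -> cadd Mone (Defs.sigma W l) = cadd Mone (W l)).
  { intros l hl. rewrite <- sigma_plus_one.
    rewrite (sigma_ext _ (fun l => Mmult (sl_inv (gm l)) (Mmult (Phi l) (sl_inv (gp l)))) l (fun l _ => hIW l) hl), hIW.
    apply sigma_fixed_mult; [apply sigma_fixed_inv; auto| |auto].
    apply sigma_fixed_mult; [auto|apply sigma_fixed_inv; auto]. }
  (* Invariance under $\sigma$ is a matter of uniqueness: $\sigma$ maps the solution to a solution,
     and the quotient of the two differs from the identity by a loop that is strictly negative by
     the left side and nonnegative by the right side. *)
  assert (key : forall l, Cmod l = 1 -> Mmult (cadd Mone (Defs.sigma p l)) (sl_inv (cadd Mone (p l))) =
     Mmult (cadd Mone (Defs.sigma v l)) (sl_inv (cadd Mone (v l)))).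
  { intros l hl.
    assert (e1 : cadd Mone (Defs.sigma v l) = Mmult (cadd Mone (Defs.sigma p l)) (cadd Mone (W l))).
    { rewrite <- sW by auto. rewrite <- !sigma_plus_one, <- sigma_mult.
      apply sigma_ext; auto. }
    rewrite e1, hh, sl_inv_mult, Mmult_assocC, <- (Mmult_assocC (cadd Mone (W l))), sl_inv_r, Mmult_1l; auto. }
  assert (id1 : forall l, Cmod l = 1 -> Mmult (cadd Mone (Defs.sigma p l)) (sl_inv (cadd Mone (p l))) = Mone).
  { assert (k1 := mrep_one_mult neg1 (Defs.sigma p) (fun l => sl_inv (p l)) _ _ ltac:(supp)
      (mrep_sigma w2 weight_w2 _ _ _ hp) (mrep_inv w2 weight_w2 _ _ _ hp)).
    assert (k2 := mrep_one_mult pos0 (Defs.sigma v) (fun l => sl_inv (v l)) _ _ ltac:(supp)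
      (mrep_sigma w2 weight_w2 _ _ _ hv) (mrep_inv w2 weight_w2 _ _ _ hv)).
    assert (k3 := fun l => one_mult_one (Defs.sigma p l) (sl_inv (p l))).
    assert (k4 := fun l => one_mult_one (Defs.sigma v l) (sl_inv (v l))).
    intros l hl. rewrite adj_plus_one, k3.
    assert (z : cadd (Defs.sigma p l) (cadd (sl_inv (p l)) (Mmult (Defs.sigma p l) (sl_inv (p l)))) = zero).
    { revert l hl. eapply (mrep_disjoint neg1 pos0); [apply k1| |supp].
      apply (mrep_ext w2 weight_w2 _ _ _ _) with (2 := k2). intros l hl.
      cbv beta. apply plus_one_cancel.
      refine (eq_trans (eq_sym (k4 l)) (eq_trans _ (k3 l))).
      rewrite <- !adj_plus_one. symmetry. apply key; auto. }
    exact (eq_trans (f_equal (cadd Mone) z) (plus_zero_rC _)). }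
  assert (sq : sigma_fixed (fun l => cadd Mone (p l))).
  { intros l hl. rewrite sigma_plus_one.
    transitivity (Mmult (cadd Mone (Defs.sigma p l)) (Mmult (sl_inv (cadd Mone (p l))) (cadd Mone (p l)))).
    - rewrite sl_inv_l, Mmult_1r; auto.
    - rewrite <- Mmult_assocC, id1, Mmult_1l; auto. }
  assert (sh : sigma_fixed (fun l => cadd Mone (v l))).
  { apply (sigma_fixed_ext (fun l => Mmult (cadd Mone (p l)) (cadd Mone (W l)))); [intros; rewrite hh; auto|].
    apply sigma_fixed_mult; auto. intros l hl. rewrite sigma_plus_one, sW; auto. }
  exists (fun l => Mmult (gm l) (sl_inv (cadd Mone (p l)))), (fun l => Mmult (cadd Mone (v l)) (gp l)).
  assert (hq : mrep w2 neg0 (B1' + 2 * (1 / 8)) (fun l => cadd Mone (p l))).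
  { apply (mrep_plus w2 weight_w2); auto. revert hp; apply mrep_mono; [supp|lra]. }
  assert (r1 := mrep_mult w2 weight_w2 neg0 neg0 neg0 _ _ _ _ ltac:(supp) hm0 (mrep_inv w2 weight_w2 _ _ _ hq)).
  assert (r2 := mrep_mult w2 weight_w2 pos0 pos0 pos0 _ _ _ _ ltac:(supp) hvp hp0).
  match type of r1 with mrep _ _ ?b1 _ => match type of r2 with mrep _ _ ?b2 _ => exists (Rmax b1 b2) end end.
  split; [revert r1; apply mrep_mono; [auto|apply Rmax_l]|].
  split; [revert r2; apply mrep_mono; [auto|apply Rmax_r]|].
  split; [|split; [|split; [|split]]].
  - intros l hl. rewrite Mmult_assocC, <- (Mmult_assocC (sl_inv _) (cadd Mone (v l))), hh.
    rewrite <- (Mmult_assocC (sl_inv (cadd Mone (p l)))), sl_inv_l, Mmult_1l, hIW by auto.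
    rewrite !Mmult_assocC, sl_inv_l, Mmult_1r, <- Mmult_assocC, sl_inv_r, Mmult_1l; auto.
  - intros l hl. rewrite mdet_mult, mdet_inv, dm, dq; auto. Cring.
  - intros l hl. rewrite mdet_mult, dp, dh; auto. Cring.
  - apply sigma_fixed_mult; auto. apply sigma_fixed_inv; auto.
  - apply sigma_fixed_mult; auto.
Qed.

Lemma in_Gplus_of_rep s B g : 0 <= s -> mrep w2 pos0 B g -> (forall l, Cmod l = 1 -> mdet (g l) = RtoC 1) ->
  sigma_fixed g -> in_Gplus s g.
Proof.
  intros hs hg hd hsig. split; [eapply mrep_in_G; eauto|].
  destruct (rep_extends B g hg) as (G & hG & _). eauto.
Qed.

Lemma in_Gminus_of_rep s B g : 0 <= s -> mrep w2 neg0 B g -> (forall l, Cmod l = 1 -> mdet (g l) = RtoC 1) ->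
  sigma_fixed g -> in_Gminus s g.
Proof.
  intros hs hg hd hsig. split; [eapply mrep_in_G; eauto|].
  assert (h : mrep w2 pos0 B (fun l => g (/ l)%C)).
  { intros i j. destruct (rep_inv_var w2 _ _ _ weight_w2 w2_opp (hg i j)) as (h & _).
    revert h. apply rep_mono; [supp|lra]. }
  destruct (rep_extends B _ h) as (G & hG & _). exists G. exact hG.
Qed.

(** * Differentiability of families of loops *)

Definition lin (u v : R) (P Q : loop) : loop := fun l => cadd (mscal (RtoC u) (P l)) (mscal (RtoC v) (Q l)).

(** Fréchet differentiability at a single point with values in the weighted algebra; [P] and [Q] are
    the partial derivatives. *)
Record adiff (X : R -> R -> loop) (x y : R) (P Q : loop) : Prop := {
  ad_X : exists B, mrep w2 allz B (X x y);
  ad_P : exists B, mrep w2 allz B P;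
  ad_Q : exists B, mrep w2 allz B Q;
  ad_lim : forall eps, 0 < eps -> exists d, 0 < d /\ forall u v, Rabs u < d -> Rabs v < d ->
    mrep w2 allz (eps * (Rabs u + Rabs v)) (fun l => csub (X (x + u) (y + v) l) (cadd (X x y l) (lin u v P Q l))) }.

Lemma mrep_lin S u v P Q B : mrep w2 S B P -> mrep w2 S B Q -> mrep w2 S (B * (Rabs u + Rabs v)) (lin u v P Q).
Proof.
  intros hP hQ. replace (B * (Rabs u + Rabs v)) with (Rabs u * B + Rabs v * B) by ring.
  apply (mrep_plus w2 weight_w2); apply (mrep_scal w2 weight_w2); auto.
Qed.

Lemma mrep_le S B B' g : B <= B' -> mrep w2 S B g -> mrep w2 S B' g.
Proof. intros h. apply mrep_mono; auto. Qed.

Lemma adiff_common X x y P Q : adiff X x y P Q -> exists B, 0 <= B /\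
  mrep w2 allz B (X x y) /\ mrep w2 allz B P /\ mrep w2 allz B Q.
Proof.
  intros [(B1 & h1) (B2 & h2) (B3 & h3) _].
  assert (p1 := mrep_ge0 _ _ _ _ h1). assert (p2 := mrep_ge0 _ _ _ _ h2). assert (p3 := mrep_ge0 _ _ _ _ h3).
  exists (B1 + B2 + B3). split; [lra|]. repeat apply conj; eapply mrep_le; eauto; lra.
Qed.

Lemma adiff_near X x y P Q : adiff X x y P Q -> exists K d, 0 <= K /\ 0 < d /\
  forall u v, Rabs u < d -> Rabs v < d ->
    mrep w2 allz (K * (Rabs u + Rabs v)) (fun l => csub (X (x + u) (y + v) l) (X x y l)) /\
    mrep w2 allz K (X (x + u) (y + v)).
Proof.
  intros h. destruct (adiff_common _ _ _ _ _ h) as (B & hB & hX & hP & hQ).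
  destruct (ad_lim _ _ _ _ _ h 1 Rlt_0_1) as (d & hd & hlim).
  exists (3 * B + 2), (Rmin d 1). split; [lra|]. split; [apply Rmin_glb_lt; lra|].
  intros u v hu hv.
  assert (hu1 := Rlt_le_trans _ _ _ hu (Rmin_l _ _)). assert (hv1 := Rlt_le_trans _ _ _ hv (Rmin_l _ _)).
  assert (hu2 := Rlt_le_trans _ _ _ hu (Rmin_r _ _)). assert (hv2 := Rlt_le_trans _ _ _ hv (Rmin_r _ _)).
  specialize (hlim u v hu1 hv1).
  assert (hs : 0 <= Rabs u + Rabs v) by (generalize (Rabs_pos u) (Rabs_pos v); lra).
  assert (h1 : mrep w2 allz (1 * (Rabs u + Rabs v) + B * (Rabs u + Rabs v)) (fun l => csub (X (x + u) (y + v) l) (X x y l))).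
  { apply (mrep_ext w2 weight_w2 _ _ (fun l => cadd (csub (X (x + u) (y + v) l) (cadd (X x y l) (lin u v P Q l))) (lin u v P Q l))).
    - intros l _. mxC.
    - apply (mrep_plus w2 weight_w2); auto. apply mrep_lin; auto. }
  split.
  - eapply mrep_le; [|apply h1]. nra.
  - apply (mrep_ext w2 weight_w2 _ _ (fun l => cadd (csub (X (x + u) (y + v) l) (X x y l)) (X x y l))).
    + intros l _. mxC.
    + eapply mrep_le; [|apply (mrep_plus w2 weight_w2); [apply h1|apply hX]]. nra.
Qed.

Lemma adiff_mult X Y x y P Q P' Q' : adiff X x y P Q -> adiff Y x y P' Q' ->
  adiff (fun x y l => Mmult (X x y l) (Y x y l)) x y
    (fun l => cadd (Mmult (P l) (Y x y l)) (Mmult (X x y l) (P' l)))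
    (fun l => cadd (Mmult (Q l) (Y x y l)) (Mmult (X x y l) (Q' l))).
Proof.
  intros hX hY.
  destruct (adiff_common _ _ _ _ _ hX) as (B & hB & b1 & b2 & b3).
  destruct (adiff_common _ _ _ _ _ hY) as (B' & hB' & b1' & b2' & b3').
  destruct (adiff_near _ _ _ _ _ hY) as (K & d0 & hK & hd0 & hnear).
  assert (mm : forall B B' g h, mrep w2 allz B g -> mrep w2 allz B' h -> mrep w2 allz (2 * B * B') (fun l => Mmult (g l) (h l))).
  { intros. apply (mrep_mult w2 weight_w2 allz allz); [supp|auto|auto]. }
  split.
  - eexists. apply (mm _ _ _ _ b1 b1').
  - eexists. apply (mrep_plus w2 weight_w2 _ _ _ _ _ (mm _ _ _ _ b2 b1') (mm _ _ _ _ b1 b2')).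
  - eexists. apply (mrep_plus w2 weight_w2 _ _ _ _ _ (mm _ _ _ _ b3 b1') (mm _ _ _ _ b1 b3')).
  - intros eps heps.
    pose (A := 2 * K + 2 * B + 1). assert (hA : 0 < A) by (unfold A; lra).
    pose (e := eps / (2 * A)). assert (he : 0 < e) by (unfold e; apply Rdiv_lt_0_compat; lra).
    destruct (ad_lim _ _ _ _ _ hX e he) as (d1 & p1 & q1).
    destruct (ad_lim _ _ _ _ _ hY e he) as (d2 & p2 & q2).
    pose (d3 := eps / (8 * B * K + 8)). assert (p3 : 0 < d3) by (unfold d3; apply Rdiv_lt_0_compat; nra).
    exists (Rmin d0 (Rmin d1 (Rmin d2 d3))).
    split; [apply Rmin_glb_lt; [auto|apply Rmin_glb_lt; [auto|apply Rmin_glb_lt; auto]]|]. intros u v hu hv.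
    assert (hm : forall z, z < Rmin d0 (Rmin d1 (Rmin d2 d3)) -> z < d0 /\ z < d1 /\ z < d2 /\ z < d3).
    { intros z hz. repeat split; eapply Rlt_le_trans; try apply hz.
      - apply Rmin_l.
      - eapply Rle_trans; [apply Rmin_r|apply Rmin_l].
      - eapply Rle_trans; [apply Rmin_r|]. eapply Rle_trans; [apply Rmin_r|apply Rmin_l].
      - eapply Rle_trans; [apply Rmin_r|]. eapply Rle_trans; [apply Rmin_r|apply Rmin_r]. }
    destruct (hm _ hu) as (u0 & u1 & u2 & u3). destruct (hm _ hv) as (v0 & v1 & v2 & v3). clear hm hu hv.
    specialize (q1 u v u1 v1). specialize (q2 u v u2 v2). destruct (hnear u v u0 v0) as (n1 & n2).
    set (s := Rabs u + Rabs v) in *.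
    assert (hs : 0 <= s) by (unfold s; generalize (Rabs_pos u) (Rabs_pos v); lra).
    assert (hs3 : s <= 2 * d3) by (unfold s; lra).
    (* With primes at the displaced point, the increment of the product minus its linear part is the
       remainder of $X$ times $Y'$, plus the linear part of $X$ times $Y'-Y$, plus $X$ times the
       remainder of $Y$. *)
    apply (mrep_ext w2 weight_w2 _ _ (fun l => cadd
      (Mmult (csub (X (x + u) (y + v) l) (cadd (X x y l) (lin u v P Q l))) (Y (x + u) (y + v) l))
      (cadd (Mmult (lin u v P Q l) (csub (Y (x + u) (y + v) l) (Y x y l)))
         (Mmult (X x y l) (csub (Y (x + u) (y + v) l) (cadd (Y x y l) (lin u v P' Q' l))))))).
    { intros l _. unfold lin. mxC. }
    eapply mrep_le; [|apply (mrep_plus w2 weight_w2); [apply (mm _ _ _ _ q1 n2)|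
      apply (mrep_plus w2 weight_w2); [apply (mm _ _ _ _ (mrep_lin _ u v _ _ _ b2 b3) n1)|apply (mm _ _ _ _ b1 q2)]]].
    fold s.
    assert (t1 : e * A = eps / 2) by (unfold e; field; lra).
    assert (t2 : 2 * B * K * s <= eps / 2).
    { apply Rle_trans with (2 * B * K * (2 * d3)).
      - apply Rmult_le_compat_l; auto. nra.
      - unfold d3. assert (0 < 8 * B * K + 8) by nra.
        apply Rmult_le_reg_r with (8 * B * K + 8); auto. field_simplify; [|lra]. nra. }
    assert (t3 : (2 * B * K * s) * s <= eps / 2 * s) by (apply Rmult_le_compat_r; auto).
    assert (t4 : 2 * e * K + 2 * B * e <= eps / 2) by (rewrite <- t1; unfold A; nra).
    assert (t5 : (2 * e * K + 2 * B * e) * s <= eps / 2 * s) by (apply Rmult_le_compat_r; auto).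
    nra.
Qed.

Lemma adiff_ext X Y x y P Q P' Q' d : 0 < d ->
  (forall u v l, Rabs u < d -> Rabs v < d -> Cmod l = 1 -> X (x + u) (y + v) l = Y (x + u) (y + v) l) ->
  (forall l, Cmod l = 1 -> P l = P' l) -> (forall l, Cmod l = 1 -> Q l = Q' l) ->
  adiff X x y P Q -> adiff Y x y P' Q'.
Proof.
  intros hd hXY hP hQ h.
  assert (h0 : forall l, Cmod l = 1 -> X x y l = Y x y l).
  { intros l hl. specialize (hXY 0 0 l). rewrite !Rplus_0_r, Rabs_R0 in hXY. auto. }
  destruct h as [(B1 & h1) (B2 & h2) (B3 & h3) hlim]. split.
  - exists B1. apply (mrep_ext w2 weight_w2 _ _ (X x y)); auto.
  - exists B2. apply (mrep_ext w2 weight_w2 _ _ P); auto.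
  - exists B3. apply (mrep_ext w2 weight_w2 _ _ Q); auto.
  - intros eps he. destruct (hlim eps he) as (d1 & hd1 & h). exists (Rmin d d1).
    split; [apply Rmin_glb_lt; auto|]. intros u v hu hv.
    eapply (mrep_ext w2 weight_w2); [|apply (h u v)].
    + intros l hl. cbv beta. unfold lin. rewrite hP, hQ, h0, hXY; auto;
      eapply Rlt_le_trans; eauto; apply Rmin_l.
    + eapply Rlt_le_trans; eauto; apply Rmin_r.
    + eapply Rlt_le_trans; eauto; apply Rmin_r.
Qed.

Lemma adiff_inv X x y P Q : adiff X x y P Q ->
  adiff (fun x y l => sl_inv (X x y l)) x y (fun l => sl_inv (P l)) (fun l => sl_inv (Q l)).
Proof.
  intros [(B1 & h1) (B2 & h2) (B3 & h3) hlim]. split.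
  - exists B1. apply (mrep_inv w2 weight_w2); auto.
  - exists B2. apply (mrep_inv w2 weight_w2); auto.
  - exists B3. apply (mrep_inv w2 weight_w2); auto.
  - intros eps he. destruct (hlim eps he) as (d1 & hd1 & h). exists d1. split; auto.
    intros u v hu hv.
    apply (mrep_ext w2 weight_w2 _ _ (fun l => sl_inv (csub (X (x + u) (y + v) l) (cadd (X x y l) (lin u v P Q l))))).
    + intros l _. unfold lin. mxC.
    + apply (mrep_inv w2 weight_w2); auto.
Qed.

Lemma mrep_project S B0 B B1 u v : mrep w2 S B0 u -> mrep w2 allz B v ->
  mrep w2 (fun n => ~ S n) B1 (fun l => cadd (u l) (v l)) -> mrep w2 S B u.
Proof.
  intros hu hv huv i j.
  apply (rep_project w2 weight_w2 S B0 B B1 _ (fun l => ent (v l) i j) (hu i j) (hv i j)).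
  apply (rep_ext w2 weight_w2 _ _ (fun l => ent (cadd (u l) (v l)) i j)); auto.
  intros l _. rewrite entC_cadd; auto.
Qed.

Lemma not_neg1 n : pos0 n -> ~ neg1 n.
Proof. supp. Qed.

(* The a priori estimate for [p + P(p W) = - P(W)]. *)
Lemma negative_solution_bound p W om B0 B1 : om <= 1 / 8 -> mrep w2 neg1 B0 p -> mrep w2 allz om W ->
  mrep w2 pos0 B1 (fun l => cadd (p l) (cadd (Mmult (p l) (W l)) (W l))) -> mrep w2 neg1 (2 * om) p.
Proof.
  intros hom hp hW hv. assert (h0 := mrep_ge0 _ _ _ _ hW). assert (hB0 := mrep_ge0 _ _ _ _ hp).
  assert (step : forall b, mrep w2 neg1 b p -> mrep w2 neg1 (2 * b * om + om) p).
  { intros b hb. apply (mrep_project neg1 B0 _ B1 p (fun l => cadd (Mmult (p l) (W l)) (W l))); auto.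
    - apply (mrep_plus w2 weight_w2); auto. apply (mrep_mult w2 weight_w2 neg1 allz); [supp|auto|auto].
    - revert hv. apply mrep_mono; [apply not_neg1|lra]. }
  (* Feeding a bound back into the equation halves its excess over [2 * om], so the excess dies out
     in the limit. *)
  assert (iter : forall k, mrep w2 neg1 (2 * om + B0 * (/ 2) ^ k) p).
  { induction k; [eapply mrep_le; [|apply hp]; simpl; lra|].
    eapply mrep_le; [|apply (step _ IHk)]. simpl. set (z := B0 * (/ 2) ^ k) in *.
    assert (hz : 0 <= z) by (apply Rmult_le_pos; auto; apply pow_le; lra).
    replace (B0 * (/ 2 * (/ 2) ^ k)) with (z / 2) by (unfold z; field). nra. }
  intros i j. apply rep_limit. intros eps he.
  destruct (pow_lt_1_zero (/ 2)) with (y := eps / (B0 + 1)) as (N & hN).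
  - rewrite Rabs_right; lra.
  - apply Rdiv_lt_0_compat; lra.
  - specialize (hN N (le_n _)). rewrite Rabs_right in hN by (apply Rle_ge, pow_le; lra).
    apply (mrep_le neg1 (2 * om + B0 * (/ 2) ^ N)); auto.
    assert (B0 * (/ 2) ^ N <= (B0 + 1) * (eps / (B0 + 1))).
    { apply Rmult_le_compat; try lra. apply pow_le; lra. }
    replace ((B0 + 1) * (eps / (B0 + 1))) with eps in H by (field; lra). lra.
Qed.

(** If $\det(1+p)=1$, the trace of $p$ is $-\det p$, so the adjugate of $p$ is $-p-\det p$, where
    $\det p$ is the product of $p$ with its adjugate. This expands $(1+p)^{-1}$ with an explicit
    second-order term. *)
Lemma adj_of_det_one (p : M2 C) : mdet (cadd Mone p) = RtoC 1 ->
  sl_inv p = csub zero (cadd p (Mmult p (sl_inv p))).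
Proof.
  intros h. rewrite plus_one_det in h.
  assert (e : (ent p 0 0 + ent p 1 1)%C = (- mdet p)%C).
  { replace (ent p 0 0 + ent p 1 1)%C with ((1 + (ent p 0 0 + ent p 1 1 + mdet p)) - 1 - mdet p)%C by ring.
    rewrite h. ring. }
  rewrite mdetC in e.
  assert (e0 : ent p 1 1 = (- (ent p 0 0 * ent p 1 1 - ent p 0 1 * ent p 1 0) - ent p 0 0)%C) by (rewrite <- e; Cring).
  assert (e1 : ent p 0 0 = (- (ent p 0 0 * ent p 1 1 - ent p 0 1 * ent p 1 0) - ent p 1 1)%C) by (rewrite <- e; Cring).
  apply mx_extC; entC; try Cring.
  - rewrite e0 at 1. Cring.
  - rewrite e1 at 1. Cring.
Qed.

(** At a nearby point (primed) $p=(H_-')^{-1}H_--1$ solves the projected equation for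
    $W=H_-^{-1}\Phi'H_+^{-1}-1$. It has the order of the displacement and equals minus the negative
    part of $W$ up to second order; to first order that part is the linear form with coefficients
    [VP] and [VQ]. *)
Lemma adiff_factor Phi Hm Hp x y P Q VP VQ Bv d0 : 0 < d0 ->
  (forall u v, Rabs u < d0 -> Rabs v < d0 -> birk (Phi (x + u) (y + v)) (Hm (x + u) (y + v)) (Hp (x + u) (y + v))) ->
  adiff Phi x y P Q ->
  mrep w2 neg1 Bv VP -> mrep w2 neg1 Bv VQ ->
  mrep w2 pos0 Bv (fun l => csub (Mmult (sl_inv (Hm x y l)) (Mmult (P l) (sl_inv (Hp x y l)))) (VP l)) ->
  mrep w2 pos0 Bv (fun l => csub (Mmult (sl_inv (Hm x y l)) (Mmult (Q l) (sl_inv (Hp x y l)))) (VQ l)) ->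
  adiff Hm x y (fun l => Mmult (Hm x y l) (VP l)) (fun l => Mmult (Hm x y l) (VQ l)).
Proof.
  intros hd0 hbirk hPhi hVP hVQ hP hQ.
  assert (hb := hbirk 0 0). rewrite !Rplus_0_r, Rabs_R0 in hb. specialize (hb hd0 hd0).
  destruct hb as [he (Bm & hm0) (Bm1 & hm1) (Bp & hp0) dm dp].
  assert (pBm := mrep_ge0 _ _ _ _ hm0). assert (pBp := mrep_ge0 _ _ _ _ hp0).
  assert (pBv := mrep_ge0 _ _ _ _ hVP).
  assert (mm : forall B B' g h, mrep w2 allz B g -> mrep w2 allz B' h -> mrep w2 allz (2 * B * B') (fun l => Mmult (g l) (h l))).
  { intros. apply (mrep_mult w2 weight_w2 allz allz); [supp|auto|auto]. }
  assert (am := mrep_all _ _ _ hm0). assert (ap := mrep_all _ _ _ hp0).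
  assert (ami := mrep_inv w2 weight_w2 _ _ _ am). assert (api := mrep_inv w2 weight_w2 _ _ _ ap).
  pose (cj := fun (g : loop) => (fun l => Mmult (sl_inv (Hm x y l)) (Mmult (g l) (sl_inv (Hp x y l)))) : loop).
  pose (Kc := 2 * Bm * (2 * 1 * Bp)).
  assert (hKc : 0 <= Kc) by (unfold Kc; nra).
  assert (hcj : forall b g, mrep w2 allz b g -> mrep w2 allz (Kc * b) (cj g)).
  { intros b g hg. eapply mrep_le; [|apply (mm _ _ _ _ ami (mm _ _ _ _ hg api))]. unfold Kc. right; ring. }
  destruct (adiff_near _ _ _ _ _ hPhi) as (K & d1 & hK & hd1 & hnear).
  destruct (mrep_one pos0) as (B1 & hone); [supp|].
  split.
  - eauto.
  - eexists. apply (mm _ _ _ _ am (mrep_all _ _ _ hVP)).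
  - eexists. apply (mm _ _ _ _ am (mrep_all _ _ _ hVQ)).
  - intros eps heps.
    pose (e := eps / (8 * (Bm + 1) * (Kc + 1))).
    assert (he0 : 0 < e) by (unfold e; apply Rdiv_lt_0_compat; nra).
    destruct (ad_lim _ _ _ _ _ hPhi e he0) as (d2 & hd2 & hlim).
    pose (KK := Kc * K). assert (hKK : 0 <= KK) by (unfold KK; nra).
    (* The first bound makes [W] at most $1/8$, the second pays for the quadratic terms of the final
       estimate. *)
    pose (d3 := Rmin (/ (16 * (KK + 1))) (eps / (96 * (Bm + 1) * (KK * KK + 1)))).
    assert (hd3 : 0 < d3).
    { unfold d3. apply Rmin_glb_lt; [apply Rinv_0_lt_compat; lra|apply Rdiv_lt_0_compat; nra]. }
    exists (Rmin d0 (Rmin d1 (Rmin d2 d3))).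
    split; [apply Rmin_glb_lt; [auto|apply Rmin_glb_lt; [auto|apply Rmin_glb_lt; auto]]|]. intros u v hu hv.
    assert (hmin : forall z, z < Rmin d0 (Rmin d1 (Rmin d2 d3)) -> z < d0 /\ z < d1 /\ z < d2 /\ z < d3).
    { intros z hz. repeat split; eapply Rlt_le_trans; try apply hz.
      - apply Rmin_l.
      - eapply Rle_trans; [apply Rmin_r|apply Rmin_l].
      - eapply Rle_trans; [apply Rmin_r|]. eapply Rle_trans; [apply Rmin_r|apply Rmin_l].
      - eapply Rle_trans; [apply Rmin_r|]. eapply Rle_trans; [apply Rmin_r|apply Rmin_r]. }
    destruct (hmin _ hu) as (u0 & u1 & u2 & u3). destruct (hmin _ hv) as (v0 & v1 & v2 & v3). clear hmin hu hv.
    specialize (hlim u v u2 v2). destruct (hnear u v u1 v1) as (n1 & _). specialize (hbirk u v u0 v0).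
    set (s := Rabs u + Rabs v) in *.
    assert (hs : 0 <= s) by (unfold s; generalize (Rabs_pos u) (Rabs_pos v); lra).
    assert (hs3 : s <= 2 * d3) by (unfold s; lra).
    set (Phi' := Phi (x + u) (y + v)) in *. set (Hm' := Hm (x + u) (y + v)) in *. set (Hp' := Hp (x + u) (y + v)) in *.
    destruct hbirk as [he' (Bm' & hm0') (Bm1' & hm1') (Bp' & hp0') dm' dp'].
    pose (W := fun l => csub (cj Phi' l) Mone).
    assert (hW : mrep w2 allz (KK * s) W).
    { apply (mrep_ext w2 weight_w2 _ _ (cj (fun l => csub (Phi' l) (Phi x y l)))).
      - intros l hl. unfold W, cj.
        replace Mone with (Mmult (sl_inv (Hm x y l)) (Mmult (Phi x y l) (sl_inv (Hp x y l)))).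
        + mxC.
        + rewrite he, Mmult_assocC, sl_inv_r, Mmult_1r, sl_inv_l; auto.
      - replace (KK * s) with (Kc * (K * s)) by (unfold KK; ring). apply hcj. exact n1. }
    assert (hom : KK * s <= 1 / 8).
    { apply Rle_trans with (KK * (2 * / (16 * (KK + 1)))).
      - apply Rmult_le_compat_l; auto. unfold d3 in hs3. generalize (Rmin_l (/ (16 * (KK + 1))) (eps / (96 * (Bm + 1) * (KK * KK + 1)))). lra.
      - apply Rmult_le_reg_r with (16 * (KK + 1)); [lra|]. field_simplify; lra. }
    pose (p := fun l => csub (Mmult (sl_inv (Hm' l)) (Hm x y l)) Mone).
    assert (hp : mrep w2 neg1 (Bm1' + (Bm1 + 2 * Bm1' * Bm1)) p).
    { apply (mrep_ext w2 weight_w2 _ _ (fun l => cadd (sl_inv (csub (Hm' l) Mone)) (cadd (csub (Hm x y l) Mone)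
         (Mmult (sl_inv (csub (Hm' l) Mone)) (csub (Hm x y l) Mone))))).
      - intros l _. unfold p. mxC.
      - apply mrep_one_mult; auto; [supp|]. apply (mrep_inv w2 weight_w2); auto. }
    assert (hq : forall l, cadd Mone (p l) = Mmult (sl_inv (Hm' l)) (Hm x y l)) by (intros l; unfold p; mxC).
    assert (hv : mrep w2 pos0 (2 * Bp' * Bp + B1) (fun l => cadd (p l) (cadd (Mmult (p l) (W l)) (W l)))).
    { apply (mrep_ext w2 weight_w2 _ _ (fun l => csub (Mmult (Hp' l) (sl_inv (Hp x y l))) Mone)).
      - intros l hl.
        assert (e1 : Mmult (Hp' l) (sl_inv (Hp x y l)) = Mmult (cadd Mone (p l)) (cadd Mone (W l))).
        { rewrite hq. replace (cadd Mone (W l)) with (cj Phi' l) by (unfold W; mxC). unfold cj.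
          rewrite he' by auto. rewrite !Mmult_assocC, <- (Mmult_assocC (Hm x y l)), sl_inv_r, Mmult_1l by auto.
          rewrite <- Mmult_assocC, sl_inv_l, Mmult_1l; auto. }
        rewrite e1. mxC.
      - apply (mrep_minus w2 weight_w2); auto. apply (mrep_mult w2 weight_w2 pos0 pos0); auto; [supp|].
        apply (mrep_inv w2 weight_w2); auto. }
    assert (hp2 := negative_solution_bound p W (KK * s) _ _ hom hp hW hv).
    set (om := KK * s) in *. assert (hom0 : 0 <= om) by (unfold om; nra).
    pose (L := lin u v VP VQ).
    pose (Pc := cj P). pose (Qc := cj Q).
    assert (hL : mrep w2 neg1 (Bv * s) L) by (apply mrep_lin; auto).
    (* In $p+L$ the first-order part of $W$ disappears under the projection; what remains is the
       product $pW$ and the conjugated remainder of [Phi]. *)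
    assert (hpL : mrep w2 neg1 (2 * (2 * om) * om + Kc * (e * s)) (fun l => cadd (p l) (L l))).
    { apply (mrep_project neg1 (2 * om + Bv * s) _ ((2 * Bp' * Bp + B1) + Bv * s) _
        (fun l => cadd (Mmult (p l) (W l)) (cj (fun l => csub (Phi' l) (cadd (Phi x y l) (lin u v P Q l))) l))).
      - apply (mrep_plus w2 weight_w2); auto.
      - apply (mrep_plus w2 weight_w2); [apply (mm _ _ _ _ (mrep_all _ _ _ hp2) hW)|].
        apply hcj. exact hlim.
      - apply (mrep_mono w2 pos0 _ ((2 * Bp' * Bp + B1) + Bv * s) ((2 * Bp' * Bp + B1) + Bv * s)); [apply not_neg1|lra|].
        apply (mrep_ext w2 weight_w2 _ _ (fun l => csub (cadd (p l) (cadd (Mmult (p l) (W l)) (W l)))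
           (lin u v (fun l => csub (Pc l) (VP l)) (fun l => csub (Qc l) (VQ l)) l))).
        + intros l hl.
          assert (e1 : cj (fun l => csub (Phi' l) (cadd (Phi x y l) (lin u v P Q l))) l =
             csub (W l) (lin u v Pc Qc l)).
          { unfold W.
            replace Mone with (cj (Phi x y) l).
            - unfold Pc, Qc, cj, lin.
              set (A := sl_inv (Hm x y l)). set (D := sl_inv (Hp x y l)). clearbody A D. mxC.
            - unfold cj. rewrite he, Mmult_assocC, sl_inv_r, Mmult_1r, sl_inv_l; auto. }
          rewrite e1. unfold L, lin. mxC.
        + apply (mrep_minus w2 weight_w2); auto. apply mrep_lin; auto. }
    assert (dq : forall l, Cmod l = 1 -> mdet (cadd Mone (p l)) = RtoC 1).
    { intros l hl. rewrite hq, mdet_mult, mdet_inv, dm, dm'; auto. Cring. }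
    (* The increment minus its linear part is $-H_-(p+L)$ minus $H_-$ times the product of $p$ and
       its adjugate, two terms of higher order. *)
    apply (mrep_ext w2 weight_w2 _ _ (fun l => csub zero (cadd (Mmult (Hm x y l) (cadd (p l) (L l)))
       (Mmult (Hm x y l) (Mmult (p l) (sl_inv (p l))))))).
    { intros l hl.
      assert (e1 : Hm' l = Mmult (Hm x y l) (cadd Mone (csub zero (cadd (p l) (Mmult (p l) (sl_inv (p l))))))).
      { rewrite <- (adj_of_det_one (p l)), <- adj_plus_one, hq, sl_inv_mult, sl_inv_invol by auto.
        rewrite <- Mmult_assocC, sl_inv_r, Mmult_1l; auto. }
      fold Hm'. rewrite e1. unfold L, lin. mxC. }
    assert (hz := mrep_zero w2 weight_w2 allz).
    eapply mrep_le; [|exact (mrep_minus w2 weight_w2 allz _ _ _ _ hz (mrep_plus w2 weight_w2 allz _ _ _ _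
      (mm _ _ _ _ am (mrep_all _ _ _ hpL))
      (mm _ _ _ _ am (mm _ _ _ _ (mrep_all _ _ _ hp2) (mrep_inv w2 weight_w2 _ _ _ (mrep_all _ _ _ hp2))))))].
    fold s.
    assert (t1 : e * (8 * (Bm + 1) * (Kc + 1)) = eps) by (unfold e; field; lra).
    assert (t2 : om * KK * (48 * (Bm + 1)) <= eps).
    { apply Rle_trans with ((KK * KK * (48 * (Bm + 1))) * (2 * (eps / (96 * (Bm + 1) * (KK * KK + 1))))).
      - replace (om * KK * (48 * (Bm + 1))) with ((KK * KK * (48 * (Bm + 1))) * s) by (unfold om; ring).
        apply Rmult_le_compat_l; [nra|]. unfold d3 in hs3.
        generalize (Rmin_r (/ (16 * (KK + 1))) (eps / (96 * (Bm + 1) * (KK * KK + 1)))). lra.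
      - assert (0 < 96 * (Bm + 1) * (KK * KK + 1)) by nra.
        apply Rmult_le_reg_r with (96 * (Bm + 1) * (KK * KK + 1)); auto. field_simplify; [|nra]. nra. }
    assert (t3 : 2 * Bm * (Kc * (e * s)) <= eps / 4 * s).
    { replace (2 * Bm * (Kc * (e * s))) with ((2 * Bm * Kc * e) * s) by ring.
      apply Rmult_le_compat_r; auto. rewrite <- t1.
      assert (0 <= e * (2 * Bm + 2 * Kc + 2)) by nra. nra. }
    assert (t4 : 24 * Bm * (om * om) <= eps / 2 * s).
    { replace (24 * Bm * (om * om)) with ((24 * Bm * (om * KK)) * s) by (unfold om; ring).
      apply Rmult_le_compat_r; auto. assert (0 <= om * KK) by nra. nra. }
    assert (0 <= eps * s) by nra.
    lra.
Qed.

(** * The extended frame as a curve of analytic loops *)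

(** [frame_potential] with its functions as parameters: [a] is the diagonal entry,
    $q=Qe^{-\omega_0/2}$, $h=\frac12He^{\omega_0/2}$ and $r=Re^{-\omega_0/2}$. *)
Definition pot (a q h r : R) : loop := fun l =>
  mx2 (K := C_Ring) (RtoC a) (RtoC (- q) * l + RtoC h * / l)%C (RtoC h * l - RtoC r * / l)%C (RtoC (- a)).

Definition u1 (n : Z) : Prop := (-1 <= n <= 1)%Z.

Lemma Czpow_1 l : Czpow l 1 = l.
Proof. simpl. ring. Qed.

Lemma Czpow_m1 l : Czpow l (-1) = (/ l)%C.
Proof. simpl. f_equal. ring. Qed.

Lemma rep_laurent w (hw : weight w) a b c : exists B, rep w u1 B (fun l => RtoC a + (RtoC b * l + RtoC c * / l))%C.
Proof.
  assert (h0 : rep w u1 (Rabs a * w 0%Z) (fun _ => RtoC a)) by (apply rep_real; [auto|unfold u1; lia|lra]).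
  assert (h1 : rep w u1 (w 1%Z) (fun l => l)).
  { apply (rep_ext w hw _ _ (fun l => Czpow l 1)); [intros; apply Czpow_1|]. apply rep_monomial; auto. unfold u1; lia. }
  assert (h2 : rep w u1 (w (-1)%Z) (fun l => / l)%C).
  { apply (rep_ext w hw _ _ (fun l => Czpow l (-1))); [intros; apply Czpow_m1|]. apply rep_monomial; auto. unfold u1; lia. }
  eexists. exact (rep_plus w hw _ _ _ _ _ h0 (rep_plus w hw _ _ _ _ _ (rep_scal w hw _ _ _ b h1) (rep_scal w hw _ _ _ c h2))).
Qed.

Lemma mrep_pot w (hw : weight w) a q h r : exists B, mrep w u1 B (pot a q h r).
Proof.
  destruct (rep_laurent w hw a 0 0) as (B1 & h1).
  destruct (rep_laurent w hw 0 (- q) h) as (B2 & h2).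
  destruct (rep_laurent w hw 0 h (- r)) as (B3 & h3).
  destruct (rep_laurent w hw (- a) 0 0) as (B4 & h4).
  assert (p1 := rep_ge0 _ _ _ _ h1). assert (p2 := rep_ge0 _ _ _ _ h2).
  assert (p3 := rep_ge0 _ _ _ _ h3). assert (p4 := rep_ge0 _ _ _ _ h4).
  exists (B1 + B2 + B3 + B4). apply mrep_intro; [auto|lra|].
  intros i j hi hj. unfold pot. destruct i as [|[|i]], j as [|[|j]]; try lia.
  - apply (rep_mono w u1 u1 B1); [auto|lra|]. apply (rep_ext w hw _ _ _ _) with (2 := h1). intros l _. entC. ring.
  - apply (rep_mono w u1 u1 B2); [auto|lra|]. apply (rep_ext w hw _ _ _ _) with (2 := h2). intros l _. entC. ring.
  - apply (rep_mono w u1 u1 B3); [auto|lra|]. apply (rep_ext w hw _ _ _ _) with (2 := h3). intros l _. entC. rewrite RtoC_opp. ring.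
  - apply (rep_mono w u1 u1 B4); [auto|lra|]. apply (rep_ext w hw _ _ _ _) with (2 := h4). intros l _. entC. ring.
Qed.

Lemma cf_shift S B g k n : rep w1 S B g -> cf (fun l => Czpow l k * g l)%C n = cf g (n - k).
Proof.
  intros hg. apply (four_cf (fun n => cf g (n - k)) _ B).
  - apply (bsum_inj (fun n => (n - k)%Z) (fun n => Rabs (cf g n))); [lia|]. apply (rep_bsum w1 weight_w1 _ _ _ hg).
  - intros l hl.
    apply (usum_ext (fun n => Czpow l k * (RtoC (cf g (n - k)) * Czpow l (n - k)))%C).
    + intros m. assert (e : Czpow l m = (Czpow l k * Czpow l (m - k))%C).
      { rewrite <- Czpow_add by (apply unit_neq0; auto). f_equal; lia. }
      rewrite e. ring.
    + apply usum_scal. apply (usum_reindex (fun n => (n - k)%Z) (fun n => (n + k)%Z)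
        (fun n => RtoC (cf g n) * Czpow l n)%C); [lia|lia|]. apply hg; auto.
Qed.

Lemma rep_shift S B g k : rep w1 S B g -> rep w1 (fun n => S (n - k)%Z) B (fun l => Czpow l k * g l)%C.
Proof.
  intros hg. replace B with (w1 k * B) by (unfold w1; ring).
  apply (rep_mult w1 weight_w1 (fun n => n = k) S); [|apply rep_monomial; auto; apply weight_w1|auto].
  intros m n -> hn. replace (k + n - k)%Z with n by lia. auto.
Qed.

Lemma cf_laurent_mult B B' g g' a b c n : rep w1 allz B g -> rep w1 allz B' g' ->
  cf (fun l => RtoC a * g l + (RtoC b * l + RtoC c * / l) * g' l)%C n =
  a * cf g n + b * cf g' (n - 1) + c * cf g' (n + 1).
Proof.
  intros hg hg'.
  assert (s1 := rep_shift _ _ _ 1 hg'). assert (s2 := rep_shift _ _ _ (-1) hg').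
  assert (k1 := rep_scal w1 weight_w1 _ _ _ a hg).
  assert (k2 := rep_scal w1 weight_w1 _ _ _ b s1).
  assert (k3 := rep_scal w1 weight_w1 _ _ _ c s2).
  assert (k4 := rep_plus w1 weight_w1 _ _ _ _ _ k2 k3).
  transitivity (cf (fun l => RtoC a * g l + (RtoC b * (Czpow l 1 * g' l) + RtoC c * (Czpow l (-1) * g' l)))%C n).
  - f_equal. apply functional_extensionality. intros l. rewrite Czpow_1, Czpow_m1. ring.
  - rewrite (cf_plus w1 weight_w1 _ _ _ _ _ _ n k1 k4), (cf_plus w1 weight_w1 _ _ _ _ _ _ n k2 k3).
    rewrite (cf_scal w1 weight_w1 _ _ _ a n hg), (cf_scal w1 weight_w1 _ _ _ b n s1), (cf_scal w1 weight_w1 _ _ _ c n s2).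
    rewrite !(cf_shift _ _ _ _ _ hg'). replace (n - -1)%Z with (n + 1)%Z by lia. ring.
Qed.

Lemma cf_pot B F a q h r i n : mrep w1 allz B F ->
  cf (fun l => ent (Mmult (F l) (pot a q h r l)) i 0) n =
    a * cf (fun l => ent (F l) i 0%nat) n + h * cf (fun l => ent (F l) i 1%nat) (n - 1) - r * cf (fun l => ent (F l) i 1%nat) (n + 1) /\
  cf (fun l => ent (Mmult (F l) (pot a q h r l)) i 1) n =
    - a * cf (fun l => ent (F l) i 1%nat) n - q * cf (fun l => ent (F l) i 0%nat) (n - 1) + h * cf (fun l => ent (F l) i 0%nat) (n + 1).
Proof.
  intros hF. split.
  - transitivity (cf (fun l => RtoC a * ent (F l) i 0 + (RtoC h * l + RtoC (- r) * / l) * ent (F l) i 1)%C n).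
    + f_equal. apply functional_extensionality. intros l. unfold pot. entC. rewrite RtoC_opp. Cring.
    + rewrite (cf_laurent_mult B B (fun l => ent (F l) i 0%nat) (fun l => ent (F l) i 1%nat)); auto. ring.
  - transitivity (cf (fun l => RtoC (- a) * ent (F l) i 1 + (RtoC (- q) * l + RtoC h * / l) * ent (F l) i 0)%C n).
    + f_equal. apply functional_extensionality. intros l. unfold pot. entC. Cring.
    + rewrite (cf_laurent_mult B B (fun l => ent (F l) i 1%nat) (fun l => ent (F l) i 0%nat)); auto. ring.
Qed.

Definition opn (J : R -> Prop) : Prop := forall t, J t -> exists d, 0 < d /\ forall t', Rabs (t' - t) < d -> J t'.

(** A supremum argument along the segment. The bound is uniform in the index [I], which will run
    over all entries and frequencies at once. *)
Lemma compact_bound {I : Type} (f : R -> I -> R) a b : a <= b ->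
  (forall t, a <= t <= b -> exists del B, 0 < del /\ forall t', a <= t' <= b -> Rabs (t' - t) < del ->
     forall i, Rabs (f t' i) <= B) ->
  exists B, forall t, a <= t <= b -> forall i, Rabs (f t i) <= B.
Proof.
  intros hab hloc.
  pose (E := fun x => a <= x <= b /\ exists B, forall t, a <= t <= x -> forall i, Rabs (f t i) <= B).
  destruct (completeness E) as (x & hx1 & hx2).
  - exists b. intros y (hy & _). lra.
  - exists a. split; [lra|]. destruct (hloc a) as (del & B & hd & h); [lra|].
    exists B. intros t ht. apply h; [lra|]. apply Rabs_lt_between; lra.
  - assert (hxa : a <= x).
    { apply hx1. split; [lra|]. destruct (hloc a) as (del & B & hd & h); [lra|].
      exists B. intros t ht. apply h; [lra|]. apply Rabs_lt_between; lra. }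
    assert (hxb : x <= b) by (apply hx2; intros y (hy & _); lra).
    destruct (hloc x) as (del & B & hd & h); [lra|].
    assert (exists y, E y /\ x - del < y) as (y & (hy & By & hBy) & hyx).
    { apply NNPP; intros hn. assert (x <= x - del); [|lra]. apply hx2. intros y hy.
      apply Rnot_lt_le; intros hlt. apply hn; eauto. }
    assert (hz : forall z, a <= z <= b -> z < x + del -> E z).
    { intros z hz1 hz2. split; auto. exists (Rmax By B). intros t ht i.
      destruct (Rle_lt_dec t y).
      - eapply Rle_trans; [apply hBy; lra|apply Rmax_l].
      - eapply Rle_trans; [apply h; [lra|]|apply Rmax_r]. apply Rabs_lt_between. lra. }
    destruct (Rle_lt_dec b (x + del / 2)) as [hb|hb].
    + destruct (hz b) as (_ & hE); [lra|lra|]. exact hE.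
    + assert (x + del / 2 <= x); [|lra]. apply hx1. apply hz; lra.
Qed.

(** One integration turns $x^m/m!$ into $x^{m+1}/(m+1)!$. The segment from [t0] to [t] is
    parametrized by $[0,1]$, which treats both sides of [t0] alike. *)
Lemma power_bound (u u' : R -> R) t0 t A K m : 0 <= K ->
  (forall x, 0 <= x <= 1 -> is_derive u (t0 + x * (t - t0)) (u' (t0 + x * (t - t0)))) -> u t0 = 0 ->
  (forall x, 0 <= x <= 1 -> Rabs (u' (t0 + x * (t - t0))) <= A * K * ((K * (x * Rabs (t - t0))) ^ m / INR (fact m))) ->
  Rabs (u t) <= A * ((K * Rabs (t - t0)) ^ (S m) / INR (fact (S m))).
Proof.
  intros hK hd h0 hb.
  set (T := Rabs (t - t0)) in *. assert (hT : 0 <= T) by apply Rabs_pos.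
  assert (hfm : 0 < INR (fact m)) by apply INR_fact_lt_0.
  assert (hfS : INR (fact (S m)) = INR (S m) * INR (fact m)) by (rewrite <- mult_INR; reflexivity).
  assert (hSm : 0 < INR (S m)) by (apply lt_0_INR; lia).
  set (fS := INR (fact (S m))) in *. set (fm := INR (fact m)) in *. clearbody fS fm.
  assert (key : forall e, Rabs e = 1 -> e * u t <= A * ((K * T) ^ (S m) / fS)).
  { intros e he.
    (* For a sign [e], the majorant minus [e * u] vanishes at $0$ and has a nonnegative
       derivative. *)
    pose (v := fun x => A * ((K * (x * T)) ^ (S m) / fS) - e * u (t0 + x * (t - t0))).
    pose (v' := fun x => A * K * T * ((K * (x * T)) ^ m / fm) - e * ((t - t0) * u' (t0 + x * (t - t0)))).
    assert (hv : forall x, 0 <= x <= 1 -> is_derive v x (v' x)).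
    { intros x hx. unfold v, v'. apply (is_derive_minus (K := R_AbsRing) (V := R_NormedModule)).
      - auto_derive; auto. change (match m with O => 1 | S _ => INR m + 1 end) with (INR (S m)).
        rewrite hfS. field. split; lra.
      - apply (is_derive_scal (fun x => u (t0 + x * (t - t0)))).
        apply (is_derive_comp (K := R_AbsRing) (V := R_NormedModule) u (fun x => t0 + x * (t - t0))); [apply hd; auto|].
        auto_derive; auto. ring. }
    destruct (MVT_gen v 0 1 v') as (x & hx & ex).
    - intros x hx. rewrite Rmin_left, Rmax_right in hx by lra. apply hv; lra.
    - intros x hx. rewrite Rmin_left, Rmax_right in hx by lra. apply derivable_continuous_pt.
      eexists. apply is_derive_Reals. apply hv; lra.
    - rewrite Rmin_left, Rmax_right in hx by lra.
      assert (hpos : 0 <= v' x).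
      { unfold v'. specialize (hb x hx).
        assert (e * ((t - t0) * u' (t0 + x * (t - t0))) <= T * (A * K * ((K * (x * T)) ^ m / fm))).
        { eapply Rle_trans; [apply Rle_abs|]. rewrite !Rabs_mult, he, Rmult_1_l. apply Rmult_le_compat_l; auto. }
        lra. }
      unfold v in ex. rewrite Rmult_0_l, Rmult_0_l, Rmult_0_r, Rplus_0_r, h0, !Rmult_1_l in ex.
      rewrite pow_i in ex by lia.
      replace (t0 + (t - t0)) with t in ex by ring. unfold Rdiv in ex at 2. rewrite Rmult_0_l in ex.
      unfold Rdiv in *. lra. }
  apply Rabs_le. split.
  - generalize (key (-1) Rabs_m1). lra.
  - generalize (key 1 Rabs_R1). lra.
Qed.

Lemma cf_one i j n : n <> 0%Z -> cf (fun _ => ent (Mone : M2 C) i j) n = 0.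
Proof.
  intros hn.
  assert (hM : ent (Mone : M2 C) i j = RtoC (Re (ent (Mone : M2 C) i j))).
  { destruct (classic (i < 2 /\ j < 2)%nat) as [[hi hj]|hno].
    - destruct i as [|[|i]], j as [|[|j]]; try lia; reflexivity.
    - rewrite !(ent_out (K := C_Ring)) by lia. reflexivity. }
  rewrite hM, cf_const. destruct Z.eq_dec; [contradiction|auto].
Qed.

Lemma bsum_fact B Y : 0 <= B -> 0 <= Y -> exists B2,
  bsum (fun n : Z => w2 n * (B * (Y ^ Z.abs_nat n / INR (fact (Z.abs_nat n))))) B2.
Proof.
  intros hB hY.
  pose (u := fun n : nat => B * ((2 * Y) ^ n / INR (fact n))).
  assert (hu : forall n, 0 <= u n).
  { intros n. apply Rmult_le_pos; auto. apply Rmult_le_pos; [apply pow_le; lra|].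
    left; apply Rinv_0_lt_compat, INR_fact_lt_0. }
  assert (h1 : ex_series u).
  { apply (ex_series_scal (K := R_AbsRing) (V := R_NormedModule) B).
    exists (exp (2 * Y)). generalize (is_exp_Reals (2 * Y)). unfold is_pseries. apply is_series_ext.
    intros n. unfold scal; simpl; unfold mult; simpl. rewrite pow_n_pow. unfold Rdiv. ring. }
  destruct h1 as (v1 & h1).
  assert (h2 : ex_series (fun n => u (S n))) by (apply (proj1 (ex_series_incr_1 u)); exists v1; exact h1).
  destruct h2 as (v2 & h2).
  exists (plus v1 v2).
  assert (e : forall k : nat, w2 (Z.of_nat k) * (B * (Y ^ k / INR (fact k))) = u k).
  { intros k. unfold w2, u. rewrite Zabs2Nat.id, Rpow_mult_distr. unfold Rdiv; ring. }
  apply zseries_bsum.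
  - intros n. apply Rmult_le_pos; [apply w_ge0, weight_w2|]. apply Rmult_le_pos; auto.
    apply Rmult_le_pos; [apply pow_le; lra|]. left; apply Rinv_0_lt_compat, INR_fact_lt_0.
  - exists v1, v2. repeat split.
    + revert h1. apply is_series_ext. intros n. rewrite Zabs2Nat.id, e. auto.
    + revert h2. apply is_series_ext. intros n. rewrite w2_opp.
      replace (Z.abs_nat (- Z.of_nat (S n))) with (S n) by lia. rewrite e. auto.
Qed.

Section Frame.

Context (s : R) (hs : s > 1 / 2) (J : R -> Prop) (hJ : opn J).
Context (hconv : forall x y z, J x -> J z -> x <= y <= z -> J y).
Context (F : R -> loop) (a q h r : R -> R) (t0 : R) (ht0 : J t0).
Hypothesis (hG : forall t, J t -> in_G s (F t)).
Hypothesis (hinit : loop_eq (F t0) (fun _ => Mone)).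
Hypothesis (hode : is_maurer_cartan s J F (fun t => pot (a t) (q t) (h t) (r t))).

Let D t : loop := fun l => Mmult (F t l) (pot (a t) (q t) (h t) (r t) l).
Let c t i j n := cf (fun l => ent (F t l) i j) n.
Let d t i j n := cf (fun l => ent (D t l) i j) n.

Lemma frame_rep1 t : J t -> exists B, mrep w1 allz B (F t) /\ mrep w1 allz B (D t).
Proof.
  intros ht. destruct (in_G_rep s (F t) hs (hG t ht)) as (B & hB).
  destruct (mrep_pot w1 weight_w1 (a t) (q t) (h t) (r t)) as (B' & hB').
  assert (hD := mrep_mult w1 weight_w1 allz u1 allz _ _ _ _ ltac:(supp) hB hB').
  exists (Rmax B (2 * B * B')). split.
  - revert hB; apply mrep_mono; [auto|apply Rmax_l].
  - revert hD; apply mrep_mono; [auto|apply Rmax_r].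
Qed.

(** A single coefficient is bounded by the $H^s$ norm, so the $H^s$ derivative makes the difference
    quotients of the coefficients converge uniformly in the frequency. *)
Lemma frame_coef_diff t eps : J t -> 0 < eps -> exists del, 0 < del /\
  forall k, k <> 0 -> Rabs k < del -> J (t + k) /\
    forall i j n, Rabs ((c (t + k) i j n - c t i j n) / k - d t i j n) <= eps.
Proof.
  intros ht he. destruct (hode t ht) as (D' & hD' & eD).
  destruct (hJ t ht) as (dJ & pJ & hdJ).
  destruct (hD' (mkposreal eps he)) as (del & hdel).
  assert (hDD : forall l, Cmod l = 1 -> D' l = D t l).
  { intros l hl. unfold D. rewrite <- (eD l hl). unfold loop_mul, loop_inv.
    rewrite <- Mmult_assocC, sl_inv_r, Mmult_1l; auto. apply (hG t ht); auto. }
  exists (Rmin del dJ). split; [apply Rmin_glb_lt; auto; apply cond_pos|].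
  intros k hk hkd.
  assert (hJk : J (t + k)).
  { apply hdJ. replace (t + k - t) with k by ring. eapply Rlt_le_trans; [apply hkd|apply Rmin_r]. }
  split; auto. intros i j n.
  destruct (hdel k hk) as (aa & qq & h1 & h2 & h3); [eapply Rlt_le_trans; [apply hkd|apply Rmin_l]|].
  simpl in h3.
  destruct (frame_rep1 t ht) as (B & b1 & b2). destruct (frame_rep1 (t + k) hJk) as (B' & b1' & _).
  set (g := fun l => minus (loop_diffq F t k l) (D' l)) in *.
  assert (eg : forall l i j, Cmod l = 1 -> ent (g l) i j =
     (RtoC (/ k) * (ent (F (t + k) l) i j + RtoC (-1) * ent (F t l) i j) + RtoC (-1) * ent (D t l) i j)%C).
  { intros l i' j' hl. unfold g, loop_diffq. rewrite hDD by auto. rewrite entC_minus, entC_mscal, entC_minus, RtoC_m1. Cring. }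
  assert (r1 := fun i j => rep_scal w1 weight_w1 _ _ _ (-1) (b1 i j)).
  assert (r2 := fun i j => rep_plus w1 weight_w1 _ _ _ _ _ (b1' i j) (r1 i j)).
  assert (r3 := fun i j => rep_scal w1 weight_w1 _ _ _ (/ k) (r2 i j)).
  assert (r4 := fun i j => rep_scal w1 weight_w1 _ _ _ (-1) (b2 i j)).
  assert (r5 := fun i j => rep_plus w1 weight_w1 _ _ _ _ _ (r3 i j) (r4 i j)).
  assert (hrho : loop_eq (rho g) g).
  { intros l hl. eapply (mrep_conj w1 allz); [|exact hl].
    intros i' j'. eapply (rep_ext w1 weight_w1); [|exact (r5 i' j')]. intros l' hl'. rewrite eg; auto. }
  destruct (Hs_fourier_rep s aa qq g hs h1 h2 hrho) as (Bg & _ & hcf).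
  assert (ecf : cf (fun l => ent (g l) i j) n = (c (t + k) i j n - c t i j n) / k - d t i j n).
  { rewrite (cf_ext _ _ (fun l hl => eg l i j hl)).
    rewrite (cf_plus w1 weight_w1 _ _ _ _ _ _ n (r3 i j) (r4 i j)).
    rewrite (cf_scal w1 weight_w1 _ _ _ (/ k) n (r2 i j)), (cf_scal w1 weight_w1 _ _ _ (-1) n (b2 i j)).
    rewrite (cf_plus w1 weight_w1 _ _ _ _ _ _ n (b1' i j) (r1 i j)), (cf_scal w1 weight_w1 _ _ _ (-1) n (b1 i j)).
    unfold c, d. field; auto. }
  rewrite <- ecf, hcf.
  eapply Rle_trans; [apply re_le_Cmod|].
  apply Rsqr_incr_0_var; [|lra]. rewrite !Rsqr_pow2.
  eapply Rle_trans; [apply (Hs_sqnorm_coef s aa qq n i j)|simpl; lra]; [lra|auto].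
Qed.

Hypothesis (hca : forall t, J t -> continuous a t) (hcq : forall t, J t -> continuous q t)
  (hch : forall t, J t -> continuous h t) (hcr : forall t, J t -> continuous r t).

Lemma frame_coef_derive t i j n : J t -> is_derive (fun t => c t i j n) t (d t i j n).
Proof.
  intros ht. apply is_derive_Reals. intros eps he.
  destruct (frame_coef_diff t (eps / 2) ht) as (del & hd & hdel); [lra|].
  exists (mkposreal del hd). intros k hk hkd. destruct (hdel k hk hkd) as (_ & hb).
  specialize (hb i j n). lra.
Qed.

(** Follows from the uniform convergence of difference quotients, with tolerance $1$; one bound for
    all entries and frequencies is the form that [compact_bound] takes as input. *)
Lemma frame_local_bound t : J t -> exists del B, 0 < del /\ forall t', Rabs (t' - t) < del ->
  forall p : nat * nat * Z, Rabs (c t' (fst (fst p)) (snd (fst p)) (snd p)) <= B.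
Proof.
  intros ht. destruct (frame_coef_diff t 1 ht Rlt_0_1) as (del & hd & hdel).
  destruct (frame_rep1 t ht) as (B & b1 & b2). assert (hB := mrep_ge0 _ _ _ _ b1).
  exists (Rmin del 1), (B + (B + 1)). split; [apply Rmin_glb_lt; lra|].
  intros t' ht' ((i, j), n). simpl.
  assert (c1 : Rabs (c t i j n) <= B) by (apply (rep_cf1 w1 weight_w1 _ _ _ n (b1 i j))).
  assert (c2 : Rabs (d t i j n) <= B) by (apply (rep_cf1 w1 weight_w1 _ _ _ n (b2 i j))).
  destruct (Req_dec t' t) as [->|hne]; [lra|].
  set (k := t' - t) in *. assert (hk : k <> 0) by (unfold k; lra).
  assert (hk1 := Rlt_le_trans _ _ _ ht' (Rmin_l _ _)). assert (hk2 := Rlt_le_trans _ _ _ ht' (Rmin_r _ _)).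
  destruct (hdel k hk hk1) as (_ & hb). specialize (hb i j n).
  replace (t + k) with t' in hb by (unfold k; ring).
  set (z := (c t' i j n - c t i j n) / k - d t i j n) in *.
  replace (c t' i j n) with (c t i j n + k * (z + d t i j n)) by (unfold z; field; auto).
  eapply Rle_trans; [apply Rabs_triang|]. rewrite Rabs_mult.
  generalize (Rabs_triang z (d t i j n)) (Rabs_pos k) (Rabs_pos (z + d t i j n)). intros. nra.
Qed.

(** The potential has the frequencies $-1,0,1$ only, so the coefficient $n$ of the derivative is
    made of three terms, with coefficients of index $n-1$, $n$ and $n+1$ of the frame. *)
Lemma frame_deriv_bound t K0 i j n M1 M2 M3 : J t ->
  Rabs (a t) <= K0 -> Rabs (q t) <= K0 -> Rabs (h t) <= K0 -> Rabs (r t) <= K0 ->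
  (forall j, Rabs (c t i j n) <= M1) -> (forall j, Rabs (c t i j (n - 1)) <= M2) ->
  (forall j, Rabs (c t i j (n + 1)) <= M3) -> Rabs (d t i j n) <= K0 * (M1 + M2 + M3).
Proof.
  intros ht ka kq kh kr m1 m2 m3.
  assert (pK := Rle_trans _ _ _ (Rabs_pos _) ka).
  assert (p1 := Rle_trans _ _ _ (Rabs_pos _) (m1 O)). assert (p2 := Rle_trans _ _ _ (Rabs_pos _) (m2 O)).
  assert (p3 := Rle_trans _ _ _ (Rabs_pos _) (m3 O)).
  destruct (frame_rep1 t ht) as (B & b1 & b2).
  assert (mul : forall x y X Y, Rabs x <= X -> Rabs y <= Y -> Rabs (x * y) <= X * Y).
  { intros x y X Y hx hy. rewrite Rabs_mult. apply Rmult_le_compat; auto; apply Rabs_pos. }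
  assert (tri : forall x y z X Y Z, Rabs x <= X -> Rabs y <= Y -> Rabs z <= Z -> Rabs (x + y + z) <= X + Y + Z).
  { intros. eapply Rle_trans; [apply Rabs_triang|]. eapply Rle_trans; [apply Rplus_le_compat_r, Rabs_triang|]. lra. }
  destruct (cf_pot B (F t) (a t) (q t) (h t) (r t) i n b1) as (e0 & e1).
  destruct j as [|[|j]].
  - unfold d, D. rewrite e0. unfold Rminus.
    replace (K0 * (M1 + M2 + M3)) with (K0 * M1 + K0 * M2 + K0 * M3) by ring.
    apply tri; [apply mul; auto; apply (m1 O)|apply mul; auto; apply (m2 1%nat)|].
    rewrite Rabs_Ropp. apply mul; auto; apply (m3 1%nat).
  - unfold d, D. rewrite e1. unfold Rminus.
    replace (K0 * (M1 + M2 + M3)) with (K0 * M1 + K0 * M2 + K0 * M3) by ring.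
    apply tri; [|rewrite Rabs_Ropp; apply mul; auto; apply (m2 O)|apply mul; auto; apply (m3 O)].
    apply mul; [rewrite Rabs_Ropp; auto|apply (m1 1%nat)].
  - unfold d. rewrite (cf_ext _ (fun _ => RtoC 0)); [rewrite cf_const|].
    + destruct Z.eq_dec; rewrite Rabs_R0; apply Rmult_le_pos; lra.
    + intros l _. rewrite (ent_out (K := C_Ring)) by lia. reflexivity.
Qed.

(** At [t0] the frame is the identity and its coefficients of index $n\ne0$ vanish. As the equation
    links neighbouring frequencies only, $|n|$ integrations from [t0] are available for the
    coefficient $n$, which puts $|n|!$ into the denominator. *)
Lemma frame_majorant T1 T2 : J T1 -> J T2 -> T1 <= t0 <= T2 -> exists (G G' : Z -> R) B,
  bsum (fun n => w2 n * G n) B /\ bsum (fun n => w2 n * G' n) B /\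
  (forall t i j n, T1 <= t <= T2 -> Rabs (c t i j n) <= G n) /\
  (forall t i j n, T1 <= t <= T2 -> Rabs (d t i j n) <= G' n).
Proof.
  intros hT1 hT2 h12.
  assert (hseg : forall t, T1 <= t <= T2 -> J t) by (intros; apply (hconv T1 t T2); auto).
  assert (hcb : forall f : R -> R, (forall t, J t -> continuous f t) -> exists B, forall t, T1 <= t <= T2 -> forall i : unit, Rabs (f t) <= B).
  { intros f hf. apply (compact_bound (fun t (_ : unit) => f t)); [lra|]. intros t ht.
    destruct (hf t (hseg t ht) (fun v => Rabs (v - f t) < 1)) as (del & hdel).
    { exists (mkposreal 1 Rlt_0_1). auto. }
    exists del, (Rabs (f t) + 1). split; [apply cond_pos|]. intros t' _ ht' _.
    specialize (hdel t' ht'). replace (f t') with (f t + (f t' - f t)) by ring.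
    eapply Rle_trans; [apply Rabs_triang|]. lra. }
  destruct (hcb a hca) as (Ka & ka). destruct (hcb q hcq) as (Kq & kq).
  destruct (hcb h hch) as (Kh & kh). destruct (hcb r hcr) as (Kr & kr).
  pose (K0 := Rabs Ka + Rabs Kq + Rabs Kh + Rabs Kr).
  assert (hK0 : 0 <= K0) by (unfold K0; generalize (Rabs_pos Ka) (Rabs_pos Kq) (Rabs_pos Kh) (Rabs_pos Kr); lra).
  assert (kall : forall t, T1 <= t <= T2 -> Rabs (a t) <= K0 /\ Rabs (q t) <= K0 /\ Rabs (h t) <= K0 /\ Rabs (r t) <= K0).
  { intros t ht. specialize (ka t ht tt). specialize (kq t ht tt). specialize (kh t ht tt). specialize (kr t ht tt).
    unfold K0. generalize (Rabs_pos Ka) (Rabs_pos Kq) (Rabs_pos Kh) (Rabs_pos Kr)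
     (Rle_abs Ka) (Rle_abs Kq) (Rle_abs Kh) (Rle_abs Kr). lra. }
  destruct (compact_bound (fun t (p : nat * nat * Z) => c t (fst (fst p)) (snd (fst p)) (snd p)) T1 T2) as (B & hB); [lra|..].
  { intros t ht. destruct (frame_local_bound t (hseg t ht)) as (del & B & hd & hb).
    exists del, B. split; auto. }
  assert (hB' : forall t i j n, T1 <= t <= T2 -> Rabs (c t i j n) <= B).
  { intros t i j n ht. apply (hB t ht ((i, j), n)). }
  assert (pB : 0 <= B) by (eapply Rle_trans; [apply Rabs_pos|apply (hB' t0 O O 0%Z h12)]).
  pose (K := 3 * K0). assert (hK : 0 <= K) by (unfold K; lra).
  (* Induction on the number $m\le|n|$ of integrations: if $m+1\le|n|$, the neighbours of $n$ have
     absolute value at least $m$. The rate is [K = 3 * K0], one [K0] for each of the three terms. *)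
  assert (dec : forall m t i j n, T1 <= t <= T2 -> (m <= Z.abs_nat n)%nat ->
     Rabs (c t i j n) <= B * ((K * Rabs (t - t0)) ^ m / INR (fact m))).
  { induction m as [|m IH]; intros t i j n ht hn.
    - simpl. rewrite Rdiv_1_r, Rmult_1_r. auto.
    - assert (hx : forall x, 0 <= x <= 1 -> T1 <= t0 + x * (t - t0) <= T2) by (intros; nra).
      apply (power_bound (fun t => c t i j n) (fun t => d t i j n)); auto.
      + intros x hx'. apply frame_coef_derive, hseg, hx, hx'.
      + unfold c. rewrite <- (cf_one i j n); [|lia].
        rewrite (cf_ext (fun l => ent (F t0 l) i j) (fun _ => ent (Mone : M2 C) i j)); auto.
        intros l hl. rewrite hinit; auto.
      + intros x hx'. specialize (hx x hx'). destruct (kall _ hx) as (k1 & k2 & k3 & k4).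
        set (tau := t0 + x * (t - t0)) in *.
        assert (hab : x * Rabs (t - t0) = Rabs (tau - t0)).
        { unfold tau. replace (t0 + x * (t - t0) - t0) with (x * (t - t0)) by ring.
          rewrite Rabs_mult, (Rabs_right x) by lra. auto. }
        rewrite hab.
        set (M := B * ((K * Rabs (tau - t0)) ^ m / INR (fact m))).
        replace (B * K * ((K * Rabs (tau - t0)) ^ m / INR (fact m))) with (K0 * (M + M + M)) by (unfold M, K; ring).
        apply frame_deriv_bound; auto; intros j'; apply IH; auto; lia. }
  pose (Y := K * (T2 - T1)). assert (hY : 0 <= Y) by (unfold Y; apply Rmult_le_pos; lra).
  pose (G := fun n => B * (Y ^ Z.abs_nat n / INR (fact (Z.abs_nat n)))).
  assert (hG1 : forall t i j n, T1 <= t <= T2 -> Rabs (c t i j n) <= G n).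
  { intros t i j n ht. eapply Rle_trans; [apply (dec (Z.abs_nat n)); auto|].
    unfold G. apply Rmult_le_compat_l; auto. apply Rmult_le_compat_r; [left; apply Rinv_0_lt_compat, INR_fact_lt_0|].
    apply pow_incr. split; [apply Rmult_le_pos; auto; apply Rabs_pos|].
    unfold Y. apply Rmult_le_compat_l; auto. apply Rabs_le; lra. }
  destruct (bsum_fact B Y pB hY) as (B2 & hB2). change (bsum (fun n => w2 n * G n) B2) in hB2.
  assert (hG0 : forall n, 0 <= G n) by (intros n; eapply Rle_trans; [apply Rabs_pos|apply (hG1 t0 O O n h12)]).
  pose (G' := fun n => K0 * (G n + G (n - 1)%Z + G (n + 1)%Z)).
  assert (pB2 := bsum_ge0 _ _ hB2).
  (* Shifting the frequency by one changes the weight by a factor of at most $2$. *)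
  assert (sh : forall k, (k = 1 \/ k = -1)%Z -> bsum (fun n => w2 n * G (n + k)%Z) (2 * B2)).
  { intros k hk.
    assert (hi : bsum (fun n => w2 (n + k)%Z * G (n + k)%Z) B2).
    { apply (bsum_inj (fun n => (n + k)%Z) (fun n => w2 n * G n)); auto. lia. }
    eapply bsum_le; [|apply (bsum_scal _ _ 2 ltac:(lra) hi)]. intros n; simpl.
    rewrite <- Rmult_assoc. apply Rmult_le_compat_r; auto.
    replace (w2 n) with (w2 ((n + k) + - k)%Z) by (f_equal; lia).
    eapply Rle_trans; [apply weight_w2|]. rewrite Rmult_comm. apply Rmult_le_compat_r; [apply w_ge0, weight_w2|].
    unfold w2. destruct hk as [-> | ->]; simpl; lra. }
  exists G, G', (B2 + K0 * (B2 + 2 * B2 + 2 * B2)).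
  assert (0 <= K0 * (B2 + 2 * B2 + 2 * B2)) by (apply Rmult_le_pos; lra).
  split; [|split; [|split]]; auto.
  - eapply bsum_mono; eauto; lra.
  - eapply bsum_mono; [|apply Rle_refl].
    eapply (bsum_mono _ (K0 * (B2 + 2 * B2 + 2 * B2))); [|lra].
    eapply bsum_le; [|apply (bsum_scal _ _ K0 hK0 (bsum_plus _ _ _ _ (bsum_plus _ _ _ _ hB2 (sh (-1)%Z ltac:(lia))) (sh 1%Z ltac:(lia))))].
    intros n; cbv beta. unfold G'. right. replace (n + -1)%Z with (n - 1)%Z by lia. ring.
  - intros t i j n ht. destruct (kall _ ht) as (k1 & k2 & k3 & k4).
    apply frame_deriv_bound; auto.
Qed.

(** Dominated convergence: the majorant of the derivative controls the remainder outside a finite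
    set of frequencies, and the uniform convergence of the difference quotients controls it on that
    set. *)
Lemma frame_adiff t : J t -> exists B, mrep w2 allz B (F t) /\ mrep w2 allz B (D t) /\
  forall eps, 0 < eps -> exists del, 0 < del /\ forall k, Rabs k < del ->
    mrep w2 allz (eps * Rabs k) (fun l => csub (F (t + k) l) (cadd (F t l) (mscal (RtoC k) (D t l)))).
Proof.
  intros ht. destruct (hJ t ht) as (dJ & pJ & hdJ).
  pose (T1 := Rmin t0 (t - dJ / 2)). pose (T2 := Rmax t0 (t + dJ / 2)).
  assert (hT1 : J T1) by (unfold T1, Rmin; destruct Rle_dec; auto; apply hdJ, Rabs_lt_between; lra).
  assert (hT2 : J T2) by (unfold T2, Rmax; destruct Rle_dec; auto; apply hdJ, Rabs_lt_between; lra).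
  assert (hT12 : T1 <= t0 <= T2) by (split; [apply Rmin_l|apply Rmax_l]).
  assert (hT1t : T1 <= t - dJ / 2) by apply Rmin_r. assert (hT2t : t + dJ / 2 <= T2) by apply Rmax_r.
  destruct (frame_majorant T1 T2 hT1 hT2 hT12) as (G & G' & B & hG1 & hG2 & hc & hd).
  assert (htt : T1 <= t <= T2) by lra.
  assert (hseg : forall t, T1 <= t <= T2 -> J t) by (intros; apply (hconv T1 t1 T2); auto).
  assert (pw := w_ge0 w2 weight_w2).
  assert (rF : forall t, T1 <= t <= T2 -> mrep w2 allz B (F t)).
  { intros t' ht'. destruct (frame_rep1 t' (hseg t' ht')) as (B1 & b1 & _).
    intros i j. destruct (b1 i j) as (_ & h2 & h3). split; [|split]; auto.
    eapply bsum_le; [|apply hG1]. intros n; simpl. apply Rmult_le_compat_l; auto. exact (hc t' i j n ht'). }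
  assert (rD : mrep w2 allz B (D t)).
  { destruct (frame_rep1 t ht) as (B1 & _ & b1).
    intros i j. destruct (b1 i j) as (_ & h2 & h3). split; [|split]; auto.
    eapply bsum_le; [|apply hG2]. intros n; simpl. apply Rmult_le_compat_l; auto. exact (hd t i j n htt). }
  exists B. split; [auto|]. split; auto. intros eps he.
  assert (hG'0 : forall n, 0 <= G' n) by (intros n; eapply Rle_trans; [apply Rabs_pos|apply (hd t O O n htt)]).
  assert (hterm : forall n, 0 <= w2 n * G' n) by (intros; apply Rmult_le_pos; auto).
  (* The remainder at frequency [n] is at most [2 * Rabs k * G' n], so a tail of [eps / 4] costs
     half of [eps]. *)
  destruct (bsum_tail _ _ hterm hG2 (eps / 4)) as (l0 & hl0 & htail); [lra|].
  pose (Wt := rsum w2 l0 + 1). assert (hWt : 0 < Wt) by (unfold Wt; generalize (rsum_ge0 w2 l0 pw); lra).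
  assert (he2 : 0 < eps / (2 * Wt)) by (apply Rdiv_lt_0_compat; lra).
  destruct (frame_coef_diff t _ ht he2) as (del & pdel & hdel).
  exists (Rmin del (dJ / 2)). split; [apply Rmin_glb_lt; lra|]. intros k hk.
  assert (hk1 := Rlt_le_trans _ _ _ hk (Rmin_l _ _)). assert (hk2 := Rlt_le_trans _ _ _ hk (Rmin_r _ _)).
  assert (htk : T1 <= t + k <= T2) by (apply Rabs_lt_between in hk2; lra).
  set (E := fun l => csub (F (t + k) l) (cadd (F t l) (mscal (RtoC k) (D t l)))).
  assert (rE : mrep w2 allz (B + (B + Rabs k * B)) E).
  { apply (mrep_minus w2 weight_w2); auto. apply (mrep_plus w2 weight_w2); auto. apply (mrep_scal w2 weight_w2); auto. }
  assert (ecf : forall i j n, cf (fun l => ent (E l) i j) n = c (t + k) i j n - c t i j n - k * d t i j n).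
  { intros i j n.
    assert (r1 := rep_scal w2 weight_w2 _ _ _ (- k) (rD i j)).
    assert (r2 := rep_scal w2 weight_w2 _ _ _ (-1) (rF t htt i j)).
    rewrite (cf_ext _ (fun l => (ent (F (t + k) l) i j + RtoC (-1) * ent (F t l) i j) + RtoC (- k) * ent (D t l) i j)%C).
    2: { intros l _. unfold E. rewrite entC_csub, entC_cadd, entC_mscal, RtoC_m1, RtoC_opp. ring. }
    rewrite (cf_plus w2 weight_w2 _ _ _ _ _ _ n (rep_plus w2 weight_w2 _ _ _ _ _ (rF _ htk i j) r2) r1).
    rewrite (cf_plus w2 weight_w2 _ _ _ _ _ _ n (rF _ htk i j) r2).
    rewrite (cf_scal w2 weight_w2 _ _ _ (- k) n (rD i j)), (cf_scal w2 weight_w2 _ _ _ (-1) n (rF t htt i j)).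
    unfold c, d. ring. }
  intros i j. destruct (rE i j) as (_ & h2 & h3). split; [|split]; auto.
  intros l hl.
  assert (hsmall : forall n, Rabs (cf (fun l => ent (E l) i j) n) <= eps / (2 * Wt) * Rabs k).
  { intros n. rewrite ecf. destruct (Req_dec k 0) as [->|hk0].
    - rewrite Rplus_0_r. replace (c t i j n - c t i j n - 0 * d t i j n) with 0 by ring. rewrite Rabs_R0; lra.
    - destruct (hdel k hk0 hk1) as (_ & hb). specialize (hb i j n).
      replace (c (t + k) i j n - c t i j n - k * d t i j n) with (((c (t + k) i j n - c t i j n) / k - d t i j n) * k) by (field; auto).
      rewrite Rabs_mult. apply Rmult_le_compat_r; auto. apply Rabs_pos. }
  assert (hbig : forall n, Rabs (cf (fun l => ent (E l) i j) n) <= 2 * Rabs k * G' n).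
  { intros n. rewrite ecf.
    assert (hlip : Rabs (c (t + k) i j n - c t i j n) <= G' n * Rabs k).
    { destruct (MVT_gen (fun t => c t i j n) t (t + k) (fun t => d t i j n)) as (x & hx & ex).
      - intros x hx. apply frame_coef_derive, hseg. revert hx. unfold Rmin, Rmax. destruct Rle_dec; lra.
      - intros x hx. apply derivable_continuous_pt. eexists. apply is_derive_Reals. apply frame_coef_derive, hseg.
        revert hx. unfold Rmin, Rmax. destruct Rle_dec; lra.
      - rewrite ex. replace (t + k - t) with k by ring. rewrite Rabs_mult. apply Rmult_le_compat_r; [apply Rabs_pos|].
        apply hd. revert hx. unfold Rmin, Rmax. destruct Rle_dec; lra. }
    unfold Rminus at 1. eapply Rle_trans; [apply Rabs_triang|]. rewrite Rabs_Ropp, Rabs_mult.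
    generalize (hd t i j n htt) (Rabs_pos k). intros. nra. }
  assert (hsplit : rsum (fun n => w2 n * Rabs (cf (fun l => ent (E l) i j) n)) l <=
    rsum (fun n => w2 n * Rabs (cf (fun l => ent (E l) i j) n)) l0 +
    rsum (fun n => w2 n * Rabs (cf (fun l => ent (E l) i j) n)) (filter (fun n => if in_dec Z.eq_dec n l0 then false else true) l)).
  { rewrite <- rsum_app. apply rsum_incl; auto.
    - intros n. apply Rmult_le_pos; auto. apply Rabs_pos.
    - intros n hn. apply in_app_iff. destruct (in_dec Z.eq_dec n l0) as [hi|hi]; [left; auto|right].
      apply filter_In. split; auto. destruct in_dec; tauto. }
  eapply Rle_trans; [apply hsplit|].
  assert (q1 : rsum (fun n => w2 n * Rabs (cf (fun l => ent (E l) i j) n)) l0 <= eps / 2 * Rabs k).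
  { apply Rle_trans with (rsum (fun n => (eps / (2 * Wt) * Rabs k) * w2 n) l0).
    - apply rsum_le. intros n _. rewrite Rmult_comm. apply Rmult_le_compat_r; auto.
    - rewrite rsum_scal. apply Rle_trans with (eps / (2 * Wt) * Rabs k * Wt).
      + apply Rmult_le_compat_l; [|unfold Wt; lra]. apply Rmult_le_pos; [lra|apply Rabs_pos].
      + right. field; lra. }
  assert (q2 : rsum (fun n => w2 n * Rabs (cf (fun l => ent (E l) i j) n)) (filter (fun n => if in_dec Z.eq_dec n l0 then false else true) l) <= eps / 2 * Rabs k).
  { apply Rle_trans with (rsum (fun n => (2 * Rabs k) * (w2 n * G' n)) (filter (fun n => if in_dec Z.eq_dec n l0 then false else true) l)).
    - apply rsum_le. intros n _. replace (2 * Rabs k * (w2 n * G' n)) with (w2 n * (2 * Rabs k * G' n)) by ring.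
      apply Rmult_le_compat_l; auto.
    - rewrite rsum_scal. replace (eps / 2 * Rabs k) with ((2 * Rabs k) * (eps / 4)) by field.
      apply Rmult_le_compat_l; [generalize (Rabs_pos k); lra|]. apply htail.
      + apply NoDup_filter; auto.
      + intros n hn. apply filter_In in hn. destruct hn as (_ & hn). destruct in_dec; [discriminate|auto]. }
  lra.
Qed.

End Frame.

(** * Smooth functions *)

Definition fdiff (f : R -> R -> R) (x y p q : R) : Prop := forall eps, 0 < eps -> exists d, 0 < d /\
  forall u v, Rabs u < d -> Rabs v < d ->
    Rabs (f (x + u) (y + v) - f x y - (u * p + v * q)) <= eps * (Rabs u + Rabs v).

Lemma fdiff_partial f x y p q : fdiff f x y p q ->
  is_derive (fun t => f t y) x p /\ is_derive (fun t => f x t) y q.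
Proof.
  intros h. split; apply is_derive_Reals; intros eps he;
    destruct (h (eps / 2)) as (d & hd & hf); try lra; exists (mkposreal d hd); intros k hk hkd; simpl in hkd.
  - specialize (hf k 0 hkd). rewrite Rabs_R0, Rplus_0_r in hf. specialize (hf hd).
    replace ((f (x + k) y - f x y) / k - p) with ((f (x + k) y - f x y - (k * p + 0 * q)) / k) by (field; auto).
    unfold Rdiv at 1. rewrite Rabs_mult, Rabs_inv. assert (hp : 0 < Rabs k) by (apply Rabs_pos_lt; auto).
    apply Rle_lt_trans with ((eps / 2 * (Rabs k + 0)) * / Rabs k).
    + apply Rmult_le_compat_r; [left; apply Rinv_0_lt_compat; auto|auto].
    + field_simplify; lra.
  - specialize (hf 0 k). rewrite Rabs_R0, Rplus_0_r in hf. specialize (hf hd hkd).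
    replace ((f x (y + k) - f x y) / k - q) with ((f x (y + k) - f x y - (0 * p + k * q)) / k) by (field; auto).
    unfold Rdiv at 1. rewrite Rabs_mult, Rabs_inv. assert (hp : 0 < Rabs k) by (apply Rabs_pos_lt; auto).
    apply Rle_lt_trans with ((eps / 2 * (0 + Rabs k)) * / Rabs k).
    + apply Rmult_le_compat_r; [left; apply Rinv_0_lt_compat; auto|auto].
    + field_simplify; lra.
Qed.

Lemma fdiff_near f x y p q : fdiff f x y p q -> exists K d, 0 <= K /\ 0 < d /\
  forall u v, Rabs u < d -> Rabs v < d -> Rabs (f (x + u) (y + v) - f x y) <= K * (Rabs u + Rabs v).
Proof.
  intros h. destruct (h 1 Rlt_0_1) as (d & hd & hf). exists (1 + Rabs p + Rabs q), d.
  split; [generalize (Rabs_pos p) (Rabs_pos q); lra|]. split; auto. intros u v hu hv.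
  specialize (hf u v hu hv).
  replace (f (x + u) (y + v) - f x y) with ((f (x + u) (y + v) - f x y - (u * p + v * q)) + (u * p + v * q)) by ring.
  eapply Rle_trans; [apply Rabs_triang|].
  assert (Rabs (u * p + v * q) <= Rabs u * Rabs p + Rabs v * Rabs q).
  { eapply Rle_trans; [apply Rabs_triang|]. rewrite !Rabs_mult. lra. }
  generalize (Rabs_pos u) (Rabs_pos v) (Rabs_pos p) (Rabs_pos q). nra.
Qed.

Lemma fdiff_continuous f x y p q : fdiff f x y p q -> continuity_2d_pt f x y.
Proof.
  intros h eps. destruct (fdiff_near _ _ _ _ _ h) as (K & d & hK & hd & hf).
  assert (he := cond_pos eps).
  assert (hd2 : 0 < Rmin d (eps / (2 * K + 2))).
  { apply Rmin_glb_lt; auto. apply Rdiv_lt_0_compat; lra. }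
  exists (mkposreal _ hd2). intros u v hu hv. simpl in hu, hv.
  assert (hu1 := Rlt_le_trans _ _ _ hu (Rmin_l _ _)). assert (hu2 := Rlt_le_trans _ _ _ hu (Rmin_r _ _)).
  assert (hv1 := Rlt_le_trans _ _ _ hv (Rmin_l _ _)). assert (hv2 := Rlt_le_trans _ _ _ hv (Rmin_r _ _)).
  specialize (hf (u - x) (v - y) hu1 hv1).
  replace (x + (u - x)) with u in hf by ring. replace (y + (v - y)) with v in hf by ring.
  eapply Rle_lt_trans; [apply hf|].
  apply Rle_lt_trans with (K * (2 * (eps / (2 * K + 2)))); [apply Rmult_le_compat_l; lra|].
  apply Rmult_lt_reg_r with (2 * K + 2); [lra|]. field_simplify; nra.
Qed.

Lemma fdiff_plus f g x y p q p' q' : fdiff f x y p q -> fdiff g x y p' q' ->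
  fdiff (fun x y => f x y + g x y) x y (p + p') (q + q').
Proof.
  intros hf hg eps he. destruct (hf (eps / 2)) as (d1 & p1 & h1); [lra|].
  destruct (hg (eps / 2)) as (d2 & p2 & h2); [lra|].
  exists (Rmin d1 d2). split; [apply Rmin_glb_lt; auto|]. intros u v hu hv.
  specialize (h1 u v (Rlt_le_trans _ _ _ hu (Rmin_l _ _)) (Rlt_le_trans _ _ _ hv (Rmin_l _ _))).
  specialize (h2 u v (Rlt_le_trans _ _ _ hu (Rmin_r _ _)) (Rlt_le_trans _ _ _ hv (Rmin_r _ _))).
  replace (f (x + u) (y + v) + g (x + u) (y + v) - (f x y + g x y) - (u * (p + p') + v * (q + q'))) with
    ((f (x + u) (y + v) - f x y - (u * p + v * q)) + (g (x + u) (y + v) - g x y - (u * p' + v * q'))) by ring.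
  eapply Rle_trans; [apply Rabs_triang|]. lra.
Qed.

Lemma fdiff_mult f g x y p q p' q' : fdiff f x y p q -> fdiff g x y p' q' ->
  fdiff (fun x y => f x y * g x y) x y (p * g x y + f x y * p') (q * g x y + f x y * q').
Proof.
  intros hf hg eps he.
  destruct (fdiff_near _ _ _ _ _ hf) as (K & d1 & hK & p1 & h1).
  destruct (fdiff_near _ _ _ _ _ hg) as (K' & d2 & hK' & p2 & h2).
  set (A := Rabs (f x y) + Rabs (g x y) + 1).
  assert (hA : 0 < A) by (unfold A; generalize (Rabs_pos (f x y)) (Rabs_pos (g x y)); lra).
  assert (he2 : 0 < eps / (2 * A)) by (apply Rdiv_lt_0_compat; lra).
  destruct (hf _ he2) as (d3 & p3 & h3). destruct (hg _ he2) as (d4 & p4 & h4).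
  set (d5 := eps / (4 * (K * K' + 1))). assert (p5 : 0 < d5) by (unfold d5; apply Rdiv_lt_0_compat; nra).
  exists (Rmin (Rmin d1 d2) (Rmin (Rmin d3 d4) d5)).
  split; [apply Rmin_glb_lt; apply Rmin_glb_lt; auto; apply Rmin_glb_lt; auto|]. intros u v hu hv.
  assert (hmin : forall z, z < Rmin (Rmin d1 d2) (Rmin (Rmin d3 d4) d5) -> z < d1 /\ z < d2 /\ z < d3 /\ z < d4 /\ z < d5).
  { intros z. unfold Rmin. repeat destruct Rle_dec; intros; repeat split; lra. }
  destruct (hmin _ hu) as (u1 & u2 & u3 & u4 & u5). destruct (hmin _ hv) as (v1 & v2 & v3 & v4 & v5).
  specialize (h1 u v u1 v1). specialize (h2 u v u2 v2). specialize (h3 u v u3 v3). specialize (h4 u v u4 v4).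
  set (s := Rabs u + Rabs v) in *. assert (hs : 0 <= s) by (unfold s; generalize (Rabs_pos u) (Rabs_pos v); lra).
  assert (hs5 : s <= 2 * d5) by (unfold s; lra).
  set (F := f (x + u) (y + v)) in *. set (G := g (x + u) (y + v)) in *.
  replace (F * G - f x y * g x y - (u * (p * g x y + f x y * p') + v * (q * g x y + f x y * q'))) with
    ((F - f x y) * (G - g x y) + ((F - f x y - (u * p + v * q)) * g x y + f x y * (G - g x y - (u * p' + v * q')))) by ring.
  eapply Rle_trans; [apply Rabs_triang|].
  eapply Rle_trans; [apply Rplus_le_compat_l, Rabs_triang|]. rewrite !Rabs_mult.
  assert (t1 : Rabs (F - f x y) * Rabs (G - g x y) <= eps / 2 * s).
  { apply Rle_trans with ((K * s) * (K' * s)); [apply Rmult_le_compat; auto; apply Rabs_pos|].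
    replace (K * s * (K' * s)) with ((K * K' * s) * s) by ring. apply Rmult_le_compat_r; auto.
    apply Rle_trans with (K * K' * (2 * d5)); [apply Rmult_le_compat_l; auto; nra|].
    unfold d5. assert (0 < 4 * (K * K' + 1)) by nra.
    apply Rmult_le_reg_r with (4 * (K * K' + 1)); auto. field_simplify; nra. }
  assert (t2 : Rabs (F - f x y - (u * p + v * q)) * Rabs (g x y) + Rabs (f x y) * Rabs (G - g x y - (u * p' + v * q')) <= eps / 2 * s).
  { apply Rle_trans with ((eps / (2 * A) * s) * Rabs (g x y) + Rabs (f x y) * (eps / (2 * A) * s)).
    - apply Rplus_le_compat; [apply Rmult_le_compat_r; auto; apply Rabs_pos|apply Rmult_le_compat_l; auto; apply Rabs_pos].
    - replace (eps / (2 * A) * s * Rabs (g x y) + Rabs (f x y) * (eps / (2 * A) * s)) with ((eps / (2 * A) * s) * (Rabs (f x y) + Rabs (g x y))) by ring.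
      apply Rle_trans with ((eps / (2 * A) * s) * A); [|right; field; lra].
      apply Rmult_le_compat_l; [|unfold A; lra]. apply Rmult_le_pos; lra. }
  lra.
Qed.

Lemma fdiff_const c x y : fdiff (fun _ _ => c) x y 0 0.
Proof.
  intros eps he. exists 1; split; [lra|]. intros u v _ _.
  replace (c - c - (u * 0 + v * 0)) with 0 by ring. rewrite Rabs_R0.
  apply Rmult_le_pos; [lra|]. generalize (Rabs_pos u) (Rabs_pos v); lra.
Qed.

Lemma fdiff_ext f g x y p q d : 0 < d ->
  (forall u v, Rabs u < d -> Rabs v < d -> f (x + u) (y + v) = g (x + u) (y + v)) ->
  fdiff f x y p q -> fdiff g x y p q.
Proof.
  intros hd he hf eps heps. destruct (hf eps heps) as (d1 & p1 & h1).
  exists (Rmin d d1). split; [apply Rmin_glb_lt; auto|]. intros u v hu hv.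
  rewrite <- he by (eapply Rlt_le_trans; eauto; apply Rmin_l).
  assert (e0 : f x y = g x y).
  { specialize (he 0 0). rewrite !Rplus_0_r, Rabs_R0 in he. auto. }
  rewrite <- e0. apply h1; eapply Rlt_le_trans; eauto; apply Rmin_r.
Qed.

Lemma fdiff_fst f l x y : is_derive f x l -> fdiff (fun x _ => f x) x y l 0.
Proof.
  intros h eps he. apply is_derive_Reals in h. destruct (h eps he) as (d & hd).
  exists d; split; [apply cond_pos|]. intros u v hu _.
  assert (hp := Rabs_pos v). assert (hpu := Rabs_pos u).
  destruct (Req_dec u 0) as [->|hn].
  - rewrite Rplus_0_r. replace (f x - f x - (0 * l + v * 0)) with 0 by ring. rewrite Rabs_R0.
    apply Rmult_le_pos; lra.
  - specialize (hd u hn hu).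
    replace (f (x + u) - f x - (u * l + v * 0)) with (((f (x + u) - f x) / u - l) * u) by (field; auto).
    rewrite Rabs_mult. nra.
Qed.

Lemma fdiff_swap f x y p q : fdiff f x y p q -> fdiff (fun y x => f x y) y x q p.
Proof.
  intros h eps he. destruct (h eps he) as (d & hd & hf). exists d; split; auto. intros u v hu hv.
  rewrite (Rplus_comm (Rabs u)), (Rplus_comm (u * q)). auto.
Qed.

Section Class.

Context (M : R -> R -> Prop) (hM : open2 M) (base : (R -> R -> R) -> Prop).

(** The algebra generated by [base]. If the partial derivatives of the generators stay in it, those
    of all elements do, and smoothness follows by induction on the order. *)
Inductive cls : (R -> R -> R) -> Prop :=
  | cls_base f : base f -> cls f
  | cls_const c : cls (fun _ _ => c)
  | cls_plus f g : cls f -> cls g -> cls (fun x y => f x y + g x y)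
  | cls_mult f g : cls f -> cls g -> cls (fun x y => f x y * g x y).

Hypothesis (hbase : forall f, base f -> exists fx fy, cls fx /\ cls fy /\
  forall x y, M x y -> fdiff f x y (fx x y) (fy x y)).

Lemma cls_diff f : cls f -> exists fx fy, cls fx /\ cls fy /\
  forall x y, M x y -> fdiff f x y (fx x y) (fy x y).
Proof.
  induction 1 as [f hf|c|f g hf (fx & fy & c1 & c2 & df) hg (gx & gy & c1' & c2' & dg)
     |f g hf (fx & fy & c1 & c2 & df) hg (gx & gy & c1' & c2' & dg)]; auto.
  - exists (fun _ _ => 0), (fun _ _ => 0). split; [apply cls_const|split; [apply cls_const|]]. intros; apply fdiff_const.
  - exists (fun x y => fx x y + gx x y), (fun x y => fy x y + gy x y).
    split; [apply cls_plus; auto|split; [apply cls_plus; auto|]]. intros. apply fdiff_plus; auto.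
  - exists (fun x y => fx x y * g x y + f x y * gx x y), (fun x y => fy x y * g x y + f x y * gy x y).
    split; [apply cls_plus; apply cls_mult; auto|split; [apply cls_plus; apply cls_mult; auto|]].
    intros. apply fdiff_mult; auto.
Qed.

Lemma cls_ex_diff_n n : forall f, cls f -> forall x y, M x y -> ex_diff_n f n x y.
Proof.
  induction n as [|n IH]; intros f hf x y hxy; destruct (cls_diff f hf) as (fx & fy & c1 & c2 & d).
  - split; auto. eapply fdiff_continuous; eauto.
  - assert (hpart : forall x y, M x y -> is_derive (fun t => f t y) x (fx x y) /\ is_derive (fun t => f x t) y (fy x y)).
    { intros x' y' h'. apply fdiff_partial; auto. }
    split; [eapply fdiff_continuous; eauto|]. split; [|split; [|split]].
    + exists (fx x y). exact (proj1 (hpart x y hxy)).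
    + exists (fy x y). exact (proj2 (hpart x y hxy)).
    + apply (ex_diff_n_ext_loc fx); auto. generalize (hM x y hxy).
      apply locally_2d_impl, locally_2d_forall. intros u v huv. symmetry. apply is_derive_unique, hpart; auto.
    + apply (ex_diff_n_ext_loc fy); auto. generalize (hM x y hxy).
      apply locally_2d_impl, locally_2d_forall. intros u v huv. symmetry. apply is_derive_unique, hpart; auto.
Qed.

End Class.

Section Smooth1.

Context (J : R -> Prop) (hJ : opn J).

(** The derivatives are existential witnesses rather than values of [Derive]; sums, products,
    inverses and roots are then handled by plain induction on [n]. *)
Fixpoint ck (n : nat) (f : R -> R) : Prop := match n with
  | O => True
  | S n => exists f', ck n f' /\ forall t, J t -> is_derive f t (f' t)
  end.

Definition csm (f : R -> R) : Prop := forall n, ck n f.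

Lemma opn_locally t : J t -> locally t J.
Proof. intros ht. destruct (hJ t ht) as (d & hd & h). exists (mkposreal d hd). intros y hy. apply h, hy. Qed.

Lemma ck_ext n f g : (forall t, J t -> f t = g t) -> ck n f -> ck n g.
Proof.
  destruct n; simpl; auto. intros e (f' & h1 & h2). exists f'; split; auto.
  intros t ht. apply (is_derive_ext_loc f); auto.
  generalize (opn_locally t ht). apply filter_imp. auto.
Qed.

Lemma ck_le n f : ck (S n) f -> ck n f.
Proof.
  revert f; induction n; intros f; [simpl; auto|].
  intros (f' & h1 & h2). exists f'. split; auto.
Qed.

Lemma ck_const n c : ck n (fun _ => c).
Proof.
  revert c; induction n; intros c; simpl; auto. exists (fun _ => 0). split; auto.
  intros; apply (is_derive_const (K := R_AbsRing) (V := R_NormedModule)).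
Qed.

Lemma ck_plus n f g : ck n f -> ck n g -> ck n (fun t => f t + g t).
Proof.
  revert f g; induction n; intros f g; simpl; auto.
  intros (f' & h1 & h2) (g' & h1' & h2'). exists (fun t => f' t + g' t). split; auto.
  intros t ht. apply (is_derive_plus (K := R_AbsRing) (V := R_NormedModule)); auto.
Qed.

Lemma ck_mult n f g : ck n f -> ck n g -> ck n (fun t => f t * g t).
Proof.
  revert f g; induction n; intros f g hf hg; simpl; auto.
  assert (hf0 := ck_le _ _ hf). assert (hg0 := ck_le _ _ hg).
  destruct hf as (f' & h1 & h2), hg as (g' & h1' & h2'). exists (fun t => f' t * g t + f t * g' t).
  split; [apply ck_plus; auto|].
  intros t ht. apply (is_derive_mult (K := R_AbsRing)); auto. intros; apply Rmult_comm.
Qed.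

Lemma csm_const c : csm (fun _ => c).
Proof. intros n; apply ck_const. Qed.

Lemma csm_plus f g : csm f -> csm g -> csm (fun t => f t + g t).
Proof. intros h h' n; apply ck_plus; auto. Qed.

Lemma csm_mult f g : csm f -> csm g -> csm (fun t => f t * g t).
Proof. intros h h' n; apply ck_mult; auto. Qed.

Lemma csm_opp f : csm f -> csm (fun t => - f t).
Proof.
  intros h n. apply (ck_ext n (fun t => (-1) * f t)); [intros; ring|]. apply ck_mult; [apply ck_const|auto].
Qed.

Lemma csm_ext f g : (forall t, J t -> f t = g t) -> csm f -> csm g.
Proof. intros e h n. apply (ck_ext n f); auto. Qed.

Lemma csm_is_derive f t : csm f -> J t -> is_derive f t (Derive f t).
Proof.
  intros h ht. destruct (h 1%nat) as (f' & _ & hf). apply Derive_correct. eexists; apply hf; auto.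
Qed.

Lemma csm_Derive f : csm f -> csm (Derive f).
Proof.
  intros h n. destruct (h (S n)) as (f' & h1 & hf). apply (ck_ext n f'); auto.
  intros t ht. symmetry. apply is_derive_unique; auto.
Qed.

Lemma csm_Derive_n f n : csm f -> csm (Derive_n f n).
Proof.
  intros h; induction n; simpl; auto. apply csm_Derive; auto.
Qed.

Lemma csm_continuous f t : csm f -> J t -> continuous f t.
Proof.
  intros h ht. apply (@ex_derive_continuous R_AbsRing R_NormedModule). eexists. apply csm_is_derive; auto.
Qed.

Lemma csm_of_ex_derive_n f : (forall n t, J t -> ex_derive_n f n t) -> csm f.
Proof.
  intros h n. revert f h; induction n; intros f h; simpl; auto.
  exists (Derive f). split.
  - apply IHn. intros m t ht. specialize (h (S m) t ht).
    destruct m; [exact I|]. change (ex_derive (Derive_n f (S m)) t) in h. change (ex_derive (Derive_n (Derive f) m) t).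
    apply (ex_derive_ext (Derive_n f (S m))); auto.
    intros x. change (Derive f) with (Derive_n f 1). rewrite Derive_n_comp. f_equal. lia.
  - intros t ht. apply Derive_correct. apply (h 1%nat t ht).
Qed.

Lemma csm_inv f : csm f -> (forall t, J t -> f t <> 0) -> csm (fun t => / f t).
Proof.
  intros h h0 n. induction n; simpl; auto.
  exists (fun t => (- Derive f t) * (/ f t * / f t)). split.
  - apply ck_mult; [apply csm_opp, csm_Derive; auto|]. apply ck_mult; auto.
  - intros t ht. evar_last.
    + apply is_derive_inv; [apply csm_is_derive; auto|auto].
    + simpl. field. auto.
Qed.

(** The derivative of the root is $\frac12f'f^{-1}e$, a product of smooth functions with [e] itself,
    so order [n] bootstraps to order [S n]. *)
Lemma csm_sqrt f e : csm f -> (forall t, J t -> 0 < e t /\ e t * e t = f t) -> csm e.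
Proof.
  intros h he.
  assert (hf0 : forall t, J t -> f t <> 0) by (intros t ht; destruct (he t ht); nra).
  assert (hes : forall t, J t -> sqrt (f t) = e t).
  { intros t ht. destruct (he t ht) as (h1 & <-). apply sqrt_square; lra. }
  intros n; induction n; simpl; auto.
  exists (fun t => Derive f t * (/ 2) * (/ f t * e t)). split.
  - apply ck_mult; [apply ck_mult; [apply csm_Derive; auto|apply ck_const]|].
    apply ck_mult; auto. apply csm_inv; auto.
  - intros t ht. apply (is_derive_ext_loc (fun t => sqrt (f t))).
    + generalize (opn_locally t ht). apply filter_imp. auto.
    + destruct (he t ht) as (h1 & h2). evar_last.
      * apply (is_derive_comp (K := R_AbsRing) (V := R_NormedModule) sqrt f t); [|apply csm_is_derive; auto].
        apply is_derive_Reals. apply derivable_pt_lim_sqrt. nra.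
      * unfold scal; simpl; unfold mult; simpl. rewrite hes by auto. rewrite <- h2. field. lra.
Qed.

End Smooth1.

(** * Bounded linear functionals of loops *)

(** The functionals through which the surface is read off: Fourier coefficients, the value at $1$
    and the $\lambda$-derivative at $1$. All have norm at most one on the weighted algebra. *)
Record lfun (L : (C -> C) -> R) : Prop := {
  lf_ext : forall g h, (forall l, Cmod l = 1 -> g l = h l) -> L g = L h;
  lf_plus : forall B B' g h, rep w2 allz B g -> rep w2 allz B' h -> L (fun l => g l + h l)%C = L g + L h;
  lf_scal : forall B g k, rep w2 allz B g -> L (fun l => RtoC k * g l)%C = k * L g;
  lf_bound : forall B g, rep w2 allz B g -> Rabs (L g) <= B }.

Lemma lfun_cf n : lfun (fun g => cf g n).
Proof.
  split.
  - intros g h e. rewrite (cf_ext g h); auto.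
  - intros. eapply (cf_plus w2 weight_w2); eauto.
  - intros. eapply (cf_scal w2 weight_w2); eauto.
  - intros. eapply (rep_cf1 w2 weight_w2); eauto.
Qed.

Definition ev1 (g : C -> C) : R := Re (g (RtoC 1)).

Lemma lfun_ev1 : lfun ev1.
Proof.
  split; unfold ev1.
  - intros g h e. rewrite e; auto. apply Cmod_1.
  - intros. reflexivity.
  - intros. unfold Re; simpl. ring.
  - intros. eapply Rle_trans; [apply re_le_Cmod|]. eapply (rep_Cmod w2 weight_w2); eauto. apply Cmod_1.
Qed.

Lemma lfun_df : lfun df.
Proof.
  split.
  - intros g h e. unfold df. rewrite (cf_ext g h); auto.
  - intros B B' g h hg hh. apply RtoC_inj.
    apply (usum_unique (fun n => RtoC (IZR n * cf (fun l => g l + h l)%C n))).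
    + eapply df_spec. apply (rep_plus w2 weight_w2 _ _ _ _ _ hg hh).
    + rewrite RtoC_plus. eapply usum_ext; [|apply usum_plus; [eapply df_spec; eauto|eapply (df_spec _ _ h); eauto]].
      intros n. cbv beta. rewrite (cf_plus w2 weight_w2 _ _ _ _ _ _ n hg hh), <- RtoC_plus. f_equal. ring.
  - intros B g k hg. apply RtoC_inj.
    apply (usum_unique (fun n => RtoC (IZR n * cf (fun l => RtoC k * g l)%C n))).
    + eapply df_spec. apply (rep_scal w2 weight_w2 _ _ _ k hg).
    + rewrite RtoC_mult. eapply usum_ext; [|apply usum_scal; eapply df_spec; eauto].
      intros n. cbv beta. rewrite (cf_scal w2 weight_w2 _ _ _ k n hg), <- RtoC_mult. f_equal. ring.
  - intros. eapply df_bound; eauto.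
Qed.

Lemma lfun_fdiff L X x y P Q i j : lfun L -> adiff X x y P Q ->
  fdiff (fun x y => L (fun l => ent (X x y l) i j)) x y (L (fun l => ent (P l) i j)) (L (fun l => ent (Q l) i j)).
Proof.
  intros hL hX eps he.
  destruct (ad_X _ _ _ _ _ hX) as (B1 & b1). destruct (ad_P _ _ _ _ _ hX) as (B2 & b2).
  destruct (ad_Q _ _ _ _ _ hX) as (B3 & b3).
  destruct (adiff_near _ _ _ _ _ hX) as (K & d0 & _ & hd0 & hn).
  destruct (ad_lim _ _ _ _ _ hX eps he) as (d & hd & hlim).
  exists (Rmin d0 d). split; [apply Rmin_glb_lt; auto|]. intros u v hu hv.
  assert (b4 := proj2 (hn u v (Rlt_le_trans _ _ _ hu (Rmin_l _ _)) (Rlt_le_trans _ _ _ hv (Rmin_l _ _))) i j).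
  specialize (hlim u v (Rlt_le_trans _ _ _ hu (Rmin_r _ _)) (Rlt_le_trans _ _ _ hv (Rmin_r _ _)) i j).
  specialize (b1 i j). specialize (b2 i j). specialize (b3 i j).
  assert (s1 := rep_scal w2 weight_w2 _ _ _ (-1) b1).
  assert (s2 := rep_scal w2 weight_w2 _ _ _ (- u) b2).
  assert (s3 := rep_scal w2 weight_w2 _ _ _ (- v) b3).
  assert (s4 := rep_plus w2 weight_w2 _ _ _ _ _ s2 s3).
  assert (s5 := rep_plus w2 weight_w2 _ _ _ _ _ b4 s1).
  assert (e : L (fun l => ent (csub (X (x + u) (y + v) l) (cadd (X x y l) (lin u v P Q l))) i j) =
    L (fun l => ent (X (x + u) (y + v) l) i j) - L (fun l => ent (X x y l) i j) -
     (u * L (fun l => ent (P l) i j) + v * L (fun l => ent (Q l) i j))).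
  { rewrite (lf_ext L hL _ (fun l => (ent (X (x + u)%R (y + v)%R l) i j + RtoC (-1) * ent (X x y l) i j) +
      (RtoC (- u) * ent (P l) i j + RtoC (- v) * ent (Q l) i j))%C).
    2: { intros l _. unfold lin. rewrite entC_csub, !entC_cadd, !entC_mscal, RtoC_m1, !RtoC_opp. ring. }
    rewrite (lf_plus L hL _ _ _ _ s5 s4), (lf_plus L hL _ _ _ _ b4 s1), (lf_plus L hL _ _ _ _ s2 s3).
    rewrite (lf_scal L hL _ _ (-1) b1), (lf_scal L hL _ _ (- u) b2), (lf_scal L hL _ _ (- v) b3). ring. }
  rewrite <- e. apply (lf_bound L hL). exact hlim.
Qed.

(** * Functionals applied entrywise, and Laurent polynomial loops *)

Definition radd (A B : M2 R) : M2 R := plus A B.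
Definition rsub (A B : M2 R) : M2 R := minus A B.

Lemma entR_radd A B i j : ent (radd A B) i j = ent A i j + ent B i j.
Proof. apply entR_plus. Qed.

Lemma entR_rsub A B i j : ent (rsub A B) i j = ent A i j - ent B i j.
Proof. apply entR_minus. Qed.

Ltac eR := repeat (rewrite ?entR_radd, ?entR_rsub; entR).
Ltac mR := apply mx_extR; eR; try Rring.

Definition ML (L : (C -> C) -> R) (g : loop) : M2 R :=
  mk_matrix 2 2 (fun i j => L (fun l => ent (g l) i j)).

Lemma ent_ML L g i j : (i < 2)%nat -> (j < 2)%nat -> ent (ML L g) i j = L (fun l => ent (g l) i j).
Proof. intros. unfold ML. apply (ent_mk (K := R_Ring) (fun i j => L (fun l => ent (g l) i j))); auto. Qed.

Lemma ML_ext2 L L' g g' : (forall i j, (i < 2)%nat -> (j < 2)%nat ->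
  L (fun l => ent (g l) i j) = L' (fun l => ent (g' l) i j)) -> ML L g = ML L' g'.
Proof. intros h. apply mx_extR; rewrite !ent_ML by lia; apply h; lia. Qed.

Lemma ML_ext L g g' : lfun L -> (forall l, Cmod l = 1 -> g l = g' l) -> ML L g = ML L g'.
Proof. intros hL h. apply ML_ext2. intros. apply (lf_ext L hL). intros; rewrite h; auto. Qed.

Lemma ML_add L g h B B' : lfun L -> mrep w2 allz B g -> mrep w2 allz B' h ->
  ML L (fun l => cadd (g l) (h l)) = radd (ML L g) (ML L h).
Proof.
  intros hL hg hh. apply mx_extR; rewrite entR_radd, !ent_ML by lia;
    (rewrite <- (lf_plus L hL B B' _ _ (hg _ _) (hh _ _)); apply (lf_ext L hL); intros; apply entC_cadd).
Qed.

Lemma lf_lin2 L B g g' a b : lfun L -> rep w2 allz B g -> rep w2 allz B g' ->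
  L (fun l => RtoC a * g l + RtoC b * g' l)%C = a * L g + b * L g'.
Proof.
  intros hL hg hg'.
  rewrite (lf_plus L hL _ _ _ _ (rep_scal w2 weight_w2 _ _ _ a hg) (rep_scal w2 weight_w2 _ _ _ b hg')).
  rewrite (lf_scal L hL B g a hg), (lf_scal L hL B g' b hg'). ring.
Qed.

Lemma lf_lin2' L B g g' a b : lfun L -> rep w2 allz B g -> rep w2 allz B g' ->
  L (fun l => g l * RtoC a + g' l * RtoC b)%C = L g * a + L g' * b.
Proof.
  intros hL hg hg'. rewrite !(Rmult_comm (L _)), <- (lf_lin2 L B g g' a b hL hg hg').
  apply (lf_ext L hL). intros. ring.
Qed.

Lemma ML_mull L A g B : lfun L -> mrep w2 allz B g ->
  ML L (fun l => Mmult (cplx A) (g l)) = Mmult A (ML L g).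
Proof.
  intros hL hg. apply mx_extR; rewrite entR_mult, !ent_ML by lia;
    (rewrite <- (lf_lin2 L B _ _ _ _ hL (hg _ _) (hg _ _)); apply (lf_ext L hL); intros;
     rewrite entC_mult, !ent_cplx; reflexivity).
Qed.

Lemma ML_mulr L A g B : lfun L -> mrep w2 allz B g ->
  ML L (fun l => Mmult (g l) (cplx A)) = Mmult (ML L g) A.
Proof.
  intros hL hg. apply mx_extR; rewrite entR_mult, !ent_ML by lia;
    (rewrite <- (lf_lin2' L B _ _ _ _ hL (hg _ _) (hg _ _)); apply (lf_ext L hL); intros;
     rewrite entC_mult, !ent_cplx; reflexivity).
Qed.

(** Multiplication by $\lambda^{\pm1}$ turns the functional [L] into [Lp] or [Lm]. A product with
    $A_0+A_1\lambda+A_{-1}\lambda^{-1}$ is thereby expressed by three functionals, which closes the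
    systems of differential equations below. *)
Record shifts (L Lp Lm : (C -> C) -> R) : Prop := {
  sh_L : lfun L;
  sh_p : forall B g, rep w2 allz B g -> L (fun l => l * g l)%C = Lp g;
  sh_m : forall B g, rep w2 allz B g -> L (fun l => / l * g l)%C = Lm g }.

Lemma shifts_cf n : shifts (fun g => cf g n) (fun g => cf g (n - 1)%Z) (fun g => cf g (n + 1)%Z).
Proof.
  split.
  - apply lfun_cf.
  - intros B g hg. rewrite <- (cf_shift allz B g 1 n (rep_weaken _ _ _ hg)).
    apply (f_equal (fun f => f n)). apply cf_ext. intros; rewrite Czpow_1; auto.
  - intros B g hg. replace (n + 1)%Z with (n - -1)%Z by lia. rewrite <- (cf_shift allz B g (-1) n (rep_weaken _ _ _ hg)).
    apply (f_equal (fun f => f n)). apply cf_ext. intros; rewrite Czpow_m1; auto.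
Qed.

Lemma shifts_ev1 : shifts ev1 ev1 ev1.
Proof.
  split.
  - apply lfun_ev1.
  - intros. unfold ev1. apply f_equal. ring.
  - intros. unfold ev1. apply f_equal. field.
Qed.

Lemma Czpow_one n : Czpow (RtoC 1) n = RtoC 1.
Proof.
  assert (e : cis 0 = RtoC 1) by (unfold cis; rewrite cos_0, sin_0; reflexivity).
  rewrite <- e at 1. rewrite Czpow_cis, Rmult_0_r. exact e.
Qed.

Lemma rep_shift2 B g k : rep w2 allz B g -> rep w2 allz (w2 k * B) (fun l => Czpow l k * g l)%C.
Proof.
  intros hg. apply (rep_mult w2 weight_w2 allz allz); auto.
  - unfold allz; auto.
  - apply (rep_monomial w2 weight_w2). exact I.
Qed.

Lemma usum_RtoC_Re {T : Type} (f : T -> R) s : usum (fun t => RtoC (f t)) s -> s = RtoC (Re s).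
Proof.
  intros h. assert (e := usum_conj _ _ h).
  assert (e2 : s = Cconj s).
  { apply (usum_unique _ _ _ h). eapply usum_ext; [|exact e]. intros t. cbv beta.
    unfold Cconj, RtoC; simpl. f_equal. ring. }
  destruct s as [u v]. unfold Cconj in e2. simpl in e2. injection e2 as e2. unfold RtoC, Re; simpl. f_equal. lra.
Qed.

(** The product rule for $\lambda^kg$ at $\lambda=1$, read off from $\sum(n+k)c_n$. *)
Lemma df_shift B g k : rep w2 allz B g -> df (fun l => Czpow l k * g l)%C = df g + IZR k * ev1 g.
Proof.
  intros hg. assert (hs := rep_shift2 B g k hg).
  assert (h1 := df_spec _ _ _ hs).
  assert (h2 := df_spec _ _ _ hg). assert (h3 := proj2 (proj2 hg) (RtoC 1) Cmod_1).
  assert (h3' : usum (fun n => RtoC (cf g n)) (g (RtoC 1))).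
  { eapply usum_ext; [|exact h3]. intros n. cbv beta. rewrite Czpow_one. ring. }
  assert (e3 := usum_RtoC_Re _ _ h3').
  assert (h4 : usum (fun n => RtoC (IZR (n + k) * cf g n)) (RtoC (df g + IZR k * ev1 g))).
  { rewrite RtoC_plus, RtoC_mult. unfold ev1. rewrite <- e3.
    eapply usum_ext; [|apply usum_plus; [exact h2|apply (usum_scal (RtoC (IZR k))); exact h3']].
    intros n. cbv beta. rewrite plus_IZR, <- RtoC_mult, <- RtoC_plus. f_equal. ring. }
  apply RtoC_inj. apply (usum_unique _ _ _ h1).
  assert (h5 := usum_reindex (fun n => (n - k)%Z) (fun n => (n + k)%Z) _ _ (fun x => Z.sub_add k x) (fun x => Z.add_simpl_r x k) h4).
  eapply usum_ext; [|exact h5].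
  intros n. cbv beta. rewrite (cf_shift allz B g k _ (rep_weaken _ _ _ hg)).
  replace (n - k + k)%Z with n by lia. reflexivity.
Qed.

Lemma shifts_df : shifts df (fun g => df g + ev1 g) (fun g => df g - ev1 g).
Proof.
  split.
  - apply lfun_df.
  - intros B g hg. replace (df g + ev1 g) with (df g + IZR 1 * ev1 g) by ring. rewrite <- (df_shift B g 1 hg).
    apply (lf_ext df lfun_df). intros; rewrite Czpow_1; auto.
  - intros B g hg. replace (df g - ev1 g) with (df g + IZR (-1) * ev1 g) by ring. rewrite <- (df_shift B g (-1) hg).
    apply (lf_ext df lfun_df). intros; rewrite Czpow_m1; auto.
Qed.

Definition lp (A0 A1 Am : M2 R) : loop := fun l =>
  cadd (cplx A0) (cadd (mscal l (cplx A1)) (mscal (/ l)%C (cplx Am))).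

Lemma ent_lp A0 A1 Am l i j : ent (lp A0 A1 Am l) i j =
  (RtoC (ent A0 i j) + (RtoC (ent A1 i j) * l + RtoC (ent Am i j) * / l))%C.
Proof. unfold lp. rewrite !entC_cadd, !entC_mscal, !ent_cplx. Cring. Qed.

Lemma mrep_lp A0 A1 Am : exists B, mrep w2 u1 B (lp A0 A1 Am).
Proof.
  assert (h : forall i j, exists B, rep w2 u1 B (fun l => ent (lp A0 A1 Am l) i j)).
  { intros i j. destruct (rep_laurent w2 weight_w2 (ent A0 i j) (ent A1 i j) (ent Am i j)) as (B & hB).
    exists B. eapply (rep_ext w2 weight_w2); [|exact hB]. intros l _. symmetry. apply ent_lp. }
  destruct (h 0%nat 0%nat) as (B1 & b1). destruct (h 0%nat 1%nat) as (B2 & b2).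
  destruct (h 1%nat 0%nat) as (B3 & b3). destruct (h 1%nat 1%nat) as (B4 & b4).
  exists (Rmax (Rmax B1 B2) (Rmax B3 B4)).
  assert (m1 := Rmax_l B1 B2). assert (m2 := Rmax_r B1 B2). assert (m3 := Rmax_l B3 B4). assert (m4 := Rmax_r B3 B4).
  assert (m5 := Rmax_l (Rmax B1 B2) (Rmax B3 B4)). assert (m6 := Rmax_r (Rmax B1 B2) (Rmax B3 B4)).
  apply (mrep_intro w2 weight_w2).
  - assert (h1 := rep_ge0 w2 _ _ _ b1). lra.
  - intros i j hi hj. destruct i as [|[|i]]; try lia; destruct j as [|[|j]]; try lia;
      (eapply (rep_mono w2); [| |eassumption]; [auto|lra]).
Qed.

Lemma mrep_cshift B g k : mrep w2 allz B g -> mrep w2 allz (w2 k * B) (fun l => mscal (Czpow l k) (g l)).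
Proof.
  intros hg i j. apply (rep_ext w2 weight_w2 _ _ (fun l => Czpow l k * ent (g l) i j)%C).
  - intros. symmetry. apply entC_mscal.
  - apply rep_shift2, hg.
Qed.

Lemma ML_p L Lp Lm g B : shifts L Lp Lm -> mrep w2 allz B g ->
  ML L (fun l => mscal l (g l)) = ML Lp g.
Proof.
  intros hs hg. apply ML_ext2. intros i j _ _. rewrite <- (sh_p _ _ _ hs B) by auto.
  apply (lf_ext L (sh_L _ _ _ hs)). intros; apply entC_mscal.
Qed.

Lemma ML_m L Lp Lm g B : shifts L Lp Lm -> mrep w2 allz B g ->
  ML L (fun l => mscal (/ l)%C (g l)) = ML Lm g.
Proof.
  intros hs hg. apply ML_ext2. intros i j _ _. rewrite <- (sh_m _ _ _ hs B) by auto.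
  apply (lf_ext L (sh_L _ _ _ hs)). intros; apply entC_mscal.
Qed.

Lemma mrep_const A : exists B, mrep w2 allz B (fun _ => cplx A).
Proof. apply mrep_real; [apply weight_w2|exact I]. Qed.

Lemma mrep_mult_all B B' g h : mrep w2 allz B g -> mrep w2 allz B' h ->
  mrep w2 allz (2 * B * B') (fun l => Mmult (g l) (h l)).
Proof. intros. apply (mrep_mult w2 weight_w2 allz allz); auto; supp. Qed.

Lemma ML_lp_l L Lp Lm A0 A1 Am g B : shifts L Lp Lm -> mrep w2 allz B g ->
  ML L (fun l => Mmult (lp A0 A1 Am l) (g l)) =
  radd (Mmult A0 (ML L g)) (radd (Mmult A1 (ML Lp g)) (Mmult Am (ML Lm g))).
Proof.
  intros hs hg. assert (hL := sh_L _ _ _ hs).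
  assert (hp := mrep_cshift _ _ 1 hg). assert (hm := mrep_cshift _ _ (-1) hg).
  destruct (mrep_const A0) as (b0 & k0). destruct (mrep_const A1) as (b1 & k1). destruct (mrep_const Am) as (bm & km).
  rewrite <- (ML_p L Lp Lm g B hs hg), <- (ML_m L Lp Lm g B hs hg).
  assert (e1 : ML L (fun l => mscal l (g l)) = ML L (fun l => mscal (Czpow l 1) (g l))).
  { apply ML_ext; auto. intros l _; rewrite Czpow_1; reflexivity. }
  assert (e2 : ML L (fun l => mscal (/ l)%C (g l)) = ML L (fun l => mscal (Czpow l (-1)) (g l))).
  { apply ML_ext; auto. intros l _; rewrite Czpow_m1; reflexivity. }
  rewrite e1, e2, <- (ML_mull L A0 g B hL hg), <- (ML_mull L A1 _ _ hL hp), <- (ML_mull L Am _ _ hL hm).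
  assert (hp' := mrep_mult_all _ _ _ _ k1 hp). assert (hm' := mrep_mult_all _ _ _ _ km hm).
  assert (h0' := mrep_mult_all _ _ _ _ k0 hg).
  rewrite <- (ML_add L _ _ _ _ hL hp' hm').
  rewrite <- (ML_add L _ _ _ _ hL h0' (mrep_plus w2 weight_w2 _ _ _ _ _ hp' hm')).
  apply ML_ext; auto. intros l _. rewrite Czpow_1, Czpow_m1. unfold lp. mxC.
Qed.

Lemma ML_lp_r L Lp Lm A0 A1 Am g B : shifts L Lp Lm -> mrep w2 allz B g ->
  ML L (fun l => Mmult (g l) (lp A0 A1 Am l)) =
  radd (Mmult (ML L g) A0) (radd (Mmult (ML Lp g) A1) (Mmult (ML Lm g) Am)).
Proof.
  intros hs hg. assert (hL := sh_L _ _ _ hs).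
  assert (hp := mrep_cshift _ _ 1 hg). assert (hm := mrep_cshift _ _ (-1) hg).
  destruct (mrep_const A0) as (b0 & k0). destruct (mrep_const A1) as (b1 & k1). destruct (mrep_const Am) as (bm & km).
  rewrite <- (ML_p L Lp Lm g B hs hg), <- (ML_m L Lp Lm g B hs hg).
  assert (e1 : ML L (fun l => mscal l (g l)) = ML L (fun l => mscal (Czpow l 1) (g l))).
  { apply ML_ext; auto. intros l _; rewrite Czpow_1; reflexivity. }
  assert (e2 : ML L (fun l => mscal (/ l)%C (g l)) = ML L (fun l => mscal (Czpow l (-1)) (g l))).
  { apply ML_ext; auto. intros l _; rewrite Czpow_m1; reflexivity. }
  rewrite e1, e2, <- (ML_mulr L A0 g B hL hg), <- (ML_mulr L A1 _ _ hL hp), <- (ML_mulr L Am _ _ hL hm).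
  assert (hp' := mrep_mult_all _ _ _ _ hp k1). assert (hm' := mrep_mult_all _ _ _ _ hm km).
  assert (h0' := mrep_mult_all _ _ _ _ hg k0).
  rewrite <- (ML_add L _ _ _ _ hL hp' hm').
  rewrite <- (ML_add L _ _ _ _ hL h0' (mrep_plus w2 weight_w2 _ _ _ _ _ hp' hm')).
  apply ML_ext; auto. intros l _. rewrite Czpow_1, Czpow_m1. unfold lp. mxC.
Qed.

Definition mfdiff (X : R -> R -> M2 R) (x y : R) (P Q : M2 R) : Prop :=
  forall i j, fdiff (fun x y => ent (X x y) i j) x y (ent P i j) (ent Q i j).

Lemma mfdiff_intro X x y P Q : (forall i j, (i < 2)%nat -> (j < 2)%nat ->
  fdiff (fun x y => ent (X x y) i j) x y (ent P i j) (ent Q i j)) -> mfdiff X x y P Q.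
Proof.
  intros h i j. destruct (le_lt_dec 2 i) as [hi|hi]; [|destruct (le_lt_dec 2 j) as [hj|hj]; [|auto]].
  - rewrite !(ent_out _ i j) by auto. apply (fdiff_ext (fun _ _ => 0) _ _ _ _ _ 1); [lra| |apply fdiff_const].
    intros. rewrite ent_out by auto. reflexivity.
  - rewrite !(ent_out _ i j) by auto. apply (fdiff_ext (fun _ _ => 0) _ _ _ _ _ 1); [lra| |apply fdiff_const].
    intros. rewrite ent_out by auto. reflexivity.
Qed.

Lemma ML_adiff L X x y P Q : lfun L -> adiff X x y P Q ->
  mfdiff (fun x y => ML L (X x y)) x y (ML L P) (ML L Q).
Proof.
  intros hL hX. apply mfdiff_intro. intros i j hi hj. rewrite !ent_ML by auto.
  apply (fdiff_ext (fun x y => L (fun l => ent (X x y l) i j)) _ _ _ _ _ 1); [lra| |].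
  - intros. rewrite ent_ML; auto.
  - apply lfun_fdiff; auto.
Qed.

Lemma cf_lp A0 A1 Am g : (forall l, Cmod l = 1 -> g l = lp A0 A1 Am l) ->
  ML (fun g => cf g 0%Z) g = A0 /\ ML (fun g => cf g 1%Z) g = A1 /\ ML (fun g => cf g (-1)%Z) g = Am.
Proof.
  intros h. assert (c1 := fun i j => cf_one i j).
  destruct (mrep_one allz I) as (B & hB).
  assert (e : forall n, ML (fun g => cf g n) g = radd (Mmult A0 (ML (fun g => cf g n) (fun _ => Mone)))
    (radd (Mmult A1 (ML (fun g => cf g (n - 1)%Z) (fun _ => Mone))) (Mmult Am (ML (fun g => cf g (n + 1)%Z) (fun _ => Mone))))).
  { intros n. rewrite <- (ML_lp_l _ _ _ A0 A1 Am _ B (shifts_cf n) hB).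
    apply ML_ext; [apply lfun_cf|]. intros l hl. rewrite (h l hl), Mmult_1r; auto. }
  assert (z : forall n, n <> 0%Z -> ML (fun g => cf g n) (fun _ => Mone) = zero).
  { intros n hn. apply mx_extR; rewrite ent_ML, c1 by (auto; lia); symmetry; apply entR_zero. }
  assert (o : ML (fun g => cf g 0%Z) (fun _ => Mone) = Mone).
  { assert (k : forall i j c, ent (Mone : M2 C) i j = RtoC c -> cf (fun _ => ent (Mone : M2 C) i j) 0 = c).
    { intros i j c0 hc. rewrite hc, cf_const. reflexivity. }
    apply mx_extR; rewrite ent_ML by lia; eR; apply k; entC; reflexivity. }
  split; [|split]; rewrite e; simpl; rewrite ?o, !z by lia; mR.
Qed.

Lemma rep_zero_of_cf S B g : rep w2 S B g -> (forall n, S n -> cf g n = 0) -> forall l, Cmod l = 1 -> g l = RtoC 0.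
Proof.
  intros (h1 & h2 & h3) h. apply (rep_empty w2 (fun _ => False) B); auto.
  split; [auto|split; [|auto]]. intros n _. destruct (classic (S n)); auto.
Qed.

Lemma lp_of_support B g : mrep w2 u1 B g -> forall l, Cmod l = 1 ->
  g l = lp (ML (fun g => cf g 0%Z) g) (ML (fun g => cf g 1%Z) g) (ML (fun g => cf g (-1)%Z) g) l.
Proof.
  intros hg l hl.
  set (A0 := ML (fun g => cf g 0%Z) g). set (A1 := ML (fun g => cf g 1%Z) g). set (Am := ML (fun g => cf g (-1)%Z) g).
  destruct (cf_lp A0 A1 Am _ (fun l _ => eq_refl)) as (e0 & e1 & em).
  destruct (mrep_lp A0 A1 Am) as (B' & hB').
  assert (h : forall i j, (i < 2)%nat -> (j < 2)%nat -> ent (g l) i j = ent (lp A0 A1 Am l) i j).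
  2: { apply mx_extC; apply h; lia. }
  intros i j hi hj. apply Ceq_minus.
  assert (hd := rep_minus w2 weight_w2 _ _ _ _ _ (hg i j) (hB' i j)).
  apply (rep_zero_of_cf _ _ _ hd); auto.
  intros n hn.
  assert (s1 := rep_scal w2 weight_w2 _ _ _ (-1) (hB' i j)).
  assert (e : cf (fun l => ent (g l) i j - ent (lp A0 A1 Am l) i j)%C n = cf (fun l => ent (g l) i j) n - cf (fun l => ent (lp A0 A1 Am l) i j) n).
  { rewrite (cf_ext _ (fun l => ent (g l) i j + RtoC (-1) * ent (lp A0 A1 Am l) i j)%C) by (intros; rewrite RtoC_m1; ring).
    rewrite (cf_plus w2 weight_w2 _ _ _ _ _ _ n (hg i j) s1), (cf_scal w2 weight_w2 _ _ _ (-1) n (hB' i j)). ring. }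
  etransitivity; [exact e|].
  assert (q : ML (fun g => cf g n) g = ML (fun g => cf g n) (lp A0 A1 Am)).
  { unfold u1 in hn. assert (c : (n = 0 \/ n = 1 \/ n = -1)%Z) by lia. destruct c as [->|[->| ->]]; auto. }
  apply (f_equal (fun A => ent A i j)) in q. rewrite !ent_ML in q by auto. lra.
Qed.

(** * The Birkhoff factors of the family *)

Notation cfn n := (fun g : C -> C => cf g n%Z).

Definition P0 (a : R) : M2 R := mx2 (K := R_Ring) a 0 0 (- a).
Definition P1 (q h : R) : M2 R := mx2 (K := R_Ring) 0 (- q) h 0.
Definition Pm (h r : R) : M2 R := mx2 (K := R_Ring) 0 h (- r) 0.

Lemma pot_lp a q h r l : pot a q h r l = lp (P0 a) (P1 q h) (Pm h r) l.
Proof.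
  unfold pot. apply mx_extC; rewrite ent_lp; unfold P0, P1, Pm; entC; entR; rewrite ?RtoC_opp; try Cring.
Qed.

Lemma pot_adj a q h r l : sl_inv (pot a q h r l) = pot (- a) (- q) (- h) (- r) l.
Proof.
  unfold pot. apply mx_extC; entC; rewrite ?RtoC_opp; try Cring.
Qed.

Lemma adj_traceless (A : M2 C) : mtr A = RtoC 0 -> sl_inv A = csub zero A.
Proof.
  rewrite mtrC. intros e. apply mx_extC; entC; try Cring.
  - apply Ceq_minus. replace (ent A 1 1 - (0 - ent A 0 0))%C with (ent A 0 0 + ent A 1 1)%C by ring. auto.
  - apply Ceq_minus. replace (ent A 0 0 - (0 - ent A 1 1))%C with (ent A 0 0 + ent A 1 1)%C by ring. auto.
Qed.

Lemma ML_support L S B g n : (L = cfn n) -> mrep w2 S B g -> ~ S n -> ML L g = zero.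
Proof.
  intros -> h hn. apply mx_extR; rewrite entR_zero, ent_ML by lia; apply (proj1 (proj2 (h _ _))); auto.
Qed.

Lemma mrep_inter S S' B B' g : mrep w2 S B g -> mrep w2 S' B' g -> mrep w2 (fun n => S n /\ S' n) B g.
Proof. intros h h' i j. apply (rep_inter w2 _ _ _ _ _ (h i j) (h' i j)). Qed.

Lemma split_upper X B : mrep w2 (fun n => n <= 1)%Z B X -> exists a0 a1, forall l, Cmod l = 1 ->
  csub (X l) (mproj X l) = lp a0 a1 zero l.
Proof.
  intros h. destruct (mproj_spec B X (mrep_all _ _ _ h)) as (h1 & h2).
  assert (h3 : mrep w2 (fun n => n <= 1)%Z (B + B) (fun l => csub (X l) (mproj X l))).
  { apply mrep_minus; [apply weight_w2|auto|]. eapply (mrep_mono w2); [|apply Rle_refl|exact h1]. supp. }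
  assert (h4 := mrep_inter _ _ _ _ _ h2 h3).
  assert (h5 : mrep w2 u1 B (fun l => csub (X l) (mproj X l))).
  { eapply (mrep_mono w2); [|apply Rle_refl|exact h4]. unfold u1, pos0. intros; lia. }
  do 2 eexists. intros l hl. rewrite (lp_of_support _ _ h5 l hl) at 1.
  rewrite (ML_support (cfn (-1)) _ _ _ (-1) eq_refl h2) by (unfold pos0; lia). reflexivity.
Qed.

Lemma split_lower X B : mrep w2 (fun n => -1 <= n)%Z B X -> exists b, forall l, Cmod l = 1 ->
  mproj X l = lp zero zero b l.
Proof.
  intros h. destruct (mproj_spec B X (mrep_all _ _ _ h)) as (h1 & h2).
  assert (h3 : mrep w2 (fun n => -1 <= n)%Z (B + B) (mproj X)).
  { apply (mrep_ext w2 weight_w2 _ _ (fun l => csub (X l) (csub (X l) (mproj X l)))); [intros; mxC|].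
    apply mrep_minus; [apply weight_w2|auto|]. eapply (mrep_mono w2); [|apply Rle_refl|exact h2]. unfold pos0; intros; lia. }
  assert (h4 := mrep_inter _ _ _ _ _ h1 h3).
  assert (h5 : mrep w2 u1 B (mproj X)).
  { eapply (mrep_mono w2); [|apply Rle_refl|exact h4]. unfold u1, neg1. intros; lia. }
  eexists. intros l hl. rewrite (lp_of_support _ _ h5 l hl) at 1.
  rewrite (ML_support (cfn 0) _ _ _ 0 eq_refl h1), (ML_support (cfn 1) _ _ _ 1 eq_refl h1) by (unfold neg1; lia). reflexivity.
Qed.

Lemma ML_minus_one L B' g : lfun L -> mrep w2 allz B' (fun l => csub (g l) Mone) ->
  ML L g = radd (ML L (fun l => csub (g l) Mone)) (ML L (fun _ => Mone)).
Proof.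
  intros hL h. destruct (mrep_one allz I) as (B & hB).
  rewrite <- (ML_add L _ _ _ _ hL h hB). apply ML_ext; auto. intros; mxC.
Qed.

Lemma ML_one : ML (cfn 0) (fun _ => Mone) = Mone.
Proof.
  destruct (cf_lp Mone zero zero (fun _ => Mone)) as (h & _); auto.
  intros l _. apply mx_extC; rewrite ent_lp; entC; entR; ring.
Qed.

Lemma birk_coef Phi gm gp : birk Phi gm gp ->
  ML (cfn 0) gm = Mone /\ (forall n, (0 < n)%Z -> ML (cfn n) gm = zero) /\
  (forall n, (n < 0)%Z -> ML (cfn n) gp = zero).
Proof.
  intros [_ (B & hB) (B1 & h1) (B2 & h2) _ _]. split; [|split].
  - rewrite (ML_minus_one _ _ _ (lfun_cf 0) (mrep_all _ _ _ h1)), ML_one.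
    rewrite (ML_support _ _ _ _ 0 eq_refl h1) by (unfold neg1; lia). mR.
  - intros n hn. apply (ML_support _ _ _ _ n eq_refl hB). unfold neg0; lia.
  - intros n hn. apply (ML_support _ _ _ _ n eq_refl h2). unfold pos0; lia.
Qed.

(** The coefficients of $\lambda$ and of $\lambda^0$ are compared. As $g_-=1+K\lambda^{-1}+\dots$
    and [VP] is strictly negative, they read $B_1=a_1$ and $B_0+B_1K=a_0+Ka_1$. *)
Lemma upper_coefs Phi gm gp B0 B1 Bm a0 a1 VP Bv : birk Phi gm gp -> mrep w2 neg1 Bv VP ->
  (forall l, Cmod l = 1 -> Mmult (lp B0 B1 Bm l) (gm l) = cadd (Mmult (gm l) (VP l)) (Mmult (gm l) (lp a0 a1 zero l))) ->
  a1 = B1 /\ a0 = radd B0 (rsub (Mmult B1 (ML (cfn (-1)) gm)) (Mmult (ML (cfn (-1)) gm) B1)).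
Proof.
  intros hb hV he. destruct (birk_coef _ _ _ hb) as (c0 & cp & _).
  destruct (bk_m _ _ _ hb) as (B & hm).
  assert (hgv : mrep w2 neg1 (2 * B * Bv) (fun l => Mmult (gm l) (VP l))).
  { apply (mrep_mult w2 weight_w2 neg0 neg1); auto; supp. }
  destruct (mrep_lp a0 a1 zero) as (B' & hl).
  assert (hga := mrep_mult_all _ _ _ _ (mrep_all _ _ _ hm) (mrep_all _ _ _ hl)).
  assert (e : forall n, ML (cfn n) (fun l => Mmult (lp B0 B1 Bm l) (gm l)) =
     radd (ML (cfn n) (fun l => Mmult (gm l) (VP l))) (ML (cfn n) (fun l => Mmult (gm l) (lp a0 a1 zero l)))).
  { intros n. rewrite <- (ML_add _ _ _ _ _ (lfun_cf n) (mrep_all _ _ _ hgv) hga). apply ML_ext; auto. apply lfun_cf. }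
  assert (e1 := e 1%Z). assert (e0 := e 0%Z).
  rewrite (ML_lp_l _ _ _ _ _ _ _ _ (shifts_cf 1) (mrep_all _ _ _ hm)), (ML_lp_r _ _ _ _ _ _ _ _ (shifts_cf 1) (mrep_all _ _ _ hm)) in e1.
  rewrite (ML_lp_l _ _ _ _ _ _ _ _ (shifts_cf 0) (mrep_all _ _ _ hm)), (ML_lp_r _ _ _ _ _ _ _ _ (shifts_cf 0) (mrep_all _ _ _ hm)) in e0.
  change (1 - 1)%Z with 0%Z in e1. change (1 + 1)%Z with 2%Z in e1. change (0 - 1)%Z with (-1)%Z in e0. change (0 + 1)%Z with 1%Z in e0.
  rewrite (ML_support _ _ _ _ 1 eq_refl hgv), !c0, !(cp 1%Z), !(cp 2%Z) in e1 by (unfold neg1; lia).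
  rewrite (ML_support _ _ _ _ 0 eq_refl hgv), !c0, !(cp 1%Z) in e0 by (unfold neg1; lia).
  set (K := ML (cfn (-1)) gm) in *.
  assert (x1 : a1 = B1).
  { apply mx_extR; [apply (f_equal (fun A => ent A 0 0)) in e1|apply (f_equal (fun A => ent A 0 1)) in e1
      |apply (f_equal (fun A => ent A 1 0)) in e1|apply (f_equal (fun A => ent A 1 1)) in e1];
    revert e1; eR; intros e1; lra. }
  split; auto. subst a1.
  apply mx_extR; [apply (f_equal (fun A => ent A 0 0)) in e0|apply (f_equal (fun A => ent A 0 1)) in e0
      |apply (f_equal (fun A => ent A 1 0)) in e0|apply (f_equal (fun A => ent A 1 1)) in e0];
    revert e0; eR; intros e0; lra.
Qed.

(** Evaluation at $\lambda=0$ is multiplicative on nonnegative supports: without its constant term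
    [u] is supported in $n\ge1$ and adds nothing to the constant term of the product. *)
Lemma rep_cf0_mult B B' u v : rep w2 pos0 B u -> rep w2 pos0 B' v -> cf (fun l => u l * v l)%C 0 = cf u 0 * cf v 0.
Proof.
  intros hu hv.
  set (u' := fun l => (u l + RtoC (- cf u 0) * RtoC 1)%C).
  assert (h1 : rep w2 pos0 (1 * 1) (fun _ => RtoC 1)).
  { apply rep_real; [apply weight_w2|supp|]. unfold w2; simpl. rewrite Rabs_R1. lra. }
  assert (s1 := rep_scal w2 weight_w2 _ _ _ (- cf u 0) h1).
  assert (p1 := rep_plus w2 weight_w2 _ _ _ _ _ hu s1). fold u' in p1.
  assert (c0 : cf u' 0 = 0).
  { unfold u'. etransitivity; [exact (cf_plus w2 weight_w2 _ _ _ _ _ _ 0 hu s1)|].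
    transitivity (cf u 0 + - cf u 0 * cf (fun _ => RtoC 1) 0).
    - apply (f_equal (fun z => cf u 0 + z)). exact (cf_scal w2 weight_w2 _ _ _ (- cf u 0) 0 h1).
    - rewrite cf_const. destruct Z.eq_dec; [ring|lia]. }
  assert (p2 : rep w2 (fun n => 1 <= n)%Z (B + Rabs (- cf u 0) * (1 * 1)) u').
  { destruct p1 as (q1 & q2 & q3). split; [auto|split; [|auto]]. intros n hn.
    destruct (Z.eq_dec n 0) as [->|]; auto. apply q2. unfold pos0. lia. }
  assert (p3 := rep_mult w2 weight_w2 (fun n => 1 <= n)%Z pos0 (fun n => 1 <= n)%Z _ _ _ _ ltac:(unfold pos0; intros; lia) p2 hv).
  assert (s3 := rep_scal w2 weight_w2 _ _ _ (cf u 0) hv).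
  rewrite (cf_ext _ (fun l => u' l * v l + RtoC (cf u 0) * v l)%C).
  2: { intros l _. unfold u'. rewrite RtoC_opp. ring. }
  etransitivity; [exact (cf_plus w2 weight_w2 _ _ _ _ _ _ 0 p3 s3)|].
  rewrite (proj1 (proj2 p3)) by lia. rewrite Rplus_0_l. exact (cf_scal w2 weight_w2 _ _ _ (cf u 0) 0 hv).
Qed.

Lemma birk_det0 Phi gm gp : birk Phi gm gp -> mdet (ML (cfn 0) gp) = 1.
Proof.
  intros hb. destruct (bk_p _ _ _ hb) as (B & hp). assert (hd := bk_detp _ _ _ hb).
  rewrite mdetR, !ent_ML by lia.
  rewrite <- !(rep_cf0_mult B B) by apply hp.
  assert (m1 := rep_mult w2 weight_w2 pos0 pos0 pos0 _ _ _ _ ltac:(supp) (hp 0%nat 0%nat) (hp 1%nat 1%nat)).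
  assert (m2 := rep_mult w2 weight_w2 pos0 pos0 pos0 _ _ _ _ ltac:(supp) (hp 0%nat 1%nat) (hp 1%nat 0%nat)).
  assert (s2 := rep_scal w2 weight_w2 _ _ _ (-1) m2).
  assert (e := cf_plus w2 weight_w2 _ _ _ _ _ _ 0 m1 s2).
  assert (e2 := cf_scal w2 weight_w2 _ _ _ (-1) 0 m2). cbv beta in e2.
  assert (e3 := eq_trans e (f_equal (Rplus _) e2)). clear e e2.
  transitivity (cf (fun _ => RtoC 1) 0); [|rewrite cf_const; reflexivity].
  rewrite <- (cf_ext _ (fun _ => RtoC 1) (fun l hl => hd l hl)).
  match goal with |- ?u - ?v = _ => replace (u - v) with (u + -1 * v) by ring end.
  refine (eq_trans (eq_sym e3) _). apply (f_equal (fun f => f 0%Z)). apply cf_ext. intros l _. rewrite mdetC, RtoC_m1. ring.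
Qed.

(** The coefficient of $\lambda^{-1}$ gives $DB_{-1}=bD$, with $D=g_+(0)$ of determinant one. *)
Lemma lower_coefs Phi gm gp B0 B1 Bm b T Bt : birk Phi gm gp -> mrep w2 pos0 Bt T ->
  (forall l, Cmod l = 1 -> Mmult (gp l) (lp B0 B1 Bm l) = cadd (Mmult (lp zero zero b l) (gp l)) (Mmult (T l) (gp l))) ->
  b = Mmult (ML (cfn 0) gp) (Mmult Bm (sl_inv (ML (cfn 0) gp))).
Proof.
  intros hb hT he. destruct (birk_coef _ _ _ hb) as (_ & _ & cp).
  destruct (bk_p _ _ _ hb) as (B & hp).
  assert (hgv : mrep w2 pos0 (2 * Bt * B) (fun l => Mmult (T l) (gp l))).
  { apply (mrep_mult w2 weight_w2 pos0 pos0); auto; supp. }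
  destruct (mrep_lp zero zero b) as (B' & hl).
  assert (hga := mrep_mult_all _ _ _ _ (mrep_all _ _ _ hl) (mrep_all _ _ _ hp)).
  assert (e : ML (cfn (-1)) (fun l => Mmult (gp l) (lp B0 B1 Bm l)) =
     radd (ML (cfn (-1)) (fun l => Mmult (lp zero zero b l) (gp l))) (ML (cfn (-1)) (fun l => Mmult (T l) (gp l)))).
  { rewrite <- (ML_add _ _ _ _ _ (lfun_cf (-1)) hga (mrep_all _ _ _ hgv)). apply ML_ext; auto. apply lfun_cf. }
  rewrite (ML_lp_l _ _ _ _ _ _ _ _ (shifts_cf (-1)) (mrep_all _ _ _ hp)), (ML_lp_r _ _ _ _ _ _ _ _ (shifts_cf (-1)) (mrep_all _ _ _ hp)) in e.
  change (-1 - 1)%Z with (-2)%Z in e. change (-1 + 1)%Z with 0%Z in e.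
  rewrite (ML_support _ _ _ _ (-1) eq_refl hgv), !(cp (-1)%Z), !(cp (-2)%Z) in e by (unfold pos0; lia).
  assert (hd := birk_det0 _ _ _ hb). set (D := ML (cfn 0) gp) in *.
  assert (e' : Mmult b D = Mmult D Bm).
  { apply mx_extR; [apply (f_equal (fun A => ent A 0 0)) in e|apply (f_equal (fun A => ent A 0 1)) in e
      |apply (f_equal (fun A => ent A 1 0)) in e|apply (f_equal (fun A => ent A 1 1)) in e];
    revert e; eR; intros e; lra. }
  transitivity (Mmult (Mmult b D) (sl_inv D)); [|rewrite e'; mR].
  transitivity (mscal (mdet D) b); [rewrite hd|]; mR.
Qed.

Lemma cf_neg B g n : rep w2 allz B g -> cf (fun l => g (- l)%C) n = sgnz n * cf g n.
Proof.
  intros hg. assert (hb := rep_bsum w2 weight_w2 _ _ _ hg).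
  apply (four_cf (fun n => sgnz n * cf g n) (fun l => g (- l)%C) B).
  - eapply bsum_le; [|exact hb]. intros k. cbv beta. rewrite Rabs_mult.
    assert (e : Rabs (sgnz k) = 1) by (unfold sgnz; destruct (Z.even k); [apply Rabs_R1|apply Rabs_m1]).
    rewrite e; lra.
  - intros l hl. assert (hl' : Cmod (- l) = 1) by (rewrite Cmod_opp; auto).
    eapply usum_ext; [|exact (proj2 (proj2 hg) _ hl')]. intros k. cbv beta.
    rewrite Czpow_opp by (apply unit_neq0; auto). rewrite RtoC_mult. ring.
Qed.

(** The substitution $\lambda\mapsto-\lambda$ multiplies the coefficient $n$ by $(-1)^n$. In a
    twisted loop the even coefficients are therefore diagonal and the odd ones off-diagonal. *)
Lemma sigma_coef B g n : mrep w2 allz B g -> sigma_fixed g ->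
  ML (cfn n) g = mscal (sgnz n) (Mmult (Mmult e2 (ML (cfn n) g)) e2).
Proof.
  intros hg hs.
  assert (k : forall i j (e : R), (forall l, ent (Defs.sigma g l) i j = (RtoC e * ent (g (- l)%C) i j)%C) ->
     cf (fun l => ent (g l) i j) n = e * (sgnz n * cf (fun l => ent (g l) i j) n)).
  { intros i j e he. assert (hn := cf_neg B _ n (hg i j)).
    transitivity (cf (fun l => RtoC e * ent (g (- l)%C) i j)%C n).
    - apply (f_equal (fun f => f n)). apply cf_ext. intros l hl. rewrite <- (hs l hl) at 1. apply he.
    - refine (eq_trans (cf_scal w2 weight_w2 _ _ _ e n (rep_neg w2 weight_w2 _ _ _ (hg i j))) _).
      apply (f_equal (Rmult e)). exact hn. }
  apply mx_extR; unfold e2; eR; rewrite !ent_ML by lia.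
  - etransitivity; [apply (k _ _ 1)|Rring]. intros l. unfold Defs.sigma, e2. entC. entR. Cring.
  - etransitivity; [apply (k _ _ (-1))|Rring]. intros l. unfold Defs.sigma, e2. entC. entR. rewrite RtoC_m1. Cring.
  - etransitivity; [apply (k _ _ (-1))|Rring]. intros l. unfold Defs.sigma, e2. entC. entR. rewrite RtoC_m1. Cring.
  - etransitivity; [apply (k _ _ 1)|Rring]. intros l. unfold Defs.sigma, e2. entC. entR. rewrite ?RtoC_m1. Cring.
Qed.

(** * Calculus of matrix-valued functions of two variables *)

Lemma fdiff_eq f x y p q p' q' : p = p' -> q = q' -> fdiff f x y p q -> fdiff f x y p' q'.
Proof. intros <- <-. auto. Qed.

Lemma mfdiff_radd X Y x y P Q P' Q' : mfdiff X x y P Q -> mfdiff Y x y P' Q' ->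
  mfdiff (fun x y => radd (X x y) (Y x y)) x y (radd P P') (radd Q Q').
Proof.
  intros h h' i j. rewrite !entR_radd.
  apply (fdiff_ext (fun x y => ent (X x y) i j + ent (Y x y) i j) _ _ _ _ _ 1 Rlt_0_1).
  - intros. rewrite entR_radd. reflexivity.
  - apply (fdiff_plus _ _ _ _ _ _ _ _ (h i j) (h' i j)).
Qed.

Lemma mfdiff_mult X Y x y P Q P' Q' : mfdiff X x y P Q -> mfdiff Y x y P' Q' ->
  mfdiff (fun x y => Mmult (X x y) (Y x y)) x y (radd (Mmult P (Y x y)) (Mmult (X x y) P')) (radd (Mmult Q (Y x y)) (Mmult (X x y) Q')).
Proof.
  intros h h' i j. rewrite !entR_radd, !entR_mult.
  apply (fdiff_ext (fun x y => ent (X x y) i 0 * ent (Y x y) 0 j + ent (X x y) i 1 * ent (Y x y) 1 j) _ _ _ _ _ 1 Rlt_0_1).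
  - intros. rewrite entR_mult. reflexivity.
  - assert (f := fdiff_plus _ _ _ _ _ _ _ _ (fdiff_mult _ _ _ _ _ _ _ _ (h i 0%nat) (h' 0%nat j)) (fdiff_mult _ _ _ _ _ _ _ _ (h i 1%nat) (h' 1%nat j))).
    cbv beta in f. refine (fdiff_eq _ _ _ _ _ _ _ _ _ f); ring.
Qed.

Lemma mfdiff_scal f X x y p q P Q : fdiff f x y p q -> mfdiff X x y P Q ->
  mfdiff (fun x y => mscal (f x y) (X x y)) x y (radd (mscal p (X x y)) (mscal (f x y) P)) (radd (mscal q (X x y)) (mscal (f x y) Q)).
Proof.
  intros h h' i j. rewrite !entR_radd, !entR_mscal.
  apply (fdiff_ext (fun x y => f x y * ent (X x y) i j) _ _ _ _ _ 1 Rlt_0_1).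
  - intros. rewrite entR_mscal. reflexivity.
  - apply (fdiff_mult _ _ _ _ _ _ _ _ h (h' i j)).
Qed.

Lemma mfdiff_const A x y P : P = zero -> mfdiff (fun _ _ => A) x y P P.
Proof. intros -> i j. rewrite entR_zero. apply fdiff_const. Qed.

Lemma mfdiff_cscal c X x y P Q : mfdiff X x y P Q -> mfdiff (fun x y => mscal c (X x y)) x y (mscal c P) (mscal c Q).
Proof.
  intros h. assert (k := mfdiff_scal (fun _ _ => c) X x y 0 0 P Q (fdiff_const c x y) h).
  replace (mscal c P) with (radd (mscal 0 (X x y)) (mscal c P)) by mR.
  replace (mscal c Q) with (radd (mscal 0 (X x y)) (mscal c Q)) by mR. exact k.
Qed.

Lemma mfdiff_rsub X Y x y P Q P' Q' : mfdiff X x y P Q -> mfdiff Y x y P' Q' ->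
  mfdiff (fun x y => rsub (X x y) (Y x y)) x y (rsub P P') (rsub Q Q').
Proof.
  intros h h'. assert (k := mfdiff_radd _ _ _ _ _ _ _ _ h (mfdiff_cscal (-1) _ _ _ _ _ h')).
  intros i j. rewrite !entR_rsub. specialize (k i j). rewrite !entR_radd, !entR_mscal in k.
  apply (fdiff_ext (fun x y => ent (radd (X x y) (mscal (-1) (Y x y))) i j) _ _ _ _ _ 1 Rlt_0_1).
  - intros. rewrite entR_rsub, entR_radd, entR_mscal. ring.
  - replace (ent P i j - ent P' i j) with (ent P i j + -1 * ent P' i j) by ring.
    replace (ent Q i j - ent Q' i j) with (ent Q i j + -1 * ent Q' i j) by ring. exact k.
Qed.

Lemma mfdiff_inv X x y P Q : mfdiff X x y P Q -> mfdiff (fun x y => sl_inv (X x y)) x y (sl_inv P) (sl_inv Q).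
Proof.
  intros h. apply mfdiff_intro.
  assert (hn : forall i j, fdiff (fun x y => - ent (X x y) i j) x y (- ent P i j) (- ent Q i j)).
  { intros i j. assert (k := mfdiff_cscal (-1) X x y P Q h i j). rewrite !entR_mscal in k.
    replace (- ent P i j) with (-1 * ent P i j) by ring. replace (- ent Q i j) with (-1 * ent Q i j) by ring.
    apply (fdiff_ext (fun x y => ent (mscal (-1) (X x y)) i j) _ _ _ _ _ 1 Rlt_0_1); [|exact k].
    intros. rewrite entR_mscal. ring. }
  intros i j hi hj. destruct i as [|[|i]]; [| |lia]; (destruct j as [|[|j]]; [| |lia]); eR.
  - apply (fdiff_ext (fun x y => ent (X x y) 1 1) _ _ _ _ _ 1 Rlt_0_1); [intros; eR; reflexivity|apply h].
  - apply (fdiff_ext (fun x y => - ent (X x y) 0 1) _ _ _ _ _ 1 Rlt_0_1); [intros; eR; reflexivity|apply hn].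
  - apply (fdiff_ext (fun x y => - ent (X x y) 1 0) _ _ _ _ _ 1 Rlt_0_1); [intros; eR; reflexivity|apply hn].
  - apply (fdiff_ext (fun x y => ent (X x y) 0 0) _ _ _ _ _ 1 Rlt_0_1); [intros; eR; reflexivity|apply h].
Qed.

Lemma mfdiff_D f x y P Q : mfdiff f x y P Q -> Defs.Dx f x y = P /\ Defs.Dy f x y = Q.
Proof.
  intros h. split; apply mx_extR; unfold Defs.Dx, Defs.Dy; rewrite ent_mderive; apply is_derive_unique; apply (fdiff_partial _ _ _ _ _ (h _ _)).
Qed.

Lemma mfdiff_ext f g x y P Q d : 0 < d ->
  (forall u v, Rabs u < d -> Rabs v < d -> f (x + u) (y + v) = g (x + u) (y + v)) -> mfdiff f x y P Q -> mfdiff g x y P Q.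
Proof.
  intros hd e h i j. apply (fdiff_ext (fun x y => ent (f x y) i j) _ _ _ _ _ d hd); [|apply h].
  intros. rewrite e; auto.
Qed.

Lemma mfdiff_eq f x y P Q P' Q' : P = P' -> Q = Q' -> mfdiff f x y P Q -> mfdiff f x y P' Q'.
Proof. intros <- <-. auto. Qed.

Definition bracket (U X : M2 R) : M2 R := rsub (Mmult U X) (Mmult X U).

(** The trace conditions make the adjugate of [U] equal to $-U$, which turns the product rule into a
    commutator. *)
Lemma mfdiff_Ad G x y U W X : mfdiff G x y (Mmult (G x y) U) (Mmult (G x y) W) ->
  ent U 1 1 = - ent U 0 0 :> R -> ent W 1 1 = - ent W 0 0 :> R ->
  mfdiff (fun x y => Ad (G x y) X) x y (Ad (G x y) (bracket U X)) (Ad (G x y) (bracket W X)).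
Proof.
  intros h hU hW.
  assert (z : zero = (zero : M2 R)) by reflexivity.
  assert (k := mfdiff_mult _ _ _ _ _ _ _ _ (mfdiff_mult _ _ _ _ _ _ _ _ h (mfdiff_const X x y zero z)) (mfdiff_inv _ _ _ _ _ h)).
  refine (mfdiff_eq _ _ _ _ _ _ _ _ _ k);
  unfold Ad, bracket; generalize (G x y); intros g; apply mx_extR; eR; rewrite ?hU, ?hW; Rring.
Qed.

Lemma rep_at_one S B g : rep w2 S B g -> g (RtoC 1) = RtoC (ev1 g).
Proof.
  intros hg. apply (usum_RtoC_Re (fun n => cf g n)).
  eapply usum_ext; [|exact (proj2 (proj2 hg) (RtoC 1) Cmod_1)]. intros n. cbv beta. rewrite Czpow_one. ring.
Qed.

(** The rational parametrization of the circle at a small parameter $t$; its distance from $1$ is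
    $2t/\sqrt{1+t^2}$. *)
Lemma circle_point d : 0 < d -> exists m, Cmod m = 1 /\ 0 < Cmod (m - 1) <= d /\ Cmod (m - 1) <= 2.
Proof.
  intros hd. set (t := Rmin 1 (d / 2)).
  assert (ht : 0 < t <= 1 /\ t <= d / 2).
  { unfold t. split; [split; [apply Rmin_glb_lt; lra|apply Rmin_l]|apply Rmin_r]. }
  assert (h1 : 0 < 1 + t * t) by nra.
  set (m := ((1 - t * t) / (1 + t * t), 2 * t / (1 + t * t)) : C). exists m.
  assert (e1 : Cmod m = 1).
  { unfold Cmod, m; simpl. replace (_ + _) with 1 by (field; lra). apply sqrt_1. }
  assert (e2 : Cmod (m - 1) = sqrt (4 * t * t / (1 + t * t))).
  { unfold Cmod, m; simpl. f_equal. field; lra. }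
  assert (b : 4 * t * t / (1 + t * t) <= (2 * t) * (2 * t)).
  { apply Rmult_le_reg_r with (1 + t * t); auto. field_simplify; nra. }
  assert (b2 : Cmod (m - 1) <= 2 * t).
  { rewrite e2, <- (sqrt_square (2 * t)) by lra. apply sqrt_le_1_alt. exact b. }
  split; auto. split; [split|]; [|lra|lra].
  rewrite e2. apply sqrt_lt_R0. apply Rdiv_lt_0_compat; nra.
Qed.

(** Both sides are first-order coefficients at $1$ along the circle, with quadratic remainders.
    Their difference $e$ satisfies $|e||m-1|\le K|m-1|^2$, and $m$ may be taken arbitrarily close to
    $1$. *)
Lemma df_mult B B' g h : rep w2 allz B g -> rep w2 allz B' h ->
  df (fun l => g l * h l)%C = df g * ev1 h + ev1 g * df h.
Proof.
  intros hg hh. assert (hgh := rep_mult w2 weight_w2 allz allz allz _ _ _ _ ltac:(supp) hg hh).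
  assert (p1 := rep_ge0 w2 _ _ _ hg). assert (p2 := rep_ge0 w2 _ _ _ hh).
  set (a := df g). set (b := df h). set (e := df (fun l => g l * h l)%C - (a * ev1 h + ev1 g * b)).
  set (K := 4 * (B * B') + (Rabs a * (Rabs b + 8 * B') + 4 * B * B' + B * (4 * B'))).
  assert (hK : 0 <= K).
  { assert (0 <= Rabs a) by apply Rabs_pos. assert (0 <= Rabs b) by apply Rabs_pos.
    unfold K. repeat apply Rplus_le_le_0_compat; repeat apply Rmult_le_pos; lra. }
  assert (main : forall m, Cmod m = 1 -> Cmod (m - 1) <= 2 -> Rabs e * Cmod (m - 1) <= K * Cmod (m - 1) ^ 2).
  { intros m hm hm2. set (z := (m - 1)%C) in *.
    assert (c1 := circle_derive_bound _ _ _ m hg hm). assert (c2 := circle_derive_bound _ _ _ m hh hm).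
    assert (c3 := circle_derive_bound _ _ _ m hgh hm). fold z in c1, c2, c3. fold a in c1. fold b in c2.
    assert (eg := rep_at_one _ _ _ hg). assert (eh := rep_at_one _ _ _ hh).
    set (G1 := g (RtoC 1)) in *. set (H1 := h (RtoC 1)) in *.
    set (Rg := (g m - G1 - RtoC a * z)%C) in *. set (Rh := (h m - H1 - RtoC b * z)%C) in *.
    set (T := (g m * h m - G1 * H1 - RtoC (df (fun l => g l * h l)%C) * z)%C) in *.
    assert (id : (RtoC e * z)%C = (- T + (RtoC a * z * (h m - H1) + (Rg * h m + G1 * Rh)))%C).
    { unfold e, T, Rg, Rh. rewrite RtoC_minus, RtoC_plus, !RtoC_mult, <- eg, <- eh. ring. }
    assert (hz := Cmod_ge_0 z).
    rewrite <- Cmod_R, <- Cmod_mult, id.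
    assert (bh : Cmod (h m - H1) <= (Rabs b + 8 * B') * Cmod z).
    { replace (h m - H1)%C with (RtoC b * z + Rh)%C by (unfold Rh; ring).
      eapply Rle_trans; [apply Cmod_triangle|]. rewrite Cmod_mult, Cmod_R.
      assert (4 * B' * Cmod z ^ 2 <= 8 * B' * Cmod z).
      { replace (4 * B' * Cmod z ^ 2) with (4 * B' * Cmod z * Cmod z) by ring.
        replace (8 * B' * Cmod z) with (4 * B' * Cmod z * 2) by ring.
        apply Rmult_le_compat_l; [apply Rmult_le_pos; lra|lra]. }
      lra. }
    assert (b1 := rep_Cmod w2 weight_w2 _ _ _ m hh hm). assert (b2 := rep_Cmod w2 weight_w2 _ _ _ (RtoC 1) hg Cmod_1). fold G1 in b2.
    assert (t1 : Cmod (RtoC a * z * (h m - H1)) <= Rabs a * (Rabs b + 8 * B') * Cmod z ^ 2).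
    { rewrite !Cmod_mult, Cmod_R. replace (Rabs a * (Rabs b + 8 * B') * Cmod z ^ 2) with (Rabs a * Cmod z * ((Rabs b + 8 * B') * Cmod z)) by ring.
      apply Rmult_le_compat_l; auto. apply Rmult_le_pos; auto. apply Rabs_pos. }
    assert (t2 : Cmod (Rg * h m) <= 4 * B * B' * Cmod z ^ 2).
    { rewrite Cmod_mult. replace (4 * B * B' * Cmod z ^ 2) with ((4 * B * Cmod z ^ 2) * B') by ring.
      apply Rmult_le_compat; auto; apply Cmod_ge_0. }
    assert (t3 : Cmod (G1 * Rh) <= B * (4 * B') * Cmod z ^ 2).
    { rewrite Cmod_mult, (Rmult_assoc B). apply Rmult_le_compat; auto; apply Cmod_ge_0. }
    eapply Rle_trans; [apply Cmod_triangle|]. rewrite Cmod_opp.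
    eapply Rle_trans; [apply Rplus_le_compat; [exact c3|eapply Rle_trans; [apply Cmod_triangle|apply Rplus_le_compat; [exact t1|
      eapply Rle_trans; [apply Cmod_triangle|apply Rplus_le_compat; [exact t2|exact t3]]]]]|].
    unfold K. lra. }
  assert (he : Rabs e = 0).
  { apply Rle_antisym; [|apply Rabs_pos]. apply le_epsilon. intros eps heps.
    destruct (circle_point (eps / (K + 1))) as (m & m1 & (m2 & m3) & m4); [apply Rdiv_lt_0_compat; lra|].
    specialize (main m m1 m4).
    assert (Rabs e <= K * Cmod (m - 1)).
    { apply Rmult_le_reg_r with (Cmod (m - 1)); auto. simpl in main. lra. }
    assert (K * Cmod (m - 1) <= K * (eps / (K + 1))) by (apply Rmult_le_compat_l; auto).
    assert (K * (eps / (K + 1)) <= eps).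
    { apply Rmult_le_reg_r with (K + 1); [lra|]. field_simplify; nra. }
    lra. }
  destruct (Req_dec e 0) as [e0|e0]; [|apply Rabs_no_R0 in e0; lra]. unfold e in e0. lra.
Qed.

(** Differentiates $\det g=1$ along the circle; that the constant $1$ has derivative $0$ is drawn
    from the product rule for $1\cdot1$. *)
Lemma df_det B g : mrep w2 allz B g -> (forall l, Cmod l = 1 -> mdet (g l) = RtoC 1) ->
  mtr (Mmult (ML df g) (sl_inv (ML ev1 g))) = 0.
Proof.
  intros hg hd.
  assert (m1 := rep_mult w2 weight_w2 allz allz allz _ _ _ _ ltac:(supp) (hg 0%nat 0%nat) (hg 1%nat 1%nat)).
  assert (m2 := rep_mult w2 weight_w2 allz allz allz _ _ _ _ ltac:(supp) (hg 0%nat 1%nat) (hg 1%nat 0%nat)).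
  assert (e1 := df_mult _ _ _ _ (hg 0%nat 0%nat) (hg 1%nat 1%nat)).
  assert (e2 := df_mult _ _ _ _ (hg 0%nat 1%nat) (hg 1%nat 0%nat)).
  assert (h1 : rep w2 allz (1 * 1) (fun _ => RtoC 1)).
  { apply rep_real; [apply weight_w2|exact I|]. unfold w2; simpl. rewrite Rabs_R1. lra. }
  assert (e3 : df (fun l => ent (g l) 0 0 * ent (g l) 1 1)%C = df (fun l => ent (g l) 0 1 * ent (g l) 1 0)%C + df (fun _ => RtoC 1)).
  { refine (eq_trans _ (lf_plus df lfun_df _ _ _ _ m2 h1)). apply (lf_ext df lfun_df).
    intros l hl. rewrite <- (hd l hl), mdetC. ring. }
  assert (e4 := df_mult _ _ _ _ h1 h1).
  assert (e5 : df (fun _ : C => (RtoC 1 * RtoC 1)%C) = df (fun _ => RtoC 1)).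
  { apply (lf_ext df lfun_df). intros; ring. }
  assert (e6 : ev1 (fun _ => RtoC 1) = 1) by reflexivity.
  assert (e7 : df (fun _ => RtoC 1) = 0).
  { assert (k := eq_trans (eq_sym e5) e4). rewrite e6 in k. lra. }
  rewrite mtrR. eR. rewrite !ent_ML by lia.
  assert (k := eq_trans (eq_sym e1) (eq_trans e3 (f_equal2 Rplus e2 e7))). cbv beta in k. apply Req_minus.
  match type of k with ?u = ?v => transitivity (u - v); [ring|lra] end.
Qed.

Lemma adiff_rep X x y P Q : adiff X x y P Q -> exists B, mrep w2 allz B (X x y).
Proof. intros h. apply (ad_X _ _ _ _ _ h). Qed.

(** A fixed name for the real zero matrix, so that rewriting meets a single instance. *)
Definition mzero : M2 R := zero.

Lemma entR_mzero i j : ent mzero i j = 0.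
Proof. apply entR_zero. Qed.

Ltac mZ := apply mx_extR; repeat (rewrite ?entR_mzero; eR); try Rring.

Section Family.

Context (s : R) (hs : s > 1 / 2) (J : R -> Prop) (hJ : opn J).
Context (hconv : forall x y z, J x -> J z -> x <= y <= z -> J y).
Context (F : R -> loop) (a q p r : R -> R) (t0 : R) (ht0 : J t0).
Hypothesis (hG : forall t, J t -> in_G s (F t)).
Hypothesis (hinit : loop_eq (F t0) (fun _ => Mone)).
Hypothesis (hode : is_maurer_cartan s J F (fun t => pot (a t) (q t) (p t) (r t))).
Hypothesis (hca : csm J a) (hcq : csm J q) (hch : csm J p) (hcr : csm J r).

Let A t : loop := pot (a t) (q t) (p t) (r t).
(* Both partial Maurer-Cartan forms of the family are values of [B]. *)
Let B t : loop := pot (- a t) (- q t) (- p t) (- r t).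

Lemma fam_det t l : J t -> Cmod l = 1 -> mdet (F t l) = RtoC 1.
Proof. intros ht. apply (G_det s _ (hG t ht)). Qed.

Lemma fam_plus x y : J x -> adiff (fun x _ => F x) x y (fun l => Mmult (F x l) (A x l)) (fun _ => zero).
Proof.
  intros hx.
  destruct (frame_adiff s hs J hJ hconv F a q p r t0 ht0 hG hinit hode
    (fun t ht => csm_continuous J a t hca ht) (fun t ht => csm_continuous J q t hcq ht)
    (fun t ht => csm_continuous J p t hch ht) (fun t ht => csm_continuous J r t hcr ht) x hx) as (K & k1 & k2 & k3).
  split; [eexists; eauto|eexists; eauto|exists 0; apply (mrep_zero w2 weight_w2)|].
  intros eps he. destruct (k3 eps he) as (d & hd & hk). exists d; split; auto. intros u v hu hv.
  eapply (mrep_ext w2 weight_w2); [|eapply mrep_le; [|apply (hk u hu)]].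
  - intros l _. unfold lin, A. mxC.
  - generalize (Rabs_pos v); nra.
Qed.

Lemma fam_minus x y : J (- y) -> adiff (fun _ y => F (- y)) x y (fun _ => zero) (fun l => Mmult (F (- y) l) (B (- y) l)).
Proof.
  intros hy.
  destruct (frame_adiff s hs J hJ hconv F a q p r t0 ht0 hG hinit hode
    (fun t ht => csm_continuous J a t hca ht) (fun t ht => csm_continuous J q t hcq ht)
    (fun t ht => csm_continuous J p t hch ht) (fun t ht => csm_continuous J r t hcr ht) (- y) hy) as (K & k1 & k2 & k3).
  assert (eB : forall l, Mmult (F (- y) l) (B (- y) l) = mscal (RtoC (-1)) (Mmult (F (- y) l) (A (- y) l))).
  { intros l. unfold A, B, pot. apply mx_extC; entC; rewrite ?RtoC_opp, ?RtoC_m1; Cring. }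
  split; [eexists; eauto|exists 0; apply (mrep_zero w2 weight_w2)| |].
  - exists (Rabs (-1) * K). apply (mrep_ext w2 weight_w2 _ _ _ _ (fun l _ => eq_sym (eB l))).
    apply mrep_scal; [apply weight_w2|auto].
  - intros eps he. destruct (k3 eps he) as (d & hd & hk). exists d; split; auto. intros u v hu hv.
    eapply (mrep_ext w2 weight_w2); [|eapply mrep_le; [|apply (hk (- v)); rewrite Rabs_Ropp; auto]].
    + intros l _. cbv beta. rewrite Ropp_plus_distr. unfold lin. rewrite eB. fold (A (- y)). apply mx_extC; entC; rewrite RtoC_opp, RtoC_m1; Cring.
    + rewrite Rabs_Ropp. generalize (Rabs_pos u); nra.
Qed.

Let Phi x y : loop := fun l => Mmult (sl_inv (F x l)) (F (- y) l).

(** From $F'=FA$ follows $(F^{-1})'=-AF^{-1}$, and the substitution $t=-y$ changes the sign of the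
    other form as well. *)
Lemma fam_Phi x y : J x -> J (- y) -> adiff Phi x y (fun l => Mmult (B x l) (Phi x y l)) (fun l => Mmult (Phi x y l) (B (- y) l)).
Proof.
  intros hx hy.
  refine (adiff_ext Phi Phi x y _ _ _ _ 1 Rlt_0_1 (fun _ _ _ _ _ _ => eq_refl) _ _
    (adiff_mult _ _ _ _ _ _ _ _ (adiff_inv _ _ _ _ _ (fam_plus x y hx)) (fam_minus x y hy))).
  - intros l hl. rewrite sl_inv_mult. unfold A. rewrite pot_adj. fold (B x). unfold Phi. rewrite <- Mmult_assocC. mxC.
  - intros l hl. unfold Phi. rewrite <- Mmult_assocC. mxC.
Qed.

Let M x y : Prop := J x /\ J (- y) /\ in_BL s (Phi x y).

Context (Hm Hp : R -> R -> loop).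
Hypothesis (hH : forall x y, M x y ->
  in_Gminus_star s (Hm x y) /\ in_Gplus s (Hp x y) /\ loop_eq (Phi x y) (loop_mul (Hm x y) (Hp x y))).

Lemma fam_birk x y : M x y -> birk (Phi x y) (Hm x y) (Hp x y).
Proof.
  intros hxy. destruct (hH x y hxy) as (h1 & h2 & h3). destruct hxy as (hx & hy & _).
  destruct (adiff_rep _ _ _ _ _ (fam_Phi x y hx hy)) as (K & hK).
  exact (birk_of_G s _ _ _ K hs h1 h2 h3 hK).
Qed.

(** [birk_near] yields factors with weighted decay, determinant one and $\sigma$-symmetry, which
    places them in $\mathcal{G}^\pm$; continuity of [Phi] in the weighted norm supplies the
    neighbourhood. *)
Lemma fam_open : open2 M.
Proof.
  intros x y hxy. assert (hb := fam_birk x y hxy).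
  destruct (hH x y hxy) as (h1 & h2 & h3). destruct hxy as (hx & hy & _).
  destruct (birk_near _ _ _ hb) as (d & hd & hn).
  destruct (adiff_near _ _ _ _ _ (fam_Phi x y hx hy)) as (K & d1 & hK & hd1 & hk).
  destruct (hJ x hx) as (d2 & hd2 & j2). destruct (hJ (- y) hy) as (d3 & hd3 & j3).
  set (d4 := d / (2 * K + 2)). assert (hd4 : 0 < d4) by (unfold d4; apply Rdiv_lt_0_compat; lra).
  assert (hdd : 0 < Rmin (Rmin d1 d2) (Rmin d3 d4)) by (repeat apply Rmin_glb_lt; auto).
  exists (mkposreal _ hdd). intros u v hu hv. simpl in hu, hv.
  assert (hmin : forall z, z < Rmin (Rmin d1 d2) (Rmin d3 d4) -> z < d1 /\ z < d2 /\ z < d3 /\ z < d4).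
  { intros z. unfold Rmin. repeat destruct Rle_dec; intros; repeat split; lra. }
  apply hmin in hu, hv. destruct hu as (u1 & u2 & u3 & u4), hv as (v1 & v2 & v3 & v4).
  assert (hu : J u) by (apply j2; auto).
  assert (hv : J (- v)) by (apply j3; replace (- v - - y) with (- (v - y)) by ring; rewrite Rabs_Ropp; auto).
  split; [auto|split; [auto|]].
  destruct (hk (u - x) (v - y) u1 v1) as (k1 & _).
  replace (x + (u - x)) with u in k1 by ring. replace (y + (v - y)) with v in k1 by ring.
  destruct (hn (Phi u v)) as (gm & gp & B' & g1 & g2 & g3 & g4 & g5 & g6 & g7).
  - eapply mrep_le; [|exact k1]. apply Rle_trans with (K * (2 * d4)); [apply Rmult_le_compat_l; lra|].
    unfold d4. apply Rmult_le_reg_r with (2 * K + 2); [lra|]. field_simplify; nra.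
  - intros l hl. unfold Phi. rewrite mdet_mult, mdet_inv, !fam_det by auto. Cring.
  - exact (G_sigma s _ (proj1 h1)).
  - exact (G_sigma s _ (proj1 h2)).
  - apply (sigma_fixed_mult (fun l => sl_inv (F u l)) (F (- v))); [apply (sigma_fixed_inv (F u))|].
    + exact (G_sigma s _ (hG u hu)).
    + exact (G_sigma s _ (hG _ hv)).
  - exists gm, gp. split; [|split].
    + apply (in_Gminus_of_rep s B'); auto. lra.
    + apply (in_Gplus_of_rep s B'); auto. lra.
    + exact g3.
Qed.

Lemma fam_near x y : M x y -> exists d, 0 < d /\ forall u v, Rabs u < d -> Rabs v < d -> M (x + u) (y + v).
Proof.
  intros hxy. destruct (fam_open x y hxy) as (d & hd). exists d. split; [apply cond_pos|]. intros u v hu hv.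
  apply hd; [replace (x + u - x) with u by ring|replace (y + v - y) with v by ring]; auto.
Qed.

Let K x y := ML (cfn (-1)) (Hm x y).
Let D x y := ML (cfn 0) (Hp x y).
Let b0 t := P0 (- a t).
Let b1 t := P1 (- q t) (- p t).
Let bm t := Pm (- p t) (- r t).

(* Minus the coefficients of the connection form [alpha dx] of the frame. *)
Definition conn0 x y := radd (b0 x) (rsub (Mmult (b1 x) (K x y)) (Mmult (K x y) (b1 x))).
Definition connm x y := Mmult (D x y) (Mmult (bm (- y)) (sl_inv (D x y))).

Let al x y : loop := lp (conn0 x y) (b1 x) zero.
Let be x y : loop := lp zero zero (connm x y).

Lemma B_lp t l : B t l = lp (b0 t) (b1 t) (bm t) l.
Proof. apply pot_lp. Qed.

Lemma mrep_B t : exists B', mrep w2 u1 B' (B t).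
Proof. apply mrep_pot, weight_w2. Qed.

Lemma trace_b t : ent (b0 t) 1 1 = - ent (b0 t) 0 0 :> R /\ ent (b1 t) 1 1 = - ent (b1 t) 0 0 :> R /\
  ent (bm t) 1 1 = - ent (bm t) 0 0 :> R.
Proof. unfold b0, b1, bm, P0, P1, Pm. split; [|split]; eR; Rring. Qed.

Lemma mtr_lp A0 A1 Am l : ent A0 1 1 = - ent A0 0 0 :> R -> ent A1 1 1 = - ent A1 0 0 :> R ->
  ent Am 1 1 = - ent Am 0 0 :> R -> mtr (lp A0 A1 Am l) = RtoC 0.
Proof.
  intros e e' e''. rewrite mtrC, !ent_lp, e, e', e'', !RtoC_opp. Cring.
Qed.

Lemma mtr_al x y l : mtr (al x y l) = RtoC 0.
Proof.
  destruct (trace_b x) as (e0 & e1 & _). refine (mtr_lp (conn0 x y) (b1 x) zero l _ e1 _).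
  - unfold conn0. revert e0. generalize (b0 x) (b1 x) (K x y). intros U V W e0. eR. rewrite e0. Rring.
  - eR. Rring.
Qed.

Lemma mtr_be x y l : mtr (be x y l) = RtoC 0.
Proof.
  destruct (trace_b (- y)) as (_ & _ & e). refine (mtr_lp zero zero (connm x y) l _ _ _); try (eR; Rring).
  unfold connm. generalize dependent (bm (- y)). generalize (D x y). intros U W e. eR. rewrite e. Rring.
Qed.

(** $\hat H_-^{-1}B\hat H_-$ has degree at most $1$ and $\hat H_+B\hat H_+^{-1}$ has degree at least
    $-1$. The nonnegative part of the first and the negative part of the second are therefore
    Laurent polynomials, namely [al] and [be]. *)
Lemma fam_factors x y : M x y ->
  (exists VP Bv, mrep w2 neg1 Bv VP /\ forall l, Cmod l = 1 ->
    Mmult (sl_inv (Hm x y l)) (Mmult (B x l) (Hm x y l)) = cadd (VP l) (al x y l)) /\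
  (exists Bt T, mrep w2 pos0 Bt T /\ forall l, Cmod l = 1 ->
    Mmult (Hp x y l) (Mmult (B (- y) l) (sl_inv (Hp x y l))) = cadd (be x y l) (T l)).
Proof.
  intros hxy. assert (hb := fam_birk x y hxy).
  destruct (bk_m _ _ _ hb) as (b & hm). destruct (bk_p _ _ _ hb) as (b' & hp).
  assert (dm := bk_detm _ _ _ hb). assert (dp := bk_detp _ _ _ hb).
  split.
  - destruct (mrep_B x) as (B' & hB).
    set (X := fun l => Mmult (sl_inv (Hm x y l)) (Mmult (B x l) (Hm x y l))).
    assert (hX : mrep w2 (fun n => n <= 1)%Z (2 * b * (2 * B' * b)) X).
    { assert (h1 : mrep w2 (fun n => n <= 1)%Z (2 * B' * b) (fun l => Mmult (B x l) (Hm x y l))).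
      { refine (mrep_mult w2 weight_w2 u1 neg0 _ _ _ _ _ _ hB hm). unfold u1, neg0; intros; lia. }
      refine (mrep_mult w2 weight_w2 neg0 _ _ _ _ _ _ _ (mrep_inv w2 weight_w2 _ _ _ hm) h1). unfold neg0; intros; lia. }
    destruct (split_upper X _ hX) as (a0 & a1 & e).
    destruct (mproj_spec _ X (mrep_all _ _ _ hX)) as (h1 & _).
    exists (mproj X), (2 * b * (2 * B' * b)). split; auto.
    assert (e2 : forall l, Cmod l = 1 -> X l = cadd (mproj X l) (lp a0 a1 zero l)).
    { intros l hl. rewrite <- e by auto. mxC. }
    destruct (upper_coefs _ _ _ (b0 x) (b1 x) (bm x) a0 a1 (mproj X) _ hb h1) as (-> & ->).
    + intros l hl. transitivity (Mmult (Hm x y l) (X l)).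
      * unfold X. rewrite <- Mmult_assocC, sl_inv_r, Mmult_1l, B_lp; auto.
      * rewrite e2 by auto. mxC.
    + exact e2.
  - destruct (mrep_B (- y)) as (B' & hB).
    set (X := fun l => Mmult (Hp x y l) (Mmult (B (- y) l) (sl_inv (Hp x y l)))).
    assert (hX : mrep w2 (fun n => -1 <= n)%Z (2 * b' * (2 * B' * b')) X).
    { assert (h1 : mrep w2 (fun n => -1 <= n)%Z (2 * B' * b') (fun l => Mmult (B (- y) l) (sl_inv (Hp x y l)))).
      { refine (mrep_mult w2 weight_w2 u1 pos0 _ _ _ _ _ _ hB (mrep_inv w2 weight_w2 _ _ _ hp)). unfold u1, pos0; intros; lia. }
      refine (mrep_mult w2 weight_w2 pos0 _ _ _ _ _ _ _ hp h1). unfold pos0; intros; lia. }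
    destruct (split_lower X _ hX) as (b2 & e).
    destruct (mproj_spec _ X (mrep_all _ _ _ hX)) as (_ & h1).
    exists (2 * b' * (2 * B' * b')), (fun l => csub (X l) (mproj X l)). split; auto.
    assert (e2 : forall l, Cmod l = 1 -> X l = cadd (lp zero zero b2 l) (csub (X l) (mproj X l))).
    { intros l hl. rewrite <- e by auto. mxC. }
    assert (eb : b2 = connm x y).
    { apply (lower_coefs _ _ _ (b0 (- y)) (b1 (- y)) (bm (- y)) b2 _ _ hb h1).
      intros l hl. transitivity (Mmult (X l) (Hp x y l)).
      - unfold X. rewrite !Mmult_assocC, sl_inv_l, Mmult_1r, B_lp; auto.
      - rewrite e2 at 1 by auto. mxC. }
    subst b2. exact e2.
Qed.

Lemma mrep_lp_support S A0 A1 Am : (~ S 0%Z -> A0 = zero) -> (~ S 1%Z -> A1 = zero) -> (~ S (-1)%Z -> Am = zero) ->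
  exists b, mrep w2 S b (lp A0 A1 Am).
Proof.
  intros h0 h1 hm. destruct (mrep_lp A0 A1 Am) as (b & hb). exists b.
  destruct (cf_lp A0 A1 Am _ (fun l _ => eq_refl)) as (c0 & c1 & cm).
  apply (mrep_intro w2 weight_w2); [apply (mrep_ge0 w2 _ _ _ hb)|].
  intros i j hi hj. destruct (hb i j) as (r1 & r2 & r3). split; [auto|split; [|auto]].
  intros n hn. destruct (classic (u1 n)) as [hu|hu]; [|auto].
  assert (z : ML (cfn n) (lp A0 A1 Am) = zero).
  { assert (c : (n = 0 \/ n = 1 \/ n = -1)%Z) by (unfold u1 in hu; lia).
    destruct c as [->|[->| ->]]; [rewrite c0|rewrite c1|rewrite cm]; auto. }
  apply (f_equal (fun A => ent A i j)) in z. rewrite ent_ML, entR_zero in z by auto. exact z.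
Qed.

Lemma fam_eq x y l : M x y -> Cmod l = 1 -> Phi x y l = Mmult (Hm x y l) (Hp x y l).
Proof. intros hxy. apply (bk_eq _ _ _ (fam_birk x y hxy)). Qed.

Lemma fam_det_m x y l : M x y -> Cmod l = 1 -> mdet (Hm x y l) = RtoC 1.
Proof. intros hxy. apply (bk_detm _ _ _ (fam_birk x y hxy)). Qed.

Lemma fam_det_p x y l : M x y -> Cmod l = 1 -> mdet (Hp x y l) = RtoC 1.
Proof. intros hxy. apply (bk_detp _ _ _ (fam_birk x y hxy)). Qed.

(** By [adiff_factor] the $x$-derivative is $\hat H_-$ times the negative part of $\hat
    H_-^{-1}\Phi_x\hat H_+^{-1}$. Since $\Phi_x=B\Phi$ and $\Phi=\hat H_-\hat H_+$, this loop is
    $\hat H_-^{-1}B\hat H_-$, whose negative part is itself minus [al]. In the $y$-direction it is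
    $\hat H_+B\hat H_+^{-1}$, with negative part [be]. *)
Lemma fam_Hm x y : M x y -> adiff Hm x y
  (fun l => csub (Mmult (B x l) (Hm x y l)) (Mmult (Hm x y l) (al x y l))) (fun l => Mmult (Hm x y l) (be x y l)).
Proof.
  intros hxy. destruct (fam_factors x y hxy) as ((VP & B1 & v1 & v2) & (B2 & T & t1 & t2)).
  assert (hjx := proj1 hxy). assert (hjy := proj1 (proj2 hxy)).
  destruct (mrep_lp_support neg1 zero zero (connm x y)) as (B3 & v3); [auto|auto|unfold neg1; lia|].
  destruct (mrep_lp_support pos0 (conn0 x y) (b1 x) zero) as (B4 & v4); [unfold pos0; lia|unfold pos0; lia|auto|].
  assert (g1 := mrep_ge0 w2 _ _ _ v1). assert (g2 := mrep_ge0 w2 _ _ _ t1).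
  assert (g3 := mrep_ge0 w2 _ _ _ v3). assert (g4 := mrep_ge0 w2 _ _ _ v4).
  set (Bv := B1 + B2 + B3 + B4).
  destruct (fam_near x y hxy) as (d & hd & hn).
  assert (w1 : mrep w2 neg1 Bv VP) by (eapply mrep_le; [|exact v1]; unfold Bv; lra).
  assert (w2' : mrep w2 neg1 Bv (be x y)) by (eapply mrep_le; [|exact v3]; unfold Bv; lra).
  assert (w3 : mrep w2 pos0 Bv (al x y)) by (eapply mrep_le; [|exact v4]; unfold Bv; lra).
  assert (w4 : mrep w2 pos0 Bv T) by (eapply mrep_le; [|exact t1]; unfold Bv; lra).
  refine (adiff_ext Hm Hm x y _ _ _ _ 1 Rlt_0_1 (fun _ _ _ _ _ _ => eq_refl) _ (fun l _ => eq_refl)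
    (adiff_factor Phi Hm Hp x y _ _ VP (be x y) Bv d hd (fun u v hu hv => fam_birk _ _ (hn u v hu hv)) (fam_Phi x y hjx hjy) w1 w2' _ _)).
  - intros l hl. cbv beta. rewrite <- (Mmult_1l (Mmult (B x l) (Hm x y l))), <- (sl_inv_r _ (fam_det_m x y l hxy hl)).
    rewrite Mmult_assocC, (v2 l hl). generalize (al x y l). intros. mxC.
  - refine (mrep_ext w2 weight_w2 _ _ _ _ _ w3). intros l hl. cbv beta.
    transitivity (csub (Mmult (sl_inv (Hm x y l)) (Mmult (B x l) (Hm x y l))) (VP l)).
    + rewrite (v2 l hl). generalize (al x y l). intros. mxC.
    + rewrite (fam_eq x y l hxy hl), !Mmult_assocC, (sl_inv_r _ (fam_det_p x y l hxy hl)), Mmult_1r. reflexivity.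
  - refine (mrep_ext w2 weight_w2 _ _ _ _ _ w4). intros l hl. cbv beta.
    transitivity (csub (Mmult (Hp x y l) (Mmult (B (- y) l) (sl_inv (Hp x y l)))) (be x y l)).
    + rewrite (t2 l hl). generalize (be x y l). intros. mxC.
    + rewrite (fam_eq x y l hxy hl), !Mmult_assocC, <- (Mmult_assocC (sl_inv (Hm x y l))), (sl_inv_l _ (fam_det_m x y l hxy hl)), Mmult_1l. reflexivity.
Qed.

(** The product rule for $\hat H_+=\hat H_-^{-1}\Phi$; in the $x$-derivative the terms with [B x]
    cancel. *)
Lemma fam_Hp x y : M x y -> adiff Hp x y
  (fun l => Mmult (al x y l) (Hp x y l))
  (fun l => csub (Mmult (Hp x y l) (B (- y) l)) (Mmult (be x y l) (Hp x y l))).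
Proof.
  intros hxy. assert (hjx := proj1 hxy). assert (hjy := proj1 (proj2 hxy)).
  destruct (fam_near x y hxy) as (d & hd & hn).
  refine (adiff_ext _ Hp x y _ _ _ _ d hd _ _ _ (adiff_mult _ _ _ _ _ _ _ _ (adiff_inv _ _ _ _ _ (fam_Hm x y hxy)) (fam_Phi x y hjx hjy))).
  - intros u v l hu hv hl. cbv beta. assert (hm := hn u v hu hv).
    rewrite (fam_eq _ _ l hm hl), <- Mmult_assocC, (sl_inv_l _ (fam_det_m _ _ l hm hl)), Mmult_1l. reflexivity.
  - intros l hl. cbv beta.
    assert (ea := adj_traceless _ (mtr_al x y l)).
    assert (eB : sl_inv (B x l) = csub zero (B x l)).
    { apply adj_traceless. rewrite B_lp. destruct (trace_b x) as (e0 & e1 & em). exact (mtr_lp _ _ _ l e0 e1 em). }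
    transitivity (cadd (Mmult (csub (Mmult (sl_inv (Hm x y l)) (sl_inv (B x l))) (Mmult (sl_inv (al x y l)) (sl_inv (Hm x y l)))) (Phi x y l))
      (Mmult (sl_inv (Hm x y l)) (Mmult (B x l) (Phi x y l)))).
    { generalize (B x l) (al x y l) (Hm x y l) (Phi x y l). intros. mxC. }
    rewrite ea, eB.
    transitivity (Mmult (al x y l) (Mmult (sl_inv (Hm x y l)) (Phi x y l))).
    { generalize (B x l) (al x y l) (sl_inv (Hm x y l)) (Phi x y l). intros. mxC. }
    rewrite (fam_eq _ _ l hxy hl), <- (Mmult_assocC (sl_inv _)), (sl_inv_l _ (fam_det_m _ _ l hxy hl)), Mmult_1l. reflexivity.
  - intros l hl. cbv beta.
    assert (eb := adj_traceless _ (mtr_be x y l)). rewrite sl_inv_mult, eb.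
    transitivity (csub (Mmult (Mmult (sl_inv (Hm x y l)) (Phi x y l)) (B (- y) l)) (Mmult (be x y l) (Mmult (sl_inv (Hm x y l)) (Phi x y l)))).
    { generalize (B (- y) l) (be x y l) (sl_inv (Hm x y l)) (Phi x y l). intros. mxC. }
    rewrite (fam_eq _ _ l hxy hl), <- !(Mmult_assocC (sl_inv _)), (sl_inv_l _ (fam_det_m _ _ l hxy hl)), Mmult_1l. reflexivity.
Qed.

Definition fam_frame (x y : R) : loop := fun l => Mmult (F (- y) l) (sl_inv (Hp x y l)).

(** In the $y$-derivative the terms with [B (- y)] coming from $\hat F_-$ and from $\hat H_+^{-1}$
    cancel, which leaves the pure $\lambda^{-1}$ term [be]. *)
Lemma fam_frame_diff x y : M x y -> adiff fam_frame x y
  (fun l => Mmult (fam_frame x y l) (csub zero (al x y l))) (fun l => Mmult (fam_frame x y l) (be x y l)).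
Proof.
  intros hxy. assert (hjy := proj1 (proj2 hxy)).
  refine (adiff_ext _ fam_frame x y _ _ _ _ 1 Rlt_0_1 (fun _ _ _ _ _ _ => eq_refl) _ _
    (adiff_mult _ _ _ _ _ _ _ _ (fam_minus x y hjy) (adiff_inv _ _ _ _ _ (fam_Hp x y hxy)))).
  - intros l hl. cbv beta. unfold fam_frame. rewrite sl_inv_mult, (adj_traceless _ (mtr_al x y l)).
    generalize (al x y l) (sl_inv (Hp x y l)) (F (- y) l). intros. mxC.
  - intros l hl. cbv beta. unfold fam_frame.
    assert (eB : sl_inv (B (- y) l) = csub zero (B (- y) l)).
    { apply adj_traceless. rewrite B_lp. destruct (trace_b (- y)) as (e0 & e1 & em). exact (mtr_lp _ _ _ l e0 e1 em). }
    transitivity (cadd (Mmult (Mmult (F (- y) l) (B (- y) l)) (sl_inv (Hp x y l)))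
       (Mmult (F (- y) l) (csub (Mmult (sl_inv (B (- y) l)) (sl_inv (Hp x y l))) (Mmult (sl_inv (Hp x y l)) (sl_inv (be x y l)))))).
    { generalize (B (- y) l) (be x y l) (Hp x y l) (F (- y) l). intros. mxC. }
    rewrite eB, (adj_traceless _ (mtr_be x y l)).
    generalize (B (- y) l) (be x y l) (sl_inv (Hp x y l)) (F (- y) l). intros. mxC.
Qed.

Lemma ML_sub L g g' bb bb' : lfun L -> mrep w2 allz bb g -> mrep w2 allz bb' g' ->
  ML L (fun l => csub (g l) (g' l)) = rsub (ML L g) (ML L g').
Proof.
  intros hL hg hg'.
  assert (e := ML_add L _ _ _ _ hL (mrep_minus w2 weight_w2 _ _ _ _ _ hg hg') hg').
  rewrite (ML_ext L _ g hL) in e by (intros; mxC). rewrite e. mR.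
Qed.

Lemma neg_lp A0 A1 l : csub zero (lp A0 A1 mzero l) = lp (rsub mzero A0) (rsub mzero A1) mzero l.
Proof. apply mx_extC; rewrite entC_csub, !ent_lp, !entR_rsub, entC_zero, !entR_mzero, !RtoC_minus; Cring. Qed.

Lemma fam_reps x y : M x y -> exists k, mrep w2 allz k (Hm x y) /\ mrep w2 allz k (Hp x y) /\ mrep w2 allz k (fam_frame x y).
Proof.
  intros hxy. destruct (adiff_rep _ _ _ _ _ (fam_Hm x y hxy)) as (k1 & h1).
  destruct (adiff_rep _ _ _ _ _ (fam_Hp x y hxy)) as (k2 & h2).
  destruct (adiff_rep _ _ _ _ _ (fam_frame_diff x y hxy)) as (k3 & h3).
  assert (g1 := mrep_ge0 w2 _ _ _ h1). assert (g2 := mrep_ge0 w2 _ _ _ h2). assert (g3 := mrep_ge0 w2 _ _ _ h3).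
  exists (k1 + k2 + k3). split; [|split]; (eapply mrep_le; [|eassumption]; lra).
Qed.

(** The derivative of coefficient $n$ involves the coefficients $n-1$ and $n+1$, so no finite set of
    coefficients is closed under differentiation; the smoothness class [fam_mat] therefore contains
    all of them. *)
Lemma Hm_coef_diff n x y : M x y -> mfdiff (fun x y => ML (cfn n) (Hm x y)) x y
  (rsub (radd (Mmult (b0 x) (ML (cfn n) (Hm x y))) (radd (Mmult (b1 x) (ML (cfn (n - 1)) (Hm x y))) (Mmult (bm x) (ML (cfn (n + 1)) (Hm x y)))))
    (radd (Mmult (ML (cfn n) (Hm x y)) (conn0 x y)) (radd (Mmult (ML (cfn (n - 1)) (Hm x y)) (b1 x)) (Mmult (ML (cfn (n + 1)) (Hm x y)) mzero))))
  (radd (Mmult (ML (cfn n) (Hm x y)) mzero) (radd (Mmult (ML (cfn (n - 1)) (Hm x y)) mzero) (Mmult (ML (cfn (n + 1)) (Hm x y)) (connm x y)))).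
Proof.
  intros hxy. destruct (fam_reps x y hxy) as (k & h1 & _ & _).
  assert (hd := ML_adiff (cfn n) _ _ _ _ _ (lfun_cf n) (fam_Hm x y hxy)).
  destruct (mrep_lp (b0 x) (b1 x) (bm x)) as (k1 & m1). destruct (mrep_lp (conn0 x y) (b1 x) mzero) as (k2 & m2).
  assert (q1 := mrep_mult_all _ _ _ _ (mrep_all _ _ _ m1) h1).
  assert (q2 := mrep_mult_all _ _ _ _ h1 (mrep_all _ _ _ m2)).
  rewrite <- (ML_lp_l _ _ _ (b0 x) (b1 x) (bm x) _ _ (shifts_cf n) h1),
    <- (ML_lp_r _ _ _ (conn0 x y) (b1 x) mzero _ _ (shifts_cf n) h1), <- (ML_lp_r _ _ _ mzero mzero (connm x y) _ _ (shifts_cf n) h1).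
  rewrite <- (ML_sub _ _ _ _ _ (lfun_cf n) q1 q2).
  assert (e : ML (cfn n) (fun l => csub (Mmult (B x l) (Hm x y l)) (Mmult (Hm x y l) (al x y l))) =
    ML (cfn n) (fun l => csub (Mmult (lp (b0 x) (b1 x) (bm x) l) (Hm x y l)) (Mmult (Hm x y l) (lp (conn0 x y) (b1 x) mzero l)))).
  { apply ML_ext; [apply lfun_cf|]. intros. rewrite B_lp. reflexivity. }
  rewrite <- e. exact hd.
Qed.

Lemma Hp_coef_diff n x y : M x y -> mfdiff (fun x y => ML (cfn n) (Hp x y)) x y
  (radd (Mmult (conn0 x y) (ML (cfn n) (Hp x y))) (radd (Mmult (b1 x) (ML (cfn (n - 1)) (Hp x y))) (Mmult mzero (ML (cfn (n + 1)) (Hp x y)))))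
  (rsub (radd (Mmult (ML (cfn n) (Hp x y)) (b0 (- y))) (radd (Mmult (ML (cfn (n - 1)) (Hp x y)) (b1 (- y))) (Mmult (ML (cfn (n + 1)) (Hp x y)) (bm (- y)))))
    (radd (Mmult mzero (ML (cfn n) (Hp x y))) (radd (Mmult mzero (ML (cfn (n - 1)) (Hp x y))) (Mmult (connm x y) (ML (cfn (n + 1)) (Hp x y)))))).
Proof.
  intros hxy. destruct (fam_reps x y hxy) as (k & _ & h1 & _).
  assert (hd := ML_adiff (cfn n) _ _ _ _ _ (lfun_cf n) (fam_Hp x y hxy)).
  destruct (mrep_lp (b0 (- y)) (b1 (- y)) (bm (- y))) as (k1 & m1). destruct (mrep_lp mzero mzero (connm x y)) as (k2 & m2).
  assert (q1 := mrep_mult_all _ _ _ _ h1 (mrep_all _ _ _ m1)).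
  assert (q2 := mrep_mult_all _ _ _ _ (mrep_all _ _ _ m2) h1).
  rewrite <- (ML_lp_r _ _ _ (b0 (- y)) (b1 (- y)) (bm (- y)) _ _ (shifts_cf n) h1),
    <- (ML_lp_l _ _ _ (conn0 x y) (b1 x) mzero _ _ (shifts_cf n) h1), <- (ML_lp_l _ _ _ mzero mzero (connm x y) _ _ (shifts_cf n) h1).
  rewrite <- (ML_sub _ _ _ _ _ (lfun_cf n) q1 q2).
  assert (e : ML (cfn n) (fun l => csub (Mmult (Hp x y l) (B (- y) l)) (Mmult (be x y l) (Hp x y l))) =
    ML (cfn n) (fun l => csub (Mmult (Hp x y l) (lp (b0 (- y)) (b1 (- y)) (bm (- y)) l)) (Mmult (lp mzero mzero (connm x y) l) (Hp x y l)))).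
  { apply ML_ext; [apply lfun_cf|]. intros. rewrite B_lp. reflexivity. }
  rewrite <- e. exact hd.
Qed.

Lemma frame_lin_diff L Lp Lm x y : shifts L Lp Lm -> M x y -> mfdiff (fun x y => ML L (fam_frame x y)) x y
  (radd (Mmult (ML L (fam_frame x y)) (rsub mzero (conn0 x y))) (radd (Mmult (ML Lp (fam_frame x y)) (rsub mzero (b1 x))) (Mmult (ML Lm (fam_frame x y)) mzero)))
  (radd (Mmult (ML L (fam_frame x y)) mzero) (radd (Mmult (ML Lp (fam_frame x y)) mzero) (Mmult (ML Lm (fam_frame x y)) (connm x y)))).
Proof.
  intros hL hxy. destruct (fam_reps x y hxy) as (k & _ & _ & h1).
  assert (hd := ML_adiff L _ _ _ _ _ (sh_L _ _ _ hL) (fam_frame_diff x y hxy)).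
  rewrite <- (ML_lp_r _ _ _ _ _ _ _ _ hL h1), <- (ML_lp_r _ _ _ mzero mzero (connm x y) _ _ hL h1).
  assert (e : ML L (fun l => Mmult (fam_frame x y l) (csub zero (al x y l))) =
    ML L (fun l => Mmult (fam_frame x y l) (lp (rsub mzero (conn0 x y)) (rsub mzero (b1 x)) mzero l))).
  { apply ML_ext; [apply (sh_L _ _ _ hL)|]. intros l _. unfold al. rewrite neg_lp. reflexivity. }
  rewrite <- e. exact hd.
Qed.

Definition fr1 x y := ML ev1 (fam_frame x y).
Definition fd1 x y := ML df (fam_frame x y).

Lemma fr1_diff x y : M x y -> mfdiff fr1 x y
  (rsub mzero (Mmult (fr1 x y) (radd (conn0 x y) (b1 x)))) (Mmult (fr1 x y) (connm x y)).
Proof.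
  intros hxy. assert (h := frame_lin_diff _ _ _ x y shifts_ev1 hxy). fold (fr1 x y) in h.
  match type of h with mfdiff _ _ _ ?U ?W =>
    replace U with (rsub mzero (Mmult (fr1 x y) (radd (conn0 x y) (b1 x)))) in h by mZ;
    replace W with (Mmult (fr1 x y) (connm x y)) in h by mZ end.
  exact h.
Qed.

Lemma fd1_diff x y : M x y -> mfdiff fd1 x y
  (rsub mzero (radd (Mmult (fd1 x y) (radd (conn0 x y) (b1 x))) (Mmult (fr1 x y) (b1 x))))
  (Mmult (rsub (fd1 x y) (fr1 x y)) (connm x y)).
Proof.
  intros hxy. assert (h := frame_lin_diff _ _ _ x y shifts_df hxy).
  assert (e1 : ML (fun g => df g + ev1 g) (fam_frame x y) = radd (fd1 x y) (fr1 x y)).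
  { unfold fd1, fr1. apply mx_extR; rewrite entR_radd, !ent_ML by lia; reflexivity. }
  assert (e2 : ML (fun g => df g - ev1 g) (fam_frame x y) = rsub (fd1 x y) (fr1 x y)).
  { unfold fd1, fr1. apply mx_extR; rewrite entR_rsub, !ent_ML by lia; reflexivity. }
  rewrite e1, e2 in h. fold (fd1 x y) in h.
  match type of h with mfdiff _ _ _ ?U ?W =>
    replace U with (rsub mzero (radd (Mmult (fd1 x y) (radd (conn0 x y) (b1 x))) (Mmult (fr1 x y) (b1 x)))) in h by mZ;
    replace W with (Mmult (rsub (fd1 x y) (fr1 x y)) (connm x y)) in h by mZ end.
  exact h.
Qed.

(** * Smoothness of the family in $(x,y)$ *)

Inductive fam_mat : (R -> R -> M2 R) -> Prop :=
  | fm_m n : fam_mat (fun x y => ML (cfn n) (Hm x y))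
  | fm_p n : fam_mat (fun x y => ML (cfn n) (Hp x y))
  | fm_fr : fam_mat fr1
  | fm_fd : fam_mat fd1.

(** The potentials and their derivatives bring in smooth functions of $x$ and of $-y$, so these are
    generators along with the matrix entries. *)
Inductive fam_base : (R -> R -> R) -> Prop :=
  | fb_x phi : csm J phi -> fam_base (fun x _ => phi x)
  | fb_y phi : csm J phi -> fam_base (fun _ y => phi (- y))
  | fb_mat X i j : fam_mat X -> fam_base (fun x y => ent (X x y) i j).

Definition mcls (X : R -> R -> M2 R) : Prop := forall i j, cls fam_base (fun x y => ent (X x y) i j).

(** Membership in [cls] is inductive on the functions themselves, so a pointwise identity must first
    become an equality of functions. *)
Lemma cls_eq f g : (forall x y, f x y = g x y) -> cls fam_base g -> cls fam_base f.
Proof.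
  intros e h. replace f with g; auto. apply functional_extensionality; intros x.
  apply functional_extensionality; auto.
Qed.

Lemma cls_sub f g : cls fam_base f -> cls fam_base g -> cls fam_base (fun x y => f x y - g x y).
Proof.
  intros hf hg. apply (cls_eq _ (fun x y => f x y + -1 * g x y)); [intros; ring|].
  apply cls_plus; auto. apply (cls_mult _ (fun _ _ => -1)); auto. apply cls_const.
Qed.

Lemma mcls_mat X : fam_mat X -> mcls X.
Proof. intros h i j. apply cls_base, fb_mat, h. Qed.

Lemma mcls_radd X Y : mcls X -> mcls Y -> mcls (fun x y => radd (X x y) (Y x y)).
Proof.
  intros h h' i j. apply (cls_eq _ (fun x y => ent (X x y) i j + ent (Y x y) i j)); [intros; apply entR_radd|].
  apply cls_plus; auto.
Qed.

Lemma mcls_rsub X Y : mcls X -> mcls Y -> mcls (fun x y => rsub (X x y) (Y x y)).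
Proof.
  intros h h' i j. apply (cls_eq _ (fun x y => ent (X x y) i j - ent (Y x y) i j)); [intros; apply entR_rsub|].
  apply (cls_sub (fun x y => ent (X x y) i j) (fun x y => ent (Y x y) i j)); auto.
Qed.

Lemma mcls_mult X Y : mcls X -> mcls Y -> mcls (fun x y => Mmult (X x y) (Y x y)).
Proof.
  intros h h' i j. eapply cls_eq; [intros; apply entR_mult|].
  apply (cls_plus _ (fun x y => ent (X x y) i 0 * ent (Y x y) 0 j) (fun x y => ent (X x y) i 1 * ent (Y x y) 1 j));
   [apply (cls_mult _ (fun x y => ent (X x y) i 0) (fun x y => ent (Y x y) 0 j))|
    apply (cls_mult _ (fun x y => ent (X x y) i 1) (fun x y => ent (Y x y) 1 j))]; auto.
Qed.

Lemma mcls_const A' : mcls (fun _ _ => A').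
Proof. intros i j. apply cls_const. Qed.

Lemma mcls_scal f X : cls fam_base f -> mcls X -> mcls (fun x y => mscal (f x y) (X x y)).
Proof.
  intros h h' i j. eapply cls_eq; [intros; apply entR_mscal|].
  apply (cls_mult _ f (fun x y => ent (X x y) i j)); auto.
Qed.

Lemma mcls_mx2 f1 f2 f3 f4 : cls fam_base f1 -> cls fam_base f2 -> cls fam_base f3 -> cls fam_base f4 ->
  mcls (fun x y => mx2 (K := R_Ring) (f1 x y) (f2 x y) (f3 x y) (f4 x y)).
Proof.
  intros h1 h2 h3 h4 i j.
  destruct (two_cases i) as [->|[->|hi]]; [destruct (two_cases j) as [->|[->|hj]]..|].
  1: refine (cls_eq _ _ (fun x y => proj1 (mx2_entR _ _ _ _)) h1).
  1: refine (cls_eq _ _ (fun x y => proj1 (proj2 (mx2_entR _ _ _ _))) h2).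
  2: refine (cls_eq _ _ (fun x y => proj1 (proj2 (proj2 (mx2_entR _ _ _ _)))) h3).
  2: refine (cls_eq _ _ (fun x y => proj2 (proj2 (proj2 (mx2_entR _ _ _ _)))) h4).
  all: apply (cls_eq _ (fun _ _ => 0)); [intros; apply (ent_out (K := R_Ring)); auto|apply cls_const].
Qed.

Lemma cls_neg f : cls fam_base f -> cls fam_base (fun x y => - f x y).
Proof.
  intros h. apply (cls_eq _ (fun x y => -1 * f x y)); [intros; ring|].
  apply (cls_mult _ (fun _ _ => -1)); auto. apply cls_const.
Qed.

Lemma mcls_inv X : mcls X -> mcls (fun x y => sl_inv (X x y)).
Proof.
  intros h. apply (mcls_mx2 (fun x y => ent (X x y) 1 1) (fun x y => - ent (X x y) 0 1) (fun x y => - ent (X x y) 1 0)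
    (fun x y => ent (X x y) 0 0)); try apply h.
  - apply (cls_neg (fun x y => ent (X x y) 0 1)), h.
  - apply (cls_neg (fun x y => ent (X x y) 1 0)), h.
Qed.

Lemma cls_x phi : csm J phi -> cls fam_base (fun x _ => phi x).
Proof. intros; apply cls_base, fb_x; auto. Qed.

Lemma cls_y phi : csm J phi -> cls fam_base (fun _ y => phi (- y)).
Proof. intros; apply cls_base, fb_y; auto. Qed.

Lemma mcls_b : (mcls (fun x _ => b0 x) /\ mcls (fun x _ => b1 x) /\ mcls (fun x _ => bm x)) /\
  (mcls (fun _ y => b0 (- y)) /\ mcls (fun _ y => b1 (- y)) /\ mcls (fun _ y => bm (- y))).
Proof.
  assert (na := csm_opp J hJ a hca). assert (nna := csm_opp J hJ _ na).
  assert (nq := csm_opp J hJ q hcq). assert (nnq := csm_opp J hJ _ nq).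
  assert (np := csm_opp J hJ p hch).
  assert (nr := csm_opp J hJ r hcr). assert (nnr := csm_opp J hJ _ nr).
  assert (cc := cls_const fam_base).
  unfold b0, b1, bm, P0, P1, Pm. split; (split; [|split]).
  - apply (mcls_mx2 (fun x _ => - a x) (fun _ _ => 0) (fun _ _ => 0) (fun x _ => - - a x)); auto; [exact (cls_x _ na)|exact (cls_x _ nna)].
  - apply (mcls_mx2 (fun _ _ => 0) (fun x _ => - - q x) (fun x _ => - p x) (fun _ _ => 0)); auto; [exact (cls_x _ nnq)|exact (cls_x _ np)].
  - apply (mcls_mx2 (fun _ _ => 0) (fun x _ => - p x) (fun x _ => - - r x) (fun _ _ => 0)); auto; [exact (cls_x _ np)|exact (cls_x _ nnr)].
  - apply (mcls_mx2 (fun _ y => - a (- y)) (fun _ _ => 0) (fun _ _ => 0) (fun _ y => - - a (- y))); auto; [exact (cls_y _ na)|exact (cls_y _ nna)].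
  - apply (mcls_mx2 (fun _ _ => 0) (fun _ y => - - q (- y)) (fun _ y => - p (- y)) (fun _ _ => 0)); auto; [exact (cls_y _ nnq)|exact (cls_y _ np)].
  - apply (mcls_mx2 (fun _ _ => 0) (fun _ y => - p (- y)) (fun _ y => - - r (- y)) (fun _ _ => 0)); auto; [exact (cls_y _ np)|exact (cls_y _ nnr)].
Qed.

Lemma mcls_conn0 : mcls conn0.
Proof.
  destruct mcls_b as ((h0 & h1 & _) & _). assert (hK := mcls_mat _ (fm_m (-1))).
  apply (mcls_radd (fun x _ => b0 x)); auto. apply (mcls_rsub (fun x y => Mmult (b1 x) (K x y)) (fun x y => Mmult (K x y) (b1 x))).
  - apply (mcls_mult (fun x _ => b1 x) K); auto.
  - apply (mcls_mult K (fun x _ => b1 x)); auto.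
Qed.

Lemma mcls_connm : mcls connm.
Proof.
  destruct mcls_b as (_ & (_ & _ & h)). assert (hD := mcls_mat _ (fm_p 0)).
  apply (mcls_mult D); auto. apply (mcls_mult (fun _ y => bm (- y)) (fun x y => sl_inv (D x y))); auto.
  apply (mcls_inv D); auto.
Qed.

Ltac mcl := cbv beta; match goal with
  | |- mcls (fun x y => radd (@?X x y) (@?Y x y)) => apply (mcls_radd X Y); mcl
  | |- mcls (fun x y => rsub (@?X x y) (@?Y x y)) => apply (mcls_rsub X Y); mcl
  | |- mcls (fun x y => Mmult (@?X x y) (@?Y x y)) => apply (mcls_mult X Y); mcl
  | |- mcls (fun x y => sl_inv (@?X x y)) => apply (mcls_inv X); mcl
  | |- mcls (fun x y => conn0 x y) => exact mcls_conn0
  | |- mcls (fun x y => connm x y) => exact mcls_connm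
  | |- mcls (fun x y => fr1 x y) => exact (mcls_mat _ fm_fr)
  | |- mcls (fun x y => fd1 x y) => exact (mcls_mat _ fm_fd)
  | |- mcls (fun x y => b0 x) => exact (proj1 (proj1 mcls_b))
  | |- mcls (fun x y => b1 x) => exact (proj1 (proj2 (proj1 mcls_b)))
  | |- mcls (fun x y => bm x) => exact (proj2 (proj2 (proj1 mcls_b)))
  | |- mcls (fun x y => b0 (- y)) => exact (proj1 (proj2 mcls_b))
  | |- mcls (fun x y => b1 (- y)) => exact (proj1 (proj2 (proj2 mcls_b)))
  | |- mcls (fun x y => bm (- y)) => exact (proj2 (proj2 (proj2 mcls_b)))
  | |- mcls (fun x y => ML (cfn ?n) (Hm x y)) => exact (mcls_mat _ (fm_m n))
  | |- mcls (fun x y => ML (cfn ?n) (Hp x y)) => exact (mcls_mat _ (fm_p n))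
  | |- mcls (fun x y => ?A) => exact (mcls_const A)
  end.

(** The partial derivatives are found by unification with the coefficient formulas, after which
    [mcl] verifies their membership by following their syntax. *)
Lemma fam_mat_diff X : fam_mat X -> exists Px Py, mcls Px /\ mcls Py /\ forall x y, M x y -> mfdiff X x y (Px x y) (Py x y).
Proof.
  destruct 1.
  - do 2 eexists. split; [|split; [|exact (Hm_coef_diff n)]]; mcl.
  - do 2 eexists. split; [|split; [|exact (Hp_coef_diff n)]]; mcl.
  - do 2 eexists. split; [|split; [|exact (fr1_diff)]]; mcl.
  - do 2 eexists. split; [|split; [|exact (fd1_diff)]]; mcl.
Qed.

Lemma fam_base_diff f : fam_base f -> exists fx fy, cls fam_base fx /\ cls fam_base fy /\ forall x y, M x y -> fdiff f x y (fx x y) (fy x y).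
Proof.
  destruct 1 as [phi h|phi h|X i j h].
  - exists (fun x _ => Derive phi x), (fun _ _ => 0). split; [apply cls_x, csm_Derive; auto|split; [apply cls_const|]].
    intros x y hxy. apply fdiff_fst. apply (csm_is_derive J); auto. apply hxy.
  - exists (fun _ _ => 0), (fun _ y => - Derive phi (- y)).
    split; [apply cls_const|split; [apply (cls_neg (fun _ y => Derive phi (- y))), cls_y, csm_Derive; auto|]].
    intros x y hxy. apply (fdiff_swap (fun y _ => phi (- y))). apply (fdiff_fst (fun y => phi (- y))).
    evar_last; [apply (is_derive_comp (K := R_AbsRing) (V := R_NormedModule) phi Ropp y)|].
    + apply (csm_is_derive J); auto. apply hxy.
    + apply (is_derive_opp (K := R_AbsRing) (V := R_NormedModule) (fun x => x)). apply is_derive_id.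
    + unfold scal, opp, one; simpl. unfold mult; simpl. ring.
  - destruct (fam_mat_diff X h) as (Px & Py & h1 & h2 & h3).
    exists (fun x y => ent (Px x y) i j), (fun x y => ent (Py x y) i j).
    split; [apply h1|split; [apply h2|]]. intros x y hxy. exact (h3 x y hxy i j).
Qed.

Lemma cls_smooth f n x y : cls fam_base f -> M x y -> ex_diff_n f n x y.
Proof. intros h hxy. apply (cls_ex_diff_n M fam_open fam_base fam_base_diff); auto. Qed.

Lemma fam_sigma x y : M x y -> sigma_fixed (Hm x y) /\ sigma_fixed (Hp x y).
Proof.
  intros hxy. destruct (hH x y hxy) as (h1 & h2 & _).
  split; [exact (G_sigma s _ (proj1 h1))|exact (G_sigma s _ (proj1 h2))].
Qed.

Lemma K_off x y : M x y -> ent (K x y) 0 0 = 0 :> R /\ ent (K x y) 1 1 = 0 :> R.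
Proof.
  intros hxy. destruct (fam_reps x y hxy) as (k & h1 & _ & _).
  assert (e := sigma_coef _ _ (-1) h1 (proj1 (fam_sigma x y hxy))).
  change (ML (cfn (-1)) (Hm x y)) with (K x y) in e. generalize dependent (K x y). intros X e.
  split; [apply (f_equal (fun A => ent A 0 0)) in e|apply (f_equal (fun A => ent A 1 1)) in e];
    revert e; unfold e2, sgnz; eR; simpl Z.even; cbv iota; lra.
Qed.

Definition dd x y : R := ent (D x y) 0 0.

Lemma D_diag x y : M x y -> ent (D x y) 0 1 = 0 :> R /\ ent (D x y) 1 0 = 0 :> R /\ dd x y * ent (D x y) 1 1 = 1.
Proof.
  intros hxy. destruct (fam_reps x y hxy) as (k & _ & h1 & _).
  assert (e := sigma_coef _ _ 0 h1 (proj2 (fam_sigma x y hxy))).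
  assert (hd := birk_det0 _ _ _ (fam_birk x y hxy)). unfold dd.
  change (ML (cfn 0) (Hp x y)) with (D x y) in e, hd. generalize dependent (D x y). intros X e hd.
  assert (e01 : ent X 0 1 = 0 :> R).
  { apply (f_equal (fun A => ent A 0 1)) in e; revert e; unfold e2, sgnz; eR; simpl Z.even; cbv iota; lra. }
  assert (e10 : ent X 1 0 = 0 :> R).
  { apply (f_equal (fun A => ent A 1 0)) in e; revert e; unfold e2, sgnz; eR; simpl Z.even; cbv iota; lra. }
  split; [auto|split; [auto|]]. rewrite mdetR, e01, e10 in hd. lra.
Qed.

(** Conjugation by $\mathrm{diag}(d,d^{-1})$ multiplies the upper right entry by $d^2$. *)
Lemma connm_entries x y : M x y -> ent (connm x y) 0 0 = 0 :> R /\ ent (connm x y) 1 1 = 0 :> R /\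
  ent (connm x y) 0 1 = - p (- y) * (dd x y * dd x y) :> R.
Proof.
  intros hxy. destruct (D_diag x y hxy) as (d1 & d2 & d3). unfold connm, dd in *.
  generalize dependent (D x y). intros X d1 d2 d3. unfold bm, Pm. eR. rewrite d1, d2. split; [|split]; Rring.
Qed.

Lemma conn_entries x y : M x y ->
  ent (conn0 x y) 0 1 = 0 :> R /\ ent (conn0 x y) 1 0 = 0 :> R /\ ent (conn0 x y) 1 1 = - ent (conn0 x y) 0 0 :> R.
Proof.
  intros hxy. destruct (K_off x y hxy) as (k1 & k2). unfold conn0.
  generalize dependent (K x y). intros X k1 k2. unfold b0, b1, P0, P1. eR. rewrite k1, k2. split; [|split]; Rring.
Qed.

Definition E12 : M2 R := mx2 (K := R_Ring) 0 1 0 0.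
Definition E21 : M2 R := mx2 (K := R_Ring) 0 0 1 0.

(* The value at [1] of the Sym expression [2 F' F^{-1} - Ad_F e2]. *)
Definition sym x y : M2 R := rsub (mscal 2 (Mmult (fd1 x y) (sl_inv (fr1 x y)))) (Ad (fr1 x y) e2).

Lemma fr1_diff' x y : M x y -> mfdiff fr1 x y
  (Mmult (fr1 x y) (rsub mzero (radd (conn0 x y) (b1 x)))) (Mmult (fr1 x y) (connm x y)).
Proof.
  intros hxy. refine (mfdiff_eq _ _ _ _ _ _ _ _ _ (fr1_diff x y hxy)); [|reflexivity].
  generalize (conn0 x y) (b1 x) (fr1 x y). intros. mZ.
Qed.

Lemma conn_traceless x y : M x y ->
  ent (rsub mzero (radd (conn0 x y) (b1 x))) 1 1 = - ent (rsub mzero (radd (conn0 x y) (b1 x))) 0 0 :> R /\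
  ent (connm x y) 1 1 = - ent (connm x y) 0 0 :> R.
Proof.
  intros hxy. destruct (connm_entries x y hxy) as (e1 & e2 & _). destruct (conn_entries x y hxy) as (_ & _ & e3).
  split; [|rewrite e1, e2; ring]. eR. rewrite ?entR_mzero, e3. unfold b1, P1. eR. Rring.
Qed.

Lemma Ad_fr1_diff X x y : M x y -> mfdiff (fun x y => Ad (fr1 x y) X) x y
  (Ad (fr1 x y) (bracket (rsub mzero (radd (conn0 x y) (b1 x))) X)) (Ad (fr1 x y) (bracket (connm x y) X)).
Proof. intros hxy. destruct (conn_traceless x y hxy). apply mfdiff_Ad; auto. apply fr1_diff'; auto. Qed.

(** The diagonal part of the connection commutes with $e_2$. The $x$-derivative is $\mathrm{Ad}_F$
    of $-2b_1+[b_1,e_2]$, the $y$-derivative that of $-2c-[c,e_2]$ with $c$ the matrix [connm]. As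
    $[E_{12},e_2]=2E_{12}$ and $[E_{21},e_2]=-2E_{21}$, one off-diagonal entry cancels and the other
    doubles: both derivatives are null. *)
Lemma sym_diff x y : M x y -> mfdiff sym x y
  (mscal (4 * p x) (Ad (fr1 x y) E21)) (mscal (4 * p (- y) * (dd x y * dd x y)) (Ad (fr1 x y) E12)).
Proof.
  intros hxy. destruct (conn_entries x y hxy) as (c1 & c2 & c3). destruct (connm_entries x y hxy) as (d1 & d2 & d3).
  refine (mfdiff_eq _ _ _ _ _ _ _ _ _ (mfdiff_rsub _ _ _ _ _ _ _ _
    (mfdiff_cscal 2 _ _ _ _ _ (mfdiff_mult _ _ _ _ _ _ _ _ (fd1_diff x y hxy) (mfdiff_inv _ _ _ _ _ (fr1_diff x y hxy))))
    (Ad_fr1_diff e2 x y hxy))).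
  - unfold Ad, bracket, b1, P1, e2, E21. generalize dependent (conn0 x y). intros U c1 c2 c3.
    generalize (fr1 x y) (fd1 x y). intros X Y.
    apply mx_extR; repeat (rewrite ?entR_mzero, ?c1, ?c2, ?c3; eR); Rring.
  - unfold Ad, bracket, e2, E12. generalize dependent (connm x y). intros U d1 d2 d3.
    generalize (fr1 x y) (fd1 x y). intros X Y.
    apply mx_extR; repeat (rewrite ?entR_mzero, ?d1, ?d2; eR); rewrite d3; Rring.
Qed.

Lemma fr1_value x y : M x y -> fam_frame x y (RtoC 1) = cplx (fr1 x y).
Proof.
  intros hxy. destruct (fam_reps x y hxy) as (k & _ & _ & h).
  assert (e : forall i j, (i < 2)%nat -> (j < 2)%nat -> ent (fam_frame x y (RtoC 1)) i j = ent (cplx (fr1 x y)) i j).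
  { intros i j hi hj. rewrite ent_cplx. unfold fr1. rewrite ent_ML by auto. exact (rep_at_one _ _ _ (h i j)). }
  apply mx_extC; apply e; lia.
Qed.

Lemma frame_det x y l : M x y -> Cmod l = 1 -> mdet (fam_frame x y l) = RtoC 1.
Proof.
  intros hxy hl. unfold fam_frame. rewrite mdet_mult, mdet_inv, (fam_det_p x y l hxy hl), (fam_det _ l (proj1 (proj2 hxy)) hl). Cring.
Qed.

Lemma fr1_det x y : M x y -> mdet (fr1 x y) = 1.
Proof.
  intros hxy. apply RtoC_inj. rewrite <- (frame_det x y (RtoC 1) hxy Cmod_1), (fr1_value x y hxy), mdetR, mdetC, !ent_cplx.
  rewrite RtoC_minus, !RtoC_mult. reflexivity.
Qed.

Lemma sym_traceless x y : M x y -> mtr (sym x y) = 0.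
Proof.
  intros hxy. destruct (fam_reps x y hxy) as (k & _ & _ & h).
  assert (e := df_det _ _ h (fun l hl => frame_det x y l hxy hl)).
  change (ML df (fam_frame x y)) with (fd1 x y) in e. change (ML ev1 (fam_frame x y)) with (fr1 x y) in e.
  transitivity (2 * mtr (Mmult (fd1 x y) (sl_inv (fr1 x y)))); [|rewrite e; Rring].
  unfold sym, Ad, e2. generalize (fd1 x y) (fr1 x y). intros. eR. Rring.
Qed.

Lemma sym_is_Sym x y : M x y -> is_Sym (fam_frame x y) (RtoC 1) (cplx (sym x y)).
Proof.
  intros hxy. destruct (fam_reps x y hxy) as (k & _ & _ & h).
  exists (cplx (fd1 x y)). split.
  - intros i j.
    assert (c := rep_circle_derive _ _ _ h i j).
    replace (ent (cplx (fd1 x y)) i j) with (ent (mk_matrix 2 2 (fun i j => RtoC (df (fun l => ent (fam_frame x y l) i j))) : M2 C) i j); [exact c|].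
    unfold fd1. destruct (le_lt_dec 2 i) as [hi|hi]; [|destruct (le_lt_dec 2 j) as [hj|hj]].
    + rewrite !(ent_out _ i j) by auto. reflexivity.
    + rewrite !(ent_out _ i j) by auto. reflexivity.
    + rewrite ent_cplx, ent_ML by auto. apply (ent_mk (K := C_Ring) (fun i j => RtoC (df (fun l => ent (fam_frame x y l) i j)))); auto.
  - rewrite (fr1_value x y hxy). unfold sym, Ad. generalize (fd1 x y) (fr1 x y). intros X Y.
    apply mx_extC; rewrite ent_cplx, entR_rsub, entR_mscal; unfold e2; entC; eR;
      repeat (rewrite ?RtoC_minus, ?RtoC_plus, ?RtoC_mult, ?RtoC_opp); Cring.
Qed.

(** Here $\Phi=I$, so $\hat H_-=\hat H_+^{-1}$, and $\hat H_--I$ has support both strictly negative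
    and nonnegative; hence both factors are $I$. *)
Lemma fam_diagonal t : J t -> M t (- t) /\ fr1 t (- t) = ML ev1 (F t) /\ dd t (- t) = 1.
Proof.
  intros ht.
  assert (e : forall l, Cmod l = 1 -> Phi t (- t) l = Mone).
  { intros l hl. unfold Phi. rewrite Ropp_involutive. apply sl_inv_l, fam_det; auto. }
  destruct (mrep_one neg0 ltac:(unfold neg0; lia)) as (k1 & m1). destruct (mrep_one pos0 ltac:(unfold pos0; lia)) as (k2 & m2).
  assert (d1 : forall l : C, Cmod l = 1 -> mdet (Mone : M2 C) = RtoC 1) by (intros; entC; Cring).
  assert (sf : sigma_fixed (fun _ => Mone)) by (intros l _; apply sigma_one).
  assert (hM : M t (- t)).
  { split; [auto|split; [rewrite Ropp_involutive; auto|]]. exists (fun _ => Mone), (fun _ => Mone). split; [|split].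
    - apply (in_Gminus_of_rep s k1); auto; lra.
    - apply (in_Gplus_of_rep s k2); auto; lra.
    - intros l hl. unfold loop_mul. rewrite Mmult_1l. apply e; auto. }
  split; auto.
  assert (hb := fam_birk _ _ hM). destruct (bk_p _ _ _ hb) as (k3 & h3). destruct (bk_1 _ _ _ hb) as (k4 & h4).
  assert (ei : forall l, Cmod l = 1 -> Hm t (- t) l = sl_inv (Hp t (- t) l)).
  { intros l hl. assert (k := fam_eq _ _ l hM hl). rewrite (e l hl) in k.
    transitivity (Mmult (Mmult (Hm t (- t) l) (Hp t (- t) l)) (sl_inv (Hp t (- t) l))).
    - rewrite Mmult_assocC, (sl_inv_r _ (fam_det_p _ _ l hM hl)), Mmult_1r. reflexivity.
    - rewrite <- k, Mmult_1l. reflexivity. }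
  assert (h5 := mrep_minus w2 weight_w2 _ _ _ _ _ (mrep_inv w2 weight_w2 _ _ _ h3) m2).
  assert (h6 : mrep w2 pos0 (k3 + k2) (fun l => csub (Hm t (- t) l) Mone)).
  { refine (mrep_ext w2 weight_w2 _ _ _ _ _ h5). intros l hl. rewrite (ei l hl). reflexivity. }
  assert (z := mrep_disjoint _ _ _ _ _ h6 h4 ltac:(unfold pos0, neg1; intros; lia)).
  assert (z' : forall l, Cmod l = 1 -> Hm t (- t) l = Mone).
  { intros l hl. transitivity (cadd (csub (Hm t (- t) l) Mone) Mone); [|rewrite (z l hl)]; mxC. }
  split.
  2: { unfold dd. replace (D t (- t)) with (Mone : M2 R); [apply MoneR|]. rewrite <- ML_one. symmetry.
    apply ML_ext; [apply lfun_cf|]. intros l hl. rewrite <- (sl_inv_invol (Hp t (- t) l)), <- (ei l hl), (z' l hl). mxC. }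
  apply ML_ext; [apply lfun_ev1|]. intros l hl. unfold fam_frame. rewrite Ropp_involutive, <- (ei l hl), (z' l hl), Mmult_1r. reflexivity.
Qed.

Lemma mcls_sym : mcls sym.
Proof.
  apply (mcls_rsub (fun x y => mscal 2 (Mmult (fd1 x y) (sl_inv (fr1 x y))))).
  - apply (mcls_scal (fun _ _ => 2)); [apply cls_const|]. mcl.
  - unfold Ad. mcl.
Qed.

Lemma mcls_normal : mcls (fun x y => Ad (fr1 x y) e2).
Proof. unfold Ad. mcl. Qed.

Lemma mcls_comb X c1 c2 c3 c4 c5 n x y : mcls X -> M x y -> ex_diff_n
  (fun x y => c1 * ent (X x y) 0 0 + (c2 * ent (X x y) 0 1 + (c3 * ent (X x y) 1 0 + (c4 * ent (X x y) 1 1 + c5)))) n x y.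
Proof.
  intros h hxy. apply cls_smooth; auto.
  assert (hs1 : forall c i j, cls fam_base (fun x y => c * ent (X x y) i j)).
  { intros c i j. apply (cls_mult _ (fun _ _ => c) (fun x y => ent (X x y) i j)); [apply cls_const|apply h]. }
  apply (cls_plus _ (fun x y => c1 * ent (X x y) 0 0)); auto.
  apply (cls_plus _ (fun x y => c2 * ent (X x y) 0 1)); auto.
  apply (cls_plus _ (fun x y => c3 * ent (X x y) 1 0)); auto.
  apply (cls_plus _ (fun x y => c4 * ent (X x y) 1 1)); auto. apply cls_const.
Qed.

(** What the geometry needs, separated from the loops. Smoothness is stated for affine combinations
    of entries because the inverse isometry mixes them. For $\mathrm{Ad}_GE_{21}$ the $y$-derivative
    is made explicit, as it yields the mixed derivative of the surface. *)
Theorem family_summary : exists (G S : R -> R -> M2 R) (d : R -> R -> R),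
  open2 M /\
  (forall t, J t -> M t (- t) /\ G t (- t) = ML ev1 (F t) /\ d t (- t) = 1) /\
  (forall x y, M x y -> mdet (G x y) = 1 /\ d x y <> 0 /\ mtr (S x y) = 0 /\
    is_Sym (fam_frame x y) (RtoC 1) (cplx (S x y)) /\
    mfdiff S x y (mscal (4 * p x) (Ad (G x y) E21)) (mscal (4 * p (- y) * (d x y * d x y)) (Ad (G x y) E12)) /\
    exists P, mfdiff (fun x y => Ad (G x y) E21) x y P (mscal (p (- y) * (d x y * d x y)) (Ad (G x y) e2))) /\
  (forall c1 c2 c3 c4 c5 n x y, M x y ->
    ex_diff_n (fun x y => c1 * ent (S x y) 0 0 + (c2 * ent (S x y) 0 1 + (c3 * ent (S x y) 1 0 + (c4 * ent (S x y) 1 1 + c5)))) n x y /\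
    ex_diff_n (fun x y => c1 * ent (Ad (G x y) e2) 0 0 + (c2 * ent (Ad (G x y) e2) 0 1 +
      (c3 * ent (Ad (G x y) e2) 1 0 + (c4 * ent (Ad (G x y) e2) 1 1 + c5)))) n x y).
Proof.
  exists fr1, sym, dd. split; [exact fam_open|]. split; [exact fam_diagonal|]. split.
  - intros x y hxy. destruct (D_diag x y hxy) as (_ & _ & hd).
    split; [apply fr1_det; auto|]. split; [intros e; rewrite e in hd; lra|]. split; [apply sym_traceless; auto|].
    split; [apply sym_is_Sym; auto|]. split; [apply sym_diff; auto|].
    destruct (connm_entries x y hxy) as (d1 & d2 & d3).
    eexists. refine (mfdiff_eq _ _ _ _ _ _ _ eq_refl _ (Ad_fr1_diff E21 x y hxy)).
    generalize dependent (connm x y). intros U d1 d2 d3. unfold Ad, bracket, E21, e2. generalize (fr1 x y). intros X.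
    apply mx_extR; eR; rewrite d1, d2, d3; Rring.
  - intros c1 c2 c3 c4 c5 n x y hxy. split; [apply (mcls_comb sym); auto; apply mcls_sym|].
    apply (mcls_comb (fun x y => Ad (fr1 x y) e2)); auto. apply mcls_normal.
Qed.

End Family.

(** * The potential pair *)

Lemma is_series_two {K : AbsRing} {V : NormedModule K} (f : nat -> V) : (forall n, (2 <= n)%nat -> f n = zero) ->
  is_series f (plus (f 0%nat) (f 1%nat)).
Proof.
  intros h. apply (filterlim_ext_loc (fun _ => plus (f 0%nat) (f 1%nat))); [|apply filterlim_const].
  exists 1%nat. intros n hn. induction n as [|n IH]; [lia|].
  destruct n as [|n]; [rewrite sum_Sn, sum_O; reflexivity|].
  rewrite sum_Sn, <- IH by lia. rewrite (h (S (S n))) by lia. rewrite plus_zero_r. reflexivity.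
Qed.

Lemma zseries_three {K : AbsRing} {V : NormedModule K} (u : Z -> V) : (forall n, ~ u1 n -> u n = zero) ->
  is_zseries u (plus (plus (u 0%Z) (u 1%Z)) (plus (u (-1)%Z) zero)).
Proof.
  intros h. exists (plus (u 0%Z) (u 1%Z)), (plus (u (-1)%Z) zero). split; [|split; auto].
  - apply (is_series_two (fun n => u (Z.of_nat n))). intros n hn. apply h. unfold u1; lia.
  - replace (plus (u (-1)%Z) zero) with (plus ((fun n => u (- Z.of_nat (S n))%Z) 0%nat) ((fun n => u (- Z.of_nat (S n))%Z) 1%nat)).
    + apply is_series_two. intros n hn. apply h. unfold u1; lia.
    + cbv beta. f_equal. apply h. unfold u1; lia.
Qed.

Definition pot_coef (a q h r : R) (n : Z) : M2 C :=
  if Z.eq_dec n 0 then cplx (P0 a) else if Z.eq_dec n 1 then cplx (P1 q h)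
  else if Z.eq_dec n (-1) then cplx (Pm h r) else zero.

Lemma pot_coef_out a q h r n : ~ u1 n -> pot_coef a q h r n = zero.
Proof. intros hn. unfold pot_coef, u1 in *. repeat destruct Z.eq_dec; auto; lia. Qed.

Lemma pot_fourier a q h r : is_fourier (pot_coef a q h r) (pot a q h r).
Proof.
  intros l hl i j. rewrite pot_lp, ent_lp.
  assert (k := zseries_three (K := C_AbsRing) (V := C_NormedModule)
    (fun n => Cmult (ent (pot_coef a q h r n) i j) (Czpow l n))).
  assert (e : forall n, ~ u1 n -> Cmult (ent (pot_coef a q h r n) i j) (Czpow l n) = zero).
  { intros n hn. rewrite pot_coef_out, entC_zero by auto. apply Cmult_0_l. }
  specialize (k e).
  match type of k with is_zseries _ ?v => replace (RtoC (ent (P0 a) i j) + (RtoC (ent (P1 q h) i j) * l + RtoC (ent (Pm h r) i j) * / l))%C with v; [exact k|] end.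
  unfold pot_coef. simpl Z.eq_dec. rewrite Czpow_1, Czpow_m1, !ent_cplx.
  change (Czpow l 0) with (RtoC 1). unfold plus, zero; simpl. ring.
Qed.

Lemma frob2_cplx X : frob2 (cplx X) = ent X 0 0 ^ 2 + ent X 0 1 ^ 2 + ent X 1 0 ^ 2 + ent X 1 1 ^ 2.
Proof. unfold frob2. rewrite !ent_cplx, !Cmod_R, !pow2_abs. reflexivity. Qed.

(** The weight $(1+n^2)^s$ is $1$ at $n=0$ and $2^s$ at $n=\pm1$, and each of these three
    coefficients has two entries of size at most [e]. *)
Lemma pot_sqnorm s a q h r e : Rabs a <= e -> Rabs q <= e -> Rabs h <= e -> Rabs r <= e ->
  exists N, is_Hs_sqnorm s (pot_coef a q h r) N /\ N <= (2 + 4 * Rpower 2 s) * e ^ 2.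
Proof.
  intros ha hq hh hr.
  assert (k := zseries_three (K := R_AbsRing) (V := R_NormedModule) (fun n => Rpower (1 + IZR n ^ 2) s * frob2 (pot_coef a q h r n))).
  eexists. split; [apply k|].
  - intros n hn. rewrite pot_coef_out by auto. unfold frob2. rewrite !entC_zero, !Cmod_0. unfold zero; simpl. ring.
  - unfold plus, zero; simpl. unfold pot_coef. simpl Z.eq_dec. cbv iota. rewrite !frob2_cplx. unfold P0, P1, Pm. entR.
    replace (1 + 0 * (0 * 1)) with 1 by ring. replace (1 + 1 * (1 * 1)) with 2 by ring. replace (1 + -1 * (-1 * 1)) with 2 by ring.
    assert (sq : forall z, Rabs z <= e -> z * z <= e * e).
    { intros z hz. rewrite <- (Rabs_pos_eq (z * z)) by nra. rewrite Rabs_mult. apply Rmult_le_compat; auto; apply Rabs_pos. }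
    apply sq in ha, hq, hh, hr.
    assert (hW : 0 < Rpower 2 s) by apply exp_pos.
    assert (e1 : Rpower 1 s = 1) by (unfold Rpower; rewrite ln_1, Rmult_0_r; apply exp_0). rewrite ?e1.
    generalize dependent (Rpower 2 s). intros W hW.
    assert (W * (q * q) <= W * (e * e)) by (apply Rmult_le_compat_l; lra).
    assert (W * (h * h) <= W * (e * e)) by (apply Rmult_le_compat_l; lra).
    assert (W * (r * r) <= W * (e * e)) by (apply Rmult_le_compat_l; lra).
    lra.
Qed.

Lemma pot_Hs_coeffs s a q h r : Hs_coeffs s (pot_coef a q h r) (pot a q h r).
Proof.
  split; [apply pot_fourier|].
  destruct (pot_sqnorm s a q h r (Rabs a + Rabs q + Rabs h + Rabs r)) as (N & hN & _);
   [generalize (Rabs_pos a) (Rabs_pos q) (Rabs_pos h) (Rabs_pos r); lra..|]. exists N; auto.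
Qed.

Lemma pot_LieG s a q h r : in_LieG s (pot a q h r).
Proof.
  destruct (mrep_pot w2 weight_w2 a q h r) as (B & hB). split.
  - eexists. apply pot_Hs_coeffs.
  - intros l _. unfold pot. rewrite mtrC. entC. rewrite RtoC_opp. Cring.
  - intros l hl. apply (mrep_conj w2 _ _ _ l hB hl).
  - intros l hl. assert (l <> RtoC 0) by (apply unit_neq0; auto).
    unfold Defs.sigma, pot. apply mx_extC; entC; unfold e2; entR; rewrite ?RtoC_opp, ?RtoC_m1; apply Ceq_minus; field; auto.
Qed.

(** The difference quotient minus the derivative is again a [pot], so [pot_sqnorm] measures the
    error. *)
Lemma pot_Hs_derive s a q h r a' q' h' r' t :
  is_derive a t a' -> is_derive q t q' -> is_derive h t h' -> is_derive r t r' ->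
  is_Hs_derive s (fun t => pot (a t) (q t) (h t) (r t)) t (pot a' q' h' r').
Proof.
  intros da dq dh dr eps. apply is_derive_Reals in da, dq, dh, dr.
  set (W := 2 + 4 * Rpower 2 s). assert (hW : 0 < W) by (unfold W; generalize (exp_pos (s * ln 2)); unfold Rpower; lra).
  assert (he := cond_pos eps).
  set (e := eps / (W + 1)). assert (hep : 0 < e) by (unfold e; apply Rdiv_lt_0_compat; lra).
  destruct (da e hep) as (d1 & k1). destruct (dq e hep) as (d2 & k2).
  destruct (dh e hep) as (d3 & k3). destruct (dr e hep) as (d4 & k4).
  assert (hd : 0 < Rmin (Rmin d1 d2) (Rmin d3 d4)) by (repeat apply Rmin_glb_lt; apply cond_pos).
  exists (mkposreal _ hd). intros k hk hkd. simpl in hkd.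
  assert (hkd' : Rabs k < d1 /\ Rabs k < d2 /\ Rabs k < d3 /\ Rabs k < d4).
  { revert hkd. unfold Rmin. repeat destruct Rle_dec; intros; repeat split; lra. }
  destruct hkd' as (m1 & m2 & m3 & m4).
  specialize (k1 k hk m1). specialize (k2 k hk m2). specialize (k3 k hk m3). specialize (k4 k hk m4).
  set (za := (a (t + k) - a t) / k - a') in *. set (zq := (q (t + k) - q t) / k - q') in *.
  set (zh := (h (t + k) - h t) / k - h') in *. set (zr := (r (t + k) - r t) / k - r') in *.
  destruct (pot_sqnorm s za zq zh zr e) as (N & n1 & n2); try lra.
  exists (pot_coef za zq zh zr), N. split; [|split; auto].
  - intros l hl i j.
    replace (minus (loop_diffq (fun t => pot (a t) (q t) (h t) (r t)) t k l) (pot a' q' h' r' l)) with (pot za zq zh zr l); [apply pot_fourier; auto|].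
    unfold loop_diffq, pot.
    apply mx_extC; rewrite entC_minus, entC_mscal, entC_minus; entC; unfold za, zq, zh, zr, Rdiv;
      rewrite ?RtoC_opp, !RtoC_minus, !RtoC_mult, !RtoC_minus, ?RtoC_opp; Cring.
  - fold W in n2. apply Rle_lt_trans with (1 := n2).
    assert (e * (W + 1) = eps) by (unfold e; field; lra). nra.
Qed.

Lemma pot_smooth s I a q h r : opn I -> csm I a -> csm I q -> csm I h -> csm I r ->
  Hs_smooth s I (fun t => pot (a t) (q t) (h t) (r t)).
Proof.
  intros hI ca cq ch cr. exists (fun n t => pot (Derive_n a n t) (Derive_n q n t) (Derive_n h n t) (Derive_n r n t)).
  split; [intros t _ l _; reflexivity|]. intros n t ht. split; [eexists; apply pot_Hs_coeffs|].
  apply pot_Hs_derive; apply (csm_is_derive I); auto; apply csm_Derive_n; auto.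
Qed.

Lemma Hs_derive_flip s G t D : is_Hs_derive s G (- t) D ->
  is_Hs_derive s (fun t => G (- t)) t (fun l => mscal (RtoC (-1)) (D l)).
Proof.
  intros h eps. destruct (h eps) as (d & hd). exists d. intros k hk hkd.
  destruct (hd (- k)) as (a & N & h1 & h2 & h3); [lra|rewrite Rabs_Ropp; auto|].
  exists (fun n => mscal (RtoC (-1)) (a n)), N. split; [|split; auto].
  - intros l hl i j. destruct (h1 l hl i j) as (v1 & v2 & s1 & s2 & e).
    exists (opp v1), (opp v2). split; [|split].
    + eapply is_series_ext; [|apply is_series_opp, s1]. intros n. cbv beta. rewrite entC_mscal, RtoC_m1. unfold opp; simpl. ring.
    + eapply is_series_ext; [|apply is_series_opp, s2]. intros n. cbv beta. rewrite entC_mscal, RtoC_m1. unfold opp; simpl. ring.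
    + transitivity (Copp (plus v1 v2)); [rewrite <- e|change (Copp (Cplus v1 v2) = Cplus (Copp v1) (Copp v2)); ring].
      unfold loop_diffq. rewrite !entC_minus, !entC_mscal, !entC_minus.
      replace (- (t + k)) with (- t + - k) by ring. rewrite RtoC_m1.
      replace (/ - k) with (- / k) by (field; auto). rewrite RtoC_opp. Cring.
  - replace (fun n => mscal (RtoC (-1)) (a n)) with (fun n => csub zero (a n)).
    2: { apply functional_extensionality. intros n. rewrite RtoC_m1. mxC. }
    unfold is_Hs_sqnorm in *. replace (fun n => _) with (fun n => Rpower (1 + IZR n ^ 2) s * frob2 (a n)); auto.
    apply functional_extensionality. intros n. unfold frob2. rewrite !entC_csub, !entC_zero.
    assert (e : forall z, Cmod (RtoC 0 - z) = Cmod z) by (intros z; rewrite <- (Cmod_opp z); f_equal; ring).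
    rewrite !e. reflexivity.
Qed.

Lemma pot_opp a q h r l : mscal (RtoC (-1)) (pot a q h r l) = pot (- a) (- q) (- h) (- r) l.
Proof. unfold pot. apply mx_extC; entC; rewrite ?RtoC_opp, ?RtoC_m1; Cring. Qed.

Lemma ck_flip J n : forall f, ck J n f -> ck (fun y => J (- y)) n (fun y => f (- y)).
Proof.
  induction n; intros f; simpl; auto. intros (f' & h1 & h2).
  exists (fun y => -1 * f' (- y)). split.
  - apply (ck_mult (fun y => J (- y)) n (fun _ => -1)); [apply ck_const|auto].
  - intros t ht. evar_last; [apply (is_derive_comp (K := R_AbsRing) (V := R_NormedModule) f Ropp t); [apply h2, ht|]|].
    + apply (is_derive_opp (K := R_AbsRing) (V := R_NormedModule) (fun x => x)). apply is_derive_id.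
    + unfold scal, opp, one; simpl. unfold mult; simpl. ring.
Qed.

Lemma opn_flip J : opn J -> opn (fun y => J (- y)).
Proof.
  intros h y hy. destruct (h _ hy) as (d & hd & hj). exists d; split; auto. intros z hz. apply hj.
  replace (- z - - y) with (- (z - y)) by ring. rewrite Rabs_Ropp. auto.
Qed.

Lemma csm_flip J f : opn J -> csm J f -> csm (fun y => J (- y)) (fun y => - f (- y)).
Proof.
  intros hJ h. apply csm_opp; [apply opn_flip; auto|]. intros n. apply ck_flip, h.
Qed.

(** The entries that decide regularity are [h x] and [- h (- y)]; both are nonzero, so the pair is
    regular on all of $J\times J^-$, which serves as the open set [W]. *)
Lemma pot_pair s J F a q h r : opn J -> csm J a -> csm J q -> csm J h -> csm J r -> (forall t, J t -> h t <> 0) ->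
  is_maurer_cartan s J F (fun t => pot (a t) (q t) (h t) (r t)) ->
  exists chi psi : R -> loop,
     is_maurer_cartan s J F chi /\ is_maurer_cartan s (fun y => J (- y)) (fun y => F (- y)) psi /\
     potential_pair s J (fun y => J (- y)) chi psi /\
     exists W : R -> R -> Prop, open2 W /\ (forall t, J t -> W t (- t)) /\
       (forall x y, W x y -> J x /\ J (- y) /\ regular_at s chi psi x y).
Proof.
  intros hJ ca cq ch cr hh hmc.
  exists (fun t => pot (a t) (q t) (h t) (r t)), (fun y => pot (- a (- y)) (- q (- y)) (- h (- y)) (- r (- y))).
  split; [auto|]. split; [|split; [split|]].
  - intros y hy. destruct (hmc _ hy) as (D & h1 & h2). exists (fun l => mscal (RtoC (-1)) (D l)).
    split; [apply Hs_derive_flip; auto|]. intros l hl. rewrite <- pot_opp, <- (h2 l hl). unfold loop_mul, loop_inv. mxC.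
  - intros; apply pot_LieG.
  - intros; apply pot_LieG.
  - apply pot_smooth; auto.
  - apply (pot_smooth s (fun y => J (- y)) (fun y => - a (- y)) (fun y => - q (- y)) (fun y => - h (- y)) (fun y => - r (- y)));
     [apply opn_flip; auto|apply csm_flip; auto..].
  - intros x hx. eexists. split; [apply pot_Hs_coeffs|]. intros n hn. apply pot_coef_out. unfold u1; lia.
  - intros x hx. eexists. split; [apply pot_Hs_coeffs|]. intros n hn. apply pot_coef_out. unfold u1; lia.
  - exists (fun x y => J x /\ J (- y)). split; [|split].
    + intros x y (hx & hy). destruct (hJ x hx) as (d1 & p1 & j1). destruct (opn_flip J hJ y hy) as (d2 & p2 & j2).
      assert (hd : 0 < Rmin d1 d2) by (apply Rmin_glb_lt; auto). exists (mkposreal _ hd). simpl. intros u v hu hv.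
      split; [apply j1|apply j2]; eapply Rlt_le_trans; eauto; [apply Rmin_l|apply Rmin_r].
    + intros t ht. rewrite Ropp_involutive. auto.
    + intros x y (hx & hy). split; [auto|split; [auto|]].
      do 2 eexists. split; [apply pot_Hs_coeffs|split; [apply pot_Hs_coeffs|]].
      unfold pot_coef; simpl Z.eq_dec; cbv iota. rewrite !ent_cplx. unfold P1, Pm. entR.
      split; intros e; apply RtoC_inj in e; [apply (hh x hx e)|apply (hh _ hy); lra].
Qed.

(** * The frame along the curve *)

Lemma interval_opn lo hi : opn (interval lo hi).
Proof.
  intros t (h1 & h2).
  assert (o : forall b : Rbar, Rbar_lt b t -> exists d, 0 < d /\ forall t', Rabs (t' - t) < d -> Rbar_lt b t').
  { intros [b| |] hb; simpl in *; [|contradiction|exists 1; split; [lra|auto]].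
    exists (t - b). split; [lra|]. intros t' ht. apply Rabs_def2 in ht. lra. }
  assert (o' : forall b : Rbar, Rbar_lt t b -> exists d, 0 < d /\ forall t', Rabs (t' - t) < d -> Rbar_lt t' b).
  { intros [b| |] hb; simpl in *; [|exists 1; split; [lra|auto]|contradiction].
    exists (b - t). split; [lra|]. intros t' ht. apply Rabs_def2 in ht. lra. }
  destruct (o lo h1) as (d1 & p1 & k1). destruct (o' hi h2) as (d2 & p2 & k2).
  exists (Rmin d1 d2). split; [apply Rmin_glb_lt; auto|]. intros t' ht.
  split; [apply k1|apply k2]; eapply Rlt_le_trans; eauto; [apply Rmin_l|apply Rmin_r].
Qed.

Lemma interval_convex lo hi x y z : interval lo hi x -> interval lo hi z -> x <= y <= z -> interval lo hi y.
Proof.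
  intros (h1 & _) (_ & h2) (h3 & h4). split.
  - apply (Rbar_lt_le_trans _ x); auto.
  - apply (Rbar_le_lt_trans _ z); auto.
Qed.

Lemma constant_of_derive (J : R -> Prop) f t0 t : (forall x y z, J x -> J z -> x <= y <= z -> J y) ->
  J t0 -> J t -> (forall x, J x -> is_derive f x 0) -> f t = f t0.
Proof.
  intros hc h0 h hd.
  destruct (MVT_gen f t0 t (fun _ => 0)) as (c & _ & e).
  - intros x hx. apply hd.
    destruct (Rle_dec t0 t); [rewrite Rmin_left, Rmax_right in hx by lra|rewrite Rmin_right, Rmax_left in hx by lra];
     [apply (hc t0 x t)|apply (hc t x t0)]; auto; lra.
  - intros x hx. apply continuity_pt_filterlim. apply (@ex_derive_continuous R_AbsRing R_NormedModule).
    exists 0. apply hd.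
    destruct (Rle_dec t0 t); [rewrite Rmin_left, Rmax_right in hx by lra|rewrite Rmin_right, Rmax_left in hx by lra];
     [apply (hc t0 x t)|apply (hc t x t0)]; auto; lra.
  - lra.
Qed.

Section MatrixCurves.

Context (J : R -> Prop) (hJ : opn J).

Definition msm (X : R -> M2 R) : Prop := forall i j, csm J (fun t => ent (X t) i j).

Lemma msm_ext X Y : (forall t, J t -> X t = Y t) -> msm X -> msm Y.
Proof. intros e h i j. apply (csm_ext J hJ (fun t => ent (X t) i j)); [|apply h]. intros t ht; rewrite e; auto. Qed.

Lemma msm_smooth X : smooth_curve J X -> msm X.
Proof. intros h i j. apply csm_of_ex_derive_n. intros n t ht. apply h; auto. Qed.

Lemma msm_const A : msm (fun _ => A).
Proof. intros i j. apply csm_const. Qed.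

Lemma msm_mult X Y : msm X -> msm Y -> msm (fun t => Mmult (X t) (Y t)).
Proof.
  intros h h' i j. apply (csm_ext J hJ (fun t => ent (X t) i 0 * ent (Y t) 0 j + ent (X t) i 1 * ent (Y t) 1 j)).
  - intros; symmetry; apply entR_mult.
  - apply csm_plus; apply csm_mult; auto.
Qed.

Lemma msm_plus X Y : msm X -> msm Y -> msm (fun t => radd (X t) (Y t)).
Proof.
  intros h h' i j. apply (csm_ext J hJ (fun t => ent (X t) i j + ent (Y t) i j)).
  - intros; symmetry; apply entR_radd.
  - apply csm_plus; auto.
Qed.

Lemma msm_scal f X : csm J f -> msm X -> msm (fun t => mscal (f t) (X t)).
Proof.
  intros h h' i j. apply (csm_ext J hJ (fun t => f t * ent (X t) i j)).
  - intros; symmetry; apply entR_mscal.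
  - apply csm_mult; auto.
Qed.

Lemma msm_inv X : msm X -> msm (fun t => sl_inv (X t)).
Proof.
  intros h i j.
  destruct (two_cases i) as [->|[->|hi]]; [destruct (two_cases j) as [->|[->|hj]]..|].
  - apply (csm_ext J hJ (fun t => ent (X t) 1 1)); [intros; eR; reflexivity|apply h].
  - apply (csm_ext J hJ (fun t => - ent (X t) 0 1)); [intros; eR; reflexivity|apply csm_opp; auto].
  - apply (csm_ext J hJ (fun _ => 0)); [intros; symmetry; apply (ent_out (K := R_Ring)); auto|apply csm_const].
  - apply (csm_ext J hJ (fun t => - ent (X t) 1 0)); [intros; eR; reflexivity|apply csm_opp; auto].
  - apply (csm_ext J hJ (fun t => ent (X t) 0 0)); [intros; eR; reflexivity|apply h].
  - apply (csm_ext J hJ (fun _ => 0)); [intros; symmetry; apply (ent_out (K := R_Ring)); auto|apply csm_const].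
  - apply (csm_ext J hJ (fun _ => 0)); [intros; symmetry; apply (ent_out (K := R_Ring)); auto|apply csm_const].
Qed.

Lemma msm_mderive X : msm X -> msm (mderive X).
Proof.
  intros h i j. apply (csm_ext J hJ (Derive (fun t => ent (X t) i j))); [|apply csm_Derive; auto].
  intros t _. symmetry. apply ent_mderive.
Qed.

Lemma csm_lor X Y : msm X -> msm Y -> csm J (fun t => lor (X t) (Y t)).
Proof.
  intros h h'. assert (k := msm_mult X Y h h').
  apply csm_mult; [apply csm_const|].
  apply (csm_ext J hJ (fun t => ent (Mmult (X t) (Y t)) 0 0 + ent (Mmult (X t) (Y t)) 1 1)).
  - intros. symmetry. apply mtrR.
  - apply csm_plus; apply k.
Qed.

Lemma msm_Ad G X : msm G -> msm (fun t => Ad (G t) X).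
Proof. intros h. apply (msm_mult (fun t => Mmult (G t) X)); [apply msm_mult; auto; apply msm_const|apply msm_inv; auto]. Qed.

Lemma msm_is_derive X t i j : msm X -> J t -> is_derive (fun t => ent (X t) i j) t (ent (mderive X t) i j).
Proof. intros h ht. rewrite ent_mderive. apply (csm_is_derive J); auto. Qed.

Lemma mderive_eq (X : R -> M2 R) (t : R) (D : M2 R) : (forall i j, is_derive (fun t => ent (X t) i j) t (ent D i j)) -> mderive X t = D.
Proof. intros h. apply mx_extR; rewrite ent_mderive; apply is_derive_unique, h. Qed.

Lemma mderive_ext (X Y : R -> M2 R) (t : R) : J t -> (forall t, J t -> X t = Y t) -> mderive X t = mderive Y t.
Proof.
  intros ht e. apply mx_extR; rewrite !ent_mderive; apply Derive_ext_loc;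
  (generalize (opn_locally J hJ t ht); apply filter_imp; intros z hz; rewrite e; auto).
Qed.

End MatrixCurves.

Section FrameCurve.

Context (J : R -> Prop) (hJ : opn J) (t0 H : R) (f V : R -> M2 R) (om : R -> R) (F0 : R -> M2 R).
Hypothesis (hf : is_frame J t0 f V om F0) (hV : csm J (fun t => lor (V t) (V t))).

Let a t := ent (frame_mc F0 t) 0 0.
Let q t := coefQ H f om F0 t * exp (- om t / 2).
Let r t := coefR H f om F0 t * exp (- om t / 2).
Let h t := / 2 * H * exp (om t / 2).

Lemma exp_half t : exp (om t / 2) * exp (om t / 2) = exp (om t).
Proof. rewrite <- exp_plus. f_equal. field. Qed.

Lemma exp_mhalf t : exp (- om t / 2) = / exp (om t / 2).
Proof. rewrite <- exp_Ropp. f_equal. field. Qed.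

(** Of [om] only $e^{\omega}=\langle V,V\rangle$ on [J] is given; smoothness comes from
    $e^{\omega/2}$ being the positive root of a smooth function. *)
Lemma csm_exp_half : csm J (fun t => exp (om t / 2)).
Proof.
  apply (csm_sqrt J hJ _ _ hV). intros t ht. split; [apply exp_pos|]. rewrite exp_half. apply (fr_om _ _ _ _ _ _ hf t ht).
Qed.

Lemma msm_F0 : msm J F0.
Proof. apply msm_smooth, (fr_smooth _ _ _ _ _ _ hf). Qed.

Lemma msm_mc : msm J (frame_mc F0).
Proof. apply (msm_mult J hJ (fun t => sl_inv (F0 t))); [apply msm_inv|apply msm_mderive]; auto; apply msm_F0. Qed.

Lemma msm_velocity : msm J (mderive f).
Proof.
  apply (msm_ext J hJ (fun t => mscal (exp (om t / 2)) (Ad (F0 t) e0))).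
  - intros t ht. symmetry. apply (fr_f0 _ _ _ _ _ _ hf t ht).
  - apply (msm_scal J hJ (fun t => exp (om t / 2))); [apply csm_exp_half|apply msm_Ad; auto; apply msm_F0].
Qed.

Lemma csm_acc : csm J (half_normal_acc f F0).
Proof.
  apply csm_mult; [apply csm_const|]. apply (csm_lor J hJ (mderive (mderive f))).
  - apply msm_mderive; auto. apply msm_velocity.
  - apply msm_Ad; auto. apply msm_F0.
Qed.

Lemma frame_csm : csm J a /\ csm J q /\ csm J h /\ csm J r.
Proof.
  assert (ce := csm_exp_half). assert (cm := msm_mc). assert (ca := csm_acc).
  assert (ci : csm J (fun t => exp (- om t / 2))).
  { apply (csm_ext J hJ (fun t => / exp (om t / 2))); [intros; symmetry; apply exp_mhalf|].
    apply csm_inv; auto. intros t _. generalize (exp_pos (om t / 2)); lra. }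
  assert (co : csm J (fun t => exp (om t))).
  { apply (csm_ext J hJ (fun t => exp (om t / 2) * exp (om t / 2))); [intros; apply exp_half|]. apply csm_mult; auto. }
  assert (cd : csm J (fun t => / 2 * exp (om t / 2) * (ent (frame_mc F0 t) 0 1 - ent (frame_mc F0 t) 1 0))).
  { apply (csm_mult J (fun t => / 2 * exp (om t / 2))); [apply csm_mult; auto; apply csm_const|].
    apply (csm_plus J (fun t => ent (frame_mc F0 t) 0 1) (fun t => - ent (frame_mc F0 t) 1 0)); [apply cm|apply csm_opp; auto; apply cm]. }
  assert (ch : csm J (fun t => / 2 * H * exp (om t))) by (apply (csm_mult J (fun _ => / 2 * H)); auto; apply csm_const).
  split; [apply cm|split; [|split]].
  - apply (csm_mult J (coefQ H f om F0)); auto. unfold coefQ.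
    apply (csm_plus J (fun t => - (/ 2 * exp (om t / 2) * (ent (frame_mc F0 t) 0 1 - ent (frame_mc F0 t) 1 0)) + half_normal_acc f F0 t) (fun t => / 2 * H * exp (om t))); auto.
    apply csm_plus; auto. apply csm_opp; auto.
  - apply (csm_mult J (fun _ => / 2 * H)); auto. apply csm_const.
  - apply (csm_mult J (coefR H f om F0)); auto. unfold coefR.
    apply (csm_plus J (fun t => (/ 2 * exp (om t / 2) * (ent (frame_mc F0 t) 0 1 - ent (frame_mc F0 t) 1 0)) + half_normal_acc f F0 t) (fun t => / 2 * H * exp (om t))); auto.
    apply csm_plus; auto.
Qed.

(** The trace of $F_0^{-1}F_0'$ is the derivative of $\det F_0=1$. *)
Lemma frame_mc_trace t : J t -> ent (frame_mc F0 t) 1 1 = - ent (frame_mc F0 t) 0 0 :> R.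
Proof.
  intros ht. assert (hd := msm_is_derive J F0).
  assert (k := fun i j => hd t i j msm_F0 ht).
  assert (e : is_derive (fun t => ent (F0 t) 0 0 * ent (F0 t) 1 1 - ent (F0 t) 0 1 * ent (F0 t) 1 0) t
    ((ent (mderive F0 t) 0 0 * ent (F0 t) 1 1 + ent (F0 t) 0 0 * ent (mderive F0 t) 1 1) -
     (ent (mderive F0 t) 0 1 * ent (F0 t) 1 0 + ent (F0 t) 0 1 * ent (mderive F0 t) 1 0))).
  { apply (is_derive_minus (K := R_AbsRing) (V := R_NormedModule) (fun t => ent (F0 t) 0 0 * ent (F0 t) 1 1) (fun t => ent (F0 t) 0 1 * ent (F0 t) 1 0));
    apply (is_derive_mult (K := R_AbsRing)); auto; intros; apply Rmult_comm. }
  assert (e' : is_derive (fun t => ent (F0 t) 0 0 * ent (F0 t) 1 1 - ent (F0 t) 0 1 * ent (F0 t) 1 0) t 0).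
  { apply (is_derive_ext_loc (fun _ => 1)); [|apply (is_derive_const (K := R_AbsRing) (V := R_NormedModule))].
    generalize (opn_locally J hJ t ht). apply filter_imp. intros z hz. rewrite <- mdetR. symmetry. apply (fr_det _ _ _ _ _ _ hf z hz). }
  apply is_derive_unique in e, e'. rewrite e in e'. unfold frame_mc. eR. apply Req_minus. etransitivity; [|exact e']. ring.
Qed.

Lemma F0_derive t : J t -> mderive F0 t = Mmult (F0 t) (frame_mc F0 t).
Proof.
  intros ht. assert (hd := fr_det _ _ _ _ _ _ hf t ht). unfold frame_mc.
  transitivity (mscal (mdet (F0 t)) (mderive F0 t)); [rewrite hd|]; generalize (mderive F0 t) (F0 t); intros; mR.
Qed.

(** With $U=F_0^{-1}F_0'$, the acceleration is
    $(e^{\omega/2})'\mathrm{Ad}_{F_0}e_0+e^{\omega/2}\mathrm{Ad}_{F_0}[U,e_0]$. The first term is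
    orthogonal to the normal, and $\langle[U,e_0],e_2\rangle=-(b+c)$. *)
Lemma normal_acceleration t : J t -> lor (mderive (mderive f) t) (Ad (F0 t) e2) =
  - exp (om t / 2) * (ent (frame_mc F0 t) 0 1 + ent (frame_mc F0 t) 1 0).
Proof.
  intros ht. set (E := fun t => exp (om t / 2)).
  assert (hA : fdiff (fun t _ => E t) t 0 (Derive E t) 0).
  { apply fdiff_fst. apply (csm_is_derive J); auto. apply csm_exp_half. }
  (* The curve is viewed as a function of two variables, constant in the second; writing its zero
     derivative as a product with [F0] gives it the form that [mfdiff_Ad] expects. *)
  assert (hF : mfdiff (fun t _ => F0 t) t 0 (Mmult (F0 t) (frame_mc F0 t)) (Mmult (F0 t) mzero)).
  { intros i j. rewrite <- F0_derive by auto.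
    replace (ent (Mmult (F0 t) mzero) i j) with 0 by (rewrite entR_mult, !entR_mzero; ring).
    apply (fdiff_fst (fun t => ent (F0 t) i j)). apply (msm_is_derive J); auto. apply msm_F0. }
  assert (tr := frame_mc_trace t ht).
  assert (hAd := mfdiff_Ad (fun t _ => F0 t) t 0 (frame_mc F0 t) mzero e0 hF tr ltac:(rewrite !entR_mzero; ring)).
  assert (k := mfdiff_scal _ _ _ _ _ _ _ _ hA hAd).
  assert (e : mderive (mderive f) t = radd (mscal (Derive E t) (Ad (F0 t) e0)) (mscal (E t) (Ad (F0 t) (bracket (frame_mc F0 t) e0)))).
  { rewrite (mderive_ext J hJ _ (fun t => mscal (E t) (Ad (F0 t) e0)) t ht (fun t ht => fr_f0 _ _ _ _ _ _ hf t ht)).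
    apply mderive_eq. intros i j. exact (proj1 (fdiff_partial _ _ _ _ _ (k i j))). }
  rewrite e. assert (hd := fr_det _ _ _ _ _ _ hf t ht).
  transitivity (- E t * (ent (frame_mc F0 t) 0 1 + ent (frame_mc F0 t) 1 0) * (mdet (F0 t) * mdet (F0 t))); [|rewrite hd; unfold E; ring].
  unfold lor, Ad, bracket, e0, e2. revert tr. generalize (frame_mc F0 t) (F0 t) (E t) (Derive E t). intros A G u v tr.
  eR. rewrite tr. apply Req_minus; field.
Qed.

(** Once $\langle f'',N\rangle=-e^{\omega/2}(b+c)$ is inserted, the terms with $H$ cancel:
    $-Qe^{-\omega/2}+\frac12He^{\omega/2}=b$ and $\frac12He^{\omega/2}-Re^{-\omega/2}=c$. *)
Lemma frame_mc_pot t : J t ->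
  frame_mc F0 t = radd (P0 (a t)) (radd (P1 (q t) (h t)) (Pm (h t) (r t))).
Proof.
  intros ht. assert (hn := normal_acceleration t ht). assert (tr := frame_mc_trace t ht).
  assert (he := exp_pos (om t / 2)). assert (hm := exp_mhalf t). assert (hh := exp_half t).
  unfold P0, P1, Pm, a, q, r, h, coefQ, coefR, half_normal_acc. rewrite hn, hm, <- hh.
  generalize dependent (exp (om t / 2)). intros E _ he _ _. revert tr. generalize (frame_mc F0 t). intros A tr.
  apply mx_extR; eR; [Rring| | |rewrite tr; Rring]; apply Req_minus; field; lra.
Qed.

End FrameCurve.

(** [F0] and the loop frame at $\lambda=1$ solve the same equation $G'=GA$ with initial value $I$.
    Since [A] is traceless, its adjugate is $-A$ and the derivative of $GF_0^{-1}$ vanishes. *)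
Lemma frame_at_one s (hs : s > 1 / 2) J (hJ : opn J) (hconv : forall x y z, J x -> J z -> x <= y <= z -> J y)
  F a q h r t0 (ht0 : J t0) (hG : forall t, J t -> in_G s (F t)) (hinit : loop_eq (F t0) (fun _ => Mone))
  (hode : is_maurer_cartan s J F (fun t => pot (a t) (q t) (h t) (r t)))
  (hca : csm J a) (hcq : csm J q) (hch : csm J h) (hcr : csm J r) F0 :
  msm J F0 -> (forall t, J t -> mdet (F0 t) = 1) -> F0 t0 = Mone ->
  (forall t, J t -> mderive F0 t = Mmult (F0 t) (radd (P0 (a t)) (radd (P1 (q t) (h t)) (Pm (h t) (r t))))) ->
  forall t, J t -> ML ev1 (F t) = F0 t.
Proof.
  intros hF hd hi hD t ht. set (G := fun t => ML ev1 (F t)).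
  set (A := fun t => radd (P0 (a t)) (radd (P1 (q t) (h t)) (Pm (h t) (r t)))).
  assert (hA : forall t, ent (A t) 1 1 = - ent (A t) 0 0 :> R) by (intros z; unfold A, P0, P1, Pm; eR; Rring).
  assert (W : forall x, J x -> mfdiff (fun x _ => Mmult (G x) (sl_inv (F0 x))) x 0 mzero mzero).
  { intros x hx.
    assert (h1 := fam_plus s hs J hJ hconv F a q h r t0 ht0 hG hinit hode hca hcq hch hcr x 0 hx).
    destruct (ad_X _ _ _ _ _ h1) as (B & hB).
    assert (h2 : mfdiff (fun x _ => G x) x 0 (ML ev1 (fun l => Mmult (F x l) (pot (a x) (q x) (h x) (r x) l))) (ML ev1 (fun _ => zero)))
      by exact (ML_adiff ev1 _ _ _ _ _ lfun_ev1 h1).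
    assert (e1 : ML ev1 (fun l => Mmult (F x l) (pot (a x) (q x) (h x) (r x) l)) = Mmult (G x) (A x)).
    { transitivity (ML ev1 (fun l => Mmult (F x l) (lp (P0 (a x)) (P1 (q x) (h x)) (Pm (h x) (r x)) l))).
      - apply ML_ext; [apply lfun_ev1|]. intros l _. rewrite pot_lp. reflexivity.
      - rewrite (ML_lp_r _ _ _ _ _ _ _ _ shifts_ev1 hB). fold (G x). unfold A. generalize (G x). intros. mR. }
    assert (e2 : ML ev1 (fun _ : C => zero) = mzero).
    { apply mx_extR; rewrite ent_ML, entR_mzero by lia; unfold ev1; rewrite entC_zero; reflexivity. }
    rewrite e1, e2 in h2.
    assert (h3 : mfdiff (fun t _ => F0 t) x 0 (Mmult (F0 x) (A x)) mzero).
    { intros i j. unfold A. rewrite <- hD, entR_mzero by auto.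
      apply (fdiff_fst (fun t => ent (F0 t) i j)). apply (msm_is_derive J); auto. }
    refine (mfdiff_eq _ _ _ _ _ _ _ _ _ (mfdiff_mult _ _ _ _ _ _ _ _ h2 (mfdiff_inv _ _ _ _ _ h3))).
    - cbv beta. fold (G x). assert (hAx := hA x). revert hAx. generalize (A x) (G x) (F0 x). intros A' X Y hA'.
      apply mx_extR; rewrite ?entR_mzero; eR; rewrite ?hA'; Rring.
    - cbv beta. generalize (ML ev1 (F x)) (F0 x). intros X Y. apply mx_extR; repeat (rewrite ?entR_mzero; eR); Rring. }
  assert (k : forall i j, ent (Mmult (G t) (sl_inv (F0 t))) i j = ent (Mmult (G t0) (sl_inv (F0 t0))) i j).
  { intros i j. apply (constant_of_derive J (fun t => ent (Mmult (G t) (sl_inv (F0 t))) i j)); auto.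
    intros x hx. rewrite <- (entR_mzero i j). exact (proj1 (fdiff_partial _ _ _ _ _ (W x hx i j))). }
  assert (g0 : G t0 = Mone).
  { assert (o : ML ev1 (fun _ => Mone) = Mone).
    { apply mx_extR; rewrite ent_ML by lia; unfold ev1; entC; entR; reflexivity. }
    rewrite <- o. apply ML_ext; [apply lfun_ev1|exact hinit]. }
  rewrite g0, hi in k.
  assert (e : Mmult (G t) (sl_inv (F0 t)) = Mone).
  { apply mx_extR; rewrite k; eR; ring. }
  assert (s1 : forall X : M2 R, mscal 1 X = X) by (intros; mR).
  transitivity (Mmult (Mmult (G t) (sl_inv (F0 t))) (F0 t)); [|rewrite e; generalize (F0 t); intros; mR].
  transitivity (mscal (mdet (F0 t)) (G t)); [rewrite hd by auto; symmetry; apply s1|generalize (G t) (F0 t); intros; mR].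
Qed.

(** * Geometry of the surface *)

Lemma L3_iff X : L3 X <-> ent X 1 1 = - ent X 0 0 :> R.
Proof. unfold L3. rewrite mtrR. split; intros h; [|change (ent X 0 0 + ent X 1 1 = 0)]; simpl in h; lra. Qed.

Lemma L3_radd X Y : L3 X -> L3 Y -> L3 (radd X Y).
Proof. rewrite !L3_iff. intros h h'. eR. rewrite h, h'. ring. Qed.

Lemma L3_rsub X Y : L3 X -> L3 Y -> L3 (rsub X Y).
Proof. rewrite !L3_iff. intros h h'. eR. rewrite h, h'. ring. Qed.

Lemma L3_mscal k X : L3 X -> L3 (mscal k X).
Proof. rewrite !L3_iff. intros h. eR. rewrite h. ring. Qed.

Lemma L3_Ad G X : L3 X -> L3 (Ad G X).
Proof. rewrite !L3_iff. intros h. unfold Ad. eR. rewrite h. ring. Qed.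

Lemma L3_basis : L3 e0 /\ L3 e1 /\ L3 e2 /\ L3 E12 /\ L3 E21.
Proof. rewrite !L3_iff. unfold e0, e1, e2, E12, E21. eR. repeat split; ring. Qed.

Lemma lor_ent X Y : lor X Y = / 2 * (ent X 0 0 * ent Y 0 0 + ent X 0 1 * ent Y 1 0 + ent X 1 0 * ent Y 0 1 + ent X 1 1 * ent Y 1 1).
Proof. unfold lor. rewrite mtrR, !entR_mult. Rring. Qed.

Lemma lor_co X Y : L3 X -> L3 Y -> lor X Y = - co0 X * co0 Y + co1 X * co1 Y + co2 X * co2 Y.
Proof. rewrite !L3_iff, lor_ent. intros h h'. unfold co0, co1, co2. rewrite h, h'. field. Qed.

Lemma co_decomp X : L3 X -> X = radd (mscal (co0 X) e0) (radd (mscal (co1 X) e1) (mscal (co2 X) e2)).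
Proof.
  rewrite L3_iff. intros h. unfold co0, co1, co2, e0, e1, e2. apply mx_extR; eR; rewrite ?h; apply Req_minus; field.
Qed.

Lemma co_zero X : L3 X -> co0 X = 0 -> co1 X = 0 -> co2 X = 0 -> X = mzero.
Proof.
  intros h h0 h1 h2. rewrite (co_decomp X h), h0, h1, h2. unfold e0, e1, e2. mZ.
Qed.

(** Cramer's rule: [vol A B D] times a coordinate of [Y] is a combination of the three products,
    with $2\times2$ minors as coefficients. *)
Lemma lor_nondegenerate Y A B D : L3 Y -> L3 A -> L3 B -> L3 D -> vol A B D <> 0 ->
  lor Y A = 0 -> lor Y B = 0 -> lor Y D = 0 -> Y = mzero.
Proof.
  intros hY hA hB hD hv e1 e2 e3. rewrite lor_co in e1, e2, e3 by auto. unfold vol in hv.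
  set (a0 := co0 A) in *. set (a1 := co1 A) in *. set (a2 := co2 A) in *.
  set (b0 := co0 B) in *. set (b1 := co1 B) in *. set (b2 := co2 B) in *.
  set (c0 := co0 D) in *. set (c1 := co1 D) in *. set (c2 := co2 D) in *.
  set (v := a0 * (b1 * c2 - b2 * c1) - a1 * (b0 * c2 - b2 * c0) + a2 * (b0 * c1 - b1 * c0)) in hv.
  set (u1 := - co0 Y * a0 + co1 Y * a1 + co2 Y * a2) in e1.
  set (u2 := - co0 Y * b0 + co1 Y * b1 + co2 Y * b2) in e2.
  set (u3 := - co0 Y * c0 + co1 Y * c1 + co2 Y * c2) in e3.
  apply co_zero; auto; apply (Rmult_eq_reg_r v); auto.
  - transitivity (- (u1 * (b1 * c2 - b2 * c1) + u2 * (c1 * a2 - c2 * a1) + u3 * (a1 * b2 - a2 * b1))); [unfold u1, u2, u3, v; ring|rewrite e1, e2, e3; ring].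
  - transitivity (u1 * (b2 * c0 - b0 * c2) + u2 * (c2 * a0 - c0 * a2) + u3 * (a2 * b0 - a0 * b2)); [unfold u1, u2, u3, v; ring|rewrite e1, e2, e3; ring].
  - transitivity (u1 * (b0 * c1 - b1 * c0) + u2 * (c0 * a1 - c1 * a0) + u3 * (a0 * b1 - a1 * b0)); [unfold u1, u2, u3, v; ring|rewrite e1, e2, e3; ring].
Qed.

Lemma lor_Ad G X Y : mdet G = 1 -> lor (Ad G X) (Ad G Y) = lor X Y.
Proof.
  intros h. transitivity (mdet G * mdet G * lor X Y); [|rewrite h; ring].
  rewrite !lor_ent. unfold Ad. eR. Rring.
Qed.

Lemma vol_Ad_frame G : mdet G = 1 -> vol (Ad G E21) (Ad G E12) (Ad G e2) = / 2.
Proof.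
  intros h. transitivity (mdet G * mdet G * mdet G * / 2); [|rewrite h; field].
  unfold vol, co0, co1, co2, Ad, E21, E12, e2. eR. apply Req_minus. field.
Qed.

Lemma fdiff_lor g B x y P Q : mfdiff g x y P Q -> fdiff (fun x y => lor (g x y) B) x y (lor P B) (lor Q B).
Proof.
  intros h. assert (k := fun i j c => fdiff_mult _ _ _ _ _ _ _ _ (h i j) (fdiff_const c x y)).
  assert (k2 := fdiff_mult _ _ _ _ _ _ _ _ (fdiff_const (/ 2) x y)
    (fdiff_plus _ _ _ _ _ _ _ _ (fdiff_plus _ _ _ _ _ _ _ _ (fdiff_plus _ _ _ _ _ _ _ _ (k 0%nat 0%nat (ent B 0 0)) (k 0%nat 1%nat (ent B 1 0)))
       (k 1%nat 0%nat (ent B 0 1))) (k 1%nat 1%nat (ent B 1 1)))).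
  apply (fdiff_ext (fun x y => / 2 * (ent (g x y) 0 0 * ent B 0 0 + ent (g x y) 0 1 * ent B 1 0 + ent (g x y) 1 0 * ent B 0 1 + ent (g x y) 1 1 * ent B 1 1)) _ _ _ _ _ 1 Rlt_0_1).
  - intros. rewrite lor_ent. reflexivity.
  - cbv beta in k2. refine (fdiff_eq _ _ _ _ _ _ _ _ _ k2); rewrite lor_ent; ring.
Qed.

(** The chain rule along $t\mapsto(t,-t)$, the curve $\Delta$ that carries the initial data. *)
Lemma fdiff_antidiagonal f t p q : fdiff f t (- t) p q -> is_derive (fun t => f t (- t)) t (p - q).
Proof.
  intros h. apply is_derive_Reals. intros eps he. destruct (h (eps / 4)) as (d & hd & hf); [lra|].
  exists (mkposreal d hd). intros k hk hkd. simpl in hkd.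
  specialize (hf k (- k) hkd). rewrite Rabs_Ropp in hf. specialize (hf hkd).
  replace (- (t + k)) with (- t + - k) by ring.
  replace ((f (t + k) (- t + - k) - f t (- t)) / k - (p - q)) with ((f (t + k) (- t + - k) - f t (- t) - (k * p + - k * q)) / k) by (field; auto).
  unfold Rdiv at 1. rewrite Rabs_mult, Rabs_inv. assert (hp : 0 < Rabs k) by (apply Rabs_pos_lt; auto).
  apply Rle_lt_trans with ((eps / 4 * (Rabs k + Rabs k)) * / Rabs k).
  - apply Rmult_le_compat_r; [left; apply Rinv_0_lt_compat; auto|auto].
  - replace (eps / 4 * (Rabs k + Rabs k) * / Rabs k) with (eps / 2) by (field; lra). lra.
Qed.

(** * Inverting the isometry *)

Section Isometry.

Context (L : M2 R -> M2 R) (c : M2 R) (hL : orientation_preserving_isometry L c).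

Lemma L_lin k X Y : L3 X -> L3 Y -> L (radd (mscal k X) Y) = radd (mscal k (L X)) (L Y).
Proof. exact (opi_linear L c hL k X Y). Qed.

Lemma L_expand X : L3 X -> L X = radd (mscal (co0 X) (L e0)) (radd (mscal (co1 X) (L e1)) (mscal (co2 X) (L e2))).
Proof.
  intros h. destruct L3_basis as (h0 & h1 & h2 & _). rewrite (co_decomp X h) at 1.
  rewrite !L_lin; auto; try apply L3_radd; try apply L3_mscal; auto.
  (* Linearity is given for sums $kX+Y$; the last summand is brought into this form. *)
  replace (mscal (co2 X) e2) with (radd (mscal (co2 X - 1) e2) e2) by (unfold e2; mR).
  rewrite L_lin; auto. generalize (L e0) (L e1) (L e2). intros. mR.
Qed.

(** The inverse of [L] by duality: the coordinates of the preimage are the products with the images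
    of the basis, the minus sign stemming from $\langle e_0,e_0\rangle=-1$. The formula is linear on
    all matrices and can be differentiated entry by entry. *)
Definition Linv (X : M2 R) : M2 R :=
  radd (mscal (- lor X (L e0)) e0) (radd (mscal (lor X (L e1)) e1) (mscal (lor X (L e2)) e2)).

Lemma Linv_L3 X : L3 (Linv X).
Proof. destruct L3_basis as (h0 & h1 & h2 & _). repeat apply L3_radd; apply L3_mscal; auto. Qed.

Lemma Linv_radd X Y : Linv (radd X Y) = radd (Linv X) (Linv Y).
Proof. unfold Linv. rewrite !lor_ent. eR. generalize (L e0) (L e1) (L e2). intros. unfold e0, e1, e2. mR. Qed.

Lemma Linv_mscal k X : Linv (mscal k X) = mscal k (Linv X).
Proof. unfold Linv. rewrite !lor_ent. eR. generalize (L e0) (L e1) (L e2). intros. unfold e0, e1, e2. mR. Qed.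

Lemma Linv_L X : L3 X -> Linv (L X) = X.
Proof.
  intros h. destruct L3_basis as (h0 & h1 & h2 & _). unfold Linv.
  rewrite !(opi_isometry L c hL) by auto. rewrite (co_decomp X h) at 4. rewrite !lor_ent.
  apply L3_iff in h. unfold co0, co1, co2, e0, e1, e2. apply mx_extR; eR; rewrite ?h; apply Req_minus; field.
Qed.

Lemma lor_Linv_basis X : lor (Linv X) e0 = lor X (L e0) /\ lor (Linv X) e1 = lor X (L e1) /\ lor (Linv X) e2 = lor X (L e2).
Proof.
  unfold Linv. generalize (lor X (L e0)) (lor X (L e1)) (lor X (L e2)). intros u v w.
  rewrite !lor_ent. unfold e0, e1, e2. eR. repeat split; apply Req_minus; field.
Qed.

(** The difference of the two sides is orthogonal to the images of [e0], [e1], [e2], which are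
    independent because their volume is positive. *)
Lemma L_Linv X : L3 X -> L (Linv X) = X.
Proof.
  intros h. destruct L3_basis as (h0 & h1 & h2 & _). assert (hi := Linv_L3 X).
  destruct (lor_Linv_basis X) as (l0 & l1 & l2).
  assert (sub : forall A B D, lor (rsub A B) D = lor A D - lor B D) by (intros; rewrite !lor_ent; eR; Rring).
  assert (z : rsub (L (Linv X)) X = mzero).
  { assert (s := opi_stable L c hL).
    apply (lor_nondegenerate _ (L e0) (L e1) (L e2)); auto.
    - apply L3_rsub; auto.
    - generalize (opi_orientation L c hL). lra.
    - rewrite sub, (opi_isometry L c hL), l0 by auto. ring.
    - rewrite sub, (opi_isometry L c hL), l1 by auto. ring.
    - rewrite sub, (opi_isometry L c hL), l2 by auto. ring. }
  transitivity (radd (rsub (L (Linv X)) X) X); [mR|rewrite z; mZ].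
Qed.

Lemma lor_Linv X Y : L3 X -> L3 Y -> lor (Linv X) (Linv Y) = lor X Y.
Proof. intros h h'. rewrite <- (opi_isometry L c hL) by apply Linv_L3. rewrite !L_Linv; auto. Qed.

Lemma vol_L X Y Z : L3 X -> L3 Y -> L3 Z -> vol (L X) (L Y) (L Z) = vol X Y Z * vol (L e0) (L e1) (L e2).
Proof.
  intros h h' h''. rewrite (L_expand X h), (L_expand Y h'), (L_expand Z h'').
  assert (k0 : forall u v w A B D, co0 (radd (mscal u A) (radd (mscal v B) (mscal w D))) = u * co0 A + (v * co0 B + w * co0 D)).
  { intros. unfold co0. eR. field. }
  assert (k1 : forall u v w A B D, co1 (radd (mscal u A) (radd (mscal v B) (mscal w D))) = u * co1 A + (v * co1 B + w * co1 D)).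
  { intros. unfold co1. eR. field. }
  assert (k2 : forall u v w A B D, co2 (radd (mscal u A) (radd (mscal v B) (mscal w D))) = u * co2 A + (v * co2 B + w * co2 D)).
  { intros. unfold co2. eR. ring. }
  unfold vol. rewrite !k0, !k1, !k2. ring.
Qed.

Lemma vol_Linv X Y Z : L3 X -> L3 Y -> L3 Z -> vol X Y Z > 0 -> vol (Linv X) (Linv Y) (Linv Z) > 0.
Proof.
  intros h h' h'' hv. assert (e := vol_L _ _ _ (Linv_L3 X) (Linv_L3 Y) (Linv_L3 Z)).
  rewrite !L_Linv in e by auto. assert (o := opi_orientation L c hL).
  apply Rnot_le_gt. intros hle. assert (vol (Linv X) (Linv Y) (Linv Z) * vol (L e0) (L e1) (L e2) <= 0) by nra. lra.
Qed.

Lemma mfdiff_Linv g x y P Q : mfdiff g x y P Q -> mfdiff (fun x y => Linv (g x y)) x y (Linv P) (Linv Q).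
Proof.
  intros h i j.
  assert (k := fun A => fdiff_lor g A x y P Q h).
  assert (m := fun A (z : R) => fdiff_mult _ _ _ _ _ _ _ _ (k A) (fdiff_const z x y)).
  assert (t := fdiff_plus _ _ _ _ _ _ _ _ (m (L e0) (- ent e0 i j)) (fdiff_plus _ _ _ _ _ _ _ _ (m (L e1) (ent e1 i j)) (m (L e2) (ent e2 i j)))).
  assert (f : forall X, ent (Linv X) i j = lor X (L e0) * - ent e0 i j + (lor X (L e1) * ent e1 i j + lor X (L e2) * ent e2 i j)).
  { intros X. unfold Linv. eR. Rring. }
  rewrite !f. cbv beta in t.
  apply (fdiff_ext (fun x y => lor (g x y) (L e0) * - ent e0 i j + (lor (g x y) (L e1) * ent e1 i j + lor (g x y) (L e2) * ent e2 i j)) _ _ _ _ _ 1 Rlt_0_1).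
  - intros. rewrite f. reflexivity.
  - refine (fdiff_eq _ _ _ _ _ _ _ _ _ t); ring.
Qed.

Lemma Linv_smooth n (X : R -> R -> M2 R) k B x y i j :
  (forall c1 c2 c3 c4 c5, ex_diff_n (fun x y => c1 * ent (X x y) 0 0 + (c2 * ent (X x y) 0 1 +
    (c3 * ent (X x y) 1 0 + (c4 * ent (X x y) 1 1 + c5)))) n x y) ->
  ex_diff_n (fun x y => ent (Linv (radd (mscal k (X x y)) B)) i j) n x y.
Proof.
  intros h.
  set (w := fun a b => k * / 2 * (- ent (L e0) a b * ent e0 i j + ent (L e1) a b * ent e1 i j + ent (L e2) a b * ent e2 i j)).
  (* The indices appear transposed because the trace form pairs the entry $(i,j)$ with the entry
     $(j,i)$. *)
  specialize (h (w 0%nat 0%nat) (w 1%nat 0%nat) (w 0%nat 1%nat) (w 1%nat 1%nat) (ent (Linv B) i j)).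
  match type of h with ex_diff_n ?f _ _ _ => replace (fun x y => ent (Linv (radd (mscal k (X x y)) B)) i j) with f; auto end.
  apply functional_extensionality; intros u. apply functional_extensionality; intros v.
  unfold w, Linv. rewrite !entR_radd, !entR_mscal, !lor_ent. eR. Rring.
Qed.

End Isometry.

Lemma mscal_mscal a b (X : M2 R) : mscal a (mscal b X) = mscal (a * b) X.
Proof. mR. Qed.

Lemma lor_mscal a b X Y : lor (mscal a X) (mscal b Y) = a * b * lor X Y.
Proof. rewrite !lor_ent. eR. Rring. Qed.

Lemma lor_comb a b a' b' X Y : lor (radd (mscal a X) (mscal b Y)) (radd (mscal a' X) (mscal b' Y)) =
  a * a' * lor X X + (a * b' + b * a') * lor X Y + b * b' * lor Y Y.
Proof. rewrite !lor_ent. eR. Rring. Qed.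

Lemma in_span_radd A B a b : in_span A B (radd (mscal a A) (mscal b B)).
Proof. exists a, b. reflexivity. Qed.

(** * The surface and the geometric Cauchy problem *)

Section Surface.

Context (L : M2 R -> M2 R) (c : M2 R) (hL : orientation_preserving_isometry L c).
Context (H : R) (hH : H <> 0) (J : R -> Prop) (hJ : opn J).
Context (hconv : forall x y z, J x -> J z -> x <= y <= z -> J y) (t0 : R) (ht0 : J t0).
Context (f0 V : R -> M2 R) (hdata : geometric_cauchy_data J f0 V).
Context (om : R -> R) (F0 : R -> M2 R) (hF0 : is_frame J t0 (fun t => motion L c (f0 t)) (fun t => L (V t)) om F0).
Context (M : R -> R -> Prop) (Fh : R -> R -> loop) (G S : R -> R -> M2 R) (d : R -> R -> R).

Let mu x := exp (om x / 2).
Let nu x y := exp (om (- y) / 2) * (d x y * d x y).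

Hypothesis hM : open2 M.
Hypothesis hdiag : forall t, J t -> M t (- t) /\ G t (- t) = F0 t /\ d t (- t) = 1.
Hypothesis hfam : forall x y, M x y -> mdet (G x y) = 1 /\ d x y <> 0 /\ mtr (S x y) = 0 /\
    is_Sym (Fh x y) (RtoC 1) (cplx (S x y)) /\
    mfdiff S x y (mscal (4 * (/ 2 * H * mu x)) (Ad (G x y) E21)) (mscal (4 * (/ 2 * H * exp (om (- y) / 2)) * (d x y * d x y)) (Ad (G x y) E12)) /\
    exists P, mfdiff (fun x y => Ad (G x y) E21) x y P (mscal ((/ 2 * H * exp (om (- y) / 2)) * (d x y * d x y)) (Ad (G x y) e2)).
Hypothesis hsm : forall c1 c2 c3 c4 c5 n x y, M x y ->
    ex_diff_n (fun x y => c1 * ent (S x y) 0 0 + (c2 * ent (S x y) 0 1 + (c3 * ent (S x y) 1 0 + (c4 * ent (S x y) 1 1 + c5)))) n x y /\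
    ex_diff_n (fun x y => c1 * ent (Ad (G x y) e2) 0 0 + (c2 * ent (Ad (G x y) e2) 0 1 +
      (c3 * ent (Ad (G x y) e2) 1 0 + (c4 * ent (Ad (G x y) e2) 1 1 + c5)))) n x y.

Let kap := / (2 * H).
Let fc t := motion L c (f0 t).
(** The translation left open by the Sym formula, fixed by the initial point at [t0]. *)
Let cst := rsub (fc t0) (mscal kap (S t0 (- t0))).
Let g x y := radd (mscal kap (S x y)) cst.

(** The translated Sym surface [g] belongs to the moved data; pulling it back by the inverse motion
    returns to the original curve. *)
Definition surf (x y : R) : M2 R := Linv L (radd (mscal kap (S x y)) (rsub cst c)).

Let X1 x y := Linv L (Ad (G x y) E21).
Let X2 x y := Linv L (Ad (G x y) E12).
Let X3 x y := Linv L (Ad (G x y) e2).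

Lemma mu_pos x : 0 < mu x.
Proof. apply exp_pos. Qed.

Lemma nu_pos x y : M x y -> 0 < nu x y.
Proof.
  intros hxy. destruct (hfam x y hxy) as (_ & hd & _). unfold nu. apply Rmult_lt_0_compat; [apply exp_pos|].
  assert (0 < d x y * d x y) by nra. auto.
Qed.

Lemma fc_L3 t : J t -> L3 (fc t).
Proof.
  intros ht. apply (L3_radd (L (f0 t)) c); [|apply (opi_translation L c hL)].
  apply (opi_stable L c hL), (gcd_f0_L3 _ _ _ hdata); auto.
Qed.

Lemma cst_L3 : L3 cst.
Proof.
  apply L3_rsub; [apply fc_L3; auto|apply L3_mscal]. apply hfam, hdiag; auto.
Qed.

Lemma g_L3 x y : M x y -> L3 (g x y).
Proof. intros hxy. apply L3_radd; [apply L3_mscal; apply (hfam x y hxy)|apply cst_L3]. Qed.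

Lemma surf_eq x y : surf x y = Linv L (rsub (g x y) c).
Proof. unfold surf, g. f_equal. mR. Qed.

Lemma motion_surf x y : M x y -> motion L c (surf x y) = g x y.
Proof.
  intros hxy. rewrite surf_eq. unfold motion. rewrite (L_Linv L c hL).
  - change (radd (rsub (g x y) c) c = g x y). mR.
  - apply L3_rsub; [apply g_L3; auto|apply (opi_translation L c hL)].
Qed.

Lemma g_diff x y : M x y -> mfdiff g x y (mscal (mu x) (Ad (G x y) E21)) (mscal (nu x y) (Ad (G x y) E12)).
Proof.
  intros hxy. destruct (hfam x y hxy) as (_ & _ & _ & _ & hS & _).
  assert (z : zero = (zero : M2 R)) by reflexivity.
  refine (mfdiff_eq _ _ _ _ _ _ _ _ _ (mfdiff_radd _ _ _ _ _ _ _ _ (mfdiff_cscal kap _ _ _ _ _ hS) (mfdiff_const cst x y zero z)));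
    rewrite mscal_mscal; unfold kap, nu; apply mx_extR; eR; apply Req_minus; field; auto.
Qed.

Lemma surf_diff x y : M x y -> mfdiff surf x y (mscal (mu x) (X1 x y)) (mscal (nu x y) (X2 x y)).
Proof.
  intros hxy. assert (z : zero = (zero : M2 R)) by reflexivity.
  assert (k := mfdiff_Linv L _ _ _ _ _ (mfdiff_rsub _ _ _ _ _ _ _ _ (g_diff x y hxy) (mfdiff_const c x y zero z))).
  apply (mfdiff_ext (fun x y => Linv L (rsub (g x y) c)) _ _ _ _ _ 1 Rlt_0_1); [intros; symmetry; apply surf_eq|].
  refine (mfdiff_eq _ _ _ _ _ _ _ _ _ k); unfold X1, X2; rewrite <- Linv_mscal; f_equal; mR.
Qed.

Lemma surf_D x y : M x y -> Defs.Dx surf x y = mscal (mu x) (X1 x y) /\ Defs.Dy surf x y = mscal (nu x y) (X2 x y).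
Proof. intros hxy. apply mfdiff_D, surf_diff; auto. Qed.

Lemma null_frame x y : M x y ->
  lor (X1 x y) (X1 x y) = 0 /\ lor (X2 x y) (X2 x y) = 0 /\ lor (X1 x y) (X2 x y) = / 2 /\
  lor (X3 x y) (X3 x y) = 1 /\ lor (X1 x y) (X3 x y) = 0 /\ lor (X2 x y) (X3 x y) = 0 /\
  vol (X1 x y) (X2 x y) (X3 x y) > 0.
Proof.
  intros hxy. destruct (hfam x y hxy) as (hd & _). destruct L3_basis as (_ & _ & b2 & b12 & b21).
  unfold X1, X2, X3. rewrite !(lor_Linv L c hL), !lor_Ad by (auto; apply L3_Ad; auto).
  unfold E21, E12, e2. rewrite !lor_ent. eR. repeat split; try (apply Req_minus; field).
  apply (vol_Linv L c hL); try apply L3_Ad; auto.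
  change (vol (Ad (G x y) E21) (Ad (G x y) E12) (Ad (G x y) e2) > 0). rewrite vol_Ad_frame by auto. lra.
Qed.

(** The factor [mu x] is constant in $y$, so only $\mathrm{Ad}_GE_{21}$ is differentiated, and its
    $y$-derivative is a multiple of $\mathrm{Ad}_Ge_2$: $f_{xy}$ is normal. *)
Lemma mixed_derivative x y : M x y ->
  Defs.Dy (Defs.Dx surf) x y = mscal (/ 2 * H * (mu x * nu x y)) (X3 x y).
Proof.
  intros hxy. destruct (hfam x y hxy) as (_ & _ & _ & _ & _ & P & hP).
  assert (k := mfdiff_cscal (mu x) _ _ _ _ _ (mfdiff_Linv L _ _ _ _ _ hP)).
  (* [surf_D] describes $f_x$ on [M] only; the slice of [M] is open, which is enough for a
     derivative in $y$. *)
  assert (ho : opn (fun v => M x v)).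
  { intros v hv. destruct (hM x v hv) as (e & he). exists e. split; [apply cond_pos|]. intros v' hv'. apply he; auto.
    replace (x - x) with 0 by ring. rewrite Rabs_R0. apply cond_pos. }
  unfold Defs.Dy. rewrite (mderive_ext (fun v => M x v) ho _ (fun v => mscal (mu x) (Linv L (Ad (G x v) E21))) y hxy).
  2: { intros v hv. exact (proj1 (surf_D x v hv)). }
  apply mderive_eq. intros i j.
  assert (e := proj2 (fdiff_partial _ _ _ _ _ (k i j))). cbv beta in e.
  rewrite Linv_mscal, mscal_mscal in e. fold (X3 x y) in e.
  replace (/ 2 * H * (mu x * nu x y)) with (mu x * (/ 2 * H * exp (om (- y) / 2) * (d x y * d x y))); [exact e|].
  unfold nu. ring.
Qed.

Lemma surf_smooth : smooth2 M surf.
Proof.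
  intros n i j x y hxy. apply (Linv_smooth L n S). intros. apply hsm; auto.
Qed.

Lemma normal_smooth : smooth2 M X3.
Proof.
  intros n i j x y hxy.
  assert (k := Linv_smooth L n (fun x y => Ad (G x y) e2) 1 mzero x y i j (fun c1 c2 c3 c4 c5 => proj2 (hsm c1 c2 c3 c4 c5 n x y hxy))).
  match type of k with ex_diff_n ?f _ _ _ => replace (fun x y => ent (X3 x y) i j) with f; auto end.
  apply functional_extensionality; intros u. apply functional_extensionality; intros v.
  unfold X3. f_equal. f_equal. generalize (Ad (G u v) e2). intros. mZ.
Qed.

Lemma surf_immersion : timelike_immersion M surf.
Proof.
  split; auto.
  - intros; apply Linv_L3.
  - apply surf_smooth.
  - intros x y hxy a b h. destruct (surf_D x y hxy) as (e1 & e2). destruct (null_frame x y hxy) as (n1 & n2 & n3 & _).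
    rewrite e1, e2 in h.
    assert (hm := mu_pos x). assert (hn := nu_pos x y hxy).
    assert (h' : radd (mscal (a * mu x) (X1 x y)) (mscal (b * nu x y) (X2 x y)) = mzero).
    { rewrite <- !mscal_mscal. exact h. }
    (* Pairing the vanishing combination with one null vector isolates the coefficient of the other,
       since $\langle X_1,X_2\rangle=\frac12$. *)
    assert (k : forall a' b', lor (radd (mscal (a * mu x) (X1 x y)) (mscal (b * nu x y) (X2 x y))) (radd (mscal a' (X1 x y)) (mscal b' (X2 x y))) = 0).
    { intros. rewrite h', lor_ent. rewrite !entR_mzero. ring. }
    assert (k1 := k 0 1). assert (k2 := k 1 0). rewrite lor_comb, n1, n2, n3 in k1, k2.
    split.
    + apply (Rmult_eq_reg_r (mu x)); [|lra]. lra.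
    + apply (Rmult_eq_reg_r (nu x y)); [|lra]. lra.
  - intros x y hxy. destruct (surf_D x y hxy) as (e1 & e2). destruct (null_frame x y hxy) as (n1 & n2 & n3 & _).
    assert (hm := mu_pos x). assert (hn := nu_pos x y hxy). rewrite e1, e2.
    (* These are $X_1-X_2$ and $X_1+X_2$, orthogonal with squares $-1$ and $1$. *)
    exists (radd (mscal (/ mu x) (mscal (mu x) (X1 x y))) (mscal (- / nu x y) (mscal (nu x y) (X2 x y)))),
      (radd (mscal (/ mu x) (mscal (mu x) (X1 x y))) (mscal (/ nu x y) (mscal (nu x y) (X2 x y)))).
    split; [apply in_span_radd|split; [apply in_span_radd|]].
    rewrite !mscal_mscal, !lor_comb, n1, n2, n3. repeat split; field; lra.
Qed.

Lemma surf_CMC : timelike_CMC H M surf.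
Proof.
  (* $2\langle f_x,f_y\rangle=\mu\nu>0$, hence $\varepsilon=1$ and $\omega=\ln(\mu\nu)$. *)
  split; [apply surf_immersion|]. exists 1, (fun x y => ln (mu x * nu x y)), X3. split; [auto|split; [apply normal_smooth|]].
  intros x y hxy. destruct (surf_D x y hxy) as (e1 & e2). destruct (null_frame x y hxy) as (n1 & n2 & n3 & n4 & n5 & n6 & n7).
  assert (hm := mu_pos x). assert (hn := nu_pos x y hxy).
  assert (hmn : 0 < mu x * nu x y) by (apply Rmult_lt_0_compat; auto).
  rewrite (mixed_derivative x y hxy).
  assert (sc : forall a X Y, lor (mscal a X) Y = a * lor X Y) by (intros; rewrite !lor_ent; eR; Rring).
  unfold Du, Dv. rewrite e1, e2, !lor_mscal, !sc, n1, n2, n3, n4, n5, n6, exp_Ropp, exp_ln by auto.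
  repeat split; try ring; try (field; lra).
  - apply Linv_L3.
  (* Since $f_u=f_x-f_y$ and $f_v=f_x+f_y$, the volume is $2\mu\nu$ times that of the null frame. *)
  - intros _. apply Rlt_gt. apply Rlt_le_trans with (2 * (mu x * nu x y) * vol (X1 x y) (X2 x y) (X3 x y)).
    + apply Rmult_lt_0_compat; lra.
    + right. change (2 * (mu x * nu x y) * vol (X1 x y) (X2 x y) (X3 x y) =
        vol (rsub (mscal (mu x) (X1 x y)) (mscal (nu x y) (X2 x y))) (radd (mscal (mu x) (X1 x y)) (mscal (nu x y) (X2 x y))) (X3 x y)).
      generalize (X1 x y) (X2 x y) (X3 x y). intros A B D. unfold vol, co0, co1, co2. eR. apply Req_minus. field.
Qed.

Lemma msm_fc : msm J fc.
Proof.
  assert (hf := msm_smooth J f0 (gcd_f0_smooth _ _ _ hdata)).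
  apply (msm_ext J hJ (fun t => radd (radd (mscal (co0 (f0 t)) (L e0)) (radd (mscal (co1 (f0 t)) (L e1)) (mscal (co2 (f0 t)) (L e2)))) c)).
  - intros t ht. rewrite <- (L_expand L c hL) by (apply (gcd_f0_L3 _ _ _ hdata); auto). reflexivity.
  - assert (h2 : forall a b : R -> R, csm J a -> csm J b -> csm J (fun t => (a t + b t) / 2)).
    { intros a b ha hb. apply (csm_mult J (fun t => a t + b t)); [apply csm_plus; auto|apply csm_const]. }
    repeat apply msm_plus; auto; try apply msm_const; apply msm_scal; auto; try apply msm_const.
    + apply (h2 (fun t => ent (f0 t) 1 0) (fun t => - ent (f0 t) 0 1)); [apply hf|apply csm_opp; auto].
    + apply (h2 (fun t => ent (f0 t) 1 0) (fun t => ent (f0 t) 0 1)); apply hf.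
    + apply hf.
Qed.

Lemma antidiagonal_derive X t P Q : mfdiff X t (- t) P Q -> forall i j, is_derive (fun t => ent (X t (- t)) i j) t (ent (rsub P Q) i j).
Proof. intros h i j. rewrite entR_rsub. apply (fdiff_antidiagonal (fun x y => ent (X x y) i j)), h. Qed.

Lemma nu_diag t : J t -> nu t (- t) = mu t.
Proof. intros ht. destruct (hdiag t ht) as (_ & _ & e). unfold nu, mu. rewrite e, Ropp_involutive. ring. Qed.

(** On the diagonal $\mu=\nu$ and $E_{21}-E_{12}=e_0$, so the derivative along $\Delta$ is
    $e^{\omega/2}\mathrm{Ad}_{F_0}e_0$, the velocity of the moved curve; the two curves agree at
    [t0] by the choice of [cst]. *)
Lemma g_diag t : J t -> g t (- t) = fc t.
Proof.
  intros ht.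
  assert (k : forall i j, ent (g t (- t)) i j - ent (fc t) i j = ent (g t0 (- t0)) i j - ent (fc t0) i j).
  { intros i j. apply (constant_of_derive J (fun t => ent (g t (- t)) i j - ent (fc t) i j)); auto.
    intros x hx. destruct (hdiag x hx) as (m1 & m2 & m3).
    assert (e1 := antidiagonal_derive _ _ _ _ (g_diff x (- x) m1) i j).
    assert (e2 := msm_is_derive J fc x i j msm_fc hx).
    assert (e3 := fr_f0 _ _ _ _ _ _ hF0 x hx). fold (mu x) in e3.
    evar_last; [apply (is_derive_minus (K := R_AbsRing) (V := R_NormedModule) _ _ _ _ _ e1 e2)|].
    change (ent (rsub (mscal (mu x) (Ad (G x (- x)) E21)) (mscal (nu x (- x)) (Ad (G x (- x)) E12))) i j - ent (mderive fc x) i j = 0).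
    apply Rminus_diag_eq. apply (f_equal (fun A => ent A i j)). rewrite nu_diag by auto. etransitivity; [|symmetry; exact e3].
    rewrite m2. unfold Ad, E21, E12, e0. generalize (F0 x) (mu x). intros. mR. }
  assert (k0 : g t0 (- t0) = fc t0).
  { unfold g, cst. generalize (mscal kap (S t0 (- t0))) (fc t0). intros. mR. }
  rewrite k0 in k.
  assert (k' : forall i j, ent (g t (- t)) i j = ent (fc t) i j :> R) by (intros i j; specialize (k i j); lra).
  apply mx_extR; apply k'.
Qed.

Lemma surf_diag t : J t -> surf t (- t) = f0 t.
Proof.
  intros ht. rewrite surf_eq, g_diag by auto. unfold fc, motion.
  replace (rsub (plus (L (f0 t)) c) c) with (L (f0 t)).
  - apply (Linv_L L c hL), (gcd_f0_L3 _ _ _ hdata); auto.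
  - change (L (f0 t) = rsub (radd (L (f0 t)) c) c). mR.
Qed.

(** The velocity is obtained by differentiating [surf_diag]; the field $V$ comes from
    $E_{21}+E_{12}=e_1$ and $\mu=\nu$ on the diagonal. *)
Lemma surf_tangent t : J t ->
  mderive f0 t = rsub (Defs.Dx surf t (- t)) (Defs.Dy surf t (- t)) /\ V t = radd (Defs.Dx surf t (- t)) (Defs.Dy surf t (- t)).
Proof.
  intros ht. destruct (hdiag t ht) as (m1 & m2 & m3). destruct (surf_D t (- t) m1) as (u1 & u2). split.
  - rewrite u1, u2. rewrite <- (mderive_ext J hJ (fun t => surf t (- t)) f0 t ht surf_diag).
    apply mderive_eq. apply antidiagonal_derive, surf_diff; auto.
  - rewrite u1, u2, nu_diag by auto.
    rewrite <- (Linv_L L c hL (V t)) by (apply (gcd_V_L3 _ _ _ hdata); auto).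
    rewrite (fr_V _ _ _ _ _ _ hF0 t ht). fold (mu t). unfold X1, X2. rewrite <- !Linv_mscal, <- Linv_radd, m2. f_equal.
    unfold Ad, E21, E12, e1. generalize (F0 t) (mu t). intros. mR.
Qed.

Theorem surf_solves : is_Sym_surface H M Fh (fun x y => motion L c (surf x y)) /\
  surf t0 (- t0) = f0 t0 /\ solves_geometric_cauchy J f0 V H M surf.
Proof.
  split; [|split].
  - exists cst. split; [apply cst_L3|]. intros x y hxy. exists (cplx (S x y)).
    split; [apply (hfam x y hxy)|]. rewrite motion_surf by auto. unfold g, kap. generalize (S x y) cst. intros X Y.
    apply mx_extC; rewrite ent_cplx, entC_plus, entC_mscal, !ent_cplx, entR_radd, entR_mscal, RtoC_plus, RtoC_mult; reflexivity.
  - apply surf_diag; auto.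
  - split; [apply surf_CMC| |].
    + intros t ht. split; [apply hdiag; auto|apply surf_diag; auto].
    + intros t ht Z. destruct (surf_tangent t ht) as (-> & ->).
      generalize (Defs.Dx surf t (- t)) (Defs.Dy surf t (- t)). intros A B. split; intros (a & b & ->).
      * exists ((a - b) / 2), ((a + b) / 2).
        change (radd (mscal a A) (mscal b B) = radd (mscal ((a - b) / 2) (rsub A B)) (mscal ((a + b) / 2) (radd A B))).
        apply mx_extR; eR; apply Req_minus; field.
      * exists (a + b), (b - a).
        change (radd (mscal a (rsub A B)) (mscal b (radd A B)) = radd (mscal (a + b) A) (mscal (b - a) B)). mR.
Qed.

End Surface.

Theorem theorem3p2
  (s : R) (hs : s > 1 / 2)
  (lo hi : Rbar) (t0 : R) (H : R) (f0 V : R -> M2 R)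
  (L : M2 R -> M2 R) (c : M2 R)
  (om0 : R -> R) (F0 : R -> M2 R) (Fh0 : R -> loop) :
  let J := interval lo hi in
  let Jm := fun y => J (- y) in
  J 0 -> J t0 -> H <> 0 ->
  geometric_cauchy_data J f0 V ->
  orientation_preserving_isometry L c ->
  normalized_at t0 (fun t => motion L c (f0 t)) (fun t => L (V t)) ->
  is_extended_frame s J t0 H (fun t => motion L c (f0 t)) (fun t => L (V t))
    om0 F0 Fh0 ->
  let Fp := fun x => Fh0 x in
  let Fm := fun y => Fh0 (- y) in
  let Phi := fun x y => loop_mul (loop_inv (Fp x)) (Fm y) in
  let M := fun x y => J x /\ Jm y /\ in_BL s (Phi x y) in
  (exists chi psi : R -> loop,
     is_maurer_cartan s J Fp chi /\
     is_maurer_cartan s Jm Fm psi /\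
     potential_pair s J Jm chi psi /\
     exists W : R -> R -> Prop,
       open2 W /\
       (forall t, J t -> W t (- t)) /\
       (forall x y, W x y -> J x /\ Jm y /\ regular_at s chi psi x y)) /\
  (forall Hm Hp : R -> R -> loop,
     (forall x y, M x y ->
        in_Gminus_star s (Hm x y) /\ in_Gplus s (Hp x y) /\
        loop_eq (Phi x y) (loop_mul (Hm x y) (Hp x y))) ->
     let Fh := fun x y => loop_mul (Fm y) (loop_inv (Hp x y)) in
     exists f : R -> R -> M2 R,
       is_Sym_surface H M Fh (fun x y => motion L c (f x y)) /\
       f t0 (- t0) = f0 t0 /\
       solves_geometric_cauchy J f0 V H M f).
Proof.
  intros J Jm _ ht0 hH hdata hL _ hE Fp Fm Phi M.
  assert (hJ : opn J) by apply interval_opn.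
  assert (hconv : forall x y z, J x -> J z -> x <= y <= z -> J y) by (intros x y z; apply interval_convex).
  destruct hE as [hF hG hinit hode].
  (* The frame is built from the moved data; the isometry reduces the smoothness of $\langle
     LV,LV\rangle$ to that of $\langle V,V\rangle$. *)
  assert (hV : csm J (fun t => lor (L (V t)) (L (V t)))).
  { apply (csm_ext J hJ (fun t => lor (V t) (V t))).
    - intros t ht. symmetry. apply (opi_isometry L c hL); apply (gcd_V_L3 _ _ _ hdata); auto.
    - apply csm_lor; auto; apply msm_smooth, (gcd_V_smooth _ _ _ hdata). }
  set (fc := fun t => motion L c (f0 t)) in *. set (Vc := fun t => L (V t)) in *.
  destruct (frame_csm J hJ t0 H fc Vc om0 F0 hF hV) as (ca & cq & ch & cr).
  assert (hmc := frame_mc_pot J hJ t0 H fc Vc om0 F0 hF hV). cbv beta zeta in hmc.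
  set (a := fun t => ent (frame_mc F0 t) 0 0) in *.
  set (q := fun t => coefQ H fc om0 F0 t * exp (- om0 t / 2)) in *.
  set (r := fun t => coefR H fc om0 F0 t * exp (- om0 t / 2)) in *.
  set (h := fun t => / 2 * H * exp (om0 t / 2)) in *.
  (* [frame_potential] unfolds to [pot] with these four functions. *)
  assert (hode' : is_maurer_cartan s J Fh0 (fun t => pot (a t) (q t) (h t) (r t))) by exact hode.
  assert (hh : forall t, J t -> h t <> 0).
  { intros t _. unfold h. assert (he := exp_pos (om0 t / 2)). apply Rmult_integral_contrapositive_currified; [|lra].
    apply Rmult_integral_contrapositive_currified; auto. lra. }
  split.
  - exact (pot_pair s J Fh0 a q h r hJ ca cq ch cr hh hode').
  - intros Hm Hp hH' Fh.
    destruct (family_summary s hs J hJ hconv Fh0 a q h r t0 ht0 hG hinit hode' ca cq ch cr Hm Hp hH')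
      as (G & S & d & k1 & k2 & k3 & k4).
    assert (hone := frame_at_one s hs J hJ hconv Fh0 a q h r t0 ht0 hG hinit hode' ca cq ch cr F0
      (msm_F0 J t0 fc Vc om0 F0 hF) (fr_det _ _ _ _ _ _ hF) (fr_init _ _ _ _ _ _ hF)).
    exists (surf L c H t0 f0 S).
    apply (surf_solves L c hL H hH J hJ hconv t0 ht0 f0 V hdata om0 F0 hF M Fh G S d); auto.
    intros t ht. destruct (k2 t ht) as (m1 & m2 & m3). split; [auto|split; [|auto]].
    (* On the diagonal the frame at $\lambda=1$ is [F0], because both solve the equation whose
       coefficient matrix is computed in [frame_mc_pot]. *)
    rewrite m2. apply hone; auto. intros z hz.
    etransitivity; [exact (F0_derive J t0 fc Vc om0 F0 hF z hz)|].
    apply (f_equal (Mmult (F0 z))). exact (hmc z hz).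
Qed.
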